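(* The metrics $g_0$ and $g_1$ on $\mathscr{L}_0$ can be connected by a path of $H$-invariant metrics $g_r$, $r\in[0,1]$, with the following property. Denote by $\nabla_r\mathcal{A}_0$ the gradient of $\mathcal{A}_0$ with respect to $g_r$. Let $r_\nu\in[0,1]$ and let $y_\nu$, $\nu\in\mathbb{N}$, be a sequence of solutions of $$\partial_sy_\nu(s)+\nabla_{r_\nu}\mathcal{A}_0(y_\nu(s))=0,\quad s\in\mathbb{R},$$ whose energies $E(y_\nu)$ are uniformly bounded. Then there exist a subsequence $\nu_j$, a sequence of gauge transformations $h_j\in H$, an $r\in[0,1]$, and a flow line $y$ of $\nabla_r\mathcal{A}_0$ (i.e. a solution of $\partial_sy+\nabla_r\mathcal{A}_0(y)=0$ on $\mathbb{R}$), such that $(h_j)_*y_{\nu_j}$ converges to $y$ in the $C^\infty_{loc}$-topology as $j\to\infty$.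
   Context: Let $1\le k\le n$ be integers and let $A$ be an $n\times k$ matrix with integer entries. The torus $T^k=\{e^{iv}:v\in\mathbb{R}^k\}$ acts on $\mathbb{C}^n$ by $\rho(e^{iv})z=(e^{i(Av)_1}z_1,\dots,e^{i(Av)_n}z_n)$. Its Lie algebra is $\mathfrak{t}^k=i\mathbb{R}^k$ with the standard inner product, and $\mathbb{C}^n$ carries its standard real inner product and symplectic form $\omega=\sum_jdx_j\wedge dy_j$ ($z_j=x_j+iy_j$). For $z\in\mathbb{C}^n$ let $L_z:\mathfrak{t}^k\to\mathbb{C}^n$, $L_z(iv)=(i(Av)_1z_1,\dots,i(Av)_nz_n)$ be the infinitesimal action, $L_z^*$ its adjoint, and $X_\xi(z)=L_z\xi$. The moment map $\mu:\mathbb{C}^n\to\mathfrak{t}^k$ is the one satisfying $d\langle\mu,\xi\rangle=\iota_{X_\xi}\omega$ for $\xi\in\mathfrak{t}^k$ and $\mu(0)=0$, i.e. $\mu(z)=-\frac{i}{2}A^T(|z_1|^2,\dots,|z_n|^2)^T$. Standing assumption (H): $\mu$ is proper and $\tau\in\mathfrak{t}^k$ is a regular value of $\mu$. Write $\bar\mu(z)=\int_0^1\mu(z(t))dt$ for a loop $z$. $S^1=\mathbb{R}/\mathbb{Z}$, $\mathscr{L}_0=C^\infty(S^1,\mathbb{C}^n)\times\mathfrak{t}^k$, $\lambda=\sum_jy_j\,dx_j$, and $\mathcal{A}_0(z,\eta)=\int_0^1\lambda(z)(\partial_tz)\,dt+\langle\eta,\bar\mu(z)-\tau\rangle$. The group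 $H=\{h\in C^\infty(S^1,T^k):\partial_t(h^{-1}\partial_th)=0\}\cong T^k\times\mathbb{Z}^k$ (elements $h(t)=h_0e^{2\pi ivt}$, $h_0\in T^k$, $v\in\mathbb{Z}^k$) acts on $\mathscr{L}_0$ by $h_*(z,\eta)=(\rho(h)z,\eta-h^{-1}\partial_th)$. Metrics on $\mathscr{L}_0$: $g_0((\hat z_1,\hat\eta_1),(\hat z_2,\hat\eta_2))=\int_0^1\langle\hat z_1,\hat z_2\rangle dt+\langle\hat\eta_1,\hat\eta_2\rangle$, and at the point $(z,\eta)$, $g_1((\hat z_1,\hat\eta_1),(\hat z_2,\hat\eta_2))=\int_0^1(\langle\hat z_1-L_z\xi_1,\hat z_2-L_z\xi_2\rangle+\langle\partial_t\xi_1,\partial_t\xi_2\rangle)dt+\langle\hat\eta_1,\hat\eta_2\rangle$, where $\xi_i\in C^\infty(S^1,\mathfrak{t}^k)$ is determined by $\frac{d}{dt}(L_z^*\hat z_i-L_z^*L_z\xi_i+\partial_t^2\xi_i)=0$ and $\int_0^1\xi_i\,dt=0$. A path of metrics is a family $g_r$ depending continuously on $r$ (i.e. $r\mapsto g_r(p)(v,w)$ is continuous for all $p\in\mathscr{L}_0$ and tangent vectors $v,w$ at $p$), with the given values at $r=0,1$; part of the property is that the gradients $\nabla_r\mathcal{A}_0$ exist. A map $y=(z,\eta):\mathbb{R}\to\mathscr{L}_0$ is understood as an element of $C^\infty(\mathbb{R}\times S^1,\mathbb{C}^n)\times C^\infty(\mathbb{R},\mathfrak{t}^k)$. The $C^\infty_{loc}$-topology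 is uniform convergence of all derivatives on compact subsets of $\mathbb{R}\times S^1$. The energy is $E(z,\eta)=\int_{-\infty}^\infty\int_0^1\big(\|\partial_tz+L_z\eta\|^2+\|\bar\mu(z)-\tau\|^2\big)dt\,ds$. *)

(* Defs.v *)
From mathcomp Require Import all_boot all_order all_algebra.
From mathcomp Require Import all_classical all_reals all_analysis.
From mathcomp Require Import complex.
From mathcomp Require Import ring.
Set Implicit Arguments.
Unset Strict Implicit.
Unset Printing Implicit Defensive.
Import Order.TTheory GRing.Theory Num.Theory.
Import numFieldNormedType.Exports.
Local Open Scope complex_scope.
Local Open Scope ring_scope.
Local Open Scope classical_set_scope.

(* C^m as the real normed space R^m x R^m: z = (x, y) stands for x + i y. *)
Notation Cvec R m := ('rV[R]_m * 'rV[R]_m)%type (only parsing).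

(* Pairs (z, eta) of a not necessarily smooth or periodic z : R -> C^n and an
   element of t^k; L0 below is carved out of this type. *)
Notation config R n k := ((R -> Cvec R n) * 'rV[R]_k)%type (only parsing).

Section Coordinates.
Context {R : realType}.

Definition coordC {m} (z : Cvec R m) (j : 'I_m) : R[i] :=
  z.1 0 j +i* z.2 0 j.

Definition ofC {m} (u : 'I_m -> R[i]) : Cvec R m :=
  (\row_j complex.Re (u j), \row_j complex.Im (u j)).

Definition dot {m} (u v : 'rV[R]_m) : R := \sum_j u 0 j * v 0 j.

Definition dotC {m} (z w : Cvec R m) : R := dot z.1 w.1 + dot z.2 w.2.

(* e^{iv} *)
Definition expi {m} (v : 'rV[R]_m) : Cvec R m :=
  (\row_l cos (v 0 l), \row_l sin (v 0 l)).

Definition torus {m} : set (Cvec R m) := range expi.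

End Coordinates.

(* S^1 = R/Z: a map on S^1 (on R x S^1) is a map of t in R (of (s, t) in R x R)
   that is 1-periodic in t. *)
Section Calculus.
Context {R : realType}.

Definition circ_int (f : R -> R) : R :=
  \int[@lebesgue_measure R]_(t in `[0, 1]) f t.

Definition circ_intv {m} (f : R -> 'rV[R]_m) : 'rV[R]_m :=
  \row_l circ_int (fun t => f t 0 l).

Definition smooth {V : normedModType R} (f : R -> V) : Prop :=
  forall (m : nat) (t : R), derivable f^`(m) t 1.

Definition loop {V : normedModType R} (f : R -> V) : Prop :=
  smooth f /\ periodic f 1.

Definition d_s {V : normedModType R} (F : R -> R -> V) : R -> R -> V :=
  fun s t => (F ^~ t)^`() s.

Definition d_t {V : normedModType R} (F : R -> R -> V) : R -> R -> V :=
  fun s t => (F s)^`() t.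

(* The iterated partial derivative along a word: true is s, false is t. *)
Fixpoint pderiv {V : normedModType R} (w : seq bool) (F : R -> R -> V) :
    R -> R -> V :=
  if w is b :: w' then (if b then d_s else d_t) (pderiv w' F) else F.

Definition smooth2 {V : normedModType R} (F : R -> R -> V) : Prop :=
  forall w : seq bool,
    continuous (fun q : R * R => pderiv w F q.1 q.2) /\
    forall s t, derivable (pderiv w F ^~ t) s 1 /\
                derivable (pderiv w F s) t 1.

End Calculus.

(* The Lie algebra t^k = i R^k is identified with R^k through v |-> i v. *)
Section TorusAction.
Context {R : realType} {n k : nat} (A : 'M[int]_(n, k)).

Definition realA : 'M[R]_(n, k) := map_mx intr A.

(* A v, for a row vector v *)
Definition weight (v : 'rV[R]_k) : 'rV[R]_n := v *m realA^T.

(* The character product; rho_expi below gives its value at e^{iv}. *)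
Definition rho (w : Cvec R k) (z : Cvec R n) : Cvec R n :=
  ofC (fun j => (\prod_l coordC w l ^ A j l) * coordC z j).

(* L_z *)
Definition inf_act (z : Cvec R n) (v : 'rV[R]_k) : Cvec R n :=
  ofC (fun j => 'i * (weight v 0 j)%:C * coordC z j).

(* L_z^*; inf_act_adjP below is the adjunction. *)
Definition inf_act_adj (z w : Cvec R n) : 'rV[R]_k :=
  (\row_j (z.1 0 j * w.2 0 j - z.2 0 j * w.1 0 j)) *m realA.

Definition moment (z : Cvec R n) : 'rV[R]_k :=
  - (2^-1 *: ((\row_j (z.1 0 j ^+ 2 + z.2 0 j ^+ 2)) *m realA)).

Definition moment_proper : Prop :=
  forall K : set 'rV[R]_k, compact K -> compact (moment @^-1` K).

Definition moment_regular_value (tau : 'rV[R]_k) : Prop :=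
  forall z, moment z = tau -> range ('d moment z) = [set: 'rV[R]_k].

Definition moment_mean (z : R -> Cvec R n) : 'rV[R]_k :=
  circ_intv (moment \o z).

End TorusAction.

Section ConfigurationSpace.
Context {R : realType} {n k : nat} (A : 'M[int]_(n, k)) (tau : 'rV[R]_k).
Implicit Types (p v w : config R n k) (h : R -> Cvec R k).

(* The space itself, and also its tangent space at any of its points. *)
Definition L0 : set (config R n k) := [set p | loop p.1].

(* lambda = \sum_j y_j dx_j *)
Definition action p : R :=
  circ_int (fun t => dot (p.1 t).2 (p.1^`() t).1)
  + dot p.2 (moment_mean A p.1 - tau).

(* h^{-1} \partial_t h *)
Definition logder h : R -> Cvec R k :=
  fun t => ofC (fun l => (coordC (h t) l)^-1 * coordC (h^`() t) l).

Definition gauge : set (R -> Cvec R k) :=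
  [set h | [/\ loop h, forall t, torus (h t)
            & forall t, (logder h)^`() t = 0]].

(* For h in gauge, logder h is a constant in i R^k; its imaginary part is the
   corresponding element of t^k. *)
Definition gauge_act h p : config R n k :=
  (fun t => rho A (h t) (p.1 t), p.2 - (logder h 0).2).

(* The differential of gauge_act h; see gauge_act_affine below. *)
Definition gauge_dact h v : config R n k :=
  (fun t => rho A (h t) (v.1 t), v.2).

(* A map y : R -> L0, understood as an element of
   C^oo(R x S^1, C^n) x C^oo(R, t^k). *)
Definition smooth_curve (y : R -> config R n k) : Prop :=
  [/\ smooth2 (fun s t => (y s).1 t), forall s, periodic (y s).1 1
    & smooth (fun s => (y s).2)].

Definition curve_ds (y : R -> config R n k) : R -> config R n k :=
  fun s => (d_s (fun s' t => (y s').1 t) s, (fun s' => (y s').2)^`() s).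

Definition energy_density (y : R -> config R n k) (s t : R) : R :=
  let u := d_t (fun s' => (y s').1) s t + inf_act A ((y s).1 t) (y s).2 in
  let b := moment_mean A (y s).1 - tau in
  dotC u u + dot b b.

Definition energy (y : R -> config R n k) : \bar R :=
  (\int[@lebesgue_measure R]_(s in [set: R])
     \int[@lebesgue_measure R]_(t in `[0%R, 1%R]) (energy_density y s t)%:E)%E.

Definition cvg_Cloc (y : nat -> R -> config R n k) (y0 : R -> config R n k) :
    Prop :=
  (forall (w : seq bool) (K : set (R * R)), compact K ->
     {uniform K, (fun j (q : R * R) =>
                    pderiv w (fun s t => (y j s).1 t) q.1 q.2) @ \oo -->
                 (fun q : R * R =>
                    pderiv w (fun s t => (y0 s).1 t) q.1 q.2)}) /\
  (forall (m : nat) (K : set R), compact K ->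
     {uniform K, (fun j => (fun s => (y j s).2)^`(m)) @ \oo -->
                 (fun s => (y0 s).2)^`(m)}).

(* g p v w is the value of the metric at p on the tangent vectors v, w.  On a
   Frechet space a function is smooth iff it is smooth along smooth curves;
   this is how smooth dependence on the base point is expressed. *)
Definition is_metric (g : config R n k -> config R n k -> config R n k -> R) :
    Prop :=
  [/\ forall p v w, L0 p -> L0 v -> L0 w -> g p v w = g p w v,
      forall p (a : R) u v w, L0 p -> L0 u -> L0 v -> L0 w ->
        g p (a *: u + v) w = a * g p u w + g p v w,
      forall p v, L0 p -> L0 v -> v <> 0 -> 0 < g p v v
    & forall p v w : R -> config R n k,
        smooth_curve p -> smooth_curve v -> smooth_curve w ->
        smooth (fun s => g (p s) (v s) (w s) : R)].

Definition gauge_invariant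
    (g : config R n k -> config R n k -> config R n k -> R) : Prop :=
  forall h p v w, gauge h -> L0 p -> L0 v -> L0 w ->
    g (gauge_act h p) (gauge_dact h v) (gauge_dact h w) = g p v w.

Definition is_gradient
    (g : config R n k -> config R n k -> config R n k -> R) p (V : config R n k)
    : Prop :=
  L0 V /\
  forall v, L0 v ->
    is_derive (0 : R) (1 : R) (fun e : R => action (p + e *: v)) (g p V v).

Definition flow_line (g : config R n k -> config R n k -> config R n k -> R)
    (y : R -> config R n k) : Prop :=
  smooth_curve y /\
  forall s, exists2 V, is_gradient g (y s) V & curve_ds y s + V = 0.

Definition g0 p v w : R :=
  circ_int (fun t => dotC (v.1 t) (w.1 t)) + dot v.2 w.2.

Definition g1_residual p v (xi : R -> 'rV[R]_k) : R -> 'rV[R]_k :=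
  fun t => inf_act_adj A (p.1 t) (v.1 t)
           - inf_act_adj A (p.1 t) (inf_act A (p.1 t) (xi t))
           + derive1n 2 xi t.

(* xi is the element of C^oo(S^1, t^k) attached to the tangent vector v at p. *)
Definition g1_potential p v (xi : R -> 'rV[R]_k) : Prop :=
  [/\ loop xi, forall t, (g1_residual p v xi)^`() t = 0 & circ_intv xi = 0].

Definition g1_value p v w (xi1 xi2 : R -> 'rV[R]_k) : R :=
  circ_int (fun t =>
    dotC (v.1 t - inf_act A (p.1 t) (xi1 t)) (w.1 t - inf_act A (p.1 t) (xi2 t))
    + dot (derive1 xi1 t) (derive1 xi2 t))
  + dot v.2 w.2.

Definition metric_path
    (g : R -> config R n k -> config R n k -> config R n k -> R) : Prop :=
  [/\ forall r, 0 <= r <= 1 -> is_metric (g r),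
      forall p v w, L0 p -> L0 v -> L0 w ->
        {within `[0, 1], continuous (fun r => g r p v w : R)},
      forall p v w, L0 p -> L0 v -> L0 w -> g 0 p v w = g0 p v w,
      forall p v w, L0 p -> L0 v -> L0 w ->
        exists xi1 xi2, [/\ g1_potential p v xi1, g1_potential p w xi2
                          & g 1 p v w = g1_value p v w xi1 xi2]
    & forall r p, 0 <= r <= 1 -> L0 p -> exists V, is_gradient (g r) p V].

End ConfigurationSpace.

Section Facts.
Context {R : realType} {n k : nat} (A : 'M[int]_(n, k)).

(* rho (e^{iv}) z = (e^{i(Av)_1} z_1, ..., e^{i(Av)_n} z_n) *)
Lemma rho_expi (v : 'rV[R]_k) (z : Cvec R n) :
  rho A (expi v) z =
  ofC (fun j => (cos (weight A v 0 j) +i* sin (weight A v 0 j)) * coordC z j).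
Proof.
pose e (x : R) : R[i] := cos x +i* sin x.
have eD : {morph e : x y / x + y >-> x * y}.
  by move=> x y; rewrite /e cosD sinD; simpc; congr (_ +i* _); rewrite addrC.
have e0 : e 0 = 1 by rewrite /e cos0 sin0.
have eMn x m : e (x *+ m) = e x ^+ m.
  by elim: m => [|m IH]; rewrite ?mulr0n ?expr0 // mulrSr exprSr eD IH.
have eN x : e (- x) = (e x)^-1.
  have ee : e x * e (- x) = 1 by rewrite -eD subrr.
  have ex0 : e x != 0.
    by apply/eqP => ex0; move/eqP: ee; rewrite ex0 mul0r eq_sym oner_eq0.
  by apply: (mulfI ex0); rewrite ee mulfV.
have eMz x (m : int) : e (x *~ m) = e x ^ m.
  by case: m => m; rewrite ?NegzE ?mulrNz ?eN -?exprnN -?exprnP -?pmulrn eMn.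
rewrite /rho; congr ofC; apply/funext => j; congr (_ * _).
rewrite -[RHS]/(e _) /weight mxE (big_morph e eD e0); apply: eq_bigr => l _.
by rewrite !mxE mulrzr eMz /coordC /expi /= !mxE.
Qed.

Lemma inf_act_adjP (z w : Cvec R n) (v : 'rV[R]_k) :
  dotC (inf_act A z v) w = dot v (inf_act_adj A z w).
Proof.
pose c j := z.1 0 j * w.2 0 j - z.2 0 j * w.1 0 j.
rewrite /dotC /dot -big_split /=.
transitivity (\sum_j weight A v 0 j * c j).
  apply: eq_bigr => j _; rewrite /inf_act /ofC /coordC /= !mxE; simpc.
  by rewrite /c; ring.
transitivity (\sum_j \sum_l v 0 l * realA A j l * c j).
  apply: eq_bigr => j _; rewrite /weight mxE mulr_suml.
  by apply: eq_bigr => l _; rewrite mxE.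
rewrite exchange_big; apply: eq_bigr => l _.
rewrite mxE mulr_sumr; apply: eq_bigr => j _; rewrite !mxE /c.
by rewrite -!mulrA; congr (_ * _); rewrite mulrC.
Qed.

Lemma gauge_act_affine (h : R -> Cvec R k) (p v : config R n k) (e : R) :
  gauge_act A h (p + e *: v) = gauge_act A h p + e *: gauge_dact A h v.
Proof.
rewrite /gauge_act /gauge_dact; congr pair => /=; last by rewrite addrAC.
apply/funext => t; rewrite /rho /ofC.
by congr pair; apply/rowP => j; rewrite !mxE /=;
  case: (\prod_l _) => a b; rewrite /coordC /= !mxE; by ring.
Qed.

End Facts.

(* Main.v *)
Require Import Defs.
From HB Require Import structures.
From mathcomp Require Import all_boot all_order all_algebra.
From mathcomp Require Import all_classical all_reals all_analysis.
From mathcomp Require Import measurable_realfun.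
From mathcomp Require complex.
From mathcomp Require Import ring lra.
Set Implicit Arguments.
Unset Strict Implicit.
Unset Printing Implicit Defensive.
Import Order.TTheory GRing.Theory Num.Theory.
Import numFieldNormedType.Exports.
Local Open Scope ring_scope.
Local Open Scope classical_set_scope.

(** The path of metrics is
      g_r (v, w) = int <v, w> dt + <v_eta, w_eta> - r int <zeta_v, L_z^* w> dt,
    where zeta_v is the loop of mean zero in the Lie algebra with
      - zeta'' + Pi (r L_z^* L_z zeta) = Pi (L_z^* v),
    and Pi removes the mean over the circle.  For r = 0 this is g_0, and for r = 1 the equation is the one
    defining the potential xi in g_1.  The weak form of the equation makes g_r symmetric ([sol_sym]) and
    gives
      g_r (v, v) = int |v - r L_z zeta_v|^2 dt + |v_eta|^2 + r int |zeta_v'|^2 dt,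
    hence positivity ([gm_pos_form]).  Only L_z^* v and L_z^* L_z enter, and both are invariant under the
    torus, even under maps S^1 -> T^k, which gives gauge invariance.  Solvability ([sol_ex]) comes from a
    damped fixed point iteration, and smooth dependence on the base point from the fact that the
    s-derivative of a solution solves the same equation with another right-hand side ([sol_der],
    [sol_Cn]).

    The gradient of the action is explicit.  The potential of the gradient itself is the mean-zero
    primitive of the moment map ([zeta_grad]), so with
      x_j + i y_j = z_j,  be_j = (A eta)_j,  ga_j = r (A P mu)_j,  P the mean-zero primitive in t,
    a flow line is a solution of
      d_s x = d_t y + be x + ga y,   d_s y = - d_t x + be y - ga x,   eta' = tau - mean mu
    ([flow_lineP], [flow_systemP]): a Cauchy-Riemann system with one nonlocal zeroth order coefficient
    that is smoothing in t.

    Compactness has two halves.  First come bounds for all derivatives on compact sets, uniform along the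
    sequence ([system_bounds]).  A gauge transformation e^(2 pi i v t), v an integer vector, brings eta (0)
    into a fixed cube, and the energy bounds the oscillation of eta.  Properness and homogeneity of mu give
    int |z|^2 dt <= M |mean mu| ([msq_moment]), and the energy then bounds z and d_t z in L^2 on compact
    sets.  Differentiating int |z|^2 dt along the flow bounds it uniformly in s; this bounds P mu and ga.
    From here the elliptic estimate [L2_elliptic] for the Cauchy-Riemann operator gains one derivative in t
    at a time, the Sobolev embedding on the circle turning L^2 bounds into sup bounds; the flow equations
    convert t-derivatives into s-derivatives.  Secondly, functions on the cylinder with all derivatives
    locally bounded have a subsequence converging with all derivatives ([smooth_subseq]), and the equations
    pass to the limit ([flow_system_lim]). *)

(** * One-variable calculus with primitives *)

Section OneVariable.
Context {R : realType}.
Implicit Types (f g F : R -> R) (a b c s t : R).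

Definition der f t l := is_derive t (1 : R) f l.

Lemma der_eq f t l l' : der f t l -> l = l' -> der f t l'.
Proof. by move=> + <-. Qed.

Lemma der_ext f g t l : f =1 g -> der f t l -> der g t l.
Proof. by move=> /funext ->. Qed.

Lemma der_unique f t l l' : der f t l -> der f t l' -> l = l'.
Proof. by move=> [_ <-] [_ <-]. Qed.

Lemma derD f g t l m : der f t l -> der g t m -> der (fun x => f x + g x) t (l + m).
Proof. by move=> ? ?; exact: is_deriveD. Qed.
Lemma derB f g t l m : der f t l -> der g t m -> der (fun x => f x - g x) t (l - m).
Proof. by move=> ? ?; exact: is_deriveB. Qed.
Lemma derN f t l : der f t l -> der (fun x => - f x) t (- l).
Proof. by move=> ?; exact: is_deriveN. Qed.
Lemma derM f g t l m : der f t l -> der g t m ->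
  der (fun x => f x * g x) t (l * g t + f t * m).
Proof.
move=> hf hg; apply: der_eq (is_deriveM hf hg) _.
by rewrite /GRing.scale /=; ring.
Qed.
Lemma der_cst c t : der (fun=> c) t 0.
Proof. exact: is_derive_cst. Qed.
Lemma der_id t : der (fun x => x) t 1.
Proof. exact: is_derive_id. Qed.
Lemma derZ c f t l : der f t l -> der (fun x => c * f x) t (c * l).
Proof. by move=> h; apply: der_eq (derM (der_cst c t) h) _; rewrite mul0r add0r. Qed.
Lemma der_comp f g t l m : der f (g t) l -> der g t m -> der (fun x => f (g x)) t (l * m).
Proof. by move=> ? ?; exact: is_derive1_comp. Qed.

Lemma der_shift f t c l : der f (t + c) l -> der (fun x => f (x + c)) t l.
Proof.
move=> h; have := der_comp (g := fun x => x + c) h (derD (der_id t) (der_cst c t)).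
by move/der_eq; apply; rewrite addr0 mulr1.
Qed.

Lemma der_sum (I : Type) (r : seq I) (h : I -> R -> R) t (l : I -> R) :
  (forall i, der (h i) t (l i)) ->
  der (fun x => \sum_(i <- r) h i x) t (\sum_(i <- r) l i).
Proof.
move=> H; elim: r => [|i r IH].
  by rewrite big_nil; apply: der_ext (der_cst 0 t) => x; rewrite big_nil.
rewrite big_cons; apply: der_ext (derD (H i) IH) => x; by rewrite big_cons.
Qed.

Lemma der_cont f f' : (forall t, der f t (f' t)) -> continuous f.
Proof.
move=> h t; apply/differentiable_continuous/derivable1_diffP.
by case: (h t).
Qed.

Lemma derivable_der f t : derivable f t 1 -> der f t (f^`() t).
Proof. by move=> /derivableP; rewrite derive1E. Qed.

Lemma der_derivable f t l : der f t l -> derivable f t 1.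
Proof. by case. Qed.

Lemma der_derive1 f t l : der f t l -> f^`() t = l.
Proof. by case=> _ <-; rewrite derive1E. Qed.

Lemma der_MVT f f' a b : (forall t, der f t (f' t)) ->
  exists2 c, Num.min a b <= c <= Num.max a b & f b - f a = f' c * (b - a).
Proof.
move=> h; have cf := der_cont h.
wlog ab : a b / a <= b.
  move=> H; case: (leP a b) => [ab|/ltW ba].
    by have [c] := H a b ab; rewrite min_l // max_r //; exists c.
  have [c] := H b a ba; rewrite min_l // max_r // => hc e.
  exists c => //; by rewrite -opprB e; ring.
rewrite min_l // max_r //.
have [|c] := @MVT_segment R f f' a b ab (fun x _ => h x).
  exact: continuous_subspaceT.
by rewrite in_itv => hc e; exists c.
Qed.

Lemma der_le f f' a b : (forall t, der f t (f' t)) -> a <= b ->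
  (forall t, a <= t <= b -> 0 <= f' t) -> f a <= f b.
Proof.
move=> h ab h0; have [c] := der_MVT a b h.
rewrite min_l // max_r // => /h0 c0 e.
by rewrite -subr_ge0 e mulr_ge0 // subr_ge0.
Qed.

Lemma der_cst_eq f a b : (forall t, der f t 0) -> f a = f b.
Proof. exact: is_derive_0_is_cst. Qed.

Lemma cont_integrable f a b : continuous f ->
  (@lebesgue_measure R).-integrable `[a, b] (EFin \o f).
Proof.
move=> cf; apply: continuous_compact_integrable; first exact: segment_compact.
exact: continuous_subspaceT.
Qed.

(** The integral from [-a] is a primitive on the right of [-a] only; the choice [a = |t| + 1] near
    each [t] patches these together. *)
Lemma prim_ex f : continuous f ->
  exists F : R -> R, F 0 = 0 /\ forall t, der F t (f t).
Proof.
move=> cf.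
pose I a t : R := \int[@lebesgue_measure R]_(x in `[a, t]) f x.
pose G a t := I (- a) t - I (- a) 0.
have dI a t : - a < t -> der (I (- a)) t (f t).
  move=> at'; have tt : t < t + 1 by rewrite ltrDl.
  have [d <-] := continuous_FTC1_closed tt (cont_integrable (- a) (t + 1) cf) at' (cf t).
  exact: derivable_der.
have IB a b t : a <= b -> - a <= t -> I (- b) t - I (- b) (- a) = I (- a) t.
  move=> ab at'; rewrite /I Rintegral_itvB ?bnd_simp //.
  - apply: Rintegral_itv_obnd_cbnd.
    apply: integrableS (cont_integrable (- a) t cf) => //.
    exact: subset_itv_oc_cc.
  - exact: cont_integrable.
  - by rewrite lerN2.
have GE a b t : 0 <= a -> a <= b -> - a <= t -> G a t = G b t.
  move=> a0 ab at'; rewrite /G -(IB a b t) // -(IB a b 0) ?oppr_le0 //; ring.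
exists (fun t => G (`|t| + 1) t); split; first by rewrite /G subrr.
move=> t.
have d : der (G (`|t| + 2)) t (f t).
  apply: der_eq (derB (dI _ _ _) (der_cst _ _)) _; last by rewrite subr0.
  by rewrite ltrNl; have := ler_norm (- t); rewrite normrN; lra.
apply: near_eq_is_derive d.
near=> x.
have hx : `|x - t| < 1 by near: x; apply: cvgr_distC_lt.
apply/esym/GE; [by rewrite addr_ge0| |].
  have := ler_normD (x - t) t; rewrite subrK; lra.
have := ler_norm (- x); rewrite normrN; lra.
Unshelve. all: by end_near. Qed.

End OneVariable.

(** Locked, because unification would otherwise unfold the chosen witness whenever two primitives
    are compared. *)
HB.lock Definition prim {R : realType} (f : R -> R) : R -> R :=
  if pselect (continuous f) is left cf then sval (cid (prim_ex cf)) else fun=> 0.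

Section OneVariable.
Context {R : realType}.
Implicit Types (f g F : R -> R) (a b c s t : R).

Lemma prim0 f : prim f 0 = 0.
Proof. by rewrite unlock; case: pselect => // cf; case: cid => ? []. Qed.

Lemma der_prim f t : continuous f -> der (prim f) t (f t).
Proof. by rewrite unlock; case: pselect => // cf _; case: cid => ? [? h]; exact: h. Qed.

Lemma primE f F t : (forall x, der F x (f x)) -> continuous f -> prim f t = F t - F 0.
Proof.
move=> dF cf.
have := @der_cst_eq R (fun x => prim f x - F x) t 0.
rewrite prim0 => h; rewrite -[prim f t](subrK (F t)) h ?sub0r; first by ring.
by move=> x; apply: der_eq (derB (der_prim x cf) (dF x)) _; rewrite subrr.
Qed.

Lemma Rint_prim f a b : continuous f -> a <= b ->
  \int[@lebesgue_measure R]_(t in `[a, b]) f t = prim f b - prim f a.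
Proof.
move=> cf; rewrite le_eqVlt => /predU1P[<-|ab].
  by rewrite set_itv1 Rintegral_set1 subrr.
have cp : continuous (prim f) by apply: der_cont => t; exact: der_prim.
rewrite /Rintegral (@continuous_FTC2 _ f (prim f) a b) //.
- exact: continuous_subspaceT.
- split.
  + by move=> x _; exact: der_derivable (der_prim x cf).
  + exact/cvg_at_right_filter/cp.
  + exact/cvg_at_left_filter/cp.
- by move=> x _; exact: der_derive1 (der_prim x cf).
Qed.

Lemma circ_intE f : continuous f -> circ_int f = prim f 1.
Proof. by move=> cf; rewrite /circ_int Rint_prim // prim0 subr0. Qed.

Lemma circ_int_ext f g : f =1 g -> circ_int f = circ_int g.
Proof. by move=> /funext ->. Qed.

(** The integral from [a] to [b], additive in its bounds without ordering them. *)
Definition seg f a b := prim f b - prim f a.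

Lemma contD f g : continuous f -> continuous g -> continuous (fun x => f x + g x).
Proof. by move=> cf cg x; apply: cvgD; [exact: cf|exact: cg]. Qed.
Lemma contB f g : continuous f -> continuous g -> continuous (fun x => f x - g x).
Proof. by move=> cf cg x; apply: cvgB; [exact: cf|exact: cg]. Qed.
Lemma contM f g : continuous f -> continuous g -> continuous (fun x => f x * g x).
Proof. by move=> cf cg x; apply: cvgM; [exact: cf|exact: cg]. Qed.
Lemma contN f : continuous f -> continuous (fun x => - f x).
Proof. by move=> cf x; apply: cvgN; exact: cf. Qed.
Lemma cont_cst c : continuous (fun _ : R => c).
Proof. by move=> x; exact: cvg_cst. Qed.
Lemma contX f m : continuous f -> continuous (fun x => f x ^+ m).
Proof.
move=> cf; elim: m => [|m IH]; first exact: cont_cst.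
rewrite (_ : (fun x => _) = (fun x => f x * f x ^+ m)); first exact: contM.
by apply/funext => x; rewrite exprS.
Qed.
Lemma cont_abs f : continuous f -> continuous (fun x => `|f x|).
Proof. by move=> cf x; apply: cvg_norm; exact: cf. Qed.
Lemma cont_id : continuous (fun x : R => x).
Proof. by move=> x; exact: cvg_id. Qed.
Lemma cont_sum (I : Type) (r : seq I) (h : I -> R -> R) :
  (forall i, continuous (h i)) -> continuous (fun x => \sum_(i <- r) h i x).
Proof.
move=> H; elim: r => [|i r IH].
  by rewrite (_ : (fun x => _) = (fun=> 0)); [exact: cont_cst|apply/funext => x; rewrite big_nil].
rewrite (_ : (fun x => _) = (fun x => h i x + \sum_(j <- r) h j x)); first exact: contD.
by apply/funext => x; rewrite big_cons.
Qed.

Lemma seg_FTC F f a b : (forall x, der F x (f x)) -> continuous f -> seg f a b = F b - F a.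
Proof. by move=> dF cf; rewrite /seg !(primE _ dF) //; ring. Qed.

Lemma segD f g a b : continuous f -> continuous g ->
  seg (fun x => f x + g x) a b = seg f a b + seg g a b.
Proof.
move=> cf cg; rewrite (seg_FTC (F := fun x => prim f x + prim g x)) /seg; last exact: contD.
  ring.
by move=> x; apply: derD; exact: der_prim.
Qed.

Lemma segB f g a b : continuous f -> continuous g ->
  seg (fun x => f x - g x) a b = seg f a b - seg g a b.
Proof.
move=> cf cg; rewrite (seg_FTC (F := fun x => prim f x - prim g x)) /seg; last exact: contB.
  ring.
by move=> x; apply: derB; exact: der_prim.
Qed.

Lemma segZ c f a b : continuous f -> seg (fun x => c * f x) a b = c * seg f a b.
Proof.
move=> cf; rewrite (seg_FTC (F := fun x => c * prim f x)) /seg.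
- ring.
- by move=> x; apply: derZ; exact: der_prim.
- by apply: contM => //; exact: cont_cst.
Qed.

Lemma seg_cst c a b : seg (fun=> c) a b = c * (b - a).
Proof.
rewrite (seg_FTC (F := fun x => c * x)); [ring| |exact: cont_cst].
by move=> x; apply: der_eq (derZ _ (der_id x)) _; rewrite mulr1.
Qed.

Lemma seg_sum (I : Type) (r : seq I) (h : I -> R -> R) a b :
  (forall i, continuous (h i)) ->
  seg (fun x => \sum_(i <- r) h i x) a b = \sum_(i <- r) seg (h i) a b.
Proof.
move=> H; rewrite (seg_FTC (F := fun x => \sum_(i <- r) prim (h i) x)).
- by rewrite -sumrB.
- by move=> x; apply: der_sum => i; exact: der_prim.
- exact: cont_sum.
Qed.

Lemma seg_le f g a b : continuous f -> continuous g -> a <= b ->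
  (forall t, a <= t <= b -> f t <= g t) -> seg f a b <= seg g a b.
Proof.
move=> cf cg ab h; rewrite -subr_ge0 -segB //.
rewrite /seg subr_ge0.
apply: (der_le (f' := fun t => g t - f t)) => // t; last by move=> /h; rewrite subr_ge0.
by apply: der_prim; exact: contB.
Qed.

Lemma seg_ge0 f a b : continuous f -> a <= b ->
  (forall t, a <= t <= b -> 0 <= f t) -> 0 <= seg f a b.
Proof.
by move=> cf ab h; rewrite -(mul0r (b - a)) -seg_cst; apply: seg_le => //; exact: cont_cst.
Qed.

Lemma seg_chasles f a b c : seg f a b + seg f b c = seg f a c.
Proof. by rewrite /seg; ring. Qed.

Lemma seg_abs f a b : continuous f -> a <= b -> `|seg f a b| <= seg (fun x => `|f x|) a b.
Proof.
move=> cf ab; have ca := cont_abs cf; rewrite ler_norml -[seg f a b]mul1r; apply/andP; split.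
  rewrite lerNl mul1r -mulN1r -segZ //; apply: seg_le => //.
    by apply: contM => //; exact: cont_cst.
  by move=> t _; rewrite mulN1r -normrN; exact: ler_norm.
by rewrite mul1r; apply: seg_le => // t _; exact: ler_norm.
Qed.

Lemma seg_sub f a b a' b' : continuous f -> a' <= a -> a <= b -> b <= b' ->
  (forall t, 0 <= f t) -> seg f a b <= seg f a' b'.
Proof.
move=> cf aa ab bb f0.
rewrite -(seg_chasles f a' b b') -(seg_chasles f a' a b).
have h1 : 0 <= seg f a' a by exact: seg_ge0.
have h2 : 0 <= seg f b b' by exact: seg_ge0.
lra.
Qed.

Lemma discr_le (x y z : R) : 0 <= x -> 0 <= z -> (forall l, 0 <= x - 2 * l * y + l ^+ 2 * z) ->
  y ^+ 2 <= x * z.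
Proof.
move=> x0 z0 h; have [z00|zn0] := eqVneq z 0.
  have := h ((x + 1) / (2 * y)); rewrite z00 !mulr0 addr0.
  have [->|yn0] := eqVneq y 0; first by rewrite expr0n.
  rewrite (_ : 2 * _ * y = x + 1); last by field; rewrite yn0.
  lra.
have zp : 0 < z by rewrite lt0r zn0.
have := h (y / z).
have -> : x - 2 * (y / z) * y + (y / z) ^+ 2 * z = (x * z - y ^+ 2) / z by field.
by rewrite pmulr_lge0 ?invr_gt0 // subr_ge0.
Qed.

Lemma seg_CS f g a b : continuous f -> continuous g -> a <= b ->
  seg (fun x => f x * g x) a b ^+ 2 <=
  seg (fun x => f x ^+ 2) a b * seg (fun x => g x ^+ 2) a b.
Proof.
move=> cf cg ab; apply: discr_le.
- by apply: seg_ge0 => // [|t _]; [exact: contX|exact: sqr_ge0].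
- by apply: seg_ge0 => // [|t _]; [exact: contX|exact: sqr_ge0].
move=> l; rewrite -segZ; last exact: contM.
rewrite -segZ; last exact: contX.
have c1 : continuous (fun x => 2 * l * (f x * g x)).
  by apply: contM; [exact: cont_cst|exact: contM].
have c2 : continuous (fun x => l ^+ 2 * g x ^+ 2).
  by apply: contM; [exact: cont_cst|exact: contX].
rewrite -segB //; last exact: contX.
rewrite -segD //; last by apply: contB => //; exact: contX.
apply: seg_ge0 => //; first by apply: contD => //; apply: contB => //; exact: contX.
move=> t _; rewrite (_ : _ + _ = (f t - l * g t) ^+ 2); [exact: sqr_ge0|ring].
Qed.

Lemma circ_seg f : continuous f -> circ_int f = seg f 0 1.
Proof. by move=> cf; rewrite circ_intE // /seg prim0 subr0. Qed.

Lemma circD f g : continuous f -> continuous g ->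
  circ_int (fun x => f x + g x) = circ_int f + circ_int g.
Proof. by move=> cf cg; rewrite !circ_seg ?segD //; exact: contD. Qed.
Lemma circB f g : continuous f -> continuous g ->
  circ_int (fun x => f x - g x) = circ_int f - circ_int g.
Proof. by move=> cf cg; rewrite !circ_seg ?segB //; exact: contB. Qed.
Lemma circZ c f : continuous f -> circ_int (fun x => c * f x) = c * circ_int f.
Proof.
by move=> cf; rewrite !circ_seg ?segZ //; apply: contM => //; exact: cont_cst.
Qed.
Lemma circN f : continuous f -> circ_int (fun x => - f x) = - circ_int f.
Proof.
by move=> cf; rewrite -mulN1r -circZ //; apply: circ_int_ext => x; rewrite mulN1r.
Qed.
Lemma circ_cst c : circ_int (fun=> c : R) = c.
Proof. by rewrite circ_seg ?seg_cst ?subr0 ?mulr1 //; exact: cont_cst. Qed.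
Lemma circ_sum (I : Type) (r : seq I) (h : I -> R -> R) :
  (forall i, continuous (h i)) ->
  circ_int (fun x => \sum_(i <- r) h i x) = \sum_(i <- r) circ_int (h i).
Proof.
move=> H; rewrite circ_seg ?seg_sum //; last exact: cont_sum.
by apply: eq_bigr => i _; rewrite circ_seg.
Qed.
Lemma circ_le f g : continuous f -> continuous g ->
  (forall t, 0 <= t <= 1 -> f t <= g t) -> circ_int f <= circ_int g.
Proof. by move=> cf cg h; rewrite !circ_seg //; exact: seg_le. Qed.
Lemma circ_ge0 f : continuous f -> (forall t, 0 <= t <= 1 -> 0 <= f t) -> 0 <= circ_int f.
Proof. by move=> cf h; rewrite circ_seg //; exact: seg_ge0. Qed.
Lemma circ_abs f : continuous f -> `|circ_int f| <= circ_int (fun x => `|f x|).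
Proof. by move=> cf; rewrite !circ_seg ?seg_abs //; exact: cont_abs. Qed.
Lemma circ_bnd f c : continuous f -> (forall t, 0 <= t <= 1 -> `|f t| <= c) -> `|circ_int f| <= c.
Proof.
move=> cf h; apply: (le_trans (circ_abs cf)); rewrite -[leRHS]circ_cst.
by apply: circ_le => //; [exact: cont_abs|exact: cont_cst].
Qed.
Lemma circ_CS f g : continuous f -> continuous g ->
  circ_int (fun x => f x * g x) ^+ 2 <=
  circ_int (fun x => f x ^+ 2) * circ_int (fun x => g x ^+ 2).
Proof.
move=> cf cg; rewrite !circ_seg ?seg_CS //; try exact: contX; exact: contM.
Qed.
Lemma circ_der F f : (forall x, der F x (f x)) -> continuous f -> circ_int f = F 1 - F 0.
Proof. by move=> dF cf; rewrite circ_seg // (seg_FTC _ _ dF). Qed.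

Lemma circ_parts f f' g g' : (forall x, der f x (f' x)) -> (forall x, der g x (g' x)) ->
  continuous f' -> continuous g' -> f 1 = f 0 -> g 1 = g 0 ->
  circ_int (fun x => f' x * g x) = - circ_int (fun x => f x * g' x).
Proof.
move=> df dg cf' cg' pf pg; have cf := der_cont df; have cg := der_cont dg.
apply/eqP; rewrite -subr_eq0 opprK -circD; try exact: contM.
rewrite (circ_der (F := fun x => f x * g x)) ?pf ?pg ?subrr //.
  by move=> x; exact: derM.
by apply: contD; exact: contM.
Qed.

Lemma osc_le f f' s t : (forall x, der f x (f' x)) -> continuous f' ->
  0 <= s <= 1 -> 0 <= t <= 1 -> `|f t - f s| <= circ_int (fun x => `|f' x|).
Proof.
move=> df cf.
wlog st : s t / s <= t.
  move=> H hs ht; case: (leP s t) => [st|/ltW ts]; first exact: H.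
  by rewrite distrC; exact: H.
move=> /andP[s0 s1] /andP[t0 t1].
rewrite -(seg_FTC s t df cf); apply: (le_trans (seg_abs cf st)).
have ca := cont_abs cf.
by rewrite circ_seg //; exact: seg_sub.
Qed.

(** The oscillation bound, averaged over the circle. *)
Lemma sobolev_mean f f' t : (forall x, der f x (f' x)) -> continuous f' ->
  0 <= t <= 1 -> `|f t - circ_int f| <= circ_int (fun x => `|f' x|).
Proof.
move=> df cf t01; have cF := der_cont df.
rewrite -(circ_cst (f t)) -circB //; last exact: cont_cst.
apply: circ_bnd => [|s s01]; first by apply: contB => //; exact: cont_cst.
exact: osc_le.
Qed.

Lemma circ_sqr_le f : continuous f -> circ_int f ^+ 2 <= circ_int (fun x => f x ^+ 2).
Proof.
move=> cf; have := circ_CS cf (@cont_cst 1).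
rewrite (_ : circ_int (fun x => 1 ^+ 2) = 1) ?mulr1; last first.
  by rewrite -[RHS](circ_cst 1); apply: circ_int_ext => x; rewrite expr1n.
by rewrite (@circ_int_ext (fun x => f x * 1) f) // => x; rewrite mulr1.
Qed.

(** [sobolev_mean] applied to [f ^+ 2], whose derivative is [2 f f']. *)
Lemma sobolev_sqr f f' t : (forall x, der f x (f' x)) -> continuous f' ->
  0 <= t <= 1 -> f t ^+ 2 <= circ_int (fun x => f x ^+ 2) + 2 * circ_int (fun x => `|f x * f' x|).
Proof.
move=> df cf t01; have cF := der_cont df.
have h := @sobolev_mean (fun x => f x ^+ 2) (fun x => 2 * (f x * f' x)) t.
have {h} : `|f t ^+ 2 - circ_int (fun x => f x ^+ 2)| <= circ_int (fun x => `|2 * (f x * f' x)|).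
  apply: h => //.
    move=> x; apply: (der_ext (f := fun x => f x * f x)); first by move=> u; rewrite expr2.
    by apply: der_eq (derM (df x) (df x)) _; ring.
  by apply: contM; [exact: cont_cst|exact: contM].
have -> : circ_int (fun x => `|2 * (f x * f' x)|) = 2 * circ_int (fun x => `|f x * f' x|).
  rewrite -circZ; last by apply: cont_abs; exact: contM.
  by apply: circ_int_ext => x; rewrite normrM ger0_norm.
by rewrite ler_norml => /andP[_]; rewrite lerBlDl.
Qed.

End OneVariable.

(** * Functions on the cylinder *)

Section TwoVariables.
Context {R : realType}.
Implicit Types (f g : R -> R) (F G : R -> R -> R) (a c s t : R).

(** Avoids difference quotients: an error of size [e * |h|] near [s] is what the mean value theorem
    produces. *)
Lemma der_eps f s l : (forall e, 0 < e -> exists2 d, 0 < d &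
  forall h, `|h| < d -> `|f (s + h) - f s - h * l| <= e * `|h|) -> der f s l.
Proof.
move=> H.
have cv : (fun h => h^-1 *: (f (h *: 1 + s) - f s)) @ 0^' --> l.
  apply/cvgrPdist_le => e e0; have [d d0 hd] := H e e0.
  near=> h.
  have h0 : h != 0 by near: h; exact: nbhs_dnbhs_neq.
  have hh : `|h| < d by near: h; exact: dnbhs0_lt.
  have := hd h hh; rewrite [s + h]addrC => hd'.
  rewrite /GRing.scale /= mulr1 distrC.
  rewrite -(ler_pM2r (x := `|h|)) ?normr_gt0 // -normrM.
  by rewrite (_ : _ * h = f (h + s) - f s - h * l) //; field.
apply: DeriveDef; last exact/cvg_lim.
by apply/cvg_ex; exists l.
Unshelve. all: by end_near. Qed.

(** A single [t0] serves all periodic functions, so that several of them can be moved to the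
    fundamental interval at once. *)
Lemma per_red t : exists2 t0 : R, 0 <= t0 <= 1 &
  forall f, periodic f 1 -> f t = f t0.
Proof.
exists (t - (Num.floor t)%:~R).
  have := floor_itv t; rewrite intrD => /andP[h1 h2]; apply/andP; split; lra.
move=> f pf.
have pn (m : nat) x : f (x + m%:R) = f x.
  elim: m x => [|m IH] x; first by rewrite addr0.
  by rewrite -natr1 addrA pf IH.
case: (Num.floor t) => m.
  by rewrite -[in LHS](subrK (m%:R : R) t) pn.
by rewrite NegzE mulrNz opprK pn.
Qed.

End TwoVariables.

(** The inverse of [d/dt] on mean-zero loops, precomposed with the projection to mean zero. *)
HB.lock Definition mzp {R : realType} (f : R -> R) (t : R) : R :=
  prim (fun x => f x - circ_int f) t
  - circ_int (prim (fun x => f x - circ_int f)).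

Section TwoVariables.
Context {R : realType}.
Implicit Types (f g : R -> R) (F G : R -> R -> R) (a c s t : R).

Lemma cont_centre f : continuous f -> continuous (fun x => f x - circ_int f).
Proof. by move=> cf; apply: contB => //; exact: cont_cst. Qed.

Lemma der_mzp f t : continuous f -> der (mzp f) t (f t - circ_int f).
Proof.
move=> cf; rewrite unlock.
apply: der_eq (derB (der_prim t (cont_centre cf)) (der_cst _ t)) _.
by rewrite subr0.
Qed.

Lemma cont_mzp f : continuous f -> continuous (mzp f).
Proof. by move=> cf; apply: der_cont => t; exact: der_mzp. Qed.

Lemma circ_mzp f : continuous f -> circ_int (mzp f) = 0.
Proof.
move=> cf; have cp : continuous (prim (fun x => f x - circ_int f)).
  by apply: der_cont => t; apply: der_prim; exact: cont_centre.
by rewrite unlock circB ?circ_cst ?subrr //; exact: cont_cst.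
Qed.

Lemma circ_centre f : continuous f -> circ_int (fun x => f x - circ_int f) = 0.
Proof. by move=> cf; rewrite circB ?circ_cst ?subrr //; exact: cont_cst. Qed.

Lemma mzp10 f : continuous f -> mzp f 1 = mzp f 0.
Proof.
move=> cf; apply/eqP; rewrite -subr_eq0 -(circ_der (fun x => der_mzp x cf) (cont_centre cf)).
by rewrite circ_centre.
Qed.

Lemma mzp_uniq f h : continuous f -> (forall t, der h t (f t - circ_int f)) ->
  circ_int h = 0 -> h =1 mzp f.
Proof.
move=> cf dh h0 t; have ch := der_cont dh.
have e x : h x - mzp f x = h 0 - mzp f 0.
  apply: (@der_cst_eq _ (fun x => h x - mzp f x)) => y.
  by apply: der_eq (derB (dh y) (der_mzp y cf)) _; rewrite subrr.
have : circ_int (fun x => h x - mzp f x) = h 0 - mzp f 0.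
  by rewrite -[RHS]circ_cst; exact: circ_int_ext.
rewrite circB //; last exact: cont_mzp.
by rewrite h0 circ_mzp // subrr => e0; apply/eqP; rewrite -subr_eq0 e -e0.
Qed.

Lemma periodic_der f f' : periodic f 1 -> (forall t, der f t (f' t)) -> periodic f' 1.
Proof.
move=> pf df t; apply: (der_unique (der_shift (df (t + 1)))).
apply: der_ext (df t) => x; exact/esym/pf.
Qed.

Lemma periodic_mzp f : continuous f -> periodic f 1 -> periodic (mzp f) 1.
Proof.
move=> cf pf t; apply/eqP; rewrite -subr_eq0; apply/eqP.
rewrite (@der_cst_eq _ (fun x => mzp f (x + 1) - mzp f x) t 0).
  by rewrite add0r mzp10 // subrr.
move=> x; apply: der_eq (derB (der_shift (der_mzp (x + 1) cf)) (der_mzp x cf)) _.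
by rewrite pf subrr.
Qed.

Lemma mzpB f g t : continuous f -> continuous g ->
  mzp (fun x => f x - g x) t = mzp f t - mzp g t.
Proof.
move=> cf cg; apply/esym.
apply: (@mzp_uniq _ (fun t => mzp f t - mzp g t)); first exact: contB.
  move=> x; apply: der_eq (derB (der_mzp x cf) (der_mzp x cg)) _.
  by rewrite circB //; ring.
transitivity (circ_int (mzp f) - circ_int (mzp g)); first by apply: circB; exact: cont_mzp.
by rewrite (circ_mzp cf) (circ_mzp cg) subrr.
Qed.

Lemma mzpZ c f t : continuous f -> mzp (fun x => c * f x) t = c * mzp f t.
Proof.
move=> cf; apply/esym.
have cc := @cont_cst R c.
apply: (@mzp_uniq _ (fun t => c * mzp f t)); first exact: contM.
  move=> x; apply: der_eq (derZ c (der_mzp x cf)) _.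
  by rewrite circZ //; ring.
by rewrite circZ ?circ_mzp ?mulr0 //; exact: cont_mzp.
Qed.

Lemma mzp_ext f g t : f =1 g -> mzp f t = mzp g t.
Proof. by move=> /funext ->. Qed.

Lemma mzp_le f t : continuous f -> 0 <= t <= 1 ->
  `|mzp f t| <= 2 * circ_int (fun x => `|f x|).
Proof.
move=> cf t01.
have := sobolev_mean (fun x => der_mzp x cf) (cont_centre cf) t01.
rewrite circ_mzp // subr0 => h; apply: (le_trans h).
have ca := cont_abs cf.
have cc := @cont_cst R `|circ_int f|.
apply: (@le_trans _ _ (circ_int (fun x => `|f x| + `|circ_int f|))).
  apply: circ_le; first exact/cont_abs/cont_centre.
    exact: contD.
  by move=> x _; exact: ler_normB.
by rewrite circD // circ_cst; have := circ_abs cf; lra.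
Qed.

Lemma mzp_sup f c t : continuous f -> 0 <= t <= 1 ->
  (forall x, 0 <= x <= 1 -> `|f x| <= c) -> `|mzp f t| <= 2 * c.
Proof.
move=> cf t01 h; apply: (le_trans (mzp_le cf t01)); rewrite ler_pM2l //.
rewrite -[leRHS]circ_cst; apply: circ_le => //; [exact: cont_abs|exact: cont_cst].
Qed.

Definition cont2 F := continuous (fun q : R * R => F q.1 q.2).

Lemma cont2_l F s : cont2 F -> continuous (F s).
Proof.
move=> cF t; apply: (@continuous_comp _ _ _ (fun x : R => (s, x)) (fun q : R * R => F q.1 q.2)).
  by apply: (@cvg_pair _ _ _ _ (nbhs s) (nbhs t)); [exact: cvg_cst|exact: cvg_id].
exact: cF.
Qed.

Lemma cont2D F G : cont2 F -> cont2 G -> cont2 (fun s t => F s t + G s t).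
Proof. by move=> cF cG q; apply: cvgD; [exact: cF|exact: cG]. Qed.
Lemma cont2M F G : cont2 F -> cont2 G -> cont2 (fun s t => F s t * G s t).
Proof. by move=> cF cG q; apply: cvgM; [exact: cF|exact: cG]. Qed.
Lemma cont2_fst f : continuous f -> cont2 (fun s _ => f s).
Proof.
move=> cf q; apply: (@continuous_comp _ _ _ (fun q : R * R => q.1) f); last exact: cf.
exact: cvg_fst.
Qed.
Lemma cont2_snd f : continuous f -> cont2 (fun _ t => f t).
Proof.
move=> cf q; apply: (@continuous_comp _ _ _ (fun q : R * R => q.2) f); last exact: cf.
exact: cvg_snd.
Qed.

Lemma cont2_unif F s (e : R) : cont2 F -> 0 < e -> exists2 d : R, 0 < d &
  forall s', `|s' - s| < d -> forall t, 0 <= t <= 1 -> `|F s' t - F s t| < e.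
Proof.
move=> cF e0.
have cpt : compact `[0 : R, 1]%classic by exact: segment_compact.
have /compact_near_coveringP/near_covering_withinP ncov := cpt.
have h : forall t, `[0 : R, 1]%classic t ->
    \forall x \near t & s' \near s, `[0 : R, 1]%classic x -> `|F s' x - F s x| < e.
  move=> t _.
  have e2 : 0 < e / 2 by rewrite divr_gt0.
  have h1 : \forall q \near (s, t), `|F s t - F q.1 q.2| < e / 2.
    by have /cvgrPdist_lt := cF (s, t); apply.
  have h2 : \forall x \near t, `|F s t - F s x| < e / 2.
    by have /cvgrPdist_lt := cont2_l cF (s := s) (x := t); apply.
  case: h1 => -[U V] [/= Us Vt] UV.
  near=> x s' => _.
  have a1 : `|F s t - F s x| < e / 2 by near: x.
  have a2 : `|F s t - F s' x| < e / 2.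
    by apply: (UV (s', x)); split => /=; [near: s'|near: x].
  rewrite (_ : _ - _ = (F s t - F s x) - (F s t - F s' x)); last by ring.
  by apply: le_lt_trans (ler_normB _ _) _; lra.
have hn := ncov R (nbhs s) (fun s' x => `|F s' x - F s x| < e) _ h.
case/(_ _)/nbhs_ballP : hn => d /= d0 hd.
exists d => // s' hs t t01.
by apply: (hd s') => //=; rewrite /ball /= ?in_itv // distrC.
Unshelve. all: by end_near. Qed.

Section Functional.
Variables (T : (R -> R) -> R) (C : R).
Hypothesis TB : forall f g, continuous f -> continuous g ->
  T (fun x => f x - g x) = T f - T g.
Hypothesis TZ : forall c f, continuous f -> T (fun x => c * f x) = c * T f.
Hypothesis Tle : forall f c, continuous f -> (forall t, 0 <= t <= 1 -> `|f t| <= c) ->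
  `|T f| <= C * c.

Lemma functional_unif F s (e : R) : cont2 F -> 0 < e -> exists2 d : R, 0 < d &
  forall s', `|s' - s| < d -> `|T (F s') - T (F s)| <= C * e.
Proof.
move=> cF e0; have [d d0 h] := cont2_unif s cF e0.
exists d => // s' /h hs; rewrite -TB; try exact: cont2_l.
apply: Tle => [|t /hs/ltW //]; by apply: contB; exact: cont2_l.
Qed.

Lemma functional_cont F : 0 < C -> cont2 F -> continuous (fun s => T (F s)).
Proof.
move=> C0 cF s; apply/cvgrPdist_le => e e0.
have [|d d0 h] := functional_unif (F := F) s (e := e / C) cF; first by rewrite divr_gt0.
near=> s'; rewrite distrC; apply: (le_trans (h s' _)).
  by near: s'; exact: cvgr_distC_lt.
by rewrite mulrCA divff ?mulr1 // gt_eqF.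
Unshelve. all: by end_near. Qed.

(** Differentiation under an abstract bounded linear functional; it serves both the mean and the
    mean-zero primitive. *)
Lemma functional_der F G s : 0 < C -> cont2 F -> cont2 G ->
  (forall s t, der (F ^~ t) s (G s t)) -> der (fun s => T (F s)) s (T (G s)).
Proof.
move=> C0 cF cG dF; apply: der_eps => e e0.
have [|d d0 h] := cont2_unif s cG (e := e / C); first by rewrite divr_gt0.
exists d => // x hx.
have cl H y : cont2 H -> continuous (H y) by move=> ?; exact: cont2_l.
have cxG : continuous (fun t => x * G s t) by apply: contM; [exact: cont_cst|exact: cl].
rewrite -TB; try exact: cl.
rewrite -TZ; last exact: cl.
rewrite -TB //; last by apply: contB; exact: cl.
have -> : e * `|x| = C * (e / C * `|x|) by field; rewrite gt_eqF.
apply: Tle; first by apply: contB => //; apply: contB; exact: cl.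
move=> t t01.
have [c /andP[c1 c2] ->] := der_MVT s (s + x) (fun y => dF y t).
rewrite (_ : _ - _ = (G c t - G s t) * x); last by ring.
rewrite normrM ler_wpM2r //; apply/ltW/h => //.
apply: le_lt_trans hx.
move: c1 c2; rewrite minEle maxEle lerDl; case: (leP 0 x) => x0 c1 c2.
  by rewrite !ger0_norm //; lra.
rewrite ler0_norm; last lra.
rewrite ltr0_norm //; lra.
Qed.
End Functional.

Lemma circ_cont F : cont2 F -> continuous (fun s => circ_int (F s)).
Proof.
apply: (functional_cont (C := 1)) => // [f g cf cg|f c cf h]; first exact: circB.
by rewrite mul1r; exact: circ_bnd.
Qed.

Lemma circ_der_under F G s : cont2 F -> cont2 G ->
  (forall s t, der (F ^~ t) s (G s t)) -> der (fun s => circ_int (F s)) s (circ_int (G s)).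
Proof.
apply: (functional_der (C := 1)) => // [f g cf cg|c f cf|f c cf h]; [exact: circB|exact: circZ|].
by rewrite mul1r; exact: circ_bnd.
Qed.

Definition per2 F := forall s, periodic (F s) 1.

Lemma mzp_supp f c t : continuous f -> periodic f 1 ->
  (forall x, 0 <= x <= 1 -> `|f x| <= c) -> `|mzp f t| <= 2 * c.
Proof.
move=> cf pf h; have [t0 t01 ->] := per_red t; last exact: periodic_mzp.
exact: mzp_sup.
Qed.

Lemma mzp_der_under F G s t : cont2 F -> cont2 G ->
  (forall s t, der (F ^~ t) s (G s t)) -> 0 <= t <= 1 ->
  der (fun s => mzp (F s) t) s (mzp (G s) t).
Proof.
move=> cF cG d t01; apply: (functional_der (C := 2) (T := fun f => mzp f t)) => //.
- by move=> f g; exact: mzpB.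
- by move=> c f; exact: mzpZ.
- by move=> f c cf h; exact: mzp_sup.
Qed.

Lemma mzp_der_under_per F G s t : cont2 F -> cont2 G -> per2 F -> per2 G ->
  (forall s t, der (F ^~ t) s (G s t)) ->
  der (fun s => mzp (F s) t) s (mzp (G s) t).
Proof.
move=> cF cG pF pG d; have [t0 t01 h] := per_red t.
rewrite (h (mzp (G s))); last by apply: periodic_mzp => //; exact: cont2_l.
apply: (der_ext (f := fun s => mzp (F s) t0)); last exact: mzp_der_under.
by move=> x; apply/esym/h; apply: periodic_mzp => //; exact: cont2_l.
Qed.

Lemma cont2_mzp F : cont2 F -> per2 F -> cont2 (fun s t => mzp (F s) t).
Proof.
move=> cF pF [s t]; apply/cvgrPdist_lt => e e0.
have [|d d0 h] := cont2_unif (F := F) s (e := e / 8) cF; first by rewrite divr_gt0.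
have cs : continuous (F s) by exact: cont2_l.
have h2 : \forall x \near t, `|mzp (F s) t - mzp (F s) x| < e / 2.
  by have /cvgrPdist_lt := cont_mzp cs (x := t); apply; rewrite divr_gt0.
have h1 : nbhs (s : R) [set s' : R | `|s' - s| < d].
  by apply/nbhs_ballP; exists d => // y; rewrite /ball /= distrC.
exists ([set s' : R | `|s' - s| < d], [set x : R | `|mzp (F s) t - mzp (F s) x| < e / 2]) => //.
move=> q [/= a1 a2].
have a3 : `|mzp (F q.1) q.2 - mzp (F s) q.2| <= 2 * (e / 8).
  have cq : continuous (F q.1) by exact: cont2_l.
  rewrite -mzpB //; apply: mzp_supp; first exact: contB.
    by move=> u; rewrite pF pF.
  by move=> x x01; apply/ltW/h.
rewrite (_ : _ - _ = (mzp (F s) t - mzp (F s) q.2) - (mzp (F q.1) q.2 - mzp (F s) q.2)); last by ring.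
by apply: le_lt_trans (ler_normB _ _) _; lra.
Qed.

(** Differentiability is expressed through given derivative functions, so that closure properties
    follow by induction on [n] without computing any derivative.  With [b = false] only
    [s]-derivatives are counted: solutions of the potential equation are first known to be smooth in
    the parameter alone. *)
Fixpoint Cn (b : bool) (n : nat) F : Prop := [/\ cont2 F, per2 F &
  if n is m.+1 then
    (exists2 Fs, Cn b m Fs & forall s t, der (F ^~ t) s (Fs s t)) /\
    (b -> exists2 Ft, Cn b m Ft & forall s t, der (F s) t (Ft s t))
  else True].

Lemma Cn0 b n F : Cn b n F -> cont2 F /\ per2 F.
Proof. by case: n => [|n] []. Qed.

Lemma CnW b n F : Cn b n.+1 F -> Cn b n F.
Proof.
elim: n F => [|n IH] F; first by case.
case=> cF pF [[Fs gFs dFs] ht]; split => //; split; first by exists Fs => //; exact: IH.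
by move=> /ht[Ft gFt dFt]; exists Ft => //; exact: IH.
Qed.

Lemma Cn_ext b n F G : (forall s t, F s t = G s t) -> Cn b n F -> Cn b n G.
Proof. by move=> h; rewrite (_ : F = G) //; apply/funext => s; apply/funext => t. Qed.

Lemma Cn_cst b n c : Cn b n (fun _ _ => c).
Proof.
have h0 x : cont2 (fun _ _ => x) by apply: cont2_fst; exact: cont_cst.
elim: n c => [|n IH] c; split => //; split => [|_]; exists (fun _ _ => 0) => // s t; exact: der_cst.
Qed.

Lemma CnD b n F G : Cn b n F -> Cn b n G -> Cn b n (fun s t => F s t + G s t).
Proof.
elim: n F G => [|n IH] F G; case=> cF pF hF; case=> cG pG hG.
  by split; [exact: cont2D|move=> s t; rewrite pF pG|].
split; [exact: cont2D|move=> s t; by rewrite pF pG|split].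
  case: hF hG => [[Fs gFs dFs] _] [[Gs gGs dGs] _].
  by exists (fun s t => Fs s t + Gs s t) => [|s t]; [exact: IH|exact: derD].
move=> bb; case: hF hG => [_ /(_ bb)[Ft gFt dFt]] [_ /(_ bb)[Gt gGt dGt]].
by exists (fun s t => Ft s t + Gt s t) => [|s t]; [exact: IH|exact: derD].
Qed.

Lemma CnM b n F G : Cn b n F -> Cn b n G -> Cn b n (fun s t => F s t * G s t).
Proof.
elim: n F G => [|n IH] F G.
  move=> [cF pF hF] [cG pG hG].
  by split; [exact: cont2M|move=> s t; rewrite pF pG|].
move=> HF HG; have HF' := CnW HF; have HG' := CnW HG.
case: HF HG => cF pF hF; case=> cG pG hG.
split; [exact: cont2M|move=> s t; by rewrite pF pG|split].
  case: hF hG => [[Fs gFs dFs] _] [[Gs gGs dGs] _].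
  exists (fun s t => Fs s t * G s t + F s t * Gs s t) => [|s t]; last exact: derM.
  by apply: CnD; exact: IH.
move=> bb; case: hF hG => [_ /(_ bb)[Ft gFt dFt]] [_ /(_ bb)[Gt gGt dGt]].
exists (fun s t => Ft s t * G s t + F s t * Gt s t) => [|s t]; last exact: derM.
by apply: CnD; exact: IH.
Qed.

Lemma CnZ b n c F : Cn b n F -> Cn b n (fun s t => c * F s t).
Proof. by move=> hF; apply: CnM => //; exact: Cn_cst. Qed.
Lemma CnN b n F : Cn b n F -> Cn b n (fun s t => - F s t).
Proof. by move=> /(CnZ (-1)); apply: Cn_ext => s t; rewrite mulN1r. Qed.
Lemma CnB b n F G : Cn b n F -> Cn b n G -> Cn b n (fun s t => F s t - G s t).
Proof. by move=> hF hG; apply: CnD => //; exact: CnN. Qed.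
Lemma Cn_sum b n (I : Type) (r : seq I) (F : I -> R -> R -> R) :
  (forall i, Cn b n (F i)) -> Cn b n (fun s t => \sum_(i <- r) F i s t).
Proof.
move=> H; elim: r => [|i r IH].
  by apply: Cn_ext (Cn_cst b n 0) => s t; rewrite big_nil.
by apply: Cn_ext (CnD (H i) IH) => s t; rewrite big_cons.
Qed.
Lemma CnX b n F m : Cn b n F -> Cn b n (fun s t => F s t ^+ m).
Proof.
move=> HF; elim: m => [|m IH]; first exact: (Cn_cst _ _ 1).
by apply: Cn_ext (CnM HF IH) => s t; rewrite exprS.
Qed.

Lemma Cn_mean b n F : Cn b n F -> Cn b n (fun s _ => circ_int (F s)).
Proof.
elim: n F => [|n IH] F; case=> cF pF hF; first by split => //; apply: cont2_fst; exact: circ_cont.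
split => //; first by apply: cont2_fst; exact: circ_cont.
case: hF => -[Fs gFs dFs] _; split => [|_].
  exists (fun s _ => circ_int (Fs s)) => [|s t]; first exact: IH.
  by apply: circ_der_under => //; case: (Cn0 gFs).
by exists (fun _ _ => 0) => [|s t]; [exact: Cn_cst|exact: der_cst].
Qed.

Lemma Cn_mzp b n F : Cn b n F -> Cn b n (fun s t => mzp (F s) t).
Proof.
elim: n F => [|n IH] F HF; have [cF pF] := Cn0 HF.
  split => //; first exact: cont2_mzp.
  by move=> s; apply: periodic_mzp => //; exact: cont2_l.
split; [exact: cont2_mzp| |].
  by move=> s; apply: periodic_mzp => //; exact: cont2_l.
have HF' := CnW HF; case: HF => _ _ -[[Fs gFs dFs] _]; have [cFs pFs] := Cn0 gFs.
split => [|_].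
  exists (fun s t => mzp (Fs s) t) => [|s t]; first exact: IH.
  exact: mzp_der_under_per.
exists (fun s t => F s t - circ_int (F s)) => [|s t].
  by apply: CnB => //; exact: Cn_mean.
by apply: der_mzp; exact: cont2_l.
Qed.

Lemma Cn_fst b n f : smooth f -> Cn b n (fun s _ => f s).
Proof.
elim: n f => [|n IH] f sf.
  split => //; apply: cont2_fst; apply: der_cont => s.
  by apply: derivable_der; exact: (sf 0%N).
have df s : der f s (f^`() s) by apply: derivable_der; exact: (sf 0%N).
split => //; first by apply: cont2_fst; exact: der_cont df.
split => [|_].
  by exists (fun s _ => f^`() s) => //; apply: IH => m t; rewrite -derive1Sn; exact: sf.
by exists (fun _ _ => 0) => [|s t]; [exact: Cn_cst|exact: der_cst].
Qed.

Lemma smooth_Cn f : (forall n, Cn false n (fun s _ => f s)) -> smooth f.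
Proof.
move=> h; suff H m : forall n, Cn false n (fun s _ => f^`(m) s).
  by move=> m t; have [_ _ [[Fs _ dFs] _]] := H m 1%N; exact: der_derivable (dFs t 0).
elim: m => [|m IH] n; first exact: h.
have [_ _ [[Fs gFs dFs] _]] := IH n.+1.
apply: Cn_ext gFs => s t; rewrite derive1nS; apply/esym/der_derive1; exact: dFs.
Qed.

Lemma Cn_smooth2 n F : smooth2 F -> per2 F -> Cn true n F.
Proof.
elim: n F => [|n IH] F sF pF; first by split => //; case: (sF [::]).
have sub b : smooth2 (pderiv [:: b] F).
  move=> w; have := sF (w ++ [:: b]).
  by have -> : pderiv (w ++ [:: b]) F = pderiv w (pderiv [:: b] F) by elim: w => //= x w ->.
have ds s t : der (F ^~ t) s (d_s F s t).
  by have [_ hd] := sF [::]; have [h1 _] := hd s t; exact: derivable_der h1.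
have dt s t : der (F s) t (d_t F s t).
  by have [_ hd] := sF [::]; have [_ h1] := hd s t; exact: derivable_der h1.
split => //; first by case: (sF [::]).
split => [|_].
  exists (d_s F) => //; apply: IH; first exact: (sub true).
  move=> s t; apply: der_unique (ds s (t + 1)) _.
  by apply: der_ext (ds s t) => x; rewrite pF.
exists (d_t F) => //; apply: IH; first exact: (sub false).
by move=> s; apply: periodic_der (dt s); exact: pF.
Qed.

Definition sm F := forall n, Cn true n F.

Lemma sm_cont F : sm F -> cont2 F.
Proof. by move=> /(_ 0%N)[]. Qed.
Lemma sm_per F : sm F -> per2 F.
Proof. by move=> /(_ 0%N)[]. Qed.
Lemma sm_contl F s : sm F -> continuous (F s).
Proof. by move=> /sm_cont; exact: cont2_l. Qed.

Lemma sm_ds F : sm F -> (forall s t, der (F ^~ t) s (d_s F s t)) /\ sm (d_s F).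
Proof.
move=> h; have d s t : der (F ^~ t) s (d_s F s t).
  by have [_ _ [[Fs _ dFs] _]] := h 1%N; exact/derivable_der/der_derivable/dFs.
split=> // n; have [_ _ [[Fs gFs dFs] _]] := h n.+1.
by apply: Cn_ext gFs => s t; exact: der_unique (dFs s t) (d s t).
Qed.

Lemma sm_dt F : sm F -> (forall s t, der (F s) t (d_t F s t)) /\ sm (d_t F).
Proof.
move=> h; have d s t : der (F s) t (d_t F s t).
  by have [_ _ [_ /(_ isT)[Fs _ dFs]]] := h 1%N; exact/derivable_der/der_derivable/dFs.
split=> // n; have [_ _ [_ /(_ isT)[Fs gFs dFs]]] := h n.+1.
by apply: Cn_ext gFs => s t; exact: der_unique (dFs s t) (d s t).
Qed.

Lemma sm_pderiv w F : sm F -> sm (pderiv w F).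
Proof.
by move=> h; elim: w => //= -[] w IH; [case: (sm_ds IH)|case: (sm_dt IH)].
Qed.

Lemma sm_smooth2 F : sm F -> smooth2 F.
Proof.
move=> h w; have hw := sm_pderiv w h; split; first exact: sm_cont.
move=> s t; split.
  by have [d _] := sm_ds hw; exact/der_derivable/d.
by have [d _] := sm_dt hw; exact/der_derivable/d.
Qed.

Lemma smooth2_sm F : smooth2 F -> per2 F -> sm F.
Proof. by move=> ? ? n; exact: Cn_smooth2. Qed.

Lemma smD F G : sm F -> sm G -> sm (fun s t => F s t + G s t).
Proof. by move=> ? ? n; exact: CnD. Qed.
Lemma smB F G : sm F -> sm G -> sm (fun s t => F s t - G s t).
Proof. by move=> ? ? n; exact: CnB. Qed.
Lemma smM F G : sm F -> sm G -> sm (fun s t => F s t * G s t).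
Proof. by move=> ? ? n; exact: CnM. Qed.
Lemma smZ c F : sm F -> sm (fun s t => c * F s t).
Proof. by move=> ? n; exact: CnZ. Qed.
Lemma smX F m : sm F -> sm (fun s t => F s t ^+ m).
Proof. by move=> ? n; exact: CnX. Qed.
Lemma sm_cst c : sm (fun _ _ => c).
Proof. by move=> n; exact: Cn_cst. Qed.
Lemma sm_sum (I : Type) (r : seq I) (F : I -> R -> R -> R) :
  (forall i, sm (F i)) -> sm (fun s t => \sum_(i <- r) F i s t).
Proof. by move=> h n; apply: Cn_sum => i; exact: h. Qed.
Lemma sm_mean F : sm F -> sm (fun s _ => circ_int (F s)).
Proof. by move=> ? n; exact: Cn_mean. Qed.
Lemma sm_mzp F : sm F -> sm (fun s t => mzp (F s) t).
Proof. by move=> ? n; exact: Cn_mzp. Qed.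
Lemma sm_fst f : smooth f -> sm (fun s _ => f s).
Proof. by move=> ? n; exact: Cn_fst. Qed.

Lemma d_sE F s t l : der (F ^~ t) s l -> d_s F s t = l.
Proof. exact: der_derive1. Qed.
Lemma d_tE F s t l : der (F s) t l -> d_t F s t = l.
Proof. exact: der_derive1. Qed.

Lemma d_s_mean F s t : sm F -> d_s (fun s _ => circ_int (F s)) s t = circ_int (d_s F s).
Proof.
move=> sF; have [dF gF] := sm_ds sF; apply: d_sE.
apply: circ_der_under => //; exact: sm_cont.
Qed.
Lemma d_s_mzp F s t : sm F -> d_s (fun s t => mzp (F s) t) s t = mzp (d_s F s) t.
Proof.
move=> sF; have [dF gF] := sm_ds sF; apply: d_sE.
apply: (mzp_der_under_per (F := F)) => //; (try exact: sm_cont); exact: sm_per.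
Qed.
Lemma d_t_mzp F s t : sm F -> d_t (fun s t => mzp (F s) t) s t = F s t - circ_int (F s).
Proof. by move=> sF; apply: d_tE; apply: der_mzp; exact: sm_contl. Qed.

Lemma circ_d_t F s : sm F -> circ_int (d_t F s) = 0.
Proof.
move=> sF; have [dF gF] := sm_dt sF.
rewrite (circ_der (dF s)); last exact: sm_contl.
by rewrite -[X in F s X]add0r (sm_per sF) subrr.
Qed.

Lemma mzp_d_t F s t : sm F -> F s t = circ_int (F s) + mzp (d_t F s) t.
Proof.
move=> sF; have [dF gF] := sm_dt sF; have cF : continuous (F s) by exact: sm_contl.
have cd : continuous (d_t F s) by exact: sm_contl.
have e : F s t - circ_int (F s) = mzp (d_t F s) t.
  apply: (mzp_uniq (h := fun t => F s t - circ_int (F s))) => //; last exact: circ_centre.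
  by move=> x; rewrite circ_d_t //; apply: derB => //; exact: der_cst.
by rewrite -e; ring.
Qed.

(** Write [F] as its mean plus the mean-zero primitive of [d_t F]; both commute with [d_s]. *)
Lemma d_st F s t : sm F -> d_s (d_t F) s t = d_t (d_s F) s t.
Proof.
move=> sF; have [dFs gFs] := sm_ds sF; have [dFt gFt] := sm_dt sF.
have [dFts gFts] := sm_ds gFt.
have e x : d_s F s x = circ_int (d_s F s) + mzp (d_s (d_t F) s) x.
  apply: der_unique (dFs s x) _.
  apply: (der_ext (f := fun s => circ_int (F s) + mzp (d_t F s) x)).
    by move=> y; rewrite -mzp_d_t.
  apply: derD; first by apply: circ_der_under => //; exact: sm_cont.
  apply: mzp_der_under_per; [exact: sm_cont|exact: sm_cont|exact: sm_per|exact: sm_per|exact: dFts].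
apply/esym/d_tE; rewrite (_ : d_s F s = fun x => circ_int (d_s F s) + mzp (d_s (d_t F) s) x); last exact/funext.
have z : circ_int (d_s (d_t F) s) = 0.
  rewrite -(d_s_mean s 0 gFt).
  apply: d_sE; apply: (der_ext (f := fun=> 0)); last exact: der_cst.
  by move=> x; rewrite circ_d_t.
apply: der_eq (derD (der_cst _ t) (der_mzp t _)) _; first exact: sm_contl.
by rewrite z subr0 add0r.
Qed.

(** The two classes must be propagated together, as each function is a multiple of the derivative of
    the other. *)
Lemma sm_cos c : periodic (fun t => cos (c * t)) 1 -> periodic (fun t => sin (c * t)) 1 ->
  sm (fun _ t => cos (c * t)) /\ sm (fun _ t => sin (c * t)).
Proof.
move=> pc ps.
have dc t : der (fun t => cos (c * t)) t (- c * sin (c * t)).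
  by apply: der_eq (der_comp (g := fun t => c * t) (is_derive_cos _) (derZ c (der_id t))) _; ring.
have ds t : der (fun t => sin (c * t)) t (c * cos (c * t)).
  by apply: der_eq (der_comp (g := fun t => c * t) (is_derive_sin _) (derZ c (der_id t))) _; ring.
suff H n : Cn true n (fun _ t => cos (c * t)) /\ Cn true n (fun _ t => sin (c * t)).
  by split => n; case: (H n).
elim: n => [|n [IHc IHs]].
  by split; split => //; apply: cont2_snd; [exact: der_cont dc|exact: der_cont ds].
split; split => //.
- by apply: cont2_snd; exact: der_cont dc.
- split => [|_]; first by exists (fun _ _ => 0) => [|s t]; [exact: Cn_cst|exact: der_cst].
  by exists (fun _ t => - c * sin (c * t)) => //; exact: (CnZ (- c)).
- by apply: cont2_snd; exact: der_cont ds.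
- split => [|_]; first by exists (fun _ _ => 0) => [|s t]; [exact: Cn_cst|exact: der_cst].
  by exists (fun _ t => c * cos (c * t)) => //; exact: (CnZ c).
Qed.

End TwoVariables.

(** * The elliptic equation for the potential *)

Section Elliptic.
Context {R : realType} {n k : nat} (B : 'I_n -> 'I_k -> R).
Implicit Types (a b : 'I_n -> R -> R) (w v z f : 'I_k -> R -> R) (g : R -> R).

(** [K = - P P], with [P] the mean-zero primitive: the Green operator of [- d^2/dt^2] on mean-zero
    loops. *)
Definition Kop g : R -> R := mzp (fun t => - mzp g t).

Definition lin z (j : 'I_n) (t : R) := \sum_l B j l * z l t.
(** With [a j = |z_j|^2] this is [L_z^* L_z], as an operator on loops. *)
Definition Qop a z (l : 'I_k) (t : R) := \sum_j B j l * (a j t * lin z j t).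

Definition contf {I : Type} (z : I -> R -> R) := forall l, continuous (z l).
Definition perf {I : Type} (z : I -> R -> R) := forall l, periodic (z l) 1.

Lemma cont_lin z j : contf z -> continuous (lin z j).
Proof. by move=> cz; apply: cont_sum => l; apply: contM; [exact: cont_cst|exact: cz]. Qed.

Lemma cont_Q a z : contf a -> contf z -> contf (Qop a z).
Proof.
move=> ca cz l; apply: cont_sum => j; apply: contM; first exact: cont_cst.
by apply: contM; [exact: ca|exact: cont_lin].
Qed.

Lemma per_Q a z : perf a -> perf z -> perf (Qop a z).
Proof.
move=> pa pz l t; apply: eq_bigr => j _; rewrite pa; congr (_ * (_ * _)).
by apply: eq_bigr => i _; rewrite pz.
Qed.

(** [L_z^* L_z] is the form [<L_z ., L_z .>]. *)
Lemma Q_form a z v t : \sum_l Qop a z l t * v l t = \sum_j a j t * (lin z j t * lin v j t).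
Proof.
under eq_bigr do rewrite mulr_suml.
rewrite exchange_big; apply: eq_bigr => j _.
rewrite /lin mulrA [in RHS]mulr_sumr; apply: eq_bigr => l _.
by rewrite /lin; ring.
Qed.

Definition cB : R := \sum_j \sum_l \sum_i `|B j l| * `|B j i|.

Lemma cB_ge0 : 0 <= cB.
Proof. by do 3!(apply: sumr_ge0 => ? _); exact: mulr_ge0. Qed.

Lemma Q_bound b z (beta c : R) l t : 0 <= beta -> 0 <= c -> (forall j, `|b j t| <= beta) ->
  (forall i, `|z i t| <= c) -> `|Qop b z l t| <= cB * (beta * c).
Proof.
move=> b0 c0 hb hz; rewrite /cB mulr_suml; apply: le_trans (ler_norm_sum _ _ _) _.
apply: ler_sum => j _.
rewrite (bigD1 l) //= mulrDl; apply: ler_wpDr.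
  by rewrite mulr_ge0 ?mulr_ge0 //; do 2!(apply: sumr_ge0 => ? _); exact: mulr_ge0.
rewrite normrM -mulr_sumr -mulrA ler_wpM2l // normrM.
rewrite mulrCA ler_pM // mulr_suml; apply: le_trans (ler_norm_sum _ _ _) _.
by apply: ler_sum => i _; rewrite normrM ler_wpM2l.
Qed.

Lemma QB a b z l t : Qop (fun j t => a j t - b j t) z l t = Qop a z l t - Qop b z l t.
Proof. by rewrite -sumrB; apply: eq_bigr => j _; ring. Qed.

Lemma QZ a c z l t : Qop (fun j t => c * a j t) z l t = c * Qop a z l t.
Proof. by rewrite mulr_sumr; apply: eq_bigr => j _; ring. Qed.

Lemma linB z v j t : lin (fun l t => z l t - v l t) j t = lin z j t - lin v j t.
Proof. by rewrite -sumrB; apply: eq_bigr => i _; ring. Qed.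

Lemma linZ c z j t : lin (fun l t => c * z l t) j t = c * lin z j t.
Proof. by rewrite mulr_sumr; apply: eq_bigr => i _; ring. Qed.

Lemma QlinB a z v l t : Qop a (fun l t => z l t - v l t) l t = Qop a z l t - Qop a v l t.
Proof. by rewrite -sumrB; apply: eq_bigr => j _; rewrite linB; ring. Qed.

Lemma QlinZ a c z l t : Qop a (fun l t => c * z l t) l t = c * Qop a z l t.
Proof. by rewrite mulr_sumr; apply: eq_bigr => j _; rewrite linZ; ring. Qed.

Lemma contNmzp g : continuous g -> continuous (fun t => - mzp g t).
Proof. by move=> cg; apply: contN; exact: cont_mzp. Qed.

Lemma circ_Nmzp g : continuous g -> circ_int (fun t => - mzp g t) = 0.
Proof.
move=> cg; transitivity (- circ_int (mzp g)); last by rewrite circ_mzp // oppr0.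
by apply: circN; exact: cont_mzp.
Qed.

Lemma der_K g t : continuous g -> der (Kop g) t (- mzp g t).
Proof.
move=> cg; apply: der_eq (der_mzp t (contNmzp cg)) _.
by rewrite circ_Nmzp // subr0.
Qed.

Lemma cont_K g : continuous g -> continuous (Kop g).
Proof. by move=> cg; apply: cont_mzp; exact: contNmzp. Qed.

Lemma circ_K g : continuous g -> circ_int (Kop g) = 0.
Proof. by move=> cg; apply: circ_mzp; exact: contNmzp. Qed.

Lemma periodic_K g : continuous g -> periodic g 1 -> periodic (Kop g) 1.
Proof.
move=> cg pg; apply: periodic_mzp; first exact: contNmzp.
by move=> t; rewrite periodic_mzp.
Qed.

(** Integration by parts: [P] is antisymmetric and [K = - P P]. *)
Lemma K_form g h : continuous g -> continuous h ->
  circ_int (fun t => mzp g t * mzp h t) = circ_int (fun t => g t * Kop h t).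
Proof.
move=> cg ch.
have cmg := cont_mzp cg; have cmh := cont_mzp ch; have cK := cont_K ch.
have h1 := circ_parts (fun t => der_mzp t cg) (fun t => der_K t ch) (cont_centre cg)
  (contNmzp ch) (mzp10 cg) (mzp10 (contNmzp ch)).
have e1 : circ_int (fun t => mzp g t * mzp h t) = - circ_int (fun t => mzp g t * - mzp h t).
  rewrite -circN; last by apply: contM => //; exact: contNmzp.
  by apply: circ_int_ext => t; rewrite mulrN opprK.
rewrite e1 -h1.
transitivity (circ_int (fun t => g t * Kop h t - circ_int g * Kop h t)).
  by apply: circ_int_ext => t; rewrite mulrBl.
rewrite circB; [|exact: contM|by apply: contM => //; exact: cont_cst].
by rewrite circZ // circ_K // mulr0 subr0.
Qed.

Lemma K_ext g h t : g =1 h -> Kop g t = Kop h t.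
Proof. by move=> /funext ->. Qed.

Lemma KB g h t : continuous g -> continuous h ->
  Kop (fun x => g x - h x) t = Kop g t - Kop h t.
Proof.
move=> cg ch; rewrite /Kop -mzpB; try exact: contNmzp.
by apply: mzp_ext => x; rewrite mzpB //; ring.
Qed.

Lemma KZ c g t : continuous g -> Kop (fun x => c * g x) t = c * Kop g t.
Proof.
move=> cg; rewrite /Kop -mzpZ; last exact: contNmzp.
by apply: mzp_ext => x; rewrite mzpZ //; ring.
Qed.

Lemma K_sup g c t : continuous g -> periodic g 1 ->
  (forall x, 0 <= x <= 1 -> `|g x| <= c) -> `|Kop g t| <= 4 * c.
Proof.
move=> cg pg h; rewrite (_ : 4 * c = 2 * (2 * c)); last ring.
apply: mzp_supp; first exact: contNmzp.
  by move=> u; rewrite periodic_mzp.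
by move=> x x01; rewrite normrN; exact: mzp_supp.
Qed.

(** The squared norm dual to the Dirichlet norm: [N2 w] is the integral of [|(K w)'|^2]. *)
Definition N2 w : R := \sum_l circ_int (fun t => mzp (w l) t ^+ 2).

Lemma N2_ge0 w : contf w -> 0 <= N2 w.
Proof.
move=> cw; apply: sumr_ge0 => l _; apply: circ_ge0; first exact/contX/cont_mzp.
by move=> t _; exact: sqr_ge0.
Qed.

(** One-dimensional Sobolev embedding: a mean-zero loop is bounded by the integral of its
    derivative. *)
Lemma K_sqr w l t : contf w -> perf w -> Kop (w l) t ^+ 2 <= N2 w.
Proof.
move=> cw pw; have [t0 t01 ->] := per_red t; last exact: periodic_K.
have h := sobolev_mean (fun x => der_K x (cw l)) (contNmzp (cw l)) t01.
rewrite circ_K // subr0 in h.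
have ca : continuous (fun x => `|- mzp (w l) x|) by apply: cont_abs; exact: contNmzp.
apply: (@le_trans _ _ (circ_int (fun x => mzp (w l) x ^+ 2))).
  rewrite -real_normK ?num_real //.
  apply: (@le_trans _ _ (circ_int (fun x => `|- mzp (w l) x|) ^+ 2)).
    by rewrite lerXn2r ?nnegrE // (le_trans _ h).
  apply: le_trans (circ_sqr_le ca) _.
  rewrite (@circ_int_ext _ (fun x => `|- mzp (w l) x| ^+ 2) (fun x => mzp (w l) x ^+ 2)) //.
  by move=> x; rewrite normrN real_normK ?num_real.
rewrite /N2 (bigD1 l) //= ler_wpDr //.
apply: sumr_ge0 => i _; apply: circ_ge0; first exact/contX/cont_mzp.
by move=> x _; exact: sqr_ge0.
Qed.

Definition Kf w l := Kop (w l).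

Lemma cont_Kf w : contf w -> contf (Kf w).
Proof. by move=> cw l; exact: cont_K. Qed.
Lemma per_Kf w : contf w -> perf w -> perf (Kf w).
Proof. by move=> cw pw l; exact: periodic_K. Qed.

Definition qf a z v : R := \sum_j circ_int (fun t => a j t * (lin z j t * lin v j t)).

Lemma cont_qf a z v j : contf a -> contf z -> contf v ->
  continuous (fun t => a j t * (lin z j t * lin v j t)).
Proof. by move=> ca cz cv; apply: contM => //; apply: contM; exact: cont_lin. Qed.

Lemma qf_Q a z v : contf a -> contf z -> contf v ->
  \sum_l circ_int (fun t => Qop a z l t * v l t) = qf a z v.
Proof.
move=> ca cz cv; rewrite /qf -!circ_sum.
- by apply: circ_int_ext => t; exact: Q_form.
- by move=> j; exact: cont_qf.
- by move=> l; apply: contM; [exact: cont_Q|exact: cv].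
Qed.

Lemma N2_form w v : contf w -> contf v ->
  \sum_l circ_int (fun t => mzp (w l) t * mzp (v l) t) = \sum_l circ_int (fun t => w l t * Kf v l t).
Proof. by move=> cw cv; apply: eq_bigr => l _; exact: K_form. Qed.

Lemma N2E w : N2 w = \sum_l circ_int (fun t => mzp (w l) t * mzp (w l) t).
Proof. by apply: eq_bigr => l _; apply: circ_int_ext => t; rewrite expr2. Qed.

Lemma qf_ge0 a z : contf a -> contf z -> (forall j t, 0 <= a j t) -> 0 <= qf a z z.
Proof.
move=> ca cz a0; apply: sumr_ge0 => j _; apply: circ_ge0; first exact: cont_qf.
by move=> t _; rewrite mulr_ge0 // -expr2 sqr_ge0.
Qed.

Lemma cont_bounded g : continuous g -> periodic g 1 -> exists2 c : R, 0 <= c & forall t, `|g t| <= c.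
Proof.
move=> cg pg.
have [|c _ hc] := @EVT_max R (fun t => `|g t|) 0 1 ler01.
  by apply: continuous_subspaceT; exact: cont_abs.
exists `|g c| => // t; have [t0 t01 ->] := per_red t; last exact: pg.
by apply: hc; rewrite in_itv.
Qed.

Lemma contf_bounded (I : finType) (z : I -> R -> R) : contf z -> perf z ->
  exists2 c : R, 0 <= c & forall i t, `|z i t| <= c.
Proof.
move=> cz pz.
have /choice[c hc] i : exists c, 0 <= c /\ forall t, `|z i t| <= c.
  by have [c c0 h] := cont_bounded (cz i) (pz i); exists c.
exists (\sum_i c i) => [|i t]; first by apply: sumr_ge0 => i _; case: (hc i).
rewrite (bigD1 i) //= ler_wpDr //; last by case: (hc i).
by apply: sumr_ge0 => j _; case: (hc j).
Qed.

(** The quadratic form of [Q] is bounded relative to the Dirichlet norm; the constant fixes the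
    damping below. *)
Lemma qf_bound a : contf a -> perf a -> (forall j t, 0 <= a j t) ->
  exists2 q : R, 0 < q & forall w, contf w -> perf w -> qf a (Kf w) (Kf w) <= q * N2 w.
Proof.
move=> ca pa a0; have [c c0 hc] := contf_bounded ca pa.
exists (\sum_j c * (\sum_l `|B j l|) ^+ 2 + 1).
  by rewrite ltr_wpDl //; apply: sumr_ge0 => j _; rewrite mulr_ge0 // sqr_ge0.
move=> w cw pw; have N0 := N2_ge0 cw; have cK := cont_Kf cw.
rewrite mulrDl mul1r; apply: ler_wpDr => //.
rewrite mulr_suml; apply: ler_sum => j _.
rewrite -[leRHS]circ_cst; apply: circ_le; [exact: cont_qf|exact: cont_cst|].
move=> t _; rewrite -mulrA; apply: ler_pM => //.
- by rewrite -expr2 sqr_ge0.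
- by apply: le_trans (hc j t); exact: ler_norm.
rewrite -expr2.
have h : `|lin (Kf w) j t| <= (\sum_l `|B j l|) * Num.sqrt (N2 w).
  rewrite mulr_suml; apply: le_trans (ler_norm_sum _ _ _) _.
  apply: ler_sum => l _; rewrite normrM ler_wpM2l //.
  by rewrite -sqrtr_sqr; apply: ler_wsqrtr; exact: K_sqr.
rewrite -real_normK ?num_real // -[X in _ * X](sqr_sqrtr N0) -exprMn.
by rewrite lerXn2r ?nnegrE // mulr_ge0 ?sqrtr_ge0 // sumr_ge0.
Qed.

Section Existence.
Variables (a : 'I_n -> R -> R) (f : 'I_k -> R -> R).
Hypotheses (ca : contf a) (pa : perf a) (a0 : forall j t, 0 <= a j t).
Hypotheses (cf : contf f) (pf : perf f).

(** One step, without its source, of the damped iteration for [w = f - Q K w]; the solution is then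
    [K w]. *)
Definition damp (om : R) w : 'I_k -> R -> R :=
  fun l t => (1 - om) * w l t - om * Qop a (Kf w) l t.

Lemma cont_damp om w : contf w -> contf (damp om w).
Proof.
move=> cw l; apply: contB; apply: contM; (try exact: cont_cst); first exact: cw.
by apply: cont_Q => //; exact: cont_Kf.
Qed.

Lemma per_damp om w : contf w -> perf w -> perf (damp om w).
Proof. by move=> cw pw l t; rewrite /damp pw per_Q //; exact: per_Kf. Qed.

(** In the form [N2], the square of the step has a mixed term, [- 2 om (1 - om)] times the quadratic
    form of [Q] at [K w], and a last term that is at most [om ^+ 2 * q] times this form.  For [om =
    1 / (q + 2)] the former absorbs the latter. *)
Lemma damp_contr : exists2 om : R, 0 < om < 1 & forall w, contf w -> perf w ->
  N2 (damp om w) <= (1 - om) ^+ 2 * N2 w.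
Proof.
have [q q0 hq] := qf_bound ca pa a0.
have q2 : 0 < q + 2 by rewrite addr_gt0.
exists (q + 2)^-1.
  by rewrite invr_gt0 q2 /= invf_lt1 //; lra.
set om := (q + 2)^-1.
have om0 : 0 < om by rewrite invr_gt0.
have omq : om * (q + 2) = 1 by rewrite mulVf // gt_eqF.
move=> w cw pw; have cK := cont_Kf cw.
pose v := Qop a (Kf w); have cv : contf v by exact: cont_Q.
have pv : perf v by apply: per_Q => //; exact: per_Kf.
have cKv := cont_Kf cv.
have Nv : N2 v <= q * qf a (Kf w) (Kf w).
  have e : N2 v = qf a (Kf w) (Kf v) by rewrite N2E N2_form // qf_Q.
  (* Young's inequality; by the choice of the weights, [hq] turns the last term into half of [N2 v] *)
  have h : qf a (Kf w) (Kf v) <= q / 2 * qf a (Kf w) (Kf w) + (2 * q)^-1 * qf a (Kf v) (Kf v).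
    rewrite /qf !mulr_sumr -big_split /=; apply: ler_sum => j _.
    have c1 := @cont_qf a _ _ j ca cK cK; have c2 := @cont_qf a _ _ j ca cKv cKv.
    have c3 := @cont_qf a _ _ j ca cK cKv.
    rewrite -!circZ // -circD; try (apply: contM => //; exact: cont_cst).
    apply: circ_le => //.
      by apply: contD; apply: contM => //; exact: cont_cst.
    move=> t _; rewrite -subr_ge0.
    have -> : forall al x y : R, q / 2 * (al * (x * x)) + (2 * q)^-1 * (al * (y * y)) - al * (x * y)
        = al * ((2 * q)^-1 * (q * x - y) ^+ 2).
      by move=> al x y; field; rewrite gt_eqF.
    by rewrite mulr_ge0 // mulr_ge0 ?sqr_ge0 // invr_ge0 mulr_ge0 // ltW.
  have h2 := hq v cv pv.
  have h3 : (2 * q)^-1 * qf a (Kf v) (Kf v) <= 2^-1 * N2 v.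
    rewrite (_ : 2^-1 * N2 v = (2 * q)^-1 * (q * N2 v)); last by field; rewrite gt_eqF.
    by rewrite ler_wpM2l // invr_ge0 mulr_ge0 // ltW.
  rewrite -e in h.
  lra.
have E : N2 (damp om w) = (1 - om) ^+ 2 * N2 w - 2 * om * (1 - om) * qf a (Kf w) (Kf w) + om ^+ 2 * N2 v.
  have -> : qf a (Kf w) (Kf w) = \sum_l circ_int (fun t => mzp (v l) t * mzp (w l) t).
    by rewrite N2_form // qf_Q.
  rewrite /N2 !mulr_sumr -sumrB -big_split /=; apply: eq_bigr => l _.
  have c1 := cont_mzp (cw l); have c2 := cont_mzp (cv l).
  rewrite -!circZ; [|exact: contX|exact: contM|exact: contX].
  rewrite -circB; [|by apply: contM; [exact: cont_cst|exact: contX]|by apply: contM; [exact: cont_cst|exact: contM]].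
  rewrite -circD; last 2 first.
  - by apply: contB; apply: contM; (try exact: cont_cst); [exact: contX|exact: contM].
  - by apply: contM; [exact: cont_cst|exact: contX].
  apply: circ_int_ext => t.
  have -> : mzp (damp om w l) t = (1 - om) * mzp (w l) t - om * mzp (v l) t.
    rewrite -!mzpZ //; apply: mzpB; apply: contM => //; exact: cont_cst.
  ring.
rewrite E.
have Q0 : 0 <= qf a (Kf w) (Kf w) by exact: qf_ge0.
have h : om ^+ 2 * N2 v <= om ^+ 2 * (q * qf a (Kf w) (Kf w)) by rewrite ler_wpM2l // sqr_ge0.
have h' : om ^+ 2 * (q * qf a (Kf w) (Kf w)) <= 2 * om * (1 - om) * qf a (Kf w) (Kf w).
  rewrite mulrA ler_wpM2r //.
  have e : om * q = 1 - 2 * om by have := omq; rewrite mulrDr; lra.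
  rewrite expr2 -mulrA e -subr_ge0 (_ : _ - _ = om); last by ring.
  exact: ltW.
lra.
Qed.

Lemma Kf_damp om w v l t : contf w -> contf v ->
  damp om (fun l t => w l t - v l t) l t = damp om w l t - damp om v l t.
Proof.
move=> cw cv; rewrite /damp.
have -> : Kf (fun l t => w l t - v l t) = fun l t => Kf w l t - Kf v l t.
  by apply/funext => i; apply/funext => x; exact: KB.
by rewrite QlinB; ring.
Qed.

(** The intervals of radius [c m] around [u m] are nested; the limit is the supremum of their lower
    ends. *)
Lemma geo_cvg (u : nat -> R) (M th : R) : 0 <= th < 1 -> 0 <= M ->
  (forall m, `|u m.+1 - u m| <= M * th ^+ m) ->
  exists l, forall m, `|u m - l| <= M / (1 - th) * th ^+ m.
Proof.
move=> /andP[th0 th1] M0 h.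
have th1' : 0 < 1 - th by rewrite subr_gt0.
have C0 : 0 <= M / (1 - th) by rewrite divr_ge0 // ltW.
pose c m := M / (1 - th) * th ^+ m.
have c0 m : 0 <= c m by rewrite mulr_ge0 // exprn_ge0.
have cS m : c m - c m.+1 = M * th ^+ m by rewrite /c exprS; field; rewrite gt_eqF.
have up p m : u (m + p)%N - c (m + p)%N >= u m - c m.
  elim: p => [|p IH]; first by rewrite addn0.
  rewrite addnS; apply: le_trans IH _.
  by have := h (m + p)%N; rewrite -cS ler_norml => /andP[h1 h2]; lra.
have dn p m : u (m + p)%N + c (m + p)%N <= u m + c m.
  elim: p => [|p IH]; first by rewrite addn0.
  rewrite addnS; apply: le_trans _ IH.
  by have := h (m + p)%N; rewrite -cS ler_norml => /andP[h1 h2]; lra.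
have ud p m : u p - c p <= u m + c m.
  case: (leqP p m) => [pm|/ltnW pm].
    by have := up (m - p)%N p; rewrite subnKC // => h1; have := c0 m; lra.
  by have := dn (p - m)%N m; rewrite subnKC // => h1; have := c0 p; lra.
exists (sup (range (fun m => u m - c m))) => m.
have hs : has_sup (range (fun m => u m - c m)).
  split; first by exists (u 0%N - c 0%N), 0%N.
  by exists (u m + c m) => _ [p _ <-].
rewrite ler_norml; apply/andP; split.
  rewrite lerBrDr addrC lerBlDr; apply: ge_sup; first by case: hs.
  by move=> _ [p _ <-].
by rewrite lerBlDr -lerBlDl; apply: sup_upper_bound => //; exists m.
Qed.

(** The potential equation in integrated form, [z = K (f - Q z)], so that only continuity is asked
    for. *)
Definition sol (a : 'I_n -> R -> R) (f z : 'I_k -> R -> R) := [/\ contf z, perf z &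
  forall l t, z l t = Kop (fun x => f l x - Qop a z l x) t].

(** Iterate the damped step from zero.  The differences decay geometrically in [N2], so [K w]
    converges uniformly, and its limit solves the equation. *)
Lemma sol_ex : exists z, sol a f z.
Proof.
have [om /andP[om0 om1] hom] := damp_contr.
pose step w : 'I_k -> R -> R := fun l t => damp om w l t + om * f l t.
pose w m := iter m step (fun _ _ => 0).
have cw m : contf (w m).
  elim: m => [|m IH] l; first exact: cont_cst.
  apply: contD; first exact: cont_damp.
  by apply: contM; [exact: cont_cst|exact: cf].
have pw m : perf (w m).
  elim: m => [|m IH] l t //=.
  by rewrite /step per_damp // pf.
pose d m : 'I_k -> R -> R := fun l t => w m.+1 l t - w m l t.
have cd m : contf (d m) by move=> l; apply: contB; exact: cw.
have pd m : perf (d m) by move=> l t; rewrite /d !pw.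
have dS m : d m.+1 = damp om (d m).
  apply/funext => l; apply/funext => t; rewrite Kf_damp //.
  by rewrite /d /= /step; ring.
set th := 1 - om in hom *.
have th0 : 0 <= th by rewrite subr_ge0 ltW.
have th1 : th < 1 by rewrite ltrBlDr ltrDl.
have Nd m : N2 (d m) <= (th ^+ m) ^+ 2 * N2 (d 0%N).
  elim: m => [|m IH]; first by rewrite expr0 expr1n mul1r.
  rewrite dS; apply: le_trans (hom _ (cd m) (pd m)) _.
  by rewrite (exprS th m) exprMn -(mulrA (th ^+ 2)) ler_wpM2l ?sqr_ge0.
set M := Num.sqrt (N2 (d 0%N)).
have M0 : 0 <= M by exact: sqrtr_ge0.
have Kd m l t : `|Kf (w m.+1) l t - Kf (w m) l t| <= M * th ^+ m.
  have -> : Kf (w m.+1) l t - Kf (w m) l t = Kf (d m) l t by apply/esym/KB; exact: cw.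
  rewrite -sqrtr_sqr.
  have -> : M * th ^+ m = Num.sqrt ((th ^+ m) ^+ 2 * N2 (d 0%N)).
    by rewrite sqrtrM ?sqr_ge0 // sqrtr_sqr ger0_norm ?exprn_ge0 // mulrC.
  by apply: ler_wsqrtr; apply: le_trans (K_sqr l t (cd m) (pd m)) (Nd m).
have th01 : 0 <= th < 1 by rewrite th0.
have /choice[z hz] l : exists zl : R -> R, forall t m, `|Kf (w m) l t - zl t| <= M / (1 - th) * th ^+ m.
  have /choice[zl h] t : exists y, forall m, `|Kf (w m) l t - y| <= M / (1 - th) * th ^+ m.
    by apply: geo_cvg => // m; exact: Kd.
  by exists zl.
set C := M / (1 - th) in hz.
have C0 : 0 <= C by rewrite divr_ge0 // subr_ge0 ltW.
have thm e : 0 < e -> exists m, C * th ^+ m < e.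
  move=> e0; have C1 : 0 < C + 1 by rewrite ltr_wpDl.
  have thl : `|th| < 1 by rewrite ger0_norm.
  have /cvgrPdist_lt/(_ _ (divr_gt0 e0 C1)) := cvg_expr thl.
  move=> [m _ /(_ m (leqnn m))]; rewrite /= sub0r normrN ger0_norm ?exprn_ge0 //.
  rewrite ltr_pdivlMr // => h; exists m; apply: le_lt_trans h.
  by rewrite mulrC ler_wpM2l ?exprn_ge0 // lerDl.
have cz : contf z.
  move=> l t; apply/cvgrPdist_lt => e e0.
  have [|m hm] := thm (e / 3); first by rewrite divr_gt0.
  have ck : continuous (Kf (w m) l) by exact: cont_Kf.
  have e3 : 0 < e / 3 by rewrite divr_gt0.
  have /cvgrPdist_lt/(_ _ e3) hc := ck t; near=> x.
  have h1 : `|Kf (w m) l t - Kf (w m) l x| < e / 3 by near: x.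
  have h2 := hz l t m; have h3 := hz l x m.
  rewrite (_ : _ - _ = (Kf (w m) l t - Kf (w m) l x) - (Kf (w m) l t - z l t) + (Kf (w m) l x - z l x)); last by ring.
  apply: le_lt_trans (ler_normD _ _) _.
  have := ler_normB (Kf (w m) l t - Kf (w m) l x) (Kf (w m) l t - z l t).
  lra.
have pz : perf z.
  move=> l t; apply/eqP; rewrite -subr_eq0 -normr_le0; apply/ler_addgt0Pr => e e0.
  have [|m hm] := thm (e / 2); first by rewrite divr_gt0.
  have h2 := hz l t m; have := hz l (t + 1) m; rewrite (per_Kf (cw m) (pw m)) => h3.
  rewrite (_ : _ - _ = (Kf (w m) l t - z l t) - (Kf (w m) l t - z l (t + 1))); last by ring.
  by apply: le_trans (ler_normB _ _) _; lra.
exists z; split => // l t.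
have [ba ba0 hba] := contf_bounded ca pa.
have cQz := cont_Q ca cz; have pQz := per_Q pa pz.
apply/eqP; rewrite -subr_eq0 -normr_le0; apply/ler_addgt0Pr => e e0.
(* collects the three errors below, each relative to [C * th ^+ m] *)
pose D := (2 / om + 1 + 4 * (cB * ba)).
have D0 : 0 < D.
  have d1 : 0 <= 2 / om by rewrite divr_ge0 // ltW.
  have d2 : 0 <= cB * ba by rewrite mulr_ge0 // cB_ge0.
  by rewrite /D; lra.
have [|m hm] := thm (e / D); first by rewrite divr_gt0.
have cKw := cont_Kf (cw m); have pKw := per_Kf (cw m) (pw m).
have cQ := cont_Q ca cKw; have pQ := per_Q pa pKw.
pose g x := f l x - Qop a z l x; pose gm x := f l x - Qop a (Kf (w m)) l x.
have cg : continuous g by apply: contB => //; exact: cQz.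
have cgm : continuous gm by apply: contB => //; exact: cQ.
have e1 : Kf (w m.+1) l t - Kf (w m) l t = - om * (Kf (w m) l t - Kop gm t).
  have cB' : continuous (fun x => w m l x - gm x) by apply: contB; [exact: cw|exact: cgm].
  rewrite /Kf -(KB _ (cw m.+1 l) (cw m l)) -(KB _ (cw m l) cgm) -(KZ _ _ cB').
  by apply: K_ext => x; rewrite /= /step /damp /gm; ring.
have z1 := hz l t m; have z2 := hz l t m.+1.
have th2 : C * th ^+ m.+1 <= C * th ^+ m.
  by rewrite ler_wpM2l // exprS ler_piMl ?exprn_ge0 // ltW.
have h1 : `|Kf (w m) l t - Kop gm t| <= 2 / om * (C * th ^+ m).
  have -> : Kf (w m) l t - Kop gm t = om^-1 * ((Kf (w m) l t - z l t) - (Kf (w m.+1) l t - z l t)).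
    have -> : (Kf (w m) l t - z l t) - (Kf (w m.+1) l t - z l t) = om * (Kf (w m) l t - Kop gm t).
      by rewrite -[RHS]opprK -mulNr -e1; ring.
    by rewrite mulKf // gt_eqF.
  rewrite normrM gtr0_norm ?invr_gt0 // (_ : 2 / om * _ = om^-1 * (2 * (C * th ^+ m))); last by ring.
  rewrite ler_wpM2l ?invr_ge0 ?(ltW om0) //.
  by apply: le_trans (ler_normB _ _) _; lra.
have h2 : `|Kop g t - Kop gm t| <= 4 * (cB * (ba * (C * th ^+ m))).
  rewrite -KB //; apply: K_sup; first exact: contB.
    by move=> x; rewrite /g /gm pf pQz pQ.
  move=> x _; rewrite /g /gm (_ : _ - _ = Qop a (fun l t => Kf (w m) l t - z l t) l x).
    by apply: Q_bound => //; rewrite mulr_ge0 // exprn_ge0.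
  by rewrite QlinB; ring.
have := hz l t m => h3.
rewrite add0r (_ : z l t - _ = (Kf (w m) l t - Kop gm t) - (Kf (w m) l t - z l t) - (Kop g t - Kop gm t)); last by ring.
apply: le_trans (ler_normB _ _) _; apply: le_trans (lerD (ler_normB _ _) (lexx _)) _.
apply: (@le_trans _ _ (D * (C * th ^+ m))).
  by rewrite /D; lra.
by rewrite mulrC -ler_pdivlMr // ltW.
Unshelve. all: by end_near. Qed.

End Existence.

(** Testing the equation with its solution bounds [N2] by the source, since the quadratic form of
    [Q] is nonnegative.  The constant does not depend on [a], which yields uniqueness and continuity
    in parameters. *)
Lemma sol_bound a f z M : contf a -> (forall j t, 0 <= a j t) -> perf a ->
  contf f -> perf f -> sol a f z -> 0 <= M ->
  (forall l t, 0 <= t <= 1 -> `|f l t| <= M) -> forall l t, `|z l t| <= k%:R * M.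
Proof.
move=> ca a0 pa cf pf [cz pz hz] M0 hM.
pose w l x := f l x - Qop a z l x.
have cQ := cont_Q ca cz.
have cw : contf w by move=> l; apply: contB; [exact: cf|exact: cQ].
have pw : perf w by move=> l t; rewrite /w pf per_Q.
have zE l : z l = Kop (w l) by apply/funext => t; exact: hz.
have N0 := N2_ge0 cw.
have zb l t : `|z l t| <= Num.sqrt (N2 w).
  by rewrite -sqrtr_sqr; apply: ler_wsqrtr; rewrite zE; exact: K_sqr.
have cfz l : continuous (fun t => f l t * z l t) by apply: contM; [exact: cf|exact: cz].
have NE : N2 w = \sum_l circ_int (fun t => f l t * z l t) - qf a z z.
  rewrite N2E N2_form // -(qf_Q ca cz cz) -sumrB; apply: eq_bigr => l _.
  rewrite -circB //; last by apply: contM; [exact: cQ|exact: cz].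
  by apply: circ_int_ext => t; rewrite /Kf -zE /w mulrBl.
have q0 := qf_ge0 ca cz a0.
have h1 : N2 w <= k%:R * M * Num.sqrt (N2 w).
  rewrite {1}NE; apply: (@le_trans _ _ (\sum_l circ_int (fun t => f l t * z l t))).
    by rewrite gerBl.
  rewrite -mulrA -[k in k%:R]card_ord mulr_natl -sumr_const; apply: ler_sum => l _.
  apply: le_trans (ler_norm _) _; apply: circ_bnd => // t t01.
  by rewrite normrM; apply: ler_pM => //; exact: hM.
move=> l t; apply: le_trans (zb l t) _.
have [->|/eqP s0] := eqVneq (Num.sqrt (N2 w)) 0; first by rewrite mulr_ge0.
have sp : 0 < Num.sqrt (N2 w) by rewrite lt0r sqrtr_ge0 andbT; apply/eqP.
by rewrite -(ler_pM2r sp) -expr2 sqr_sqrtr.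
Qed.

Lemma sol_sub a f z f' z' : contf a -> contf f -> contf f' -> sol a f z -> sol a f' z' ->
  sol a (fun l t => f' l t - f l t) (fun l t => z' l t - z l t).
Proof.
move=> ca cf cf' [cz pz hz] [cz' pz' hz']; split.
- by move=> l; apply: contB; [exact: cz'|exact: cz].
- by move=> l t; rewrite pz pz'.
have cQ := cont_Q ca cz; have cQ' := cont_Q ca cz'.
move=> l t; rewrite hz hz' -KB; try exact: contB.
by apply: K_ext => x; rewrite QlinB; ring.
Qed.

Lemma sol_scale a f z c : contf a -> contf f -> sol a f z ->
  sol a (fun l t => c * f l t) (fun l t => c * z l t).
Proof.
move=> ca cf [cz pz hz]; split.
- by move=> l; apply: contM; [exact: cont_cst|exact: cz].
- by move=> l t; rewrite pz.
have cQ := cont_Q ca cz.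
move=> l t; rewrite hz -KZ; last exact: contB.
by apply: K_ext => x; rewrite QlinZ; ring.
Qed.

(** A solution for the coefficient [b] solves the equation for [a] with a corrected source; all
    perturbation arguments go through this. *)
Lemma sol_change a b f z : sol b f z ->
  sol a (fun l t => f l t - Qop (fun j t => b j t - a j t) z l t) z.
Proof.
move=> [cz pz hz]; split => // l t; rewrite hz; apply: K_ext => x.
by rewrite QB; ring.
Qed.

Lemma sol_ext a f f' z : (forall l t, f l t = f' l t) -> sol a f z -> sol a f' z.
Proof.
by move=> h [cz pz hz]; split => // l t; rewrite hz; apply: K_ext => x; rewrite h.
Qed.

Lemma sol_unique a f z z' : contf a -> (forall j t, 0 <= a j t) -> perf a ->
  contf f -> perf f -> sol a f z -> sol a f z' -> forall l t, z l t = z' l t.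
Proof.
move=> ca a0 pa cf pf hz hz' l t; apply/eqP; rewrite eq_sym -subr_eq0 -normr_le0.
have h := sol_sub ca cf cf hz hz'.
rewrite -(mulr0 k%:R); apply: (sol_bound ca a0 pa _ _ h) => //.
- by move=> i; apply: contB; exact: cf.
- by move=> i x; rewrite !pf.
- by move=> i x _; rewrite subrr normr0.
Qed.

(** Compare both solutions for the same coefficient and use the bound by the source. *)
Lemma sol_perturb a f z b (g : 'I_k -> R -> R) y (e Z : R) : contf a -> (forall j t, 0 <= a j t) -> perf a ->
  contf f -> perf f -> contf b -> perf b -> contf g -> perf g ->
  sol a f z -> sol b g y -> 0 <= e -> 0 <= Z ->
  (forall j t, 0 <= t <= 1 -> `|b j t - a j t| <= e) ->
  (forall l t, 0 <= t <= 1 -> `|g l t - f l t| <= e) ->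
  (forall l t, `|y l t| <= Z) ->
  forall l t, `|y l t - z l t| <= k%:R * ((1 + cB * Z) * e).
Proof.
move=> ca a0 pa cf pf cb pb cg pg hz hy e0 Z0 hab hfg hZ.
have [cy py _] := hy.
have cba : contf (fun j t => b j t - a j t) by move=> j; apply: contB; [exact: cb|exact: ca].
have cQ := cont_Q cba cy.
have pba : perf (fun j t => b j t - a j t) by move=> j t; rewrite pa pb.
have h := sol_sub ca cf _ hz (sol_change a hy).
apply: (sol_bound ca a0 pa _ _ (h _)).
- by move=> l; apply: contB; [apply: contB; [exact: cg|exact: cQ]|exact: cf].
- by move=> l t; rewrite pf pg (per_Q pba py).
- by move=> l; apply: contB; [exact: cg|exact: cQ].
- by rewrite mulr_ge0 // addr_ge0 // mulr_ge0 // cB_ge0.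
move=> l t t01; rewrite addrAC; apply: le_trans (ler_normB _ _) _.
rewrite mulrDl mul1r -mulrA [Z * e]mulrC; apply: lerD; first exact: hfg.
by apply: Q_bound => // j; exact: hab.
Qed.

End Elliptic.

Section EllipticParameter.
Context {R : realType} {n k : nat} (B : 'I_n -> 'I_k -> R).
Implicit Types (F G : R -> R -> R).

Lemma near_unif F s (e : R) : cont2 F -> 0 < e ->
  \forall h \near (0 : R), forall t, 0 <= t <= 1 -> `|F (s + h) t - F s t| < e.
Proof.
move=> cF e0; have [d d0 hd] := cont2_unif s cF e0.
apply/nbhs_ballP; exists d => // h; rewrite /ball /= sub0r normrN => hh t t01.
by apply: hd => //; rewrite addrC addKr.
Qed.

Lemma near_der F G s (e : R) : cont2 G -> (forall s t, der (F ^~ t) s (G s t)) -> 0 < e ->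
  \forall h \near (0 : R), forall t, 0 <= t <= 1 -> `|F (s + h) t - F s t - h * G s t| <= e * `|h|.
Proof.
move=> cG dF e0; have [d d0 hd] := cont2_unif s cG e0.
apply/nbhs_ballP; exists d => // x; rewrite /ball /= sub0r normrN => hx t t01.
have [c /andP[c1 c2] ->] := der_MVT s (s + x) (fun y => dF y t).
rewrite (_ : _ - _ = (G c t - G s t) * x); last by ring.
rewrite normrM ler_wpM2r //; apply/ltW/hd => //.
apply: le_lt_trans hx.
move: c1 c2; rewrite minEle maxEle lerDl; case: (leP 0 x) => x0 c1 c2.
  by rewrite !ger0_norm //; lra.
rewrite ler0_norm; last lra.
rewrite ltr0_norm //; lra.
Qed.

Lemma near_all (I : finType) (P : I -> R -> Prop) :
  (forall i, \forall h \near (0 : R), P i h) -> \forall h \near (0 : R), forall i, P i h.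
Proof. by move=> h; apply: (@filter_forall R I P (nbhs (0 : R)) _ h). Qed.

Section Family.
Variables (a : 'I_n -> R -> R -> R).
Hypothesis a0 : forall j s t, 0 <= a j s t.

Lemma sol_cont2 (f z : 'I_k -> R -> R -> R) :
  (forall j, cont2 (a j) /\ per2 (a j)) -> (forall l, cont2 (f l) /\ per2 (f l)) ->
  (forall s, sol B (fun j => a j s) (fun l => f l s) (fun l => z l s)) ->
  forall l, cont2 (z l) /\ per2 (z l).
Proof.
move=> ha hf hz.
have ca s : contf (fun j => a j s) by move=> j; apply: cont2_l; case: (ha j).
have pa s : perf (fun j => a j s) by move=> j; case: (ha j) => _; exact.
have cf s : contf (fun j => f j s) by move=> j; apply: cont2_l; case: (hf j).
have pf s : perf (fun j => f j s) by move=> j; case: (hf j) => _; exact.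
have pz l : per2 (z l) by move=> s; case: (hz s) => _ + _; exact.
move=> l; split => // -[s t].
have [M M0 hM] := contf_bounded (cf s) (pf s).
pose Z := k%:R * (M + 1); have Z0 : 0 <= Z by rewrite mulr_ge0 // addr_ge0.
pose C := k%:R * (1 + cB B * Z).
have C0 : 0 <= C by rewrite mulr_ge0 // addr_ge0 // mulr_ge0 // cB_ge0.
have unif (e : R) : 0 < e <= 1 -> \forall h \near (0 : R), forall i x, `|z i (s + h) x - z i s x| <= C * e.
  move=> /andP[e0 e1].
  have Hf : \forall h \near (0 : R), forall i x, 0 <= x <= 1 -> `|f i (s + h) x - f i s x| < e.
    by apply: near_all => i; apply: near_unif => //; case: (hf i).
  have Ha : \forall h \near (0 : R), forall i x, 0 <= x <= 1 -> `|a i (s + h) x - a i s x| < e.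
    by apply: near_all => i; apply: near_unif => //; case: (ha i).
  near=> h => i x.
  have Hf' : forall i x, 0 <= x <= 1 -> `|f i (s + h) x - f i s x| < e by near: h.
  have Ha' : forall i x, 0 <= x <= 1 -> `|a i (s + h) x - a i s x| < e by near: h.
  rewrite /C -mulrA; apply: (sol_perturb (ca s) (a0 ^~ s) (pa s) (cf s) (pf s)
    (ca (s + h)) (pa (s + h)) (cf (s + h)) (pf (s + h)) (hz s) (hz (s + h))).
  - exact: ltW.
  - by [].
  - by move=> j y y01; apply/ltW/Ha'.
  - by move=> j y y01; apply/ltW/Hf'.
  move=> j y; apply: (sol_bound (ca (s + h)) (a0 ^~ (s + h)) (pa (s + h)) (cf (s + h)) (pf (s + h)) (hz (s + h))).
    by rewrite addr_ge0.
  move=> p q q01; have := Hf' p q q01; have := hM p q.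
  have := ler_normD (f p (s + h) q - f p s q) (f p s q); rewrite subrK; lra.
apply/cvgrPdist_lt => e e0.
pose e1 := Num.min 1 (e / (2 * (C + 1))).
have C1 : 0 < 2 * (C + 1) by rewrite mulr_gt0 // ltr_wpDl.
have e10 : 0 < e1 by rewrite lt_min ltr01 divr_gt0.
have e11 : e1 <= 1 by rewrite ge_min lexx.
have e12 : C * e1 < e / 2.
  apply: (@lt_le_trans _ _ ((C + 1) * e1)); first by rewrite mulrDl mul1r ltrDl.
  have : e1 <= e / (2 * (C + 1)) by rewrite ge_min lexx orbT.
  rewrite ler_pdivlMr //; lra.
have /nbhs_ballP[d /= d0 hd] : nbhs (0 : R) [set h : R | forall i x, `|z i (s + h) x - z i s x| <= C * e1].
  by apply: unif; rewrite e10.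
have czs : continuous (z l s) by have [cz _ _] := hz s; exact: cz.
have h2 : nbhs (t : R) [set x : R | `|z l s t - z l s x| < e / 2].
  by have /cvgrPdist_lt := czs t; apply; rewrite divr_gt0.
have h1 : nbhs (s : R) [set s' : R | `|s' - s| < d].
  by apply/nbhs_ballP; exists d => // y; rewrite /ball /= distrC.
exists ([set s' : R | `|s' - s| < d], [set x : R | `|z l s t - z l s x| < e / 2]) => //.
move=> q [/= a1 a2].
have := hd (q.1 - s); rewrite /ball /= sub0r normrN => /(_ a1 l q.2).
rewrite [s + _]addrC subrK => a3.
rewrite (_ : _ - _ = (z l s t - z l s q.2) - (z l q.1 q.2 - z l s q.2)); last by ring.
by apply: le_lt_trans (ler_normB _ _) _; lra.
Unshelve. all: by end_near. Qed.

Lemma Cn_Q b m (z : 'I_k -> R -> R -> R) (c : 'I_n -> R -> R -> R) :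
  (forall j, Cn b m (c j)) -> (forall l, Cn b m (z l)) ->
  forall l, Cn b m (fun s t => Qop B (fun j => c j s) (fun i => z i s) l t).
Proof.
move=> hc hz l; apply: Cn_sum => j; apply: CnZ; apply: CnM => //.
by apply: Cn_sum => i; exact: CnZ.
Qed.

(** The difference quotient and the candidate derivative solve the same equation up to sources of
    size [o(h)], so [sol_bound] compares them. *)
Lemma sol_der (f z : 'I_k -> R -> R -> R) (f1 z1 : 'I_k -> R -> R -> R) (a1 : 'I_n -> R -> R -> R) :
  (forall j, cont2 (a j) /\ per2 (a j)) -> (forall l, cont2 (f l) /\ per2 (f l)) ->
  (forall j, cont2 (a1 j) /\ per2 (a1 j)) -> (forall l, cont2 (f1 l) /\ per2 (f1 l)) ->
  (forall j s t, der (a j ^~ t) s (a1 j s t)) -> (forall l s t, der (f l ^~ t) s (f1 l s t)) ->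
  (forall s, sol B (fun j => a j s) (fun l => f l s) (fun l => z l s)) ->
  (forall s, sol B (fun j => a j s)
     (fun l t => f1 l s t - Qop B (fun j => a1 j s) (fun i => z i s) l t) (fun l => z1 l s)) ->
  forall l s t, der (z l ^~ t) s (z1 l s t).
Proof.
move=> ha hf ha1 hf1 da df hz hz1.
have ca s : contf (fun j => a j s) by move=> j; apply: cont2_l; case: (ha j).
have pa s : perf (fun j => a j s) by move=> j; case: (ha j) => _; exact.
have cf s : contf (fun j => f j s) by move=> j; apply: cont2_l; case: (hf j).
have pf s : perf (fun j => f j s) by move=> j; case: (hf j) => _; exact.
have ca1 s : contf (fun j => a1 j s) by move=> j; apply: cont2_l; case: (ha1 j).
have pa1 s : perf (fun j => a1 j s) by move=> j; case: (ha1 j) => _; exact.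
have cf1 s : contf (fun j => f1 j s) by move=> j; apply: cont2_l; case: (hf1 j).
have pf1 s : perf (fun j => f1 j s) by move=> j; case: (hf1 j) => _; exact.
have hz2 := sol_cont2 ha hf hz.
have cz s : contf (fun l => z l s) by case: (hz s).
have pz s : perf (fun l => z l s) by case: (hz s).
move=> l s t; apply: der_eps => e e0.
have [A1 A10 hA1] := contf_bounded (ca1 s) (pa1 s).
have [Z Z0 hZ] := contf_bounded (cz s) (pz s).
pose C := k%:R * (1 + cB B * (Z + 1) + cB B * A1).
have C0 : 0 <= C by rewrite mulr_ge0 // !addr_ge0 // mulr_ge0 ?cB_ge0 // addr_ge0.
pose e1 := Num.min 1 (e / (C + 1)).
have C1 : 0 < C + 1 by rewrite ltr_wpDl.
have e10 : 0 < e1 by rewrite lt_min ltr01 divr_gt0.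
have e11 : e1 <= 1 by rewrite ge_min lexx.
have e12 : C * e1 <= e.
  apply: (@le_trans _ _ ((C + 1) * e1)); first by rewrite mulrDl mul1r lerDl ltW.
  have : e1 <= e / (C + 1) by rewrite ge_min lexx orbT.
  by rewrite ler_pdivlMr // mulrC.
have Hf : \forall h \near (0 : R), forall i x, 0 <= x <= 1 ->
    `|f i (s + h) x - f i s x - h * f1 i s x| <= e1 * `|h|.
  by apply: near_all => i; apply: near_der => //; case: (hf1 i).
have Ha : \forall h \near (0 : R), forall i x, 0 <= x <= 1 ->
    `|a i (s + h) x - a i s x - h * a1 i s x| <= e1 * `|h|.
  by apply: near_all => i; apply: near_der => //; case: (ha1 i).
have Hz : \forall h \near (0 : R), forall i x, 0 <= x <= 1 -> `|z i (s + h) x - z i s x| < e1.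
  by apply: near_all => i; apply: near_unif => //; case: (hz2 i).
have /nbhs_ballP[d /= d0 hd] : nbhs (0 : R) [set h : R | [/\ forall i x, 0 <= x <= 1 ->
    `|f i (s + h) x - f i s x - h * f1 i s x| <= e1 * `|h|,
    forall i x, 0 <= x <= 1 -> `|a i (s + h) x - a i s x - h * a1 i s x| <= e1 * `|h| &
    forall i x, 0 <= x <= 1 -> `|z i (s + h) x - z i s x| < e1]].
  by near=> h; split; near: h.
exists d => // h hh.
have [|{}Hf {}Ha {}Hz] := hd h; first by rewrite /ball /= sub0r normrN.
apply: (@le_trans _ _ (C * e1 * `|h|)); last by rewrite ler_wpM2r.
have cba : contf (fun j t => a j (s + h) t - a j s t) by move=> j; apply: contB; exact: ca.
have pba : perf (fun j t => a j (s + h) t - a j s t) by move=> j x; rewrite !pa.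
have cQ := cont_Q (B := B) cba (cz (s + h)).
have cQ1 := cont_Q (B := B) (ca1 s) (cz s).
have s1 := sol_sub (ca s) (cf s) (fun l => contB (cf (s + h) l) (cQ l)) (hz s)
  (sol_change (fun j => a j s) (hz (s + h))).
have s2 := sol_scale h (ca s) (fun l => contB (cf1 s l) (cQ1 l)) (hz1 s).
have c1 i : continuous (fun x => f i (s + h) x - Qop B (fun j x => a j (s + h) x - a j s x) (fun i => z i (s + h)) i x - f i s x).
  by apply: contB; [apply: contB; [exact: cf|exact: cQ]|exact: cf].
have c2 i : continuous (fun x => h * (f1 i s x - Qop B (fun j => a1 j s) (fun i => z i s) i x)).
  by apply: contM; [exact: cont_cst|apply: contB; [exact: cf1|exact: cQ1]].
have s3 := sol_sub (ca s) c2 c1 s2 s1.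
rewrite /C -2!mulrA; apply: (sol_bound (ca s) (a0 ^~ s) (pa s) _ _ s3).
- by move=> i; apply: contB; [exact: c1|exact: c2].
- move=> i x; rewrite !pf pf1 (per_Q B pba (pz (s + h))) (per_Q B (pa1 s) (pz s)) //.
- by rewrite mulr_ge0 // ?mulr_ge0 // ?(ltW e10) // !addr_ge0 // mulr_ge0 ?cB_ge0 // addr_ge0.
move=> i x x01 /=.
pose q1 := Qop B (fun j x => a j (s + h) x - a j s x - h * a1 j s x) (fun i => z i (s + h)) i x.
pose q2 := Qop B (fun j => a1 j s) (fun i x => z i (s + h) x - z i s x) i x.
rewrite (_ : _ - _ = (f i (s + h) x - f i s x - h * f1 i s x) - q1 - h * q2); last first.
  have E1 : q1 = Qop B (fun j x => a j (s + h) x - a j s x) (fun i => z i (s + h)) i x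
      - h * Qop B (fun j => a1 j s) (fun i => z i (s + h)) i x.
    rewrite -(QZ B (fun j => a1 j s)) /q1.
    exact: (QB B (fun j x => a j (s + h) x - a j s x) (fun j t => h * a1 j s t)).
  have E2 : q2 = Qop B (fun j => a1 j s) (fun i => z i (s + h)) i x
      - Qop B (fun j => a1 j s) (fun i => z i s) i x.
    exact: (QlinB B (fun j => a1 j s) (fun i => z i (s + h)) (fun i => z i s)).
  by rewrite E1 E2; ring.
have b1 : `|q1| <= cB B * ((e1 * `|h|) * (Z + 1)).
  apply: Q_bound => [|||j]; first by rewrite mulr_ge0 // ltW.
  - by rewrite addr_ge0.
  - by move=> j; exact: Ha.
  have := ler_normD (z j (s + h) x - z j s x) (z j s x); rewrite subrK.
  have := Hz j x x01; have := hZ j x; lra.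
have b2 : `|q2| <= cB B * (A1 * e1).
  by apply: Q_bound => // [|j]; [exact: ltW|apply/ltW/Hz].
have b3 : `|h * q2| <= `|h| * (cB B * (A1 * e1)) by rewrite normrM ler_wpM2l.
have := Hf i x x01 => b4.
apply: le_trans (ler_normB _ _) _; apply: le_trans (lerD (ler_normB _ _) (lexx _)) _.
lra.
Unshelve. all: by end_near. Qed.

(** Induction on the order: the derivative in [s] is the solution with source [f_s - Q_s z], which
    is one order less smooth. *)
Lemma sol_Cn m : (forall j, Cn false m (a j)) -> forall f z : 'I_k -> R -> R -> R,
  (forall l, Cn false m (f l)) ->
  (forall s, sol B (fun j => a j s) (fun l => f l s) (fun l => z l s)) ->
  forall l, Cn false m (z l).
Proof.
elim: m => [|m IH] Ha f z Hf hz l.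
  have [||c p] := sol_cont2 _ _ hz l => // i; first exact: Cn0 (Ha i).
  exact: Cn0 (Hf i).
have ha j := Cn0 (Ha j); have hf j := Cn0 (Hf j).
have [c p] := sol_cont2 ha hf hz l.
have IHz := IH (fun j => CnW (Ha j)) f z (fun j => CnW (Hf j)) hz.
have /choice[a1 Ha1] j : exists c, Cn false m c /\ forall s t, der (a j ^~ t) s (c s t).
  by have [_ _ [[c' ? ?] _]] := Ha j; exists c'.
have /choice[f1 Hf1] j : exists c, Cn false m c /\ forall s t, der (f j ^~ t) s (c s t).
  by have [_ _ [[c' ? ?] _]] := Hf j; exists c'.
pose g l s t := f1 l s t - Qop B (fun j => a1 j s) (fun i => z i s) l t.
have Hg i : Cn false m (g i).
  apply: CnB; first by case: (Hf1 i).
  by apply: Cn_Q => // j; case: (Ha1 j).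
have /choice[y hy] s : exists y, sol B (fun j => a j s) (fun l => g l s) y.
  apply: sol_ex => [j|j|j|j|j]; last 2 first.
  - by apply: cont2_l; case: (Cn0 (Hg j)).
  - by case: (Cn0 (Hg j)) => _; exact.
  - by apply: cont2_l; case: (ha j).
  - by case: (ha j) => _; exact.
  - exact: a0.
pose z1 l s := y s l.
split => //; split => //; exists (z1 l).
  by apply: (IH _ g z1) => // j; exact: CnW.
move=> s t; apply: (sol_der ha hf _ _ _ _ hz hy).
- by move=> j; have [h _] := Ha1 j; exact: Cn0 h.
- by move=> j; have [h _] := Hf1 j; exact: Cn0 h.
- by move=> j; case: (Ha1 j).
- by move=> j; case: (Hf1 j).
Qed.
End Family.
End EllipticParameter.

(** * Vector-valued maps through coordinates *)

Lemma is_derive_lin (R : realType) (V W : normedModType R) (L : V -> W)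
  (f : R -> V) (t : R) (l : V) :
  (forall (a : R) u v, L (a *: u + v) = a *: L u + L v) -> continuous L ->
  is_derive t (1 : R) f l -> is_derive t (1 : R) (fun x => L (f x)) (L l).
Proof.
move=> linL cL [df <-].
have L0 : L 0 = 0.
  by have := linL (-1) 0 0; rewrite addr0 scaler0 scaleN1r addNr.
have LB u v : L (u - v) = L u - L v.
  by rewrite addrC -scaleN1r linL scaleN1r addrC.
have LZ (a : R) u : L (a *: u) = a *: L u.
  by rewrite -[a *: u]addr0 linL L0 addr0.
have cv : (fun h => h^-1 *: (L (f (h *: 1 + t)) - L (f t))) @ 0^' --> L ('D_1 f t).
  have -> : (fun h => h^-1 *: (L (f (h *: 1 + t)) - L (f t))) =
      L \o (fun h => h^-1 *: (f (h *: 1 + t) - f t)).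
    by apply/funext => h /=; rewrite LZ LB.
  by apply: continuous_cvg; [exact: cL|exact: df].
apply: DeriveDef; last exact/cvg_lim.
by apply/cvg_ex; eexists; exact: cv.
Qed.

Section Coordinates.
Context {R : realType} {V : normedModType R} {I : finType}.
Variables (c : I -> V -> R) (e : I -> V).
Hypothesis c_lin : forall i (a : R) u v, c i (a *: u + v) = a * c i u + c i v.
Hypothesis c_cont : forall i, continuous (c i).
Hypothesis c_e : forall v, v = \sum_i c i v *: e i.
Hypothesis c_row : forall (x : I -> R) i, c i (\sum_j x j *: e j) = x i.

(** Everything in this section reduces vector-valued calculus to coordinates: [c i] are the
    coordinates for a finite basis [e i]. *)
Lemma v_der (f : R -> V) t l : is_derive t (1 : R) f l <-> forall i, der (fun x => c i (f x)) t (c i l).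
Proof.
split=> [df i|H]; first exact: (is_derive_lin (L := c i)).
have E : f = \sum_i (fun x => c i (f x) *: e i).
  by apply/funext => x; rewrite fct_sumE -c_e.
rewrite E (c_e l).
have hi i : is_derive t (1 : R) (fun x => c i (f x) *: e i) (c i l *: e i).
  apply: (is_derive_lin (L := fun x : R => x *: e i) _ _ (H i)).
    by move=> a u v; rewrite scalerDl scalerA.
  by move=> x; apply: cvgZr_tmp; exact: cvg_id.
rewrite unlock /=; elim: (index_enum I) => [|i r IH] /=.
  exact: is_derive_cst.
exact: is_deriveD.
Qed.

Lemma v_ext u v : (forall i, c i u = c i v) -> u = v.
Proof. by move=> h; rewrite (c_e u) (c_e v); apply: eq_bigr => i _; rewrite h. Qed.

Lemma v_cont (T : topologicalType) (f : T -> V) :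
  continuous f <-> forall i, continuous (fun x => c i (f x)).
Proof.
split=> [cf i x|H]; first by apply: continuous_comp; [exact: cf|exact: c_cont].
have E : f = \sum_i (fun x => c i (f x) *: e i).
  by apply/funext => x; rewrite fct_sumE -c_e.
rewrite E unlock /=; elim: (index_enum I) => [|i r IH] x /=.
  exact: cvg_cst.
apply: cvgD; last exact: IH.
by apply: cvgZr_tmp; exact: H.
Qed.

Lemma v_derivable (f : R -> V) t :
  derivable f t 1 <-> forall i, derivable (fun x => c i (f x)) t 1.
Proof.
split=> [df i|H].
  have /v_der/(_ i) : is_derive t (1 : R) f ('D_1 f t) by exact: derivableP.
  exact: der_derivable.
have : is_derive t (1 : R) f (\sum_i derive1 (fun x => c i (f x)) t *: e i).
  by apply/v_der => i; rewrite c_row; apply: derivable_der.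
by case.
Qed.

Lemma v_derive1 (f : R -> V) t i : derivable f t 1 -> c i (f^`() t) = (fun x => c i (f x))^`() t.
Proof.
move=> df; have /v_der/(_ i) h : is_derive t (1 : R) f ('D_1 f t) by exact: derivableP.
by rewrite derive1E; apply/esym/der_derive1.
Qed.

Lemma v_smooth (f : R -> V) : smooth f <-> forall i, smooth (fun x => c i (f x)).
Proof.
split=> [sf i|H].
  have E m : (fun x => c i (f x))^`(m) = fun x => c i (f^`(m) x).
    elim: m => [|m IH] //.
    rewrite derive1nS IH; apply/funext => x.
    by rewrite derive1nS v_derive1 //; exact: sf.
  move=> m t; rewrite E; have := sf m t => /v_derivable; exact.
have E m : (forall t, derivable f^`(m) t 1) /\ forall i, (fun x => c i (f x))^`(m) = fun x => c i (f^`(m) x).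
  elim: m => [|m [IH1 IH2]].
    by split => // t; apply/v_derivable => i; exact: (H i 0%N).
  have E2 i : (fun x => c i (f x))^`(m.+1) = fun x => c i (f^`(m.+1) x).
    by rewrite derive1nS IH2; apply/funext => x; rewrite derive1nS v_derive1.
  by split => // t; apply/v_derivable => i; rewrite -E2; exact: (H i m.+1).
by move=> m; case: (E m).
Qed.

Lemma v_derive1n (f : R -> V) m i t : smooth f -> (fun x => c i (f x))^`(m) t = c i (f^`(m) t).
Proof.
move=> sf; elim: m t => [|m IH] // t.
rewrite derive1nS (_ : (fun x => c i (f x))^`(m) = fun x => c i (f^`(m) x)); last exact/funext.
by rewrite derive1nS v_derive1 //; exact: sf.
Qed.

Lemma v_pderiv (F : R -> R -> V) w i s t : smooth2 F ->
  c i (pderiv w F s t) = pderiv w (fun s t => c i (F s t)) s t.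
Proof.
move=> sF; elim: w s t => [|b w IH] // s t.
have IH' : (fun s t => c i (pderiv w F s t)) = pderiv w (fun s t => c i (F s t)).
  by apply/funext => x; apply/funext => y.
have [_ /(_ s t)[h1 h2]] := sF w.
by case: b => /=; rewrite -IH' /d_s /d_t; apply: v_derive1.
Qed.

Lemma v_smooth2 (F : R -> R -> V) : smooth2 F <-> forall i, smooth2 (fun s t => c i (F s t)).
Proof.
split=> [sF i w|H].
  have E : pderiv w (fun s t => c i (F s t)) = fun s t => c i (pderiv w F s t).
    by apply/funext => x; apply/funext => y; rewrite v_pderiv.
  have [h1 h2] := sF w; rewrite E; split; first by move/v_cont : h1; exact.
  move=> s t; have [h3 h4] := h2 s t; split.
    by move/v_derivable : h3; exact.
  by move/v_derivable : h4; exact.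
have E w : (forall s t, derivable (pderiv w F ^~ t) s 1 /\ derivable (pderiv w F s) t 1) /\
    forall i, pderiv w (fun s t => c i (F s t)) = fun s t => c i (pderiv w F s t).
  elim: w => [|b w [IH1 IH2]].
    split => // s t; split; apply/v_derivable => i; have [_ hd] := H i [::];
      have [h1 h2] := hd s t; [exact: h1|exact: h2].
  have E2 i : pderiv (b :: w) (fun s t => c i (F s t)) = fun s t => c i (pderiv (b :: w) F s t).
    rewrite /= IH2; apply/funext => s; apply/funext => t.
    have [h1 h2] := IH1 s t.
    by case: b; rewrite /d_s /d_t v_derive1.
  split => // s t; split; apply/v_derivable => i; have [_ /(_ s t)[]] := H i (b :: w); by rewrite E2.
move=> w; have [E1 E2] := E w; split => //.
by apply/v_cont => i; have [+ _] := H i w; rewrite E2.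
Qed.

End Coordinates.

Section Instances.
Context {R : realType}.

Definition rc {m} (l : 'I_m) (v : 'rV[R]_m) : R := v 0 l.
Definition re_ {m} (l : 'I_m) : 'rV[R]_m := delta_mx 0 l.

Lemma rc_lin m (l : 'I_m) (a : R) u v : rc l (a *: u + v) = a * rc l u + rc l v.
Proof. by rewrite /rc !mxE. Qed.
Lemma rc_cont m (l : 'I_m) : continuous (rc l).
Proof. exact: coord_continuous. Qed.
Lemma rc_e m (v : 'rV[R]_m) : v = \sum_l rc l v *: re_ l.
Proof. exact: row_sum_delta. Qed.
Lemma rc_row m (x : 'I_m -> R) l : rc l (\sum_i x i *: re_ i) = x l.
Proof.
rewrite /rc summxE (bigD1 l) //= big1 ?addr0 => [|i il]; first by rewrite !mxE !eqxx mulr1.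
by rewrite !mxE eqxx eq_sym (negbTE il) mulr0.
Qed.

Definition cc {m} (i : 'I_m + 'I_m) (z : Cvec R m) : R :=
  match i with inl j => z.1 0 j | inr j => z.2 0 j end.
Definition ce {m} (i : 'I_m + 'I_m) : Cvec R m :=
  match i with inl j => (delta_mx 0 j, 0) | inr j => (0, delta_mx 0 j) end.

Lemma cc_lin m (i : 'I_m + 'I_m) (a : R) u v : cc i (a *: u + v) = a * cc i u + cc i v.
Proof. by case: i => j /=; rewrite !mxE. Qed.
Lemma cc_cont m (i : 'I_m + 'I_m) : continuous (cc i).
Proof.
case: i => j x.
  by apply: (@continuous_comp _ _ _ fst (rc j)); [exact: cvg_fst|exact: rc_cont].
by apply: (@continuous_comp _ _ _ snd (rc j)); [exact: cvg_snd|exact: rc_cont].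
Qed.
Lemma fst_sum (J : finType) m (F : J -> Cvec R m) : (\sum_i F i).1 = \sum_i (F i).1.
Proof. exact: (big_morph fst). Qed.
Lemma snd_sum (J : finType) m (F : J -> Cvec R m) : (\sum_i F i).2 = \sum_i (F i).2.
Proof. exact: (big_morph snd). Qed.

Lemma cc_row m (x : 'I_m + 'I_m -> R) i : cc i (\sum_j x j *: ce j) = x i.
Proof.
case: i => j /=.
  rewrite fst_sum big_sumType /= addrC big1 ?add0r => [|i _]; last by rewrite scaler0.
  exact: (rc_row (fun j => x (inl j))).
rewrite snd_sum big_sumType /= big1 ?add0r => [|i _]; last by rewrite scaler0.
exact: (rc_row (fun j => x (inr j))).
Qed.

Lemma cc_e m (v : Cvec R m) : v = \sum_i cc i v *: ce i.
Proof.
rewrite [v]surjective_pairing; set u := \sum_i _.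
rewrite [RHS]surjective_pairing; congr pair; apply/rowP => j.
  by have := cc_row (fun i => cc i v) (inl j) => /= ->.
by have := cc_row (fun i => cc i v) (inr j) => /= ->.
Qed.

Definition C_smooth {m} (f : R -> Cvec R m) := v_smooth (@cc_lin m) (@cc_cont m) (@cc_e m) (@cc_row m) f.
Definition C_smooth2 {m} (F : R -> R -> Cvec R m) := v_smooth2 (@cc_lin m) (@cc_cont m) (@cc_e m) (@cc_row m) F.
Definition C_pderiv {m} (F : R -> R -> Cvec R m) w i s t sF := @v_pderiv _ _ _ _ _ (@cc_lin m) (@cc_cont m) (@cc_e m) F w i s t sF.
Definition r_smooth {m} (f : R -> 'rV[R]_m) := v_smooth (@rc_lin m) (@rc_cont m) (@rc_e m) (@rc_row m) f.
Definition r_derive1n {m} (f : R -> 'rV[R]_m) j i t sf := @v_derive1n _ _ _ _ _ (@rc_lin m) (@rc_cont m) (@rc_e m) f j i t sf.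

Lemma C_derive1 m (f : R -> Cvec R m) t i : derivable f t 1 -> cc i (f^`() t) = derive1 (fun x => cc i (f x)) t.
Proof. exact: (v_derive1 (@cc_lin m) (@cc_cont m) (@cc_e m)). Qed.
Lemma r_derive1 m (f : R -> 'rV[R]_m) t i : derivable f t 1 -> rc i (derive1 f t) = derive1 (fun x => rc i (f x)) t.
Proof. exact: (v_derive1 (@rc_lin m) (@rc_cont m) (@rc_e m)). Qed.

Lemma C_per m (f : R -> Cvec R m) : periodic f 1 <-> forall i, periodic (fun x => cc i (f x)) 1.
Proof.
split => [pf i t|h t]; first by rewrite pf.
by apply: (v_ext (@cc_e m)) => i; exact: h.
Qed.

Lemma C_loop m (f : R -> Cvec R m) : loop f <->
  forall i, smooth (fun x => cc i (f x)) /\ periodic (fun x => cc i (f x)) 1.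
Proof.
rewrite /loop; split => [[/C_smooth h1 /C_per h2] i //|h].
by split; [apply/C_smooth => i|apply/C_per => i]; case: (h i).
Qed.

Lemma r_loop m (f : R -> 'rV[R]_m) : loop f <->
  forall i, smooth (fun x => rc i (f x)) /\ periodic (fun x => rc i (f x)) 1.
Proof.
rewrite /loop; split => [[h1 h2] i|h].
  by split; [move: h1 => /r_smooth; exact|move=> t; rewrite h2].
split; first by apply/r_smooth => i; case: (h i).
by move=> t; apply: (v_ext (@rc_e m)) => i; case: (h i) => _; exact.
Qed.

End Instances.

(** * The torus action in coordinates *)

Section Algebra.
Import complex.
Local Open Scope ring_scope.
Local Open Scope classical_set_scope.
Context {R : realType} {n k : nat} (A : 'M[int]_(n, k)).
Implicit Types (z w : Cvec R n) (v : 'rV[R]_k).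

Definition Bc (j : 'I_n) (l : 'I_k) : R := (A j l)%:~R.

Lemma weightE v j : weight A v 0 j = \sum_l Bc j l * v 0 l.
Proof. by rewrite mxE; apply: eq_bigr => l _; rewrite !mxE mulrC. Qed.

Lemma inf_act1 z v j : (inf_act A z v).1 0 j = - (weight A v 0 j * z.2 0 j).
Proof. by rewrite /inf_act /ofC /coordC /= mxE; simpc; ring. Qed.

Lemma inf_act2 z v j : (inf_act A z v).2 0 j = weight A v 0 j * z.1 0 j.
Proof. by rewrite /inf_act /ofC /coordC /= mxE; simpc; ring. Qed.

Lemma inf_adjE z w l : inf_act_adj A z w 0 l =
  \sum_j Bc j l * (z.1 0 j * w.2 0 j - z.2 0 j * w.1 0 j).
Proof. by rewrite mxE; apply: eq_bigr => j _; rewrite !mxE mulrC. Qed.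

Lemma momentE z l : moment A z 0 l = - (2^-1 * \sum_j Bc j l * (z.1 0 j ^+ 2 + z.2 0 j ^+ 2)).
Proof.
rewrite !mxE; congr (- (_ * _)); apply: eq_bigr => j _.
by rewrite !mxE mulrC.
Qed.

Lemma adj_inf z v l : inf_act_adj A z (inf_act A z v) 0 l =
  \sum_j Bc j l * ((z.1 0 j ^+ 2 + z.2 0 j ^+ 2) * weight A v 0 j).
Proof.
rewrite inf_adjE; apply: eq_bigr => j _; rewrite inf_act1 inf_act2; ring.
Qed.

Lemma rho1 v z j : (rho A (expi v) z).1 0 j =
  cos (weight A v 0 j) * z.1 0 j - sin (weight A v 0 j) * z.2 0 j.
Proof. by rewrite rho_expi /ofC /coordC /= mxE. Qed.
Lemma rho2 v z j : (rho A (expi v) z).2 0 j =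
  cos (weight A v 0 j) * z.2 0 j + sin (weight A v 0 j) * z.1 0 j.
Proof. by rewrite rho_expi /ofC /coordC /= mxE. Qed.

Lemma cs1 (x : R) : cos x ^+ 2 = 1 - sin x ^+ 2.
Proof. by rewrite -(cos2Dsin2 x); ring. Qed.

Lemma rho_dotC (u : Cvec R k) z w : torus u -> dotC (rho A u z) (rho A u w) = dotC z w.
Proof.
move=> [v _ <-]; rewrite /dotC /dot -!big_split; apply: eq_bigr => j _ /=.
rewrite !rho1 !rho2; set c := cos _; set s := sin _.
have h : c ^+ 2 = 1 - s ^+ 2 by exact: cs1.
transitivity ((c ^+ 2 + s ^+ 2) * (z.1 0 j * w.1 0 j + z.2 0 j * w.2 0 j)); first ring.
by rewrite h; ring.
Qed.

Lemma rho_adj (u : Cvec R k) z w : torus u -> inf_act_adj A (rho A u z) (rho A u w) = inf_act_adj A z w.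
Proof.
move=> [v _ <-]; apply/rowP => l; rewrite !inf_adjE; apply: eq_bigr => j _.
rewrite !rho1 !rho2; set c := cos _; set s := sin _.
have h : c ^+ 2 = 1 - s ^+ 2 by exact: cs1.
congr (_ * _).
transitivity ((c ^+ 2 + s ^+ 2) * (z.1 0 j * w.2 0 j - z.2 0 j * w.1 0 j)); first ring.
by rewrite h; ring.
Qed.

Lemma rho_sqr (u : Cvec R k) z j : torus u ->
  (rho A u z).1 0 j ^+ 2 + (rho A u z).2 0 j ^+ 2 = z.1 0 j ^+ 2 + z.2 0 j ^+ 2.
Proof.
move=> [v _ <-]; rewrite !rho1 !rho2; set c := cos _; set s := sin _.
have h : c ^+ 2 = 1 - s ^+ 2 by exact: cs1.
transitivity ((c ^+ 2 + s ^+ 2) * (z.1 0 j ^+ 2 + z.2 0 j ^+ 2)); first ring.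
by rewrite h; ring.
Qed.

Lemma dotC_inf z w v : dotC w (inf_act A z v) = \sum_l v 0 l * inf_act_adj A z w 0 l.
Proof.
by rewrite -[RHS](inf_act_adjP A z w v) /dotC /dot; congr (_ + _); apply: eq_bigr => i _; rewrite mulrC.
Qed.

Lemma dotCC z w : dotC z w = dotC w z.
Proof. by rewrite /dotC /dot; congr (_ + _); apply: eq_bigr => i _; rewrite mulrC. Qed.

Lemma dotC_lin (a : R) z z' w : dotC (a *: z + z') w = a * dotC z w + dotC z' w.
Proof.
rewrite /dotC /dot mulrDr !mulr_sumr addrACA -!big_split /=.
by apply: eq_bigr => i _; rewrite !mxE; ring.
Qed.

Lemma dotC_ge0 z : 0 <= dotC z z.
Proof. by rewrite addr_ge0 //; apply: sumr_ge0 => i _; rewrite -expr2 sqr_ge0. Qed.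

Lemma dot_ge0 m (u : 'rV[R]_m) : 0 <= dot u u.
Proof. by apply: sumr_ge0 => i _; rewrite -expr2 sqr_ge0. Qed.

Lemma dot_eq0 m (u : 'rV[R]_m) : dot u u = 0 -> u = 0.
Proof.
move=> h; apply/rowP => i; rewrite mxE; apply/eqP; rewrite -sqrf_eq0 expr2; apply/eqP.
by move/psumr_eq0P : h; apply => // j _; rewrite -expr2 sqr_ge0.
Qed.

Lemma dotC_eq0 z : dotC z z = 0 -> z = 0.
Proof.
move/eqP; rewrite paddr_eq0 ?dot_ge0 // => /andP[/eqP/dot_eq0 h1 /eqP/dot_eq0 h2].
by rewrite [z]surjective_pairing h1 h2.
Qed.

End Algebra.

(** The primitive is monotone and gains nothing over a period, so it is constant. *)
Lemma circ_eq0_per (R : realType) (f : R -> R) : continuous f -> periodic f 1 -> (forall t, 0 <= f t) ->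
  circ_int f = 0 -> forall t, f t = 0.
Proof.
move=> cf pf f0; rewrite circ_seg // => i0 t.
have dp x : der (prim f) x (f x) by exact: der_prim.
have per x : prim f (x + 1) = prim f x.
  have := @der_cst_eq _ (fun x => prim f (x + 1) - prim f x) x 0; rewrite add0r.
  move: i0; rewrite /seg => -> h; apply/eqP; rewrite -subr_eq0; apply/eqP/h => y.
  by apply: der_eq (derB (der_shift (dp (y + 1))) (dp y)) _; rewrite pf subrr.
have mono a b : a <= b -> prim f a <= prim f b.
  by move=> ab; apply: (der_le dp).
have h a b : a <= b -> b <= a + 1 -> prim f a = prim f b.
  move=> ab ba; apply/eqP; rewrite eq_le mono //= -(per a); exact: mono.
have d0 : der (fun=> prim f (t - 2^-1)) t 0 by exact: der_cst.
apply: der_unique (dp t) _.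
apply: near_eq_is_derive d0; near=> x.
have : `|x - t| < 2^-1 by near: x; apply: cvgr_distC_lt.
rewrite ltr_norml => /andP[h1 h2]; apply: h; lra.
Unshelve. all: by end_near. Qed.

Section EllipticForm.
Context {R : realType} {n k : nat} (B : 'I_n -> 'I_k -> R).

(** For a solution [z = K (f - Q z)] this is [- z''] up to constants, and its mean-zero primitive is
    [- z']. *)
Definition resw (a : 'I_n -> R -> R) (f z : 'I_k -> R -> R) : 'I_k -> R -> R :=
  fun l t => f l t - Qop B a z l t.

Lemma cont_resw a f z : contf a -> contf f -> contf z -> contf (resw a f z).
Proof. by move=> ca cf cz l; apply: contB; [exact: cf|exact: cont_Q]. Qed.

(** The weak form of the equation, with another solution as a test function. *)
Lemma sol_form a f z f' z' : contf a -> contf f -> contf f' -> sol B a f z -> sol B a f' z' ->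
  \sum_l circ_int (fun t => f l t * z' l t) =
  \sum_l circ_int (fun t => mzp (resw a f z l) t * mzp (resw a f' z' l) t) + qf B a z z'.
Proof.
move=> ca cf cf' [cz pz hz] [cz' pz' hz'].
have cw := cont_resw ca cf cz; have cw' := cont_resw ca cf' cz'.
have cQ := cont_Q (B := B) ca cz.
rewrite N2_form // -(qf_Q B ca cz cz') -big_split; apply: eq_bigr => l _ /=.
have E : Kf (resw a f' z') l = z' l by apply/funext => t; rewrite hz'.
rewrite -circD; last 2 first.
- by rewrite E; apply: contM; [exact: cw|exact: cz'].
- by apply: contM; [exact: cQ|exact: cz'].
by apply: circ_int_ext => t; rewrite E /resw; ring.
Qed.

Lemma qf_sym a z z' : qf B a z z' = qf B a z' z.
Proof. by apply: eq_bigr => j _; apply: circ_int_ext => t; rewrite (mulrC (lin _ _ _ _)). Qed.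

(** The weak form is symmetric in the two solutions; this is the symmetry of the metric. *)
Lemma sol_sym a f z f' z' : contf a -> contf f -> contf f' -> sol B a f z -> sol B a f' z' ->
  \sum_l circ_int (fun t => f l t * z' l t) = \sum_l circ_int (fun t => f' l t * z l t).
Proof.
move=> ca cf cf' hz hz'; rewrite (sol_form ca cf cf' hz hz') (sol_form ca cf' cf hz' hz).
rewrite qf_sym; congr (_ + _); apply: eq_bigr => l _.
by apply: circ_int_ext => t; rewrite mulrC.
Qed.

(** Bootstrapping: the right-hand side of [z = K (f - Q z)] has two derivatives more than [z]. *)
Lemma sol_smooth a f z : (forall j, smooth (a j)) -> (forall l, smooth (f l)) -> sol B a f z ->
  forall l, smooth (z l).
Proof.
move=> sa sf [cz pz hz] l; apply: smooth_Cn => m.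
suff H : forall m l, Cn false m (fun s _ => z l s) by [].
elim=> [|m' IH] i; first by split => //; apply: cont2_fst; exact: cz.
have ca : contf a by move=> j; apply: der_cont => t; apply: derivable_der; exact: (sa j 0%N).
have cf : contf f by move=> j; apply: der_cont => t; apply: derivable_der; exact: (sf j 0%N).
have cw := cont_resw ca cf cz.
have zE i' : z i' = Kop (resw a f z i') by apply/funext => t; exact: hz.
have hw : Cn false m' (fun s _ => resw a f z i s).
  apply: CnB; first exact: Cn_fst.
  apply: Cn_sum => j; apply: CnZ; apply: CnM; first exact: Cn_fst.
  by apply: Cn_sum => i'; exact: CnZ.
have hm : Cn false m'.+1 (fun s _ => mzp (resw a f z i) s).
  split => //; first by apply: cont2_fst; exact: cont_mzp.
  split => //; exists (fun s _ => resw a f z i s - circ_int (resw a f z i)).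
    by apply: CnB => //; exact: Cn_cst.
  by move=> s _; exact: der_mzp.
split => //; first by apply: cont2_fst; exact: cz.
split => //; exists (fun s _ => - mzp (resw a f z i) s).
  by apply: CnN; exact: CnW.
by move=> s _; rewrite zE; apply: der_ext (der_K s (cw i)).
Qed.

End EllipticForm.

(** * The metrics *)

Section MetricFamily.
Context {R : realType} {n k : nat} (A : 'M[int]_(n, k)).
Implicit Types (p v w : config R n k) (r : R).
Let B : 'I_n -> 'I_k -> R := Bc A.

Definition reC p j t : R := (p.1 t).1 0 j.
Definition imC p j t : R := (p.1 t).2 0 j.
Definition sqmod p j t : R := reC p j t ^+ 2 + imC p j t ^+ 2.
Definition adjv p v l t : R := inf_act_adj A (p.1 t) (v.1 t) 0 l.

Lemma adjvE p v l t : adjv p v l t =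
  \sum_j B j l * (reC p j t * imC v j t - imC p j t * reC v j t).
Proof. exact: inf_adjE. Qed.

Lemma sqmod_ge0 p j t : 0 <= sqmod p j t.
Proof. by rewrite addr_ge0 // sqr_ge0. Qed.

Lemma L0_comp p : L0 p -> (forall j, smooth (reC p j) /\ periodic (reC p j) 1) /\
  (forall j, smooth (imC p j) /\ periodic (imC p j) 1).
Proof.
by move=> /C_loop h; split=> j; [exact: (h (inl j))|exact: (h (inr j))].
Qed.

Lemma comp_L0 p : (forall j, smooth (reC p j) /\ periodic (reC p j) 1) ->
  (forall j, smooth (imC p j) /\ periodic (imC p j) 1) -> L0 p.
Proof. by move=> h1 h2; apply/C_loop => -[j|j]; [exact: h1|exact: h2]. Qed.

Lemma smooth_contf (I : Type) (f : I -> R -> R) : (forall i, smooth (f i)) -> contf f.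
Proof. by move=> h i; apply: der_cont => t; apply: derivable_der; exact: (h i 0%N). Qed.

Lemma reC_smooth p j : L0 p -> smooth (reC p j). Proof. by move=> /L0_comp[h _]; case: (h j). Qed.
Lemma imC_smooth p j : L0 p -> smooth (imC p j). Proof. by move=> /L0_comp[_ h]; case: (h j). Qed.
Lemma reC_per p j : L0 p -> periodic (reC p j) 1. Proof. by move=> /L0_comp[h _]; case: (h j). Qed.
Lemma imC_per p j : L0 p -> periodic (imC p j) 1. Proof. by move=> /L0_comp[_ h]; case: (h j). Qed.

Lemma sqmod_smooth p j : L0 p -> smooth (sqmod p j).
Proof.
move=> hp; apply: smooth_Cn => m.
by apply: CnD; apply: CnX; apply: Cn_fst; [exact: reC_smooth|exact: imC_smooth].
Qed.
Lemma sqmod_per p : L0 p -> perf (sqmod p).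
Proof. by move=> hp j t; rewrite /sqmod (reC_per _ hp) (imC_per _ hp). Qed.

Lemma adjv_smooth p v l : L0 p -> L0 v -> smooth (adjv p v l).
Proof.
move=> hp hv; apply: smooth_Cn => m.
apply: (@Cn_ext _ _ _ (fun t _ => \sum_j B j l * (reC p j t * imC v j t - imC p j t * reC v j t))).
  by move=> s t; rewrite adjvE.
apply: Cn_sum => j; apply: CnZ; apply: CnB; apply: CnM; apply: Cn_fst.
- exact: reC_smooth.
- exact: imC_smooth.
- exact: imC_smooth.
- exact: reC_smooth.
Qed.
Lemma adjv_per p v : L0 p -> L0 v -> perf (adjv p v).
Proof. by move=> [_ pp] [_ pv] l t; rewrite /adjv pp pv. Qed.

Definition rsqmod r p j t : R := r * sqmod p j t.

Lemma rsqmod_smooth r p j : L0 p -> smooth (rsqmod r p j).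
Proof. by move=> hp; apply: smooth_Cn => m; apply: CnZ; apply: Cn_fst; exact: sqmod_smooth. Qed.
Lemma rsqmod_per r p : L0 p -> perf (rsqmod r p).
Proof. by move=> hp j t; rewrite /rsqmod sqmod_per. Qed.
Lemma rsqmod_ge0 r p j t : 0 <= r -> 0 <= rsqmod r p j t.
Proof. by move=> r0; rewrite mulr_ge0 // sqmod_ge0. Qed.

Lemma rsqmod_cont r p : L0 p -> contf (rsqmod r p).
Proof. by move=> hp; apply: smooth_contf => j; exact: rsqmod_smooth. Qed.
Lemma adjv_cont p v : L0 p -> L0 v -> contf (adjv p v).
Proof. by move=> hp hv; apply: smooth_contf => j; exact: adjv_smooth. Qed.

End MetricFamily.

(** A solution, and zero where there is none.  Locked, because unfolding the choice is never useful.
    *)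
HB.lock Definition zeta {R : realType} {n k : nat} (A : 'M[int]_(n, k)) (r : R)
    (p v : config R n k) : 'I_k -> R -> R :=
  xget (fun _ _ => 0) [set z | sol (Bc A) (rsqmod r p) (adjv A p v) z].

Section MetricFamily.
Context {R : realType} {n k : nat} (A : 'M[int]_(n, k)).
Implicit Types (p v w : config R n k) (r : R).
Let B : 'I_n -> 'I_k -> R := Bc A.
Local Notation adjv := (adjv A).
Local Notation zeta := (zeta A).

Lemma zetaP r p v : 0 <= r -> L0 p -> L0 v -> sol B (rsqmod r p) (adjv p v) (zeta r p v).
Proof.
move=> r0 hp hv; have [z hz] : exists z, sol B (rsqmod r p) (adjv p v) z.
  apply: sol_ex; [exact: rsqmod_cont|exact: rsqmod_per| |exact: adjv_cont|exact: adjv_per].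
  by move=> j t; exact: rsqmod_ge0.
rewrite unlock; exact: (@xgetPex _ _ [set z | sol B (rsqmod r p) (adjv p v) z] (ex_intro _ z hz)).
Qed.

Lemma zeta_uniq r p v z : 0 <= r -> L0 p -> L0 v -> sol B (rsqmod r p) (adjv p v) z ->
  forall l t, zeta r p v l t = z l t.
Proof.
move=> r0 hp hv hz; apply: (sol_unique _ _ _ _ _ (zetaP r0 hp hv) hz).
- exact: rsqmod_cont.
- by move=> j t; exact: rsqmod_ge0.
- exact: rsqmod_per.
- exact: adjv_cont.
- exact: adjv_per.
Qed.

Definition gm r p v w : R :=
  circ_int (fun t => dotC (v.1 t) (w.1 t)) + dot v.2 w.2
  - r * \sum_l circ_int (fun t => adjv p w l t * zeta r p v l t).

Lemma cont_dotC v w : L0 v -> L0 w -> continuous (fun t => dotC (v.1 t) (w.1 t)).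
Proof.
move=> hv hw; apply: contD; apply: cont_sum => j; apply: contM.
- by apply: (smooth_contf (f := reC v)) => i; exact: reC_smooth.
- by apply: (smooth_contf (f := reC w)) => i; exact: reC_smooth.
- by apply: (smooth_contf (f := imC v)) => i; exact: imC_smooth.
- by apply: (smooth_contf (f := imC w)) => i; exact: imC_smooth.
Qed.

Lemma L0_lin (a : R) u v : L0 u -> L0 v -> L0 (a *: u + v).
Proof.
move=> hu hv; apply: comp_L0 => j; split.
- apply: smooth_Cn => m; apply: (@Cn_ext _ _ _ (fun t _ => a * reC u j t + reC v j t)).
    by move=> s t; rewrite /reC /= !mxE.
  by apply: CnD; [apply: CnZ|]; apply: Cn_fst; exact: reC_smooth.
- by move=> t; have := reC_per j hu t; have := reC_per j hv t; rewrite /reC /= !mxE => -> ->.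
- apply: smooth_Cn => m; apply: (@Cn_ext _ _ _ (fun t _ => a * imC u j t + imC v j t)).
    by move=> s t; rewrite /imC /= !mxE.
  by apply: CnD; [apply: CnZ|]; apply: Cn_fst; exact: imC_smooth.
- by move=> t; have := imC_per j hu t; have := imC_per j hv t; rewrite /imC /= !mxE => -> ->.
Qed.

Lemma adjv_lin p (a : R) u v l t : adjv p (a *: u + v) l t = a * adjv p u l t + adjv p v l t.
Proof.
rewrite !adjvE mulr_sumr -big_split; apply: eq_bigr => j _ /=.
by rewrite /reC /imC /= !mxE; ring.
Qed.

Lemma gm_sym r p v w : 0 <= r -> L0 p -> L0 v -> L0 w -> gm r p v w = gm r p w v.
Proof.
move=> r0 hp hv hw; rewrite /gm.
have := sol_sym (rsqmod_cont (r := r) hp) (adjv_cont hp hw) (adjv_cont hp hv) (zetaP r0 hp hw) (zetaP r0 hp hv).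
move=> ->.
have -> : circ_int (fun t => dotC (v.1 t) (w.1 t)) = circ_int (fun t => dotC (w.1 t) (v.1 t)).
  by apply: circ_int_ext => t; exact: dotCC.
by have -> : dot v.2 w.2 = dot w.2 v.2 by apply: eq_bigr => i _; rewrite mulrC.
Qed.

Lemma zeta_cont r p v : 0 <= r -> L0 p -> L0 v -> contf (zeta r p v).
Proof. by move=> r0 hp hv; case: (zetaP r0 hp hv). Qed.

Lemma gm_lin r p (a : R) u v w : 0 <= r -> L0 p -> L0 u -> L0 v -> L0 w ->
  gm r p (a *: u + v) w = a * gm r p u w + gm r p v w.
Proof.
move=> r0 hp hu hv hw; have huv := L0_lin a hu hv.
have zE l t : zeta r p (a *: u + v) l t = a * zeta r p u l t + zeta r p v l t.
  have h1 := sol_scale (- a) (rsqmod_cont (r := r) hp) (adjv_cont hp hu) (zetaP r0 hp hu).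
  have c1 : contf (fun l t => - a * adjv p u l t).
    by move=> i; apply: contM; [exact: cont_cst|exact: adjv_cont].
  have h2 := sol_sub (rsqmod_cont (r := r) hp) c1 (adjv_cont hp hv) h1 (zetaP r0 hp hv).
  rewrite (zeta_uniq r0 hp huv (z := fun l t => zeta r p v l t - - a * zeta r p u l t)); first by ring.
  by apply: sol_ext h2 => i x; rewrite adjv_lin; ring.
rewrite /gm.
have -> : circ_int (fun t => dotC ((a *: u + v).1 t) (w.1 t)) =
    a * circ_int (fun t => dotC (u.1 t) (w.1 t)) + circ_int (fun t => dotC (v.1 t) (w.1 t)).
  have c1 := cont_dotC hu hw; have c2 := cont_dotC hv hw.
  rewrite -circZ // -circD //; last by apply: contM => //; exact: cont_cst.
  by apply: circ_int_ext => t; exact: dotC_lin.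
have -> : dot (a *: u + v).2 w.2 = a * dot u.2 w.2 + dot v.2 w.2.
  by rewrite mulr_sumr -big_split; apply: eq_bigr => i _ /=; rewrite !mxE; ring.
have -> : \sum_l circ_int (fun t => adjv p w l t * zeta r p (a *: u + v) l t) =
    a * (\sum_l circ_int (fun t => adjv p w l t * zeta r p u l t)) +
    \sum_l circ_int (fun t => adjv p w l t * zeta r p v l t).
  rewrite mulr_sumr -big_split; apply: eq_bigr => l _ /=.
  have c1 : continuous (fun t => adjv p w l t * zeta r p u l t).
    by apply: contM; [exact: adjv_cont|exact: zeta_cont].
  have c2 : continuous (fun t => adjv p w l t * zeta r p v l t).
    by apply: contM; [exact: adjv_cont|exact: zeta_cont].
  rewrite -circZ // -circD //; last by apply: contM => //; exact: cont_cst.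
  by apply: circ_int_ext => t; rewrite zE; ring.
ring.
Qed.

Definition zvec r p v (t : R) : 'rV[R]_k := \row_l zeta r p v l t.

Lemma weight_zvec r p v t j : weight A (zvec r p v t) 0 j = lin B (zeta r p v) j t.
Proof. by rewrite weightE; apply: eq_bigr => l _; rewrite mxE. Qed.

Lemma dotC_inf_inf z (u u' : 'rV[R]_k) : dotC (inf_act A z u) (inf_act A z u') =
  \sum_j (z.1 0 j ^+ 2 + z.2 0 j ^+ 2) * (weight A u 0 j * weight A u' 0 j).
Proof.
rewrite /dotC /dot -big_split; apply: eq_bigr => j _ /=.
by rewrite !inf_act1 !inf_act2; ring.
Qed.

(** The weak form of the potential equation, tested with [zeta] itself, completes the square. *)
Lemma gm_pos_form r p v : 0 <= r -> L0 p -> L0 v ->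
  gm r p v v = circ_int (fun t => dotC (v.1 t - inf_act A (p.1 t) (r *: zvec r p v t))
                                       (v.1 t - inf_act A (p.1 t) (r *: zvec r p v t)))
    + dot v.2 v.2 + r * N2 (resw B (rsqmod r p) (adjv p v) (zeta r p v)).
Proof.
move=> r0 hp hv; have hz := zetaP r0 hp hv.
have cz := zeta_cont r0 hp hv; have cf : contf (adjv p v) by exact: adjv_cont.
have ca := rsqmod_cont (r := r) hp.
have := sol_form ca cf cf hz hz; rewrite -N2E => HS.
rewrite /gm; set S := \sum_l _ in HS *.
have cv := cont_dotC hv hv.
have -> : circ_int (fun t => dotC (v.1 t - inf_act A (p.1 t) (r *: zvec r p v t))
                                  (v.1 t - inf_act A (p.1 t) (r *: zvec r p v t))) =
  circ_int (fun t => dotC (v.1 t) (v.1 t)) - 2 * r * S + r * qf B (rsqmod r p) (zeta r p v) (zeta r p v).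
  rewrite /S /qf -!circ_sum; last 2 first.
  - by move=> l; apply: contM; [exact: cf|exact: cz].
  - by move=> j; exact: cont_qf.
  have c1 : continuous (fun t => \sum_l adjv p v l t * zeta r p v l t).
    by apply: cont_sum => l; apply: contM; [exact: cf|exact: cz].
  have c2 : continuous (fun t => \sum_j rsqmod r p j t * (lin B (zeta r p v) j t * lin B (zeta r p v) j t)).
    by apply: cont_sum => l; exact: cont_qf.
  rewrite -!circZ // -circB //; last by apply: contM => //; exact: cont_cst.
  rewrite -circD //; last 2 first.
  - by apply: contB => //; apply: contM => //; exact: cont_cst.
  - by apply: contM => //; exact: cont_cst.
  apply: circ_int_ext => t.
  set z := p.1 t; set u := zvec r p v t.
  have e1 : dotC (v.1 t - inf_act A z (r *: u)) (v.1 t - inf_act A z (r *: u)) =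
     dotC (v.1 t) (v.1 t) - 2 * dotC (v.1 t) (inf_act A z (r *: u))
     + dotC (inf_act A z (r *: u)) (inf_act A z (r *: u)).
    set y := inf_act A z (r *: u); rewrite /dotC /dot; set V := v.1 t.
    rewrite -!big_split /= mulr_sumr -sumrB -big_split /=.
    by apply: eq_bigr => j _; rewrite !mxE; ring.
  rewrite e1 dotC_inf dotC_inf_inf; congr (_ - _ + _).
  - rewrite -mulrA; congr (2 * _); rewrite mulr_sumr; apply: eq_bigr => l _.
    have -> : (r *: u) 0 l = r * zeta r p v l t by rewrite !mxE.
    by have -> : inf_act_adj A z (v.1 t) 0 l = adjv p v l t by []; ring.
  - rewrite mulr_sumr; apply: eq_bigr => j _.
    have -> : weight A (r *: u) 0 j = r * lin B (zeta r p v) j t.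
      by rewrite /weight -scalemxAl mxE -weight_zvec.
    by rewrite /rsqmod /sqmod /reC /imC -/z; ring.
rewrite HS; ring.
Qed.

Lemma Csub1 (x y : Cvec R n) j : (x - y).1 0 j = x.1 0 j - y.1 0 j.
Proof. by rewrite /= !mxE. Qed.
Lemma Csub2 (x y : Cvec R n) j : (x - y).2 0 j = x.2 0 j - y.2 0 j.
Proof. by rewrite /= !mxE. Qed.

Lemma cont_vres r p v : 0 <= r -> L0 p -> L0 v -> continuous
  (fun t => dotC (v.1 t - inf_act A (p.1 t) (r *: zvec r p v t))
                 (v.1 t - inf_act A (p.1 t) (r *: zvec r p v t))) /\
  periodic (fun t => dotC (v.1 t - inf_act A (p.1 t) (r *: zvec r p v t))
                 (v.1 t - inf_act A (p.1 t) (r *: zvec r p v t))) 1.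
Proof.
move=> r0 hp hv; have cz := zeta_cont r0 hp hv.
have [_ pz _] := zetaP r0 hp hv.
have wE t j : weight A (r *: zvec r p v t) 0 j = r * lin B (zeta r p v) j t.
  by rewrite /weight -scalemxAl mxE -weight_zvec.
have cw j : continuous (fun t => weight A (r *: zvec r p v t) 0 j).
  rewrite (_ : (fun t => _) = fun t => r * lin B (zeta r p v) j t); last exact/funext.
  by apply: contM; [exact: cont_cst|exact: cont_lin].
split; last first.
  move=> t; have [_ pp] := hp; have [_ pv] := hv.
  have -> : zvec r p v (t + 1) = zvec r p v t by apply/rowP => l; rewrite !mxE pz.
  by rewrite pp pv.
have cx j : continuous (reC p j) by apply: (smooth_contf (f := reC p)) => i; exact: reC_smooth.
have cy j : continuous (imC p j) by apply: (smooth_contf (f := imC p)) => i; exact: imC_smooth.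
have cvx j : continuous (reC v j) by apply: (smooth_contf (f := reC v)) => i; exact: reC_smooth.
have cvy j : continuous (imC v j) by apply: (smooth_contf (f := imC v)) => i; exact: imC_smooth.
have c1 j : continuous (fun t => (v.1 t - inf_act A (p.1 t) (r *: zvec r p v t)).1 0 j).
  rewrite (_ : (fun t => _) = fun t => reC v j t - - (weight A (r *: zvec r p v t) 0 j * imC p j t)).
    by apply: contB => //; apply: contN; exact: contM.
  by apply/funext => t; rewrite Csub1 inf_act1.
have c2 j : continuous (fun t => (v.1 t - inf_act A (p.1 t) (r *: zvec r p v t)).2 0 j).
  rewrite (_ : (fun t => _) = fun t => imC v j t - (weight A (r *: zvec r p v t) 0 j * reC p j t)).
    by apply: contB => //; exact: contM.
  by apply/funext => t; rewrite Csub2 inf_act2.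
by apply: contD; apply: cont_sum => j; apply: contM.
Qed.

(** All terms of [gm_pos_form] are nonnegative.  If they vanish, then so does [r *: zeta], and with
    it [v]. *)
Lemma gm_pos r p v : 0 <= r -> L0 p -> L0 v -> v <> 0 -> 0 < gm r p v v.
Proof.
move=> r0 hp hv v0; have [cd pd] := cont_vres r0 hp hv.
have cz := zeta_cont r0 hp hv; have cf : contf (adjv p v) by exact: adjv_cont.
have ca := rsqmod_cont (r := r) hp.
have cw := cont_resw (B := B) ca cf cz.
have hd : 0 <= circ_int (fun t => dotC (v.1 t - inf_act A (p.1 t) (r *: zvec r p v t))
                 (v.1 t - inf_act A (p.1 t) (r *: zvec r p v t))).
  by apply: circ_ge0 => // t _; exact: dotC_ge0.
have hN := N2_ge0 cw; have h2 := @dot_ge0 R _ v.2.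
rewrite lt0r gm_pos_form // !addr_ge0 ?mulr_ge0 // andbT.
apply/negP; rewrite paddr_eq0 ?addr_ge0 ?mulr_ge0 // paddr_eq0 //.
move=> /andP[/andP[/eqP d0 /eqP/dot_eq0 v20] /eqP rN0]; apply: v0.
have hv1 t : v.1 t = inf_act A (p.1 t) (r *: zvec r p v t).
  apply/eqP; rewrite -subr_eq0; apply/eqP/dotC_eq0.
  by apply: (circ_eq0_per cd pd) => // x; exact: dotC_ge0.
have rz t : r *: zvec r p v t = 0.
  apply/rowP => l; rewrite !mxE.
  move/eqP: rN0; rewrite mulf_eq0 => /orP[/eqP->|/eqP N0]; first by rewrite mul0r.
  have [_ _ hz] := zetaP r0 hp hv.
  have pw : perf (resw B (rsqmod r p) (adjv p v) (zeta r p v)).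
    move=> i x; have [_ pz _] := zetaP r0 hp hv.
    by rewrite /resw adjv_per // (per_Q B (rsqmod_per r hp) pz).
  have := K_sqr l t cw pw; rewrite N0 -/(resw B (rsqmod r p) (adjv p v) (zeta r p v) l) => h.
  have : Kop (resw B (rsqmod r p) (adjv p v) (zeta r p v) l) t ^+ 2 == 0 by rewrite eq_le h sqr_ge0.
  by rewrite sqrf_eq0 hz => /eqP ->; rewrite mulr0.
rewrite [v]surjective_pairing v20; congr pair; apply/funext => t.
rewrite hv1 rz; rewrite [LHS]surjective_pairing; congr pair; apply/rowP => j.
  by rewrite inf_act1 /weight mul0mx !mxE mul0r oppr0.
by rewrite inf_act2 /weight mul0mx !mxE mul0r.
Qed.

End MetricFamily.

(** * Smoothness, endpoints and invariance of the metrics *)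

Section Curves.
Context {R : realType} {n k : nat}.
Implicit Types (p v w : R -> config R n k).

Definition reY p j s t : R := reC (p s) j t.
Definition imY p j s t : R := imC (p s) j t.

Lemma smooth_curve_sm p : smooth_curve p ->
  (forall j, sm (reY p j)) /\ (forall j, sm (imY p j)).
Proof.
move=> [s1 pp _].
have sF : smooth2 (fun s t => (p s).1 t) by exact: s1.
move/C_smooth2 : s1 => H; split=> j; apply: smooth2_sm.
- exact: (H (inl j)).
- by move=> s t; rewrite /reY /reC pp.
- exact: (H (inr j)).
- by move=> s t; rewrite /imY /imC pp.
Qed.

Lemma sm_slice (F : R -> R -> R) s : sm F -> smooth (F s).
Proof.
move=> sF.
have E m : sm (iter m d_t F) /\ (F s)^`(m) = iter m d_t F s.
  elim: m => [|m [IH1 IH2]] //; have [d g] := sm_dt IH1; split => //.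
  rewrite derive1nS IH2; apply/funext => t; exact: der_derive1 (d s t).
move=> m t; have [h1 h2] := E m; rewrite h2; have [d _] := sm_dt h1.
exact: der_derivable (d s t).
Qed.

Lemma smooth_curve_L0 p s : smooth_curve p -> L0 (p s).
Proof.
move=> hp; have [h1 h2] := smooth_curve_sm hp; apply: comp_L0 => j; split.
- exact: (sm_slice (s := s) (h1 j)).
- by move=> t; exact: (sm_per (h1 j)).
- exact: (sm_slice (s := s) (h2 j)).
- by move=> t; exact: (sm_per (h2 j)).
Qed.

Lemma sm_false (F : R -> R -> R) m : sm F -> Cn false m F.
Proof.
move=> /(_ m); elim: m F => [|m IH] F [cF pF hF]; first by split.
split => //; case: hF => -[Fs gFs dFs] _; split => //.
by exists Fs => //; exact: IH.
Qed.

End Curves.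

Section MetricProperties.
Context {R : realType} {n k : nat} (A : 'M[int]_(n, k)) (tau : 'rV[R]_k).
Implicit Types (p v w : config R n k) (r : R).
Let B : 'I_n -> 'I_k -> R := Bc A.
Local Notation adjv := (adjv A).
Local Notation zeta := (zeta A).
Local Notation gm := (gm A).

(** Along smooth curves the sources and coefficients of the potential equation are smooth in [s],
    hence so is the solution. *)
Lemma gm_smooth r (p v w : R -> config R n k) : 0 <= r ->
  smooth_curve p -> smooth_curve v -> smooth_curve w ->
  smooth (fun s => gm r (p s) (v s) (w s) : R).
Proof.
move=> r0 hp hv hw.
have [px py] := smooth_curve_sm hp; have [vx vy] := smooth_curve_sm hv.
have [wx wy] := smooth_curve_sm hw.
have Lp s := smooth_curve_L0 s hp; have Lv s := smooth_curve_L0 s hv.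
have Lw s := smooth_curve_L0 s hw.
have haa m j : Cn false m (fun s t => rsqmod r (p s) j t).
  by apply: CnZ; apply: CnD; apply: CnX; apply: sm_false; [exact: px|exact: py].
have hff m (u : R -> config R n k) l : smooth_curve u -> Cn false m (fun s t => adjv (p s) (u s) l t).
  move=> hu; have [ux uy] := smooth_curve_sm hu.
  apply: (@Cn_ext _ _ _ (fun s t => \sum_j B j l * (reY p j s t * imY u j s t - imY p j s t * reY u j s t))).
    by move=> s t; rewrite adjvE.
  apply: Cn_sum => j; apply: CnZ; apply: CnB; apply: CnM; apply: sm_false.
  - exact: px.
  - exact: uy.
  - exact: py.
  - exact: ux.
have hz m l : Cn false m (fun s t => zeta r (p s) (v s) l t).
  apply: (@sol_Cn _ _ _ B (fun j s t => rsqmod r (p s) j t) _ m _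
    (fun l s t => adjv (p s) (v s) l t) (fun l s t => zeta r (p s) (v s) l t)).
  - by move=> j s t; exact: rsqmod_ge0.
  - by move=> j; exact: haa.
  - by move=> i; exact: hff.
  - by move=> s; exact: zetaP.
apply: smooth_Cn => m; apply: CnB; first apply: CnD.
- apply: (@Cn_ext _ _ _ (fun s _ => circ_int (fun t => \sum_j reY v j s t * reY w j s t + \sum_j imY v j s t * imY w j s t))).
    by move=> s t; apply: circ_int_ext.
  apply: (@Cn_mean _ _ _ (fun s t => \sum_j reY v j s t * reY w j s t + \sum_j imY v j s t * imY w j s t)).
  apply: CnD; apply: Cn_sum => j; apply: CnM; apply: sm_false.
  + exact: vx.
  + exact: wx.
  + exact: vy.
  + exact: wy.
- have [_ _ /r_smooth v2] := hv; have [_ _ /r_smooth w2] := hw.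
  apply: (@Cn_sum _ _ _ _ _ (fun l s _ => rc l (v s).2 * rc l (w s).2)) => l.
  by apply: CnM; apply: Cn_fst; [exact: v2|exact: w2].
- apply: CnZ; apply: (@Cn_sum _ _ _ _ _ (fun l s _ => circ_int (fun t => adjv (p s) (w s) l t * zeta r (p s) (v s) l t))) => l.
  apply: (@Cn_mean _ _ _ (fun s t => adjv (p s) (w s) l t * zeta r (p s) (v s) l t)).
  by apply: CnM; [exact: hff|exact: hz].
Qed.

Lemma gm_metric r : 0 <= r -> is_metric (gm r).
Proof.
move=> r0; split.
- by move=> p v w; exact: gm_sym.
- by move=> p a u v w; exact: gm_lin.
- by move=> p v; exact: gm_pos.
- by move=> p v w; exact: gm_smooth.
Qed.

Lemma lip_within (f : R -> R) (C : R) :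
  (forall r r', 0 <= r <= 1 -> 0 <= r' <= 1 -> `|f r' - f r| <= C * `|r' - r|) ->
  {within `[0, 1], continuous f}.
Proof.
move=> h; apply/subspace_continuousP => x; rewrite /= in_itv /= => x01.
have C0 : 0 <= C.
  by have := h 0 1; rewrite subr0 normr1 mulr1 !lexx ler01 => /(_ isT isT); exact: le_trans.
apply/cvgrPdist_lt => e e0.
have C1 : 0 < C + 1 by rewrite ltr_wpDl.
near=> y.
have y01 : 0 <= y <= 1.
  have : `[0 : R, 1]%classic y by near: y; exact: withinT.
  by rewrite /= in_itv.
have hy : `|x - y| < e / (C + 1).
  near: y; rewrite near_withinE.
  have hnb : nbhs (x : R) [set y : R | `|x - y| < e / (C + 1)].
    by apply/nbhs_ballP; exists (e / (C + 1)) => //=; rewrite divr_gt0.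
  by apply: filterS hnb => z hz _.
apply: le_lt_trans (h y x y01 x01) _.
apply: (@le_lt_trans _ _ ((C + 1) * `|x - y|)).
  by rewrite mulrDl mul1r lerDl.
by rewrite mulrC -ltr_pdivlMr.
Unshelve. all: by end_near. Qed.

(** Only the coefficient of the potential equation depends on [r], so the potential is Lipschitz in
    [r] by [sol_perturb]. *)
Lemma gm_cont p v w : L0 p -> L0 v -> L0 w ->
  {within `[0, 1], continuous (fun r => gm r p v w : R)}.
Proof.
move=> hp hv hw.
have [Ma Ma0 hMa] : exists2 c : R, 0 <= c & forall i t, `|sqmod p i t| <= c.
  by apply: contf_bounded; [apply: smooth_contf => j; exact: sqmod_smooth|exact: sqmod_per].
have [Mv Mv0 hMv] : exists2 c : R, 0 <= c & forall i t, `|adjv p v i t| <= c.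
  by apply: contf_bounded; [exact: adjv_cont|exact: adjv_per].
have [Mw Mw0 hMw] : exists2 c : R, 0 <= c & forall i t, `|adjv p w i t| <= c.
  by apply: contf_bounded; [exact: adjv_cont|exact: adjv_per].
pose Z := k%:R * Mv; have Z0 : 0 <= Z by rewrite mulr_ge0.
have hZ r l t : 0 <= r -> `|zeta r p v l t| <= Z.
  move=> r0; apply: (sol_bound _ _ _ _ _ (zetaP A r0 hp hv)) => //.
  - exact: rsqmod_cont.
  - by move=> j x; exact: rsqmod_ge0.
  - exact: rsqmod_per.
  - exact: adjv_cont.
  - exact: adjv_per.
pose D := k%:R * ((1 + cB B * Z) * Ma); have D0 : 0 <= D.
  by rewrite mulr_ge0 // mulr_ge0 // addr_ge0 // mulr_ge0 // cB_ge0.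
have hD r r' l t : 0 <= r -> 0 <= r' -> `|zeta r' p v l t - zeta r p v l t| <= D * `|r' - r|.
  move=> r0 r'0; rewrite /D -2!mulrA.
  apply: (sol_perturb _ _ _ _ _ _ _ _ _ (zetaP A r0 hp hv) (zetaP A r'0 hp hv)).
  - exact: rsqmod_cont.
  - by move=> j x; exact: rsqmod_ge0.
  - exact: rsqmod_per.
  - exact: adjv_cont.
  - exact: adjv_per.
  - exact: rsqmod_cont.
  - exact: rsqmod_per.
  - exact: adjv_cont.
  - exact: adjv_per.
  - by rewrite mulr_ge0.
  - exact: Z0.
  - by move=> j x _; rewrite /rsqmod -mulrBl normrM mulrC ler_wpM2r.
  - by move=> j x _; rewrite subrr normr0 mulr_ge0.
  - by move=> j x; exact: hZ.
pose S r := \sum_l circ_int (fun t => adjv p w l t * zeta r p v l t).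
have cS r l : 0 <= r -> continuous (fun t => adjv p w l t * zeta r p v l t).
  by move=> r0; apply: contM; [exact: adjv_cont|exact: zeta_cont].
have Sb r : 0 <= r -> `|S r| <= k%:R * (Mw * Z).
  move=> r0; apply: le_trans (ler_norm_sum _ _ _) _.
  rewrite -[k in k%:R]card_ord mulr_natl -sumr_const; apply: ler_sum => l _.
  apply: circ_bnd => [|t _]; first exact: cS.
  by rewrite normrM; apply: ler_pM => //; exact: hZ.
have Sd r r' : 0 <= r -> 0 <= r' -> `|S r' - S r| <= k%:R * (Mw * D) * `|r' - r|.
  move=> r0 r'0; rewrite /S -sumrB; apply: le_trans (ler_norm_sum _ _ _) _.
  rewrite -mulrA -[k in k%:R]card_ord mulr_natl -sumr_const; apply: ler_sum => l _.
  have c1 := cS r l r0; have c2 := cS r' l r'0.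
  rewrite -circB //; apply: circ_bnd => [|t _]; first exact: contB.
  by rewrite -mulrBr normrM -mulrA; apply: ler_pM => //; exact: hD.
apply: (@lip_within _ (k%:R * (Mw * Z) + k%:R * (Mw * D))) => r r' /andP[r0 r1] /andP[r'0 r'1].
rewrite /gm -/(S r) -/(S r').
rewrite (_ : _ - _ = - ((r' - r) * S r' + r * (S r' - S r))); last by ring.
rewrite normrN; apply: le_trans (ler_normD _ _) _; rewrite [leRHS]mulrDl; apply: lerD.
  by rewrite normrM mulrC ler_wpM2r // Sb.
rewrite normrM (ger0_norm r0); apply: le_trans (Sd r r' r0 r'0).
by rewrite ler_piMl.
Qed.

Lemma gm_g0 p v w : gm 0 p v w = g0 p v w.
Proof. by rewrite /gm mul0r subr0. Qed.

Lemma der_zeta r p v l t : 0 <= r -> L0 p -> L0 v ->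
  der (zeta r p v l) t (- mzp (resw B (rsqmod r p) (adjv p v) (zeta r p v) l) t).
Proof.
move=> r0 hp hv; have [cz _ hz] := zetaP A r0 hp hv.
have cw : contf (resw B (rsqmod r p) (adjv p v) (zeta r p v)).
  by apply: cont_resw; [exact: rsqmod_cont|exact: adjv_cont|].
rewrite (_ : zeta r p v l = Kop (resw B (rsqmod r p) (adjv p v) (zeta r p v) l)); last exact/funext.
exact: der_K.
Qed.

Lemma rowBD (a b c : 'rV[R]_k) l : (a - b + c) 0 l = a 0 l - b 0 l + c 0 l.
Proof. by rewrite !mxE. Qed.

(** For [r = 1], differentiating the fixed point equation twice gives the equation of the potential
    with its mean removed. *)
Lemma zeta_potential p v : L0 p -> L0 v -> g1_potential A p v (zvec A 1 p v).
Proof.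
move=> hp hv; have hz := zetaP A ler01 hp hv; have [cz pz ez] := hz.
have sz : forall l, smooth (zeta 1 p v l).
  apply: (sol_smooth _ _ hz) => j; first exact: rsqmod_smooth.
  exact: adjv_smooth.
pose W := resw B (rsqmod 1 p) (adjv p v) (zeta 1 p v).
have cW : contf W by apply: cont_resw; [exact: rsqmod_cont|exact: adjv_cont|].
have rcE l : (fun t => rc l (zvec A 1 p v t)) = zeta 1 p v l.
  by apply/funext => t; rewrite /rc mxE.
have lp : loop (zvec A 1 p v) by apply/r_loop => l; rewrite rcE.
split => //.
- have E : g1_residual A p v (zvec A 1 p v) = fun=> \row_l circ_int (W l).
    apply/funext => t; apply/rowP => l; rewrite [RHS]mxE /g1_residual rowBD.
    have -> : inf_act_adj A (p.1 t) (v.1 t) 0 l = adjv p v l t by [].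
    have -> : inf_act_adj A (p.1 t) (inf_act A (p.1 t) (zvec A 1 p v t)) 0 l = Qop B (rsqmod 1 p) (zeta 1 p v) l t.
      rewrite adj_inf; apply: eq_bigr => j _; congr (_ * _).
      by rewrite weight_zvec /rsqmod mul1r.
    have -> : derive1n 2 (zvec A 1 p v) t 0 l = - (W l t - circ_int (W l)).
      have [sl _] := lp.
      transitivity (derive1n 2 (fun t => rc l (zvec A 1 p v t)) t).
        by rewrite (r_derive1n 2 l t sl).
      rewrite rcE derive1nS derive1n1.
      have -> : derive1 (zeta 1 p v l) = fun t => - mzp (W l) t.
        by apply/funext => x; apply: der_derive1; exact: der_zeta.
      by apply: der_derive1; apply: derN; exact: der_mzp.
    by rewrite /W /resw; ring.
  by move=> t; rewrite E derive1_cst.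
- apply/rowP => l; rewrite !mxE.
  transitivity (circ_int (zeta 1 p v l)); first by rewrite -rcE.
  rewrite (_ : zeta 1 p v l = Kop (W l)); last exact/funext.
  exact: circ_K.
Qed.

(** Expanding the square in [g1] and integrating the derivative term by parts leaves [g_0] minus the
    correction term, by the weak form. *)
Lemma gm_g1 p v w : L0 p -> L0 v -> L0 w ->
  gm 1 p v w = g1_value A p v w (zvec A 1 p v) (zvec A 1 p w).
Proof.
move=> hp hv hw.
have hzv := zetaP A ler01 hp hv; have hzw := zetaP A ler01 hp hw.
have czv : contf (zeta 1 p v) by exact: zeta_cont.
have czw : contf (zeta 1 p w) by exact: zeta_cont.
have cfv : contf (adjv p v) by exact: adjv_cont.
have cfw : contf (adjv p w) by exact: adjv_cont.
have ca := rsqmod_cont (r := 1) hp.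
have HS := sol_form ca cfw cfv hzw hzv.
have HS2 := sol_sym ca cfv cfw hzv hzw.
have cvw := cont_dotC hv hw.
pose Wv := resw B (rsqmod 1 p) (adjv p v) (zeta 1 p v).
pose Ww := resw B (rsqmod 1 p) (adjv p w) (zeta 1 p w).
have cWv : contf Wv by exact: cont_resw.
have cWw : contf Ww by exact: cont_resw.
rewrite /gm /g1_value mul1r addrAC; congr (_ + _).
have dz u t l : L0 u -> derive1 (zvec A 1 p u) t 0 l = - mzp (resw B (rsqmod 1 p) (adjv p u) (zeta 1 p u) l) t.
  move=> hu; have [[sl _] _ _] := zeta_potential hp hu.
  transitivity (derive1 (fun t => rc l (zvec A 1 p u t)) t).
    have := r_derive1 l (sl 0%N t); rewrite /rc => <- //.
  have -> : (fun t => rc l (zvec A 1 p u t)) = zeta 1 p u l.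
    by apply/funext => x; rewrite /rc mxE.
  by apply: der_derive1; exact: der_zeta.
pose F1 t := \sum_l adjv p v l t * zeta 1 p w l t.
pose F2 t := \sum_l adjv p w l t * zeta 1 p v l t.
pose F3 t := \sum_j rsqmod 1 p j t * (lin B (zeta 1 p v) j t * lin B (zeta 1 p w) j t).
pose F4 t := \sum_l mzp (Wv l) t * mzp (Ww l) t.
have c1 : continuous F1 by apply: cont_sum => l; apply: contM; [exact: cfv|exact: czw].
have c2 : continuous F2 by apply: cont_sum => l; apply: contM; [exact: cfw|exact: czv].
have c3 : continuous F3 by apply: cont_sum => l; exact: cont_qf.
have c4 : continuous F4 by apply: cont_sum => l; apply: contM; apply: cont_mzp; [exact: cWv|exact: cWw].
have E1 : \sum_l circ_int (fun t => adjv p v l t * zeta 1 p w l t) = circ_int F1.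
  by rewrite circ_sum // => l; apply: contM; [exact: cfv|exact: czw].
have E2 : \sum_l circ_int (fun t => adjv p w l t * zeta 1 p v l t) = circ_int F2.
  by rewrite circ_sum // => l; apply: contM; [exact: cfw|exact: czv].
have E3 : qf B (rsqmod 1 p) (zeta 1 p w) (zeta 1 p v) = circ_int F3.
  by rewrite qf_sym circ_sum // => l; exact: cont_qf.
have E4 : \sum_l circ_int (fun t => mzp (Ww l) t * mzp (Wv l) t) = circ_int F4.
  rewrite circ_sum; last by move=> l; apply: contM; apply: cont_mzp; [exact: cWv|exact: cWw].
  by apply: eq_bigr => l _; apply: circ_int_ext => t; rewrite mulrC.
have HF : circ_int F2 = circ_int F4 + circ_int F3 by rewrite -E2 HS E3 E4.
have HF2 : circ_int F1 = circ_int F2 by rewrite -E1 -E2 HS2.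
transitivity (circ_int (fun t => dotC (v.1 t) (w.1 t)) - circ_int F1 - circ_int F2 + circ_int F3 + circ_int F4).
  by rewrite E2 HF2 HF; ring.
rewrite -circB // -circB //; last exact: contB.
rewrite -circD //; last by apply: contB => //; exact: contB.
rewrite -circD //; last by apply: contD => //; apply: contB => //; exact: contB.
apply: circ_int_ext => t.
have -> : dot (derive1 (zvec A 1 p v) t) (derive1 (zvec A 1 p w) t) = F4 t.
  by apply: eq_bigr => l _; rewrite !dz // mulrNN.
congr (_ + _).
set y1 := inf_act A (p.1 t) (zvec A 1 p v t); set y2 := inf_act A (p.1 t) (zvec A 1 p w t).
have -> : dotC (v.1 t - y1) (w.1 t - y2) = dotC (v.1 t) (w.1 t) - dotC (v.1 t) y2 - dotC (w.1 t) y1 + dotC y1 y2.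
  rewrite /dotC /dot; set V := v.1 t; set U := w.1 t.
  rewrite -!big_split /= -!sumrB -big_split /=.
  by apply: eq_bigr => j _; rewrite !mxE; ring.
have -> : dotC y1 y2 = F3 t.
  rewrite /y1 /y2 dotC_inf_inf; apply: eq_bigr => j _; by rewrite !weight_zvec /rsqmod mul1r.
have -> : dotC (v.1 t) y2 = F1 t.
  by rewrite /y2 dotC_inf; apply: eq_bigr => l _; rewrite mxE mulrC.
have -> // : dotC (w.1 t) y1 = F2 t.
by rewrite /y1 dotC_inf; apply: eq_bigr => l _; rewrite mxE mulrC.
Qed.

(** The coefficients [|z_j|^2] and the source [L_p^* v] of the potential equation are pointwise
    invariant under the torus. *)
Lemma gm_gauge r : gauge_invariant A (gm r).
Proof.
move=> h p v w [_ hT _] hp hv hw; rewrite /gm.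
have eff (u : config R n k) : adjv (gauge_act A h p) (gauge_dact A h u) = adjv p u.
  by apply/funext => l; apply/funext => t; rewrite /adjv /= rho_adj.
have era : rsqmod r (gauge_act A h p) = rsqmod r p.
  by apply/funext => j; apply/funext => t; rewrite /rsqmod /sqmod /reC /imC /= rho_sqr.
have ez u : zeta r (gauge_act A h p) (gauge_dact A h u) = zeta r p u.
  by rewrite unlock eff era.
rewrite ez eff; congr (_ + _ - _).
by apply: circ_int_ext => t; rewrite /= rho_dotC.
Qed.

Definition mom p l t : R := moment A (p.1 t) 0 l.

Lemma mom_smooth p l : L0 p -> smooth (mom p l).
Proof.
move=> hp; apply: smooth_Cn => m.
apply: (@Cn_ext _ _ _ (fun t _ => - (2^-1 * \sum_j B j l * (reC p j t ^+ 2 + imC p j t ^+ 2)))).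
  by move=> s t; rewrite /mom momentE.
apply: CnN; apply: CnZ; apply: Cn_sum => j; apply: CnZ.
by apply: CnD; apply: CnX; apply: Cn_fst; [exact: reC_smooth|exact: imC_smooth].
Qed.

Lemma mom_per p : L0 p -> perf (mom p).
Proof. by move=> [_ pp] l t; rewrite /mom pp. Qed.

Lemma mom_cont p : L0 p -> contf (mom p).
Proof. by move=> hp; apply: smooth_contf => l; exact: mom_smooth. Qed.

Lemma smooth_der (f : R -> R) t : smooth f -> der f t (derive1 f t).
Proof. by move=> sf; apply: derivable_der; exact: (sf 0%N). Qed.
Lemma der_reC p j t : L0 p -> der (reC p j) t (derive1 (reC p j) t).
Proof. by move=> hp; apply: smooth_der; exact: reC_smooth. Qed.
Lemma der_imC p j t : L0 p -> der (imC p j) t (derive1 (imC p j) t).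
Proof. by move=> hp; apply: smooth_der; exact: imC_smooth. Qed.

Lemma smooth_derive1 (f : R -> R) : smooth f -> smooth (derive1 f).
Proof. by move=> sf m t; rewrite -derive1Sn; exact: sf. Qed.
Lemma cont_dreC p j : L0 p -> continuous (derive1 (reC p j)).
Proof.
move=> hp; apply: der_cont => t; apply: smooth_der; apply: smooth_derive1.
exact: reC_smooth.
Qed.
Lemma cont_dimC p j : L0 p -> continuous (derive1 (imC p j)).
Proof.
move=> hp; apply: der_cont => t; apply: smooth_der; apply: smooth_derive1.
exact: imC_smooth.
Qed.
Lemma cont_reC p j : L0 p -> continuous (reC p j).
Proof. by move=> hp; apply: der_cont => t; exact: der_reC. Qed.
Lemma cont_imC p j : L0 p -> continuous (imC p j).
Proof. by move=> hp; apply: der_cont => t; exact: der_imC. Qed.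

(** [(A P mu)_j], with [P] the mean-zero primitive in [t]. *)
Definition gam p j t : R := \sum_l B j l * mzp (mom p l) t.

(** The first component is [i (z' + L_z eta) + r L_z P mu], in real and imaginary parts. *)
Definition gradA r p : config R n k :=
  (fun t => (\row_j (- (derive1 (imC p j) t + weight A p.2 0 j * reC p j t) - r * gam p j t * imC p j t),
             \row_j (derive1 (reC p j) t - weight A p.2 0 j * imC p j t + r * gam p j t * reC p j t)),
   moment_mean A p.1 - tau).

Lemma smooth_mzp (f : R -> R) : smooth f -> smooth (mzp f).
Proof.
move=> sf; apply: smooth_Cn => m.
have cf : continuous f by apply: der_cont => t; apply: derivable_der; exact: (sf 0%N).
apply: CnW; split => //; first by apply: cont2_fst; exact: cont_mzp.
split => //; exists (fun s _ => f s - circ_int f) => [|s _]; last exact: der_mzp.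
by apply: CnB; [exact: Cn_fst|exact: Cn_cst].
Qed.

Lemma gam_smooth p j : L0 p -> smooth (gam p j).
Proof.
move=> hp; apply: smooth_Cn => m; apply: (@Cn_sum _ _ _ _ _ (fun l s _ => B j l * mzp (mom p l) s)) => l.
by apply: CnZ; apply: Cn_fst; apply: smooth_mzp; exact: mom_smooth.
Qed.
Lemma gam_per p j : L0 p -> periodic (gam p j) 1.
Proof.
move=> hp t; apply: eq_bigr => l _; rewrite periodic_mzp //; first exact: mom_cont.
exact: mom_per.
Qed.

Lemma gradA_re r p j t : reC (gradA r p) j t =
  - (derive1 (imC p j) t + weight A p.2 0 j * reC p j t) - r * gam p j t * imC p j t.
Proof. by rewrite /reC mxE. Qed.
Lemma gradA_im r p j t : imC (gradA r p) j t =
  derive1 (reC p j) t - weight A p.2 0 j * imC p j t + r * gam p j t * reC p j t.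
Proof. by rewrite /imC mxE. Qed.

Lemma gradA_L0 r p : L0 p -> L0 (gradA r p).
Proof.
move=> hp; apply: comp_L0 => j.
- have E : reC (gradA r p) j = fun t => - (derive1 (imC p j) t + weight A p.2 0 j * reC p j t) - r * gam p j t * imC p j t.
    by apply/funext => t; rewrite gradA_re.
  rewrite E; split.
    apply: smooth_Cn => m; apply: CnB; last apply: CnM.
    + apply: CnN; apply: CnD; first by apply: Cn_fst; apply: smooth_derive1; exact: imC_smooth.
      by apply: CnZ; apply: Cn_fst; exact: reC_smooth.
    + by apply: CnZ; apply: Cn_fst; exact: gam_smooth.
    + by apply: Cn_fst; exact: imC_smooth.
  move=> t; rewrite gam_per // imC_per // reC_per //.
  have pd : periodic (derive1 (imC p j)) 1.
    by apply: (periodic_der (f := imC p j)) => [|x]; [exact: imC_per|exact: der_imC].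
  by rewrite pd.
- have E : imC (gradA r p) j = fun t => derive1 (reC p j) t - weight A p.2 0 j * imC p j t + r * gam p j t * reC p j t.
    by apply/funext => t; rewrite gradA_im.
  rewrite E; split.
    apply: smooth_Cn => m; apply: CnD; last apply: CnM.
    + apply: CnB; first by apply: Cn_fst; apply: smooth_derive1; exact: reC_smooth.
      by apply: CnZ; apply: Cn_fst; exact: imC_smooth.
    + by apply: CnZ; apply: Cn_fst; exact: gam_smooth.
    + by apply: Cn_fst; exact: reC_smooth.
  move=> t; rewrite gam_per // imC_per // reC_per //.
  have pd : periodic (derive1 (reC p j)) 1.
    by apply: (periodic_der (f := reC p j)) => [|x]; [exact: reC_per|exact: der_reC].
  by rewrite pd.
Qed.

Lemma der_mom p l t : L0 p -> der (mom p l) t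
  (- (\sum_j B j l * (reC p j t * derive1 (reC p j) t + imC p j t * derive1 (imC p j) t))).
Proof.
move=> hp.
apply: (der_ext (f := fun t => - (2^-1 * \sum_j B j l * (reC p j t * reC p j t + imC p j t * imC p j t)))).
  move=> x; rewrite /mom momentE; congr (- (_ * _)); apply: eq_bigr => j _.
apply: derN; apply: der_eq (derZ _ (der_sum _ (l := fun j => B j l * (2 * (reC p j t * derive1 (reC p j) t + imC p j t * derive1 (imC p j) t))) _)) _.
  move=> j; apply: derZ; apply: der_eq (derD (derM (der_reC j t hp) (der_reC j t hp)) (derM (der_imC j t hp) (der_imC j t hp))) _.
  ring.
rewrite mulr_sumr; apply: eq_bigr => j _; by field.
Qed.

(** For the gradient, [L_z^* V] is minus the derivative of the moment map plus [r L_z^* L_z P mu],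
    so [P mu] solves the equation.  This makes the gradient explicit. *)
Lemma zeta_grad r p : 0 <= r -> L0 p -> forall l t, zeta r p (gradA r p) l t = mzp (mom p l) t.
Proof.
move=> r0 hp; have hV := gradA_L0 r hp; have cm := mom_cont hp.
apply: zeta_uniq => //; split.
- by move=> l; exact: cont_mzp.
- by move=> l; apply: periodic_mzp => //; exact: mom_per.
move=> l t.
pose dm x := \sum_j B j l * (reC p j x * derive1 (reC p j) x + imC p j x * derive1 (imC p j) x).
have cdm : continuous dm.
  apply: cont_sum => j; apply: contM; first exact: cont_cst.
  apply: contD; apply: contM; [exact: cont_reC|exact: cont_dreC|exact: cont_imC|exact: cont_dimC].
have -> : (fun x => adjv p (gradA r p) l x - Qop B (rsqmod r p) (fun l => mzp (mom p l)) l x) = dm.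
  apply/funext => x; rewrite adjvE -sumrB; apply: eq_bigr => j _.
  rewrite gradA_re gradA_im /rsqmod /sqmod; have -> : lin B (fun l => mzp (mom p l)) j x = gam p j x by [].
  ring.
have e : (fun x => - mzp dm x) = (fun x => mom p l x - circ_int (mom p l)).
  apply/funext => x.
  have h : - (mom p l x - circ_int (mom p l)) = mzp dm x.
    apply: (mzp_uniq (h := fun x => - (mom p l x - circ_int (mom p l)))) => //.
      move=> y; apply: der_eq (derN (derB (der_mom l y hp) (der_cst _ y))) _.
      rewrite subr0 opprK -/(dm y).
      suff -> : circ_int dm = 0 by rewrite subr0.
      have := circ_der (F := fun x => - mom p l x) (f := dm); rewrite -[X in mom p l X]add0r mom_per // subrr; apply => //.
      by move=> z; apply: der_eq (derN (der_mom l z hp)) _; rewrite opprK.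
    by rewrite circN ?circ_centre ?oppr0 //; exact: cont_centre.
  by rewrite -h opprK.
rewrite /Kop e.
have c1 := cm l.
rewrite mzpB //; last exact: cont_cst.
rewrite -[LHS]subr0; congr (_ - _); apply/esym.
rewrite -(@mzp_uniq _ (fun=> circ_int (mom p l)) (fun=> 0)) //.
- exact: cont_cst.
- by move=> x; rewrite circ_cst subrr; exact: der_cst.
- exact: circ_cst.
Qed.

End MetricProperties.

(** * The gradient flow *)

Section Gradient.
Context {R : realType} {n k : nat} (A : 'M[int]_(n, k)) (tau : 'rV[R]_k).
Implicit Types (p v w : config R n k) (r : R).
Let B : 'I_n -> 'I_k -> R := Bc A.
Local Notation adjv := (adjv A).
Local Notation zeta := (zeta A).
Local Notation gm := (gm A).
Local Notation gradA := (gradA A tau).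

Lemma cont2_sum (I : Type) (s : seq I) (F : I -> R -> R -> R) :
  (forall i, cont2 (F i)) -> cont2 (fun x y => \sum_(i <- s) F i x y).
Proof.
move=> H; elim: s => [|i s IH].
  have -> : (fun x y => \sum_(i <- [::]) F i x y) = fun _ _ => 0.
    by apply/funext => x; apply/funext => y; rewrite big_nil.
  by apply: cont2_fst; exact: cont_cst.
have -> : (fun x y => \sum_(j <- i :: s) F j x y) = fun x y => F i x y + \sum_(j <- s) F j x y.
  by apply/funext => x; apply/funext => y; rewrite big_cons.
exact: cont2D.
Qed.

Definition gradL p v (t : R) : R := \sum_j
  ((derive1 (reC p j) t - weight A p.2 0 j * imC p j t) * imC v j t
   - (derive1 (imC p j) t + weight A p.2 0 j * reC p j t) * reC v j t).

(** By [zeta_grad] the correction term of the metric cancels the terms of the gradient that involve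
    [P mu]: the pairing does not depend on [r]. *)
Lemma gm_gradA r p v : 0 <= r -> L0 p -> L0 v -> gm r p (gradA r p) v =
  circ_int (gradL p v) + dot (moment_mean A p.1 - tau) v.2.
Proof.
move=> r0 hp hv; have hV := gradA_L0 A tau r hp.
have cm : contf (mom A p) by exact: mom_cont.
have cff : contf (adjv p v) by exact: adjv_cont.
have E1 : \sum_l circ_int (fun t => adjv p v l t * zeta r p (gradA r p) l t) =
    circ_int (fun t => \sum_l adjv p v l t * mzp (mom A p l) t).
  rewrite circ_sum; last by move=> l; apply: contM; [exact: cff|exact: cont_mzp].
  by apply: eq_bigr => l _; apply: circ_int_ext => t; rewrite zeta_grad.
rewrite /gm E1 addrAC; congr (_ + _).
have cs : continuous (fun t => \sum_l adjv p v l t * mzp (mom A p l) t).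
  by apply: cont_sum => l; apply: contM; [exact: cff|exact: cont_mzp].
rewrite -circZ // -circB; [|exact: cont_dotC|by apply: contM => //; exact: cont_cst].
apply: circ_int_ext => t.
have -> : \sum_l adjv p v l t * mzp (mom A p l) t =
    \sum_j gam A p j t * (reC p j t * imC v j t - imC p j t * reC v j t).
  under eq_bigr do rewrite adjvE mulr_suml.
  rewrite exchange_big; apply: eq_bigr => j _; rewrite mulr_suml.
  by apply: eq_bigr => l _; ring.
have -> : dotC ((gradA r p).1 t) (v.1 t) = \sum_j
    (reC (gradA r p) j t * reC v j t + imC (gradA r p) j t * imC v j t).
  by rewrite big_split.
rewrite mulr_sumr -sumrB; apply: eq_bigr => j _.
by rewrite gradA_re gradA_im; ring.
Qed.

Lemma L0_add p v (e : R) : L0 p -> L0 v -> L0 (p + e *: v).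
Proof. by move=> hp hv; rewrite addrC; exact: L0_lin. Qed.

Lemma reC_add p v (e : R) j t : reC (p + e *: v) j t = reC p j t + e * reC v j t.
Proof. by rewrite /reC /= !mxE. Qed.
Lemma imC_add p v (e : R) j t : imC (p + e *: v) j t = imC p j t + e * imC v j t.
Proof. by rewrite /imC /= !mxE. Qed.

Lemma action_comp p v (e : R) : L0 p -> L0 v -> action A tau (p + e *: v) =
  circ_int (fun t => \sum_j (imC p j t + e * imC v j t) *
     (derive1 (reC p j) t + e * derive1 (reC v j) t))
  + \sum_l (p.2 0 l + e * v.2 0 l) * (circ_int (fun t =>
      - (2^-1 * \sum_j B j l * ((reC p j t + e * reC v j t) ^+ 2 + (imC p j t + e * imC v j t) ^+ 2))) - tau 0 l).
Proof.
move=> hp hv; have hq := L0_add e hp hv; rewrite /action; congr (_ + _).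
  apply: circ_int_ext => t; apply: eq_bigr => j _; congr (_ * _).
    exact: imC_add.
  have [sq _] := hq.
  transitivity (derive1 (reC (p + e *: v) j) t).
    exact: (C_derive1 (inl j) (sq 0%N t)).
  apply: der_derive1; apply: der_ext (derD (der_reC j t hp) (derZ e (der_reC j t hv))) => x.
  by rewrite reC_add.
apply: eq_bigr => l _; rewrite !mxE; congr (_ * (_ - _)).
apply: circ_int_ext => t.
transitivity (moment A ((p + e *: v).1 t) 0 l) => //.
rewrite momentE; congr (- (_ * _)); apply: eq_bigr => j _.
by rewrite -/(reC (p + e *: v) j t) -/(imC (p + e *: v) j t) reC_add imC_add.
Qed.

(** The action is polynomial in the real parameter [e]; the boundary terms of the integration by
    parts cancel by periodicity. *)
Lemma gradA_grad r p : 0 <= r -> L0 p -> is_gradient A tau (gm r) p (gradA r p).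
Proof.
move=> r0 hp; split; first exact: gradA_L0.
move=> v hv; rewrite gm_gradA //.
pose F e t := \sum_j (imC p j t + e * imC v j t) * (derive1 (reC p j) t + e * derive1 (reC v j) t).
pose G e t := \sum_j (imC v j t * (derive1 (reC p j) t + e * derive1 (reC v j) t)
    + (imC p j t + e * imC v j t) * derive1 (reC v j) t).
pose M l e t := - (2^-1 * \sum_j B j l * ((reC p j t + e * reC v j t) ^+ 2 + (imC p j t + e * imC v j t) ^+ 2)).
pose N l e t := - (\sum_j B j l * ((reC p j t + e * reC v j t) * reC v j t + (imC p j t + e * imC v j t) * imC v j t)).
have cid : cont2 (fun e _ : R => e) by apply: cont2_fst; exact: cont_id.
have cc1 j : cont2 (fun e t => imC p j t + e * imC v j t).
  by apply: cont2D; [|apply: cont2M => //]; apply: cont2_snd; exact: cont_imC.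
have cc2 j : cont2 (fun e t => reC p j t + e * reC v j t).
  by apply: cont2D; [|apply: cont2M => //]; apply: cont2_snd; exact: cont_reC.
have cc3 j : cont2 (fun e t => derive1 (reC p j) t + e * derive1 (reC v j) t).
  by apply: cont2D; [|apply: cont2M => //]; apply: cont2_snd; exact: cont_dreC.
have csnd (f : R -> R) : continuous f -> cont2 (fun _ t => f t) by exact: cont2_snd.
have cF : cont2 F by apply: cont2_sum => j; exact: cont2M.
have cG : cont2 G.
  apply: cont2_sum => j; apply: cont2D; apply: cont2M => //; apply: csnd.
    exact: cont_imC.
  exact: cont_dreC.
have ccst (c : R) : cont2 (fun _ _ => c) by apply: cont2_fst; exact: cont_cst.
have cM l : cont2 (M l).
  have -> : M l = fun e t => (- 2^-1) * \sum_j B j l * ((reC p j t + e * reC v j t) * (reC p j t + e * reC v j t) + (imC p j t + e * imC v j t) * (imC p j t + e * imC v j t)).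
    by apply/funext => e; apply/funext => t; rewrite mulNr.
  apply: cont2M => //; apply: cont2_sum => j; apply: cont2M => //.
  by apply: cont2D; exact: cont2M.
have cN l : cont2 (N l).
  have -> : N l = fun e t => (- 1) * \sum_j B j l * ((reC p j t + e * reC v j t) * reC v j t + (imC p j t + e * imC v j t) * imC v j t).
    by apply/funext => e; apply/funext => t; rewrite mulN1r.
  apply: cont2M => //; apply: cont2_sum => j; apply: cont2M => //.
  apply: cont2D; apply: cont2M => //; apply: csnd; first exact: cont_reC.
  exact: cont_imC.
have dlin (a b e : R) : der (fun e => a + e * b) e b.
  by apply: der_eq (derD (der_cst a e) (derM (der_id e) (der_cst b e))) _; ring.
have dF e t : der (F ^~ t) e (G e t).
  by apply: der_sum => j; apply: derM; exact: dlin.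
have dM l e t : der (M l ^~ t) e (N l e t).
  apply: der_eq (derN (derZ _ (der_sum _ (l := fun j => B j l * (2 * ((reC p j t + e * reC v j t) * reC v j t + (imC p j t + e * imC v j t) * imC v j t))) _))) _.
    move=> j; apply: derZ.
    apply: der_eq (derD (derM (dlin _ _ e) (dlin _ _ e)) (derM (dlin _ _ e) (dlin _ _ e))) _.
    ring.
  by rewrite /N mulr_sumr; congr (- _); apply: eq_bigr => j _; field.
have D1 := @circ_der_under R _ _ 0 cF cG dF.
have D2 l := @circ_der_under R _ _ 0 (cM l) (cN l) (dM l).
have D : der (fun e => circ_int (F e) + \sum_l (p.2 0 l + e * v.2 0 l) * (circ_int (M l e) - tau 0 l)) 0
   (circ_int (G 0) + \sum_l (v.2 0 l * (circ_int (M l 0) - tau 0 l) + (p.2 0 l + 0 * v.2 0 l) * (circ_int (N l 0) - 0))).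
  apply: derD; first exact: D1.
  apply: der_sum => l; apply: derM; first exact: dlin.
  by apply: derB; [exact: D2|exact: der_cst].
have -> : (fun e => action A tau (p + e *: v)) =
    (fun e => circ_int (F e) + \sum_l (p.2 0 l + e * v.2 0 l) * (circ_int (M l e) - tau 0 l)).
  by apply/funext => e; exact: action_comp.
apply: der_eq D _.
have H1 : circ_int (G 0) + \sum_l p.2 0 l * circ_int (N l 0) = circ_int (gradL p v).
  have cpx j : continuous (derive1 (reC p j)) by exact: cont_dreC.
  have cpy j : continuous (derive1 (imC p j)) by exact: cont_dimC.
  have cdv j : continuous (derive1 (reC v j)) by exact: cont_dreC.
  have cvx j : continuous (reC v j) by exact: cont_reC.
  have cvy j : continuous (imC v j) by exact: cont_imC.
  have cx j : continuous (reC p j) by exact: cont_reC.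
  have cy j : continuous (imC p j) by exact: cont_imC.
  have cG0 : continuous (G 0) by exact: cont2_l.
  have cN0 l : continuous (N l 0) by exact: (@cont2_l _ (N l)).
  have cgl : continuous (gradL p v).
    apply: cont_sum => j; apply: contB; apply: contM => //.
      by apply: contB => //; apply: contM => //; exact: cont_cst.
    by apply: contD => //; apply: contM => //; exact: cont_cst.
  have -> : \sum_l p.2 0 l * circ_int (N l 0) = circ_int (fun t => \sum_l p.2 0 l * N l 0 t).
    rewrite circ_sum; last by move=> l; apply: contM => //; exact: cont_cst.
    by apply: eq_bigr => l _; rewrite circZ.
  have cS : continuous (fun t => \sum_l p.2 0 l * N l 0 t).
    by apply: cont_sum => l; apply: contM => //; exact: cont_cst.
  apply/eqP; rewrite -subr_eq0 -circD // -circB //; last exact: contD.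
  rewrite (_ : (fun t => _) = fun t => \sum_j (derive1 (imC p j) t * reC v j t + imC p j t * derive1 (reC v j) t)).
    rewrite (circ_der (F := fun t => \sum_j imC p j t * reC v j t)).
    - rewrite -sumrB big1 // => j _; rewrite -[X in imC p j X * reC v j X - _]add0r.
      by rewrite imC_per // reC_per // subrr.
    - by move=> t; apply: der_sum => j; apply: derM; [exact: der_imC|exact: der_reC].
    - by apply: cont_sum => j; apply: contD; exact: contM.
  apply/funext => t.
  have -> : \sum_l p.2 0 l * N l 0 t = - \sum_j weight A p.2 0 j * (reC p j t * reC v j t + imC p j t * imC v j t).
    under eq_bigr do rewrite /N mulrN mulr_sumr.
    rewrite sumrN exchange_big; congr (- _); apply: eq_bigr => j _.
    rewrite weightE mulr_suml; apply: eq_bigr => l _; rewrite /B; ring.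
  rewrite /G /gradL -sumrN -big_split /= -sumrB; apply: eq_bigr => j _; ring.
rewrite -H1 -!addrA; congr (_ + _); rewrite big_split /= addrC; congr (_ + _).
  by apply: eq_bigr => l _; rewrite mul0r addr0 subr0.
apply: eq_bigr => l _; rewrite mulrC !mxE; congr ((_ - _) * _).
apply: circ_int_ext => t; rewrite /M -[RHS]/(moment A (p.1 t) 0 l) momentE.
congr (- (_ * _)); apply: eq_bigr => j _.
by rewrite !mul0r !addr0.
Qed.

Lemma grad_unique r p V V' : 0 <= r -> L0 p -> is_gradient A tau (gm r) p V ->
  is_gradient A tau (gm r) p V' -> V = V'.
Proof.
move=> r0 hp [hV gV] [hV' gV'].
have hD : L0 ((-1) *: V' + V) by exact: L0_lin.
have e : gm r p ((-1) *: V' + V) ((-1) *: V' + V) = 0.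
  rewrite gm_lin // mulN1r; apply/eqP; rewrite addrC subr_eq0; apply/eqP.
  exact: der_unique (gV _ hD) (gV' _ hD).
apply/eqP; rewrite -subr_eq0; apply/eqP.
have [//|/eqP n0] := pselect (V - V' = 0).
have : 0 < gm r p ((-1) *: V' + V) ((-1) *: V' + V).
  by apply: gm_pos => //; rewrite scaleN1r addrC; exact/eqP.
by rewrite e ltxx.
Qed.

Lemma gm_path : metric_path A tau gm.
Proof.
split.
- by move=> r /andP[r0 _]; exact: gm_metric.
- by move=> p v w; exact: gm_cont.
- by move=> p v w _ _ _; exact: gm_g0.
- move=> p v w hp hv hw; exists (zvec A 1 p v), (zvec A 1 p w); split.
  + exact: zeta_potential.
  + exact: zeta_potential.
  + exact: gm_g1.
- by move=> r p /andP[r0 _] hp; exists (gradA r p); exact: gradA_grad.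
Qed.

(** The gradient is unique because the metric is positive definite. *)
Lemma flow_lineP r (y : R -> config R n k) : 0 <= r ->
  flow_line A tau (gm r) y <->
  smooth_curve y /\ forall s, curve_ds y s + gradA r (y s) = 0.
Proof.
move=> r0; split => -[sy h]; split => // s; have hs := smooth_curve_L0 s sy.
  by have [V gV <-] := h s; rewrite (grad_unique r0 hs (gradA_grad r0 hs) gV).
by exists (gradA r (y s)) => //; exact: gradA_grad.
Qed.

End Gradient.

(** * Uniform bounds and the elliptic estimate *)

HB.lock Definition msq {R : realType} (F : R -> R -> R) (s : R) : R :=
  circ_int (fun t => F s t ^+ 2).

Lemma msqE (R : realType) (F : R -> R -> R) s : msq F s = circ_int (fun t => F s t ^+ 2).
Proof. by rewrite unlock. Qed.

Section Families.
Context {R : realType}.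
Notation fam := (nat -> R -> R -> R).
Implicit Types (F G H : fam) (f g : nat -> R -> R) (S C : R).

Definition smf F := forall nu, sm (F nu).
(** The bounds below are uniform in the index [nu] and local in [s]: [LB] is a bound in the sup
    norm, [SL] in [L^2] of the circle for each [s], [L1] and [L2] for integrals over bounded
    intervals of [s]. *)
Definition LB F := forall S, exists C, forall nu s t, `|s| <= S -> `|F nu s t| <= C.
Definition SL F := forall S, exists C, forall nu s, `|s| <= S -> msq (F nu) s <= C.
Definition L1 f := forall S, 0 <= S -> exists C, forall nu, seg (f nu) (- S) S <= C.
Definition L2 F := L1 (fun nu => msq (F nu)).

Lemma cont_msq (F : R -> R -> R) : sm F -> continuous (msq F).
Proof.
rewrite unlock => sF; apply: (circ_cont (F := fun s t => F s t ^+ 2)).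
by apply: sm_cont; exact: (smX 2).
Qed.

Lemma msq_ge0 (F : R -> R -> R) s : sm F -> 0 <= msq F s.
Proof.
move=> sF; rewrite msqE; apply: circ_ge0 => [|t _]; last exact: sqr_ge0.
by apply: contX; exact: sm_contl.
Qed.

Lemma abs_itv (s S : R) : - S <= s <= S -> `|s| <= S.
Proof. by rewrite ler_norml. Qed.

Lemma L1_dom f g : (forall nu, continuous (f nu)) -> (forall nu, continuous (g nu)) ->
  (forall S, 0 <= S -> exists C1 C2, 0 <= C1 /\ forall nu s, `|s| <= S -> f nu s <= C1 * g nu s + C2) ->
  L1 g -> L1 f.
Proof.
move=> cf cg h Lg S S0; have [C1 [C2 [C10 hC]]] := h S S0; have [C hg] := Lg S S0.
exists (C1 * C + C2 * (S - - S)) => nu.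
have c1 : continuous (fun s => C1 * g nu s) by apply: contM => //; exact: cont_cst.
apply: (@le_trans _ _ (seg (fun s => C1 * g nu s + C2) (- S) S)).
  apply: seg_le => //; first by apply: contD => //; exact: cont_cst.
    by lra.
  by move=> s /abs_itv; exact: hC.
rewrite segD //; last exact: cont_cst.
by rewrite seg_cst segZ // lerD2r ler_wpM2l.
Qed.

Lemma L1_le f g : (forall nu, continuous (f nu)) -> (forall nu, continuous (g nu)) ->
  (forall nu s, f nu s <= g nu s) -> L1 g -> L1 f.
Proof.
move=> cf cg h; apply: L1_dom => // S S0; exists 1, 0; split=> // nu s _.
by rewrite mul1r addr0.
Qed.

Lemma L1D f g : (forall nu, continuous (f nu)) -> (forall nu, continuous (g nu)) ->
  L1 f -> L1 g -> L1 (fun nu s => f nu s + g nu s).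
Proof.
move=> cf cg hf hg S S0; have [C1 h1] := hf S S0; have [C2 h2] := hg S S0.
by exists (C1 + C2) => nu; rewrite segD // lerD.
Qed.

Lemma msqD_le (F G : R -> R -> R) s : sm F -> sm G ->
  msq (fun s t => F s t + G s t) s <= 2 * msq F s + 2 * msq G s.
Proof.
move=> sF sG; have cF := contX (m := 2) (sm_contl (s := s) sF); have cG := contX (m := 2) (sm_contl (s := s) sG).
have c2 := @cont_cst R 2.
rewrite !msqE -!circZ // -circD; try exact: contM.
apply: circ_le.
- by apply: contX; apply: contD; exact: sm_contl.
- by apply: contD; exact: contM.
- move=> t _; rewrite -subr_ge0 (_ : _ - _ = (F s t - G s t) ^+ 2); [exact: sqr_ge0|ring].
Qed.

Lemma msqM_le (F G : R -> R -> R) s C : sm F -> sm G -> (forall t, `|F s t| <= C) ->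
  msq (fun s t => F s t * G s t) s <= C ^+ 2 * msq G s.
Proof.
move=> sF sG h; have cG := contX (m := 2) (sm_contl (s := s) sG).
rewrite !msqE -circZ //; apply: circ_le.
- by apply: contX; apply: contM; exact: sm_contl.
- by apply: contM => //; exact: cont_cst.
move=> t _; rewrite exprMn ler_wpM2r ?sqr_ge0 // -real_normK ?num_real //.
by rewrite lerXn2r ?nnegrE // (le_trans _ (h t)).
Qed.

Lemma LB_SL F : smf F -> LB F -> SL F.
Proof.
move=> sF h S; have [C hC] := h S; exists (C ^+ 2) => nu s hs.
rewrite msqE -[leRHS]circ_cst; apply: circ_le.
- by apply: contX; exact: sm_contl.
- exact: cont_cst.
move=> t _; rewrite -real_normK ?num_real // lerXn2r ?nnegrE //; last exact: hC.
by apply: le_trans (hC nu s t hs).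
Qed.

Lemma SL_L2 F : smf F -> SL F -> L2 F.
Proof.
move=> sF h S S0; have [C hC] := h S; exists (C * (S - - S)) => nu.
rewrite -seg_cst; apply: seg_le; [exact: cont_msq|exact: cont_cst|lra|].
by move=> s /abs_itv; exact: hC.
Qed.

Lemma LBD F G : LB F -> LB G -> LB (fun nu s t => F nu s t + G nu s t).
Proof.
move=> hF hG S; have [C1 h1] := hF S; have [C2 h2] := hG S; exists (C1 + C2) => nu s t hs.
by apply: le_trans (ler_normD _ _) _; apply: lerD; [exact: h1|exact: h2].
Qed.
Lemma LBM F G : LB F -> LB G -> LB (fun nu s t => F nu s t * G nu s t).
Proof.
move=> hF hG S; have [C1 h1] := hF S; have [C2 h2] := hG S; exists (C1 * C2) => nu s t hs.
by rewrite normrM; apply: ler_pM => //; [exact: h1|exact: h2].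
Qed.
Lemma LB_cst (c : R) : LB (fun _ _ _ => c).
Proof. by move=> S; exists `|c|. Qed.
Lemma LBZ (c : R) F : LB F -> LB (fun nu s t => c * F nu s t).
Proof. by move=> h; apply: (LBM (F := fun _ _ _ => c)) => //; exact: LB_cst. Qed.
Lemma LB_sum (I : Type) (r : seq I) (F : I -> fam) : (forall i, LB (F i)) ->
  LB (fun nu s t => \sum_(i <- r) F i nu s t).
Proof.
move=> h; elim: r => [|i r IH].
  by move=> S; exists 0 => nu s t _; rewrite big_nil normr0.
move=> S; have [C hC] := LBD (h i) IH S; exists C => nu s t hs; rewrite big_cons; exact: hC.
Qed.
Lemma LB_mean F : smf F -> LB F -> LB (fun nu s _ => circ_int (F nu s)).
Proof.
move=> sF h S; have [C hC] := h S; exists C => nu s _ hs; apply: circ_bnd => [|t _].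
  exact: sm_contl.
exact: hC.
Qed.
Lemma LB_mzp F : smf F -> LB F -> LB (fun nu s t => mzp (F nu s) t).
Proof.
move=> sF h S; have [C hC] := h S; exists (2 * C) => nu s t hs; apply: mzp_supp.
- exact: sm_contl.
- exact: sm_per.
- by move=> x _; exact: hC.
Qed.

Lemma smfD F G : smf F -> smf G -> smf (fun nu s t => F nu s t + G nu s t).
Proof. by move=> h1 h2 nu; exact: smD. Qed.
Lemma smfM F G : smf F -> smf G -> smf (fun nu s t => F nu s t * G nu s t).
Proof. by move=> h1 h2 nu; exact: smM. Qed.

Lemma SLD F G : smf F -> smf G -> SL F -> SL G -> SL (fun nu s t => F nu s t + G nu s t).
Proof.
move=> sF sG hF hG S; have [C1 h1] := hF S; have [C2 h2] := hG S; exists (2 * C1 + 2 * C2) => nu s hs.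
apply: le_trans (msqD_le s (sF nu) (sG nu)) _.
by apply: lerD; rewrite ler_wpM2l //; [exact: h1|exact: h2].
Qed.
Lemma SLM F G : smf F -> smf G -> LB F -> SL G -> SL (fun nu s t => F nu s t * G nu s t).
Proof.
move=> sF sG hF hG S; have [C1 h1] := hF S; have [C2 h2] := hG S; exists (C1 ^+ 2 * C2) => nu s hs.
apply: le_trans (msqM_le (C := C1) (sF nu) (sG nu) _) _; first by move=> t; exact: h1.
by rewrite ler_wpM2l ?sqr_ge0 //; exact: h2.
Qed.
Lemma L2D F G : smf F -> smf G -> L2 F -> L2 G -> L2 (fun nu s t => F nu s t + G nu s t).
Proof.
move=> sF sG hF hG.
have cF nu := cont_msq (sF nu); have cG nu := cont_msq (sG nu).
apply: (@L1_dom _ (fun nu s => msq (F nu) s + msq (G nu) s)).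
- by move=> nu; apply: cont_msq; exact: smD.
- by move=> nu; exact: contD.
- move=> S S0; exists 2, 0; split=> // nu s _; rewrite addr0 mulrDr; exact: msqD_le.
- exact: L1D.
Qed.
Lemma L2M F G : smf F -> smf G -> LB F -> L2 G -> L2 (fun nu s t => F nu s t * G nu s t).
Proof.
move=> sF sG hF.
apply: (@L1_dom _ (fun nu s => msq (G nu) s)).
- by move=> nu; apply: cont_msq; exact: smM.
- by move=> nu; exact: cont_msq.
- move=> S S0; have [C hC] := hF S; exists (C ^+ 2), 0; split; first exact: sqr_ge0.
  by move=> nu s hs; rewrite addr0; apply: msqM_le => // t; exact: hC.
Qed.
Lemma SL0 : SL (fun _ _ _ => 0).
Proof.
move=> S; exists 0 => nu s _; rewrite msqE (@circ_int_ext _ _ (fun=> 0)) ?circ_cst //.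
by move=> t; rewrite expr0n.
Qed.
Lemma L2_sum (I : Type) (r : seq I) (F : I -> fam) : (forall i, smf (F i)) -> (forall i, L2 (F i)) ->
  L2 (fun nu s t => \sum_(i <- r) F i nu s t).
Proof.
move=> sF h; elim: r => [|i r IH].
  have -> : (fun nu s t => \sum_(i <- [::]) F i nu s t) = fun _ _ _ => 0.
    by do 3!apply/funext => ?; rewrite big_nil.
  by apply: SL_L2; [move=> nu; exact: sm_cst|exact: SL0].
have -> : (fun nu s t => \sum_(j <- i :: r) F j nu s t) = fun nu s t => F i nu s t + \sum_(j <- r) F j nu s t.
  by do 3!apply/funext => ?; rewrite big_cons.
by apply: L2D => // nu; apply: sm_sum => j; exact: sF.
Qed.

Lemma sup_t (F : R -> R -> R) s t : sm F -> F s t ^+ 2 <= 2 * msq F s + msq (d_t F) s.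
Proof.
move=> sF; have [dF sFt] := sm_dt sF.
have [t0 t01 ->] := per_red t; last exact: sm_per.
have cF := sm_contl (s := s) sF; have cFt := sm_contl (s := s) sFt.
apply: le_trans (sobolev_sqr (dF s) cFt t01) _.
have h : 2 * circ_int (fun x => `|F s x * d_t F s x|) <= msq F s + msq (d_t F) s.
  rewrite !msqE -circD; try exact: contX.
  rewrite -circZ; last by apply: cont_abs; exact: contM.
  apply: circ_le.
  - by apply: contM; [exact: cont_cst|apply: cont_abs; exact: contM].
  - by apply: contD; exact: contX.
  move=> x _; rewrite normrM -(real_normK (num_real (F s x))) -(real_normK (num_real (d_t F s x))).
  by rewrite -subr_ge0 (_ : _ - _ = (`|F s x| - `|d_t F s x|) ^+ 2); [exact: sqr_ge0|ring].
rewrite !msqE in h *; lra.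
Qed.

(** The Sobolev embedding on the circle, applied for each [s]. *)
Lemma SL_LB F : smf F -> SL F -> SL (fun nu => d_t (F nu)) -> LB F.
Proof.
move=> sF h0 h1 S; have [C0 H0] := h0 S; have [C1 H1] := h1 S.
exists (1 + (2 * C0 + C1)) => nu s t hs.
have h : F nu s t ^+ 2 <= 2 * C0 + C1.
  apply: le_trans (sup_t s t (sF nu)) _; have := H0 nu s hs; have := H1 nu s hs; lra.
rewrite -real_normK ?num_real // in h.
have := normr_ge0 (F nu s t); nra.
Qed.

(** A function is at most its mean plus its oscillation. *)
Lemma sup_seg (f f' g : R -> R) S x : 0 < S -> (forall s, der f s (f' s)) -> continuous f' ->
  continuous g -> (forall s, - S <= s <= S -> `|f' s| <= g s) -> - S <= x <= S ->
  f x <= (2 * S)^-1 * seg f (- S) S + seg g (- S) S.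
Proof.
move=> S0 df cf' cg hg xS; have cf := der_cont df.
have SS : - S <= S by lra.
have ca := cont_abs cf'.
have osc y : - S <= y <= S -> f x - f y <= seg g (- S) S.
  move=> yS; apply: (@le_trans _ _ (seg (fun s => `|f' s|) (- S) S)); last exact: seg_le.
  case: (leP y x) => [yx|/ltW xy].
    rewrite -(seg_FTC y x df cf'); apply: le_trans (ler_norm _) _; apply: le_trans (seg_abs cf' yx) _.
    by apply: seg_sub => //; lra.
  apply: (@le_trans _ _ `|f y - f x|); first by rewrite distrC ler_norm.
  rewrite -(seg_FTC x y df cf'); apply: le_trans (seg_abs cf' xy) _.
  by apply: seg_sub => //; lra.
have h : seg (fun y => f x - f y) (- S) S <= seg (fun=> seg g (- S) S) (- S) S.
  apply: seg_le => //; [by apply: contB => //; exact: cont_cst|exact: cont_cst].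
rewrite segB // in h; last exact: cont_cst.
rewrite !seg_cst in h.
have S2 : 0 < 2 * S by rewrite mulr_gt0.
rewrite -(ler_pM2l S2) mulrDr mulrA divff ?gt_eqF // mul1r.
have -> : 2 * S * f x = f x * (S - - S) by ring.
have -> : 2 * S * seg g (- S) S = seg g (- S) S * (S - - S) by ring.
lra.
Qed.

Lemma der_msq (F : R -> R -> R) s : sm F ->
  der (msq F) s (circ_int (fun t => 2 * (F s t * d_s F s t))).
Proof.
move=> sF; have [dF sFs] := sm_ds sF; rewrite unlock.
apply: (circ_der_under (F := fun s t => F s t ^+ 2) (G := fun s t => 2 * (F s t * d_s F s t))).
- by apply: sm_cont; exact: (smX 2).
- by apply: sm_cont; apply: smZ; exact: smM.
move=> x t; apply: (der_ext (f := fun s => F s t * F s t)); first by move=> y; rewrite expr2.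
by apply: der_eq (derM (dF x t) (dF x t)) _; ring.
Qed.

(** [sup_seg] for [msq F], whose derivative is at most [msq F + msq (d_s F)]. *)
Lemma L2_SL F : smf F -> L2 F -> L2 (fun nu => d_s (F nu)) -> SL F.
Proof.
move=> sF h0 h1 S.
pose T := `|S| + 1; have T0 : 0 < T by rewrite ltr_wpDl.
have [C0 H0] := h0 T (ltW T0); have [C1 H1] := h1 T (ltW T0).
exists ((2 * T)^-1 * C0 + (C0 + C1)) => nu s hs.
have [dF sFs] := sm_ds (sF nu).
have cF := cont_msq (sF nu); have cFs := cont_msq sFs.
have sT : - T <= s <= T.
  by rewrite -ler_norml; apply: le_trans hs _; have := ler_norm S; rewrite /T; lra.
have := @sup_seg (msq (F nu)) (fun s => circ_int (fun t => 2 * (F nu s t * d_s (F nu) s t)))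
  (fun s => msq (F nu) s + msq (d_s (F nu)) s) T s T0.
move=> /(_ (fun s => der_msq s (sF nu))).
have -> : seg (fun s => msq (F nu) s + msq (d_s (F nu)) s) (- T) T =
  seg (msq (F nu)) (- T) T + seg (msq (d_s (F nu))) (- T) T by exact: segD.
move=> h; have {}h : msq (F nu) s <= (2 * T)^-1 * seg (msq (F nu)) (- T) T + (seg (msq (F nu)) (- T) T + seg (msq (d_s (F nu))) (- T) T).
  apply: h => //.
  - apply: (circ_cont (F := fun s t => 2 * (F nu s t * d_s (F nu) s t))).
    by apply: sm_cont; apply: smZ; exact: smM.
  - exact: contD.
  move=> x _.
  have c1 := sm_contl (s := x) (sF nu); have c2 := sm_contl (s := x) sFs.
  have c3 : continuous (fun t => 2 * (F nu x t * d_s (F nu) x t)).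
    by apply: contM; [exact: cont_cst|exact: contM].
  apply: le_trans (circ_abs c3) _; rewrite !msqE -circD; try exact: contX.
  apply: circ_le; [exact: cont_abs|by apply: contD; exact: contX|].
  move=> t _; rewrite !normrM ger0_norm // -(real_normK (num_real (F nu x t))) -(real_normK (num_real (d_s (F nu) x t))).
  by rewrite -subr_ge0 (_ : _ - _ = (`|F nu x t| - `|d_s (F nu) x t|) ^+ 2); [exact: sqr_ge0|ring].
apply: le_trans h _; apply: lerD; first by rewrite ler_wpM2l ?invr_ge0 ?mulr_ge0 // ?ltW.
by apply: lerD.
Qed.

(** With [f1 = u_s - v_t] and [f2 = v_s + u_t] one has [|f1|^2 + |f2|^2 = |du|^2 + |dv|^2 + 2 q'],
    where [q] is the mean of [v u_t]: the mixed terms form a derivative in [s] after integration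
    over the circle.  Multiplying by the square of the cutoff [chi] and integrating by parts in [s]
    leaves [q] against [chi chi'], which is absorbed. *)
Lemma elliptic_one (u v : R -> R -> R) S : 0 <= S -> sm u -> sm v -> seg (fun s => msq (d_s u) s + msq (d_t v) s + msq (d_s v) s + msq (d_t u) s) (- S) S <=
  2 * (S + 1) ^+ 4 * seg (fun s => msq (fun s t => d_s u s t - d_t v s t) s
      + msq (fun s t => d_s v s t + d_t u s t) s) (- (S + 1)) (S + 1)
  + 64 * (S + 1) ^+ 2 * seg (msq v) (- (S + 1)) (S + 1).
Proof.
move=> S0 su sv; set T := S + 1.
pose f1 s t := d_s u s t - d_t v s t; pose f2 s t := d_s v s t + d_t u s t.
have T1 : 1 <= T by rewrite /T; lra.
have TT : - T <= T by lra.
have [dus sus] := sm_ds su; have [dut sut] := sm_dt su.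
have [dvs svs] := sm_ds sv; have [dvt svt] := sm_dt sv.
have [duts suts] := sm_ds sut.
have sf1 : sm f1 by exact: smB.
have sf2 : sm f2 by exact: smD.
pose G s := msq (d_s u) s + msq (d_t v) s + msq (d_s v) s + msq (d_t u) s.
pose F s := msq f1 s + msq f2 s.
pose q s := circ_int (fun t => v s t * d_t u s t).
pose q' s := circ_int (fun t => d_s v s t * d_t u s t - d_t v s t * d_s u s t).
have cG : continuous G by do 3?apply: contD; exact: cont_msq.
have cF : continuous F by apply: contD; exact: cont_msq.
have cv := cont_msq sv.
have cut := cont_msq sut.
have dq s : der q s (q' s).
  apply: (der_eq (circ_der_under (F := fun s t => v s t * d_t u s t)
    (G := fun s t => d_s v s t * d_t u s t + v s t * d_s (d_t u) s t) s _ _ _)).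
  - by apply: sm_cont; exact: smM.
  - by apply: sm_cont; apply: smD; exact: smM.
  - by move=> x t; exact: derM.
  rewrite /q' circD; [|by apply: contM; exact: sm_contl|by apply: contM; exact: sm_contl].
  rewrite circB; [|by apply: contM; exact: sm_contl|by apply: contM; exact: sm_contl].
  congr (_ + _).
  have e : circ_int (fun t => d_t v s t * d_s u s t) = - circ_int (fun t => v s t * d_t (d_s u) s t).
    have [dust sust] := sm_dt sus.
    apply: (circ_parts (dvt s) (dust s)); try exact: sm_contl.
      by rewrite -[1]add0r (sm_per sv).
    by rewrite -[1]add0r (sm_per sus).
  rewrite e opprK; apply: circ_int_ext => t; by rewrite d_st.
have cq' : continuous q'.
  apply: (circ_cont (F := fun s t => d_s v s t * d_t u s t - d_t v s t * d_s u s t)).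
  by apply: sm_cont; apply: smB; exact: smM.
have cq : continuous q by apply: der_cont => s; exact: dq.
have FG s : F s = G s + 2 * q' s.
  rewrite /F /G /q' !msqE.
  have c1 := contX (m := 2) (sm_contl (s := s) sus); have c2 := contX (m := 2) (sm_contl (s := s) svt).
  have c3 := contX (m := 2) (sm_contl (s := s) svs); have c4 := contX (m := 2) (sm_contl (s := s) sut).
  have c5 := contX (m := 2) (sm_contl (s := s) sf1); have c6 := contX (m := 2) (sm_contl (s := s) sf2).
  have c7 : continuous (fun t => d_s v s t * d_t u s t - d_t v s t * d_s u s t).
    by apply: contB; apply: contM; exact: sm_contl.
  have c8 := contM (@cont_cst R 2) c7; have c12 := contD c1 c2; have c123 := contD c12 c3.
  rewrite -(circZ 2 c7) -(circD c1 c2) -(circD c12 c3) -(circD c123 c4) -(circD (contD c123 c4) c8) -(circD c5 c6).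
  by apply: circ_int_ext => t; rewrite /f1 /f2; ring.
(* the cutoff vanishes at both ends of the larger interval and is at least 1 on the smaller one *)
pose chi (s : R) := T ^+ 2 - s * s.
have dchi s : der chi s (- 2 * s).
  by apply: der_eq (derB (der_cst _ s) (derM (der_id s) (der_id s))) _; ring.
have cchi : continuous chi by apply: der_cont => s; exact: dchi.
have cid := @cont_id R.
have c2s : continuous (fun s : R => - 2 * s) by apply: contM => //; exact: cont_cst.
have D : forall s, der (fun s => chi s * chi s * q s) s
    (2 * (chi s * (- 2 * s) * q s) + chi s * chi s * q' s).
  by move=> s; apply: der_eq (derM (derM (dchi s) (dchi s)) (dq s)) _; ring.
have cA : continuous (fun s => 2 * (chi s * (- 2 * s) * q s)).
  by apply: contM; [exact: cont_cst|apply: contM => //; exact: contM].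
have cB : continuous (fun s => chi s * chi s * q' s) by apply: contM => //; exact: contM.
have chiT : chi T = 0 by rewrite /chi; ring.
have chiNT : chi (- T) = 0 by rewrite /chi; ring.
have I0 : seg (fun s => 2 * (chi s * (- 2 * s) * q s)) (- T) T + seg (fun s => chi s * chi s * q' s) (- T) T = 0.
  rewrite -(segD (- T) T cA cB) (seg_FTC _ _ D (contD cA cB)).
  by move: chiT chiNT; move: (chi T) (chi (- T)) (q T) (q (- T)) => c d x x' -> ->; rewrite !mul0r subrr.
have ccG : continuous (fun s => chi s * chi s * G s) by apply: contM => //; exact: contM.
have ccF : continuous (fun s => chi s * chi s * F s) by apply: contM => //; exact: contM.
have I1 : seg (fun s => chi s * chi s * G s) (- T) T =
    seg (fun s => chi s * chi s * F s) (- T) T + 2 * seg (fun s => 2 * (chi s * (- 2 * s) * q s)) (- T) T.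
  have -> : seg (fun s => chi s * chi s * F s) (- T) T =
     seg (fun s => chi s * chi s * G s) (- T) T + 2 * seg (fun s => chi s * chi s * q' s) (- T) T.
    rewrite -segZ // -segD //; last by apply: contM => //; exact: cont_cst.
    congr (seg _ _ _); apply/funext => s; rewrite FG; ring.
  lra.
have chib s : - T <= s <= T -> 0 <= chi s <= T ^+ 2.
  by move=> /andP[h1 h2]; rewrite /chi; apply/andP; split; nra.
(* Young's inequality; the weights leave half of the first term to be absorbed *)
have hq s : 2 * (2 * (chi s * (- 2 * s) * q s)) <= 2^-1 * (chi s * chi s * msq (d_t u) s) + 8 * ((- 2 * s) ^+ 2 * msq v s).
  have a1 := sm_contl (s := s) sv; have a2 := sm_contl (s := s) sut.
  have a3 := contX (m := 2) a1; have a4 := contX (m := 2) a2.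
  have -> : 2 * (2 * (chi s * (- 2 * s) * q s)) = 4 * (chi s * (- 2 * s)) * q s by ring.
  have -> : 2^-1 * (chi s * chi s * msq (d_t u) s) + 8 * ((- 2 * s) ^+ 2 * msq v s) =
     2^-1 * (chi s * chi s) * msq (d_t u) s + 8 * ((- 2 * s) ^+ 2) * msq v s by ring.
  rewrite /q !msqE -!circZ //; last exact: contM.
  rewrite -circD; try (apply: contM => //; exact: cont_cst).
  apply: circ_le.
  - by apply: contM; [exact: cont_cst|exact: contM].
  - by apply: contD; apply: contM => //; exact: cont_cst.
  move=> t _; rewrite -subr_ge0.
  rewrite (_ : _ - _ = 2^-1 * (chi s * d_t u s t - 4 * (- 2 * s) * v s t) ^+ 2); last by field.
  by rewrite mulr_ge0 ?sqr_ge0 // invr_ge0.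
have cU : continuous (fun s => 2^-1 * (chi s * chi s * msq (d_t u) s) + 8 * ((- 2 * s) ^+ 2 * msq v s)).
  apply: contD; apply: contM; try exact: cont_cst.
    by apply: contM => //; exact: contM.
  by apply: contM => //; exact: contX.
have msq0 (w : R -> R -> R) s : sm w -> 0 <= msq w s by exact: msq_ge0.
have I2 : seg (fun s => chi s * chi s * G s) (- T) T <=
   2 * seg (fun s => chi s * chi s * F s) (- T) T + 16 * (4 * T ^+ 2) * seg (msq v) (- T) T.
  have h : 2 * seg (fun s => 2 * (chi s * (- 2 * s) * q s)) (- T) T <=
      2^-1 * seg (fun s => chi s * chi s * G s) (- T) T + 8 * (4 * T ^+ 2) * seg (msq v) (- T) T.
    rewrite -!segZ // -segD; try (by apply: contM => //; exact: cont_cst).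
    apply: seg_le => //.
    - by apply: contM => //; exact: cont_cst.
    - by apply: contD; apply: contM => //; exact: cont_cst.
    move=> s /andP[s1 s2]; apply: le_trans (hq s) _; apply: lerD.
      rewrite ler_wpM2l ?invr_ge0 // ler_wpM2l -?expr2 ?sqr_ge0 //.
      by rewrite /G; have := msq0 _ s sus; have := msq0 _ s svt; have := msq0 _ s svs; lra.
    rewrite -mulrA ler_wpM2l // ler_wpM2r ?msq0 //; nra.
  lra.
have I3 : seg G (- S) S <= seg (fun s => chi s * chi s * G s) (- T) T.
  apply: (@le_trans _ _ (seg (fun s => chi s * chi s * G s) (- S) S)).
    apply: seg_le => //; first lra.
    move=> s /andP[s1 s2]; rewrite -[leLHS]mul1r ler_wpM2r //.
      by rewrite /G !addr_ge0 // msq0.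
    have : 1 <= chi s by rewrite /chi /T; nra.
    by move=> h; nra.
  apply: seg_sub => //; try (rewrite /T; lra).
  by move=> s; rewrite mulr_ge0 // -?expr2 ?sqr_ge0 // /G !addr_ge0 // msq0.
have I4 : seg (fun s => chi s * chi s * F s) (- T) T <= T ^+ 4 * seg F (- T) T.
  rewrite -segZ //; apply: seg_le => //; first by apply: contM => //; exact: cont_cst.
  move=> s /chib/andP[h1 h2]; rewrite ler_wpM2r ?addr_ge0 ?msq0 //.
  by rewrite (_ : T ^+ 4 = T ^+ 2 * T ^+ 2); [apply: ler_pM|ring].
have I5 : seg G (- S) S <= 2 * T ^+ 4 * seg F (- T) T + 64 * T ^+ 2 * seg (msq v) (- T) T.
  apply: le_trans I3 _; apply: le_trans I2 _; lra.
exact: I5.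
Qed.

Lemma L2_elliptic F G : smf F -> smf G -> L2 F -> L2 G ->
  L2 (fun nu s t => d_s (F nu) s t - d_t (G nu) s t) ->
  L2 (fun nu s t => d_s (G nu) s t + d_t (F nu) s t) ->
  [/\ L2 (fun nu => d_s (F nu)), L2 (fun nu => d_t (F nu)),
      L2 (fun nu => d_s (G nu)) & L2 (fun nu => d_t (G nu))].
Proof.
move=> sF sG hF hG h1 h2.
have sFs nu := (sm_ds (sF nu)).2; have sFt nu := (sm_dt (sF nu)).2.
have sGs nu := (sm_ds (sG nu)).2; have sGt nu := (sm_dt (sG nu)).2.
pose g nu s := msq (d_s (F nu)) s + msq (d_t (G nu)) s + msq (d_s (G nu)) s + msq (d_t (F nu)) s.
have cg nu : continuous (g nu) by do 3?apply: contD; exact: cont_msq.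
have Lg : L1 g.
  move=> S S0; have S1 : 0 <= S + 1 by rewrite addr_ge0.
  have [C1 H1] := h1 _ S1; have [C2 H2] := h2 _ S1; have [C3 H3] := hG _ S1.
  exists (2 * (S + 1) ^+ 4 * (C1 + C2) + 64 * (S + 1) ^+ 2 * C3) => nu.
  apply: le_trans (elliptic_one S0 (sF nu) (sG nu)) _.
  apply: lerD; apply: ler_wpM2l => //.
  - by rewrite mulr_ge0 // exprn_ge0.
  - rewrite segD; [by apply: lerD; [exact: H1|exact: H2]| |].
      by apply: cont_msq; exact: smB.
    by apply: cont_msq; exact: smD.
  - by rewrite mulr_ge0 // exprn_ge0.
have p4 (a b c d : R) : 0 <= a -> 0 <= b -> 0 <= c -> 0 <= d ->
    [/\ a <= a + b + c + d, d <= a + b + c + d, c <= a + b + c + d & b <= a + b + c + d].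
  by move=> *; split; lra.
have p nu s := p4 _ _ _ _ (msq_ge0 s (sFs nu)) (msq_ge0 s (sGt nu)) (msq_ge0 s (sGs nu)) (msq_ge0 s (sFt nu)).
split; [apply: (L1_le (fun nu => cont_msq (sFs nu)) cg _ Lg)|apply: (L1_le (fun nu => cont_msq (sFt nu)) cg _ Lg)
  |apply: (L1_le (fun nu => cont_msq (sGs nu)) cg _ Lg)|apply: (L1_le (fun nu => cont_msq (sGt nu)) cg _ Lg)];
  by move=> nu s; case: (p nu s).
Qed.

End Families.

(** * Bounds for higher derivatives *)

Section TimeDerivatives.
Context {R : realType}.
Notation fam := (nat -> R -> R -> R).
Implicit Types (F G H : fam) (S C : R).

Definition Dt F : fam := fun nu => d_t (F nu).
Definition Ds F : fam := fun nu => d_s (F nu).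

Lemma smf_Dt F : smf F -> smf (Dt F).
Proof. by move=> h nu; case: (sm_dt (h nu)). Qed.
Lemma smf_Ds F : smf F -> smf (Ds F).
Proof. by move=> h nu; case: (sm_ds (h nu)). Qed.
Lemma smf_Dtn m F : smf F -> smf (iter m Dt F).
Proof. by move=> h; elim: m => //= m IH; exact: smf_Dt. Qed.

Lemma fam_ext F G : (forall nu s t, F nu s t = G nu s t) -> F = G.
Proof. by move=> h; do 3!apply/funext => ?. Qed.

Lemma DtD F G : smf F -> smf G ->
  Dt (fun nu s t => F nu s t + G nu s t) = fun nu s t => Dt F nu s t + Dt G nu s t.
Proof.
move=> sF sG; apply: fam_ext => nu s t; apply: d_tE.
have [dF _] := sm_dt (sF nu); have [dG _] := sm_dt (sG nu); exact: derD.
Qed.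
Lemma DtM F G : smf F -> smf G -> Dt (fun nu s t => F nu s t * G nu s t) =
  fun nu s t => Dt F nu s t * G nu s t + F nu s t * Dt G nu s t.
Proof.
move=> sF sG; apply: fam_ext => nu s t; apply: d_tE.
have [dF _] := sm_dt (sF nu); have [dG _] := sm_dt (sG nu); exact: derM.
Qed.
Lemma DsD F G : smf F -> smf G ->
  Ds (fun nu s t => F nu s t + G nu s t) = fun nu s t => Ds F nu s t + Ds G nu s t.
Proof.
move=> sF sG; apply: fam_ext => nu s t; apply: d_sE.
have [dF _] := sm_ds (sF nu); have [dG _] := sm_ds (sG nu); exact: derD.
Qed.
Lemma DsM F G : smf F -> smf G -> Ds (fun nu s t => F nu s t * G nu s t) =
  fun nu s t => Ds F nu s t * G nu s t + F nu s t * Ds G nu s t.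
Proof.
move=> sF sG; apply: fam_ext => nu s t; apply: d_sE.
have [dF _] := sm_ds (sF nu); have [dG _] := sm_ds (sG nu); exact: derM.
Qed.
Lemma DtnD m F G : smf F -> smf G ->
  iter m Dt (fun nu s t => F nu s t + G nu s t) = fun nu s t => iter m Dt F nu s t + iter m Dt G nu s t.
Proof.
move=> sF sG; elim: m => //= m ->; apply: DtD; exact: smf_Dtn.
Qed.
Lemma Ds_Dtn m F : smf F -> Ds (iter m Dt F) = iter m Dt (Ds F).
Proof.
move=> sF; elim: m => //= m <-; apply: fam_ext => nu s t; apply: d_st.
exact: smf_Dtn.
Qed.
Lemma Dt_indep (f : nat -> R -> R) : Dt (fun nu s _ => f nu s) = fun _ _ _ => 0.
Proof. by apply: fam_ext => nu s t; apply: d_tE; exact: der_cst. Qed.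

(** [graded m F] bounds the [t]-derivatives of order below [m] in the sup norm and the derivative of
    order [m] in [L^2] for each [s]; the top order is one step weaker, as the Sobolev embedding
    loses one derivative. *)
Fixpoint graded m F : Prop := if m is m'.+1 then LB F /\ graded m' (Dt F) else SL F.

Lemma gradedW m F : smf F -> graded m.+1 F -> graded m F.
Proof.
elim: m F => [|m IH] F sF [h1 h2]; first exact: LB_SL.
by split => //; apply: IH => //; exact: smf_Dt.
Qed.
Lemma graded_le m m' F : smf F -> (m' <= m)%N -> graded m F -> graded m' F.
Proof.
move=> sF; elim: m => [|m IH]; first by rewrite leqn0 => /eqP ->.
by rewrite leq_eqVlt => /predU1P[-> //|]; rewrite ltnS => /IH h /gradedW h'; apply: h; exact: h'.
Qed.
Lemma graded_LB m F : graded m.+1 F -> LB F. Proof. by case. Qed.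
Lemma gradedD m F G : smf F -> smf G -> graded m F -> graded m G -> graded m (fun nu s t => F nu s t + G nu s t).
Proof.
elim: m F G => [|m IH] F G sF sG; first exact: SLD.
move=> [f1 f2] [g1 g2]; split; first exact: LBD.
by rewrite DtD //; apply: IH => //; exact: smf_Dt.
Qed.
(** In the Leibniz formula only one factor carries the top derivative, and the other one is bounded.
    *)
Lemma gradedM m F G : smf F -> smf G -> graded m.+1 F -> graded m.+1 G -> graded m.+1 (fun nu s t => F nu s t * G nu s t).
Proof.
elim: m F G => [|m IH] F G sF sG hF hG; have sFt := smf_Dt sF; have sGt := smf_Dt sG.
  case: hF hG => f1 f2 [g1 g2]; split; [exact: LBM|rewrite DtM //].
  apply: SLD; [exact: smfM|exact: smfM| |exact: SLM].
  have -> : (fun nu s t => Dt F nu s t * G nu s t) = fun nu s t => G nu s t * Dt F nu s t.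
    by apply: fam_ext => nu s t; rewrite mulrC.
  exact: SLM.
have hF' := gradedW sF hF; have hG' := gradedW sG hG.
have hFt : graded m.+1 (Dt F) by case: hF.
have hGt : graded m.+1 (Dt G) by case: hG.
split; first by apply: LBM; [exact: graded_LB hF|exact: graded_LB hG].
rewrite DtM //; apply: (gradedD (m := m.+1)); [exact: smfM|exact: smfM| |].
  exact: IH.
exact: IH.
Qed.
Lemma graded_indep m (f : nat -> R -> R) : smf (fun nu s _ => f nu s) -> LB (fun nu s _ => f nu s) ->
  graded m (fun nu s _ => f nu s).
Proof.
elim: m f => [|m IH] f sf h /=; first exact: LB_SL.
split => //; rewrite Dt_indep; apply: (IH (fun _ _ => 0)); first by move=> nu; exact: sm_cst.
exact: LB_cst.
Qed.
Lemma graded_sum m (I : Type) (r : seq I) (F : I -> fam) : (forall i, smf (F i)) -> (forall i, graded m (F i)) ->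
  graded m (fun nu s t => \sum_(i <- r) F i nu s t).
Proof.
move=> sF h; elim: r => [|i r IH].
  have -> : (fun nu s t => \sum_(i <- [::]) F i nu s t) = fun _ _ _ => 0.
    by apply: fam_ext => ? ? ?; rewrite big_nil.
  by apply: (@graded_indep m (fun _ _ => 0)); [move=> nu; exact: sm_cst|exact: LB_cst].
have -> : (fun nu s t => \sum_(j <- i :: r) F j nu s t) = fun nu s t => F i nu s t + \sum_(j <- r) F j nu s t.
  by apply: fam_ext => ? ? ?; rewrite big_cons.
by apply: gradedD => // nu; apply: sm_sum => j; exact: sF.
Qed.
Lemma graded_cst m (c : R) : graded m (fun _ _ _ => c).
Proof. by apply: (@graded_indep m (fun _ _ => c)); [move=> nu; exact: sm_cst|exact: LB_cst]. Qed.
Lemma graded_up m F : graded m F -> LB (iter m Dt F) -> SL (iter m.+1 Dt F) -> graded m.+1 F.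
Proof.
elim: m F => [|m IH] F // [h1 h2] h3 h4; split => //.
by apply: IH => //; rewrite -iterSr.
Qed.
Lemma graded_SL m F : graded m F -> SL (iter m Dt F).
Proof. by elim: m F => [|m IH] F // [_ h]; rewrite iterSr; exact: IH. Qed.
Lemma graded_LBn m i F : (i < m)%N -> graded m F -> LB (iter i Dt F).
Proof.
elim: i m F => [|i IH] [|m] F // im [h1 h2] //; rewrite iterSr; exact: (IH m).
Qed.

(** All terms of the Leibniz formula except [F] times the top derivative of [U] have a factor [Dt
    F], and their orders are lower by one. *)
Lemma lead m i F U : (0 < m)%N -> smf F -> smf U -> LB F -> graded m (Dt F) -> (i <= m.+1)%N ->
  L2 (iter i Dt U) -> (if i is i'.+1 then graded i' U else True) ->
  L2 (iter i Dt (fun nu s t => F nu s t * U nu s t)).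
Proof.
move=> m0 sF sU hF hFt; elim: i U sU => [|i IH] U sU im hU hT; first exact: L2M.
have sFt := smf_Dt sF; have sUt := smf_Dt sU.
rewrite iterSr DtM // DtnD; [|exact: smfM|exact: smfM].
apply: L2D; [by apply: smf_Dtn; exact: smfM|by apply: smf_Dtn; exact: smfM| |].
  apply: SL_L2; first by apply: smf_Dtn; exact: smfM.
  case: i IH im hU hT => [|i] IH im hU hT /=.
    by apply: SLM => //; case: (m) m0 hFt => // m' _ [].
  apply: (graded_SL (m := i.+1)); apply: gradedM => //; exact: graded_le hFt.
apply: IH => //; first exact: ltnW.
  by rewrite -iterSr.
by case: i hT {im hU} => // i [].
Qed.

(** The inequality [sup f^2 <= |f|^2 + 2 |f| |f_t|] in [L^2] norms, squared; the factor [|f|^2],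
    bounded in [s], is what makes [cubic] integrable. *)
Lemma sup_t4 (F : R -> R -> R) s t : sm F ->
  (F s t ^+ 2) ^+ 2 <= 2 * msq F s ^+ 2 + 8 * (msq F s * msq (d_t F) s).
Proof.
move=> sF; have [dF sFt] := sm_dt sF.
have [t0 t01 ->] := per_red t; last exact: sm_per.
have cF := sm_contl (s := s) sF; have cFt := sm_contl (s := s) sFt.
have h1 := sobolev_sqr (dF s) cFt t01.
have h2 := circ_CS (cont_abs cF) (cont_abs cFt).
have e (f : R -> R) : circ_int (fun x => `|f x| ^+ 2) = circ_int (fun x => f x ^+ 2).
  by apply: circ_int_ext => x; rewrite real_normK ?num_real.
have e2 : circ_int (fun x => `|F s x| * `|d_t F s x|) = circ_int (fun x => `|F s x * d_t F s x|).
  by apply: circ_int_ext => x; rewrite normrM.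
rewrite !e e2 -!msqE in h2; rewrite -msqE in h1.
set b := circ_int _ in h1 h2; set x := F s t0 in h1 *.
have x0 := sqr_ge0 x; have a0 := msq_ge0 s sF.
apply: (@le_trans _ _ ((msq F s + 2 * b) ^+ 2)).
  by rewrite lerXn2r ?nnegrE // (le_trans x0 h1).
have := sqr_ge0 (msq F s - 2 * b); nra.
Qed.

(** The one product that appears before any sup bound is known.  The squares of [F] and [G] are
    paired through [sup_t4], so that the derivatives enter only quadratically. *)
Lemma cubic F G H : smf F -> smf G -> smf H -> SL F -> SL G -> SL H -> L2 (Dt F) -> L2 (Dt G) ->
  L2 (fun nu s t => F nu s t * G nu s t * H nu s t).
Proof.
move=> sF sG sH hF hG hH lF lG.
have sFt := smf_Dt sF; have sGt := smf_Dt sG.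
have cF nu := cont_msq (sFt nu); have cG nu := cont_msq (sGt nu).
have sFG : smf (fun nu s t => F nu s t * G nu s t) by exact: smfM.
have [c1 h1] := choice hF; have [c2 h2] := choice hG; have [c3 h3] := choice hH.
apply: (@L1_dom _ _ (fun nu s => msq (Dt F nu) s + msq (Dt G nu) s)).
- by move=> nu; apply: cont_msq; exact: (smfM sFG sH).
- by move=> nu; exact: contD.
- move=> S S0.
  pose a := `|c1 S| + `|c2 S|; have a0 : 0 <= a by rewrite addr_ge0.
  pose d := `|c3 S|; have d0 : 0 <= d by rewrite /d normr_ge0.
  exists (4 * a * d), (2 * a ^+ 2 * d); split; first by rewrite !mulr_ge0.
  move=> nu s hs.
  have f1 : msq (F nu) s <= a.
    by apply: le_trans (h1 S nu s hs) _; have := ler_norm (c1 S); have := normr_ge0 (c2 S); rewrite /a; lra.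
  have g1 : msq (G nu) s <= a.
    by apply: le_trans (h2 S nu s hs) _; have := ler_norm (c2 S); have := normr_ge0 (c1 S); rewrite /a; lra.
  have e1 : msq (H nu) s <= d by apply: le_trans (h3 S nu s hs) _; exact: ler_norm.
  have f0 := msq_ge0 s (sF nu); have g0 := msq_ge0 s (sG nu); have e0 := msq_ge0 s (sH nu).
  have ft0 := msq_ge0 s (sFt nu); have gt0 := msq_ge0 s (sGt nu).
  pose K := 2 * a ^+ 2 + 4 * a * (msq (Dt F nu) s + msq (Dt G nu) s).
  have K0 : 0 <= K by rewrite addr_ge0 // ?mulr_ge0 ?sqr_ge0 // addr_ge0.
  have b1 t : (F nu s t * G nu s t) ^+ 2 <= K.
    have p1 := sup_t4 s t (sF nu); have p2 := sup_t4 s t (sG nu).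
    rewrite exprMn; set x := F nu s t ^+ 2 in p1 *; set y := G nu s t ^+ 2 in p2 *.
    have xy : x * y <= 2^-1 * (x ^+ 2 + y ^+ 2).
      by rewrite -subr_ge0 (_ : _ - _ = 2^-1 * (x - y) ^+ 2); [rewrite mulr_ge0 ?sqr_ge0 // invr_ge0|field].
    have q1 : msq (F nu) s ^+ 2 <= a ^+ 2 by rewrite lerXn2r ?nnegrE.
    have q2 : msq (G nu) s ^+ 2 <= a ^+ 2 by rewrite lerXn2r ?nnegrE.
    have q3 : msq (F nu) s * msq (Dt F nu) s <= a * msq (Dt F nu) s by rewrite ler_wpM2r.
    have q4 : msq (G nu) s * msq (Dt G nu) s <= a * msq (Dt G nu) s by rewrite ler_wpM2r.
    rewrite -/(Dt F nu) in p1; rewrite -/(Dt G nu) in p2; rewrite /K; lra.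
  have : msq (fun s t => F nu s t * G nu s t * H nu s t) s <= K * msq (H nu) s.
    have cHs : continuous (H nu s) by exact: sm_contl.
    rewrite !msqE -circZ; last by exact: contX.
    apply: circ_le.
    + exact: (contX (m := 2) (contM (contM (sm_contl (s := s) (sF nu)) (sm_contl (s := s) (sG nu))) cHs)).
    + by apply: contM; [exact: cont_cst|exact: contX].
    + by move=> t _; rewrite exprMn ler_wpM2r ?sqr_ge0.
  move=> h; apply: le_trans h _; apply: (@le_trans _ _ (K * d)); first by rewrite ler_wpM2l.
  by rewrite /K; lra.
- exact: L1D.
Qed.

Lemma osc_seg (f f' : R -> R) S x y : (forall s, der f s (f' s)) -> continuous f' ->
  - S <= x <= S -> - S <= y <= S -> `|f x - f y| <= seg (fun s => `|f' s|) (- S) S.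
Proof.
move=> df cf' xS yS; have ca := cont_abs cf'.
case: (leP y x) => [yx|/ltW xy].
  rewrite -(seg_FTC y x df cf'); apply: le_trans (seg_abs cf' yx) _.
  by apply: seg_sub => //; lra.
rewrite distrC -(seg_FTC x y df cf'); apply: le_trans (seg_abs cf' xy) _.
by apply: seg_sub => //; lra.
Qed.

(** A function is at most its mean plus its oscillation; the derivative is controlled by an
    integrable family. *)
Lemma L1_sup (f f' g : nat -> R -> R) : (forall nu s, der (f nu) s (f' nu s)) ->
  (forall nu, continuous (f' nu)) -> (forall nu, continuous (g nu)) ->
  (forall S, 0 <= S -> exists C, 0 <= C /\ forall nu s, `|s| <= S -> `|f' nu s| <= C * g nu s) ->
  L1 f -> L1 g -> forall S, exists C, forall nu s, `|s| <= S -> f nu s <= C.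
Proof.
move=> df cf' cg h hf hg S.
pose U := `|S| + 1; have U0 : 0 < U by rewrite ltr_wpDl.
have [C [C0 hC]] := h _ (ltW U0).
have [C1 H1] := hf _ (ltW U0); have [C2 H2] := hg _ (ltW U0).
exists ((2 * U)^-1 * C1 + C * C2) => nu s hs.
have sU : - U <= s <= U.
  by rewrite -ler_norml; apply: le_trans hs _; have := ler_norm S; rewrite /U; lra.
have cCg : continuous (fun s => C * g nu s) by apply: contM => //; exact: cont_cst.
apply: le_trans (sup_seg U0 (df nu) (cf' nu) cCg _ sU) _.
  by move=> x /abs_itv; exact: hC.
rewrite segZ //; apply: lerD; apply: ler_wpM2l => //.
by rewrite invr_ge0 mulr_ge0 // ltW.
Qed.

(** [mixed N a F] bounds all derivatives of order at most [N] with at most [a] of them in [s]: the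
    recursion follows the induction on [a] by which the equations trade [s]-derivatives for
    [t]-derivatives. *)
Fixpoint mixed (N a : nat) F : Prop := LB F /\
  if N is N'.+1 then mixed N' a (Dt F) /\ (if a is a'.+1 then mixed N' a' (Ds F) else True) else True.

Lemma mixed_LB N a F : mixed N a F -> LB F. Proof. by case: N => [|N] []. Qed.

Lemma mixedW N a F : mixed N.+1 a F -> mixed N a F.
Proof.
elim: N a F => [|N IH] a F; first by case.
move=> [h1 [h2 h3]]; split => //; split; first exact: IH.
by case: a h2 h3 => // a _; exact: IH.
Qed.
Lemma mixedD N a F G : smf F -> smf G -> mixed N a F -> mixed N a G -> mixed N a (fun nu s t => F nu s t + G nu s t).
Proof.
elim: N a F G => [|N IH] a F G sF sG; first by move=> [f _] [g _]; split => //; exact: LBD.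
move=> [f1 [f2 f3]] [g1 [g2 g3]]; split; first exact: LBD.
rewrite DtD // DsD //; split; first by apply: IH => //; exact: smf_Dt.
by case: a f2 f3 g2 g3 => // a _ ? _ ?; apply: IH => //; exact: smf_Ds.
Qed.
Lemma mixedM N a F G : smf F -> smf G -> mixed N a F -> mixed N a G -> mixed N a (fun nu s t => F nu s t * G nu s t).
Proof.
elim: N a F G => [|N IH] a F G sF sG; first by move=> [f _] [g _]; split => //; exact: LBM.
move=> hF hG; have hF' := mixedW hF; have hG' := mixedW hG.
case: hF hG => f1 [f2 f3] [g1 [g2 g3]]; split; first exact: LBM.
have sFt := smf_Dt sF; have sGt := smf_Dt sG; have sFs := smf_Ds sF; have sGs := smf_Ds sG.
rewrite DtM // DsM //; split; first by apply: mixedD; (try exact: smfM); exact: IH.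
case: a f2 f3 g2 g3 hF' hG' => // a f2 f3 g2 g3 hF' hG'.
have low b H : mixed N b.+1 H -> mixed N b H.
  elim: N b H {IH f2 f3 g2 g3 hF' hG'} => [|N IH] b H; first by case.
  move=> [h1 [h2 h3]]; split => //; split; first exact: IH.
  by case: b h2 h3 => // b _; exact: IH.
by apply: mixedD; (try exact: smfM); apply: IH => //; exact: low.
Qed.
Lemma mixed_indep N a (f : nat -> R -> R) : LB (fun nu s _ => f nu s) ->
  (forall a', a = a'.+1 -> mixed N a' (Ds (fun nu s _ => f nu s))) -> mixed N.+1 a (fun nu s _ => f nu s).
Proof.
move=> h h2; split => //; rewrite Dt_indep; split; last by case: a h2 => // a; apply.
elim: N a {h2 h f} => [|N IH] a; first by split => //; exact: LB_cst.
split; first exact: LB_cst.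
have -> : Ds (fun (_ : nat) (_ _ : R) => (0 : R)) = fun _ _ _ => 0.
  by apply: fam_ext => nu s t; apply: d_sE; exact: der_cst.
by rewrite (Dt_indep (fun _ _ => 0)); split => //; case: a.
Qed.
Lemma mixed_cst N a (f : nat -> R) (c : R) : (forall nu, `|f nu| <= c) -> mixed N a (fun nu _ _ => f nu).
Proof.
move=> h; have hL : LB (fun nu (_ _ : R) => f nu) by move=> S; exists c.
elim: N a f c h hL => [|N IH] a f c h hL; first by split.
apply: (@mixed_indep N a (fun nu _ => f nu)) => // a' _.
have -> : Ds (fun nu (_ _ : R) => f nu) = fun _ _ _ => 0.
  by apply: fam_ext => nu s t; apply: d_sE; exact: der_cst.
apply: (IH a' (fun _ => 0) 0) => [nu|]; first by rewrite normr0.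
exact: LB_cst.
Qed.
Lemma mixed_sum N a (I : Type) (r : seq I) (F : I -> fam) : (forall i, smf (F i)) -> (forall i, mixed N a (F i)) ->
  mixed N a (fun nu s t => \sum_(i <- r) F i nu s t).
Proof.
move=> sF h; elim: r => [|i r IH].
  have -> : (fun nu s t => \sum_(i <- [::]) F i nu s t) = fun _ _ _ => 0.
    by apply: fam_ext => ? ? ?; rewrite big_nil.
  by apply: (@mixed_cst N a (fun _ => 0) 0) => nu; rewrite normr0.
have -> : (fun nu s t => \sum_(j <- i :: r) F j nu s t) = fun nu s t => F i nu s t + \sum_(j <- r) F j nu s t.
  by apply: fam_ext => ? ? ?; rewrite big_cons.
by apply: mixedD => // nu; apply: sm_sum => j; exact: sF.
Qed.
Lemma mixedZ N a (c : R) F : smf F -> mixed N a F -> mixed N a (fun nu s t => c * F nu s t).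
Proof.
move=> sF h; apply: (mixedM (F := fun _ _ _ => c)) => //; first by move=> nu; exact: sm_cst.
exact: (@mixed_cst N a (fun _ => c) `|c|).
Qed.
Lemma mixed_mean N a F : smf F -> mixed N a F -> mixed N a (fun nu s _ => circ_int (F nu s)).
Proof.
elim: N a F => [|N IH] a F sF; first by move=> [f _]; split => //; exact: LB_mean.
move=> [h1 [h2 h3]]; apply: (@mixed_indep N a (fun nu s => circ_int (F nu s))); first exact: LB_mean.
move=> a' ea; rewrite ea in h3.
have -> : Ds (fun nu s _ => circ_int (F nu s)) = fun nu s _ => circ_int (Ds F nu s).
  by apply: fam_ext => nu s t; exact: d_s_mean.
by apply: IH => //; exact: smf_Ds.
Qed.
Lemma mixed_mzp N a F : smf F -> mixed N a F -> mixed N a (fun nu s t => mzp (F nu s) t).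
Proof.
elim: N a F => [|N IH] a F sF; first by move=> [f _]; split => //; exact: LB_mzp.
move=> hF; have hF' := mixedW hF; case: hF => h1 [h2 h3]; split; first exact: LB_mzp.
split.
  have -> : Dt (fun nu s t => mzp (F nu s) t) = fun nu s t => F nu s t + (-1) * circ_int (F nu s).
    by apply: fam_ext => nu s t; rewrite /Dt d_t_mzp // mulN1r.
  have smm : smf (fun nu s _ => circ_int (F nu s)) by move=> nu; exact: sm_mean.
  apply: mixedD => //; first by move=> nu; apply: smZ; exact: smm.
  exact: (mixedZ (-1) smm (mixed_mean sF hF')).
have -> : Ds (fun nu s t => mzp (F nu s) t) = fun nu s t => mzp (Ds F nu s) t.
  by apply: fam_ext => nu s t; exact: d_s_mzp.
by case: a h2 h3 hF' => // a _ h3 _; apply: IH => //; exact: smf_Ds.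
Qed.
Lemma mixed_Dtn m N a F : mixed (N + m) a F -> mixed N a (iter m Dt F).
Proof.
elim: m F => [|m IH] F; first by rewrite addn0.
by rewrite addnS iterSr => -[_ [h _]]; exact: IH.
Qed.
Lemma mixed_pderiv w N a F : (size w <= N)%N -> (size w <= a)%N -> mixed N a F ->
  LB (fun nu => pderiv w (F nu)).
Proof.
elim/last_ind: w N a F => [|w b IH] N a F; first by move=> _ _ /mixed_LB.
rewrite size_rcons; case: N => // N; case: a => // a; rewrite !ltnS => wN wa [_ [h1 h2]].
have E (G : R -> R -> R) : pderiv (rcons w b) G = pderiv w ((if b then d_s else d_t) G).
  by elim: w {IH wN wa} => //= x w ->.
have -> : (fun nu => pderiv (rcons w b) (F nu)) = fun nu => pderiv w ((if b then Ds F else Dt F) nu).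
  by apply/funext => nu; rewrite E; case: b {E}.
case: b {E}; first exact: (IH N a).
by apply: (IH N a.+1) => //; exact: leqW.
Qed.

End TimeDerivatives.

(** * A priori bounds for flow lines *)

Section SystemDefs.
Context {R : realType} {n k : nat} (B : 'I_n -> 'I_k -> R) (tau : 'I_k -> R).
Implicit Types (Z : bool -> 'I_n -> R -> R -> R) (E : 'I_k -> R -> R).

Definition sg (b : bool) : R := if b then 1 else -1.
Definition betf E j s : R := \sum_l B j l * E l s.
(** The components of the moment map, as a function of the real and imaginary parts of [z]: [Z true
    j] and [Z false j]. *)
Definition muf Z l s t : R :=
  - 2^-1 * \sum_j B j l * (Z true j s t * Z true j s t + Z false j s t * Z false j s t).
Definition gaf (r : R) Z j s t : R := r * \sum_l B j l * mzp (muf Z l s) t.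

(** The two real equations differ by signs only; the boolean carries the sign, so that one argument
    covers both. *)
Definition flow_system (r : R) Z E : Prop :=
  (forall b j s t, d_s (Z b j) s t =
     sg b * d_t (Z (~~ b) j) s t
     + (betf E j s * Z b j s t + (sg b * gaf r Z j s t) * Z (~~ b) j s t))
  /\ forall l s, der (E l) s (tau l - circ_int (muf Z l s)).

(** The components of [d_t z + L_z eta], the first part of the energy density. *)
Definition edef Z E b j s t : R := d_t (Z b j) s t - sg b * (betf E j s * Z (~~ b) j s t).
Definition edens Z E s : R :=
  \sum_(p : bool * 'I_n) msq (edef Z E p.1 p.2) s
  + \sum_l (circ_int (muf Z l s) - tau l) ^+ 2.

Lemma sm_betf E j : (forall l, sm (fun s _ => E l s)) -> sm (fun s _ => betf E j s).
Proof. by move=> h; apply: sm_sum => l; apply: smZ; exact: h. Qed.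
Lemma sm_muf Z l : (forall b j, sm (Z b j)) -> sm (muf Z l).
Proof.
by move=> h; apply: smZ; apply: sm_sum => j; apply: smZ; apply: smD; apply: smM; exact: h.
Qed.
Lemma sm_gaf r Z j : (forall b j, sm (Z b j)) -> sm (gaf r Z j).
Proof.
by move=> h; apply: smZ; apply: sm_sum => l; apply: smZ; apply: sm_mzp; exact: sm_muf.
Qed.
Lemma sm_edef Z E b j : (forall l, sm (fun s _ => E l s)) -> (forall b j, sm (Z b j)) ->
  sm (edef Z E b j).
Proof.
move=> hE hZ; apply: smB; first by have [] := sm_dt (hZ b j).
apply: smZ; apply: smM; [exact: sm_betf|exact: hZ].
Qed.
End SystemDefs.

Section L1Sums.
Context {R : realType}.
Lemma L1_cst (c : R) : L1 (fun _ _ => c).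
Proof. by move=> S S0; exists (c * (S - - S)) => nu; rewrite seg_cst. Qed.
Lemma L1_sum (I : Type) (r : seq I) (f : I -> nat -> R -> R) :
  (forall i nu, continuous (f i nu)) -> (forall i, L1 (f i)) -> L1 (fun nu s => \sum_(i <- r) f i nu s).
Proof.
move=> cf h; elim: r => [|i r IH].
  have -> : (fun nu s => \sum_(i <- [::]) f i nu s) = fun _ _ => 0.
    by do 2!apply/funext => ?; rewrite big_nil.
  exact: L1_cst.
have -> : (fun nu s => \sum_(j <- i :: r) f j nu s) = fun nu s => f i nu s + \sum_(j <- r) f j nu s.
  by do 2!apply/funext => ?; rewrite big_cons.
apply: L1D => // nu; exact: (cont_sum (h := fun i => f i nu)).
Qed.
Lemma sum_term (I : finType) (f : I -> R) i : (forall i, 0 <= f i) -> f i <= \sum_j f j.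
Proof. by move=> h; rewrite (bigD1 i) //= lerDl sumr_ge0. Qed.
Lemma sum_bj n (F : bool -> 'I_n -> R) :
  \sum_(p : bool * 'I_n) F p.1 p.2 = \sum_j (F true j + F false j).
Proof. by rewrite -(pair_bigA _ F) exchange_big; apply: eq_bigr => j _; rewrite big_bool. Qed.
Lemma DtnZ m c (F : nat -> R -> R -> R) : smf F ->
  iter m Dt (fun nu s t => c * F nu s t) = fun nu s t => c * iter m Dt F nu s t.
Proof.
move=> sF; elim: m => //= m ->; apply: fam_ext => nu s t; apply: d_tE.
have [dF _] := sm_dt (smf_Dtn m sF nu); exact: derZ.
Qed.
End L1Sums.

Section Bootstrap.
Context {R : realType} {n k : nat} (B : 'I_n -> 'I_k -> R) (tau : 'I_k -> R).
Notation fam := (nat -> R -> R -> R).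
Variables (r : nat -> R) (Z : nat -> bool -> 'I_n -> R -> R -> R) (E : nat -> 'I_k -> R -> R).
Hypothesis (hr : forall nu, 0 <= r nu <= 1).
Hypothesis (sZ : forall nu b j, sm (Z nu b j)) (sE : forall nu l, sm (fun s _ => E nu l s)).
Hypothesis (sys : forall nu, flow_system B tau (r nu) (Z nu) (E nu)).
Hypothesis (bE : forall l, exists C, forall nu, `|E nu l 0| <= C).
Hypothesis (hen : L1 (fun nu => edens B tau (Z nu) (E nu))).
Hypothesis (hprop : exists M, forall nu s,
  \sum_(p : bool * 'I_n) msq (Z nu p.1 p.2) s <= M * \sum_l `|circ_int (muf B (Z nu) l s)|).

Let z b j : fam := fun nu => Z nu b j.
Let e l : fam := fun nu s _ => E nu l s.
Let be j : fam := fun nu s _ => betf B (E nu) j s.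
Let mu l : fam := fun nu => muf B (Z nu) l.
Let G b j : fam := fun nu s t => sg b * gaf B (r nu) (Z nu) j s t.
Let en nu := edens B tau (Z nu) (E nu).

Let sz b j : smf (z b j). Proof. by move=> nu; exact: sZ. Qed.
Let se l : smf (e l). Proof. by move=> nu; exact: sE. Qed.
Let sbe j : smf (be j). Proof. by move=> nu; apply: sm_betf. Qed.
Let smu l : smf (mu l). Proof. by move=> nu; apply: sm_muf; exact: sZ. Qed.
Let sG b j : smf (G b j). Proof. by move=> nu; apply: smZ; apply: sm_gaf; exact: sZ. Qed.

Let cem nu l : continuous (fun s => circ_int (mu l nu s)).
Proof. by apply: circ_cont; apply: sm_cont; exact: smu. Qed.
Let cdef nu l : continuous (fun s => (circ_int (mu l nu s) - tau l) ^+ 2).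
Proof. by apply: contX; apply: contB; [exact: cem|exact: cont_cst]. Qed.
Let sdef nu b j : sm (edef B (Z nu) (E nu) b j).
Proof. by apply: sm_edef; [exact: sE|exact: sZ]. Qed.
Let cen nu : continuous (en nu).
Proof.
apply: contD.
  by apply: (cont_sum (h := fun p : bool * 'I_n => msq (edef B (Z nu) (E nu) p.1 p.2))) => p; apply: cont_msq; exact: sdef.
by apply: (cont_sum (h := fun l s => (circ_int (mu l nu s) - tau l) ^+ 2)) => l; exact: cdef.
Qed.

Let en1 nu s b j : msq (edef B (Z nu) (E nu) b j) s <= en nu s.
Proof.
apply: (@le_trans _ _ (\sum_(p : bool * 'I_n) msq (edef B (Z nu) (E nu) p.1 p.2) s)).
  apply: (sum_term (f := fun p : bool * 'I_n => msq (edef B (Z nu) (E nu) p.1 p.2) s) (b, j)) => p.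
  by apply: msq_ge0; exact: sdef.
by rewrite lerDl sumr_ge0 // => l _; exact: sqr_ge0.
Qed.
Let en2 nu s l : (circ_int (mu l nu s) - tau l) ^+ 2 <= en nu s.
Proof.
apply: (@le_trans _ _ (\sum_l (circ_int (mu l nu s) - tau l) ^+ 2)).
  apply: (sum_term (f := fun l => (circ_int (mu l nu s) - tau l) ^+ 2)) => i.
  exact: sqr_ge0.
by rewrite lerDr sumr_ge0 // => p _; apply: msq_ge0; exact: sdef.
Qed.
(** The oscillation of eta is the integral of [tau - mean mu], bounded by the energy through [|x| <=
    1 + x^2]. *)
Let bound_e l : LB (e l).
Proof.
move=> S; have [C0 h0] := bE l; have [C hC] := hen (normr_ge0 S).
exists (C0 + (C + 1 * (`|S| - - `|S|))) => nu s t hs.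
have S0 := normr_ge0 S.
have SS : - `|S| <= `|S| by lra.
have hs' : - `|S| <= s <= `|S| by rewrite -ler_norml; exact: le_trans hs (ler_norm S).
have [_ dE] := sys nu.
have cE : continuous (fun s => tau l - circ_int (mu l nu s)) by apply: contB; [exact: cont_cst|exact: cem].
have h := osc_seg (fun s => dE l s) cE hs' (_ : - `|S| <= 0 <= `|S|).
have {}h := h ltac:(lra).
apply: le_trans (_ : `|E nu l 0| + `|E nu l s - E nu l 0| <= _).
  by rewrite -[X in `|X| <= _](subrK (E nu l 0)) addrC; exact: ler_normD.
apply: lerD; first exact: h0.
apply: le_trans h _; apply: (@le_trans _ _ (seg (fun s => en nu s + 1) (- `|S|) `|S|)).
  apply: seg_le => //; first exact: cont_abs.
    by apply: contD; [exact: cen|exact: cont_cst].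
  move=> x _; have := en2 nu x l; set y := circ_int _; move=> hy.
  rewrite distrC; apply: le_trans (_ : (y - tau l) ^+ 2 + 1 <= _); last by rewrite lerD2r.
  rewrite -real_normK ?num_real //; have := normr_ge0 (y - tau l); have := sqr_ge0 (`|y - tau l| - 1); nra.
rewrite segD; [|exact: cen|exact: cont_cst].
by rewrite seg_cst lerD2r; exact: hC.
Qed.

Let bound_be j : LB (be j).
Proof. apply: (@LB_sum _ _ _ (fun l nu s t => B j l * E nu l s)) => l; apply: (@LBZ _ _ (e l)); exact: bound_e. Qed.

(** Properness bounds [|z|^2] by the moment map, and [|mean mu| <= |mean mu - tau| + |tau|]. *)
Let L1z : L1 (fun nu s => \sum_(p : bool * 'I_n) msq (Z nu p.1 p.2) s).
Proof.
have [M hM] := hprop.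
apply: (@L1_dom _ _ en) => //.
- by move=> nu; apply: (cont_sum (h := fun p : bool * 'I_n => msq (Z nu p.1 p.2))) => p; exact: cont_msq.
- move=> S _; exists `|M|, (`|M| * \sum_l (1 + `|tau l|)); split => // nu s _.
  apply: le_trans (hM nu s) _; rewrite -mulrDr.
  apply: (@le_trans _ _ (`|M| * \sum_l `|circ_int (mu l nu s)|)).
    by rewrite ler_wpM2r ?ler_norm // sumr_ge0.
  apply: ler_wpM2l => //.
  apply: (@le_trans _ _ (\sum_l ((circ_int (mu l nu s) - tau l) ^+ 2 + (1 + `|tau l|)))).
    apply: ler_sum => l _; set y := circ_int _.
    have h : `|y| <= `|y - tau l| + `|tau l| by rewrite -[X in `|X| <= _](subrK (tau l)); exact: ler_normD.
    apply: le_trans h _; rewrite addrA lerD2r.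
    rewrite -real_normK ?num_real //; have := normr_ge0 (y - tau l); have := sqr_ge0 (`|y - tau l| - 1); nra.
  rewrite big_split /= lerD2r lerDr sumr_ge0 // => p _; apply: msq_ge0; exact: sdef.
Qed.

Let sum_z nu s b j : msq (Z nu b j) s <= \sum_(p : bool * 'I_n) msq (Z nu p.1 p.2) s.
Proof.
by apply: (sum_term (f := fun p : bool * 'I_n => msq (Z nu p.1 p.2) s) (b, j)) => p; exact: msq_ge0.
Qed.

Let L2z b j : L2 (z b j).
Proof.
apply: (@L1_le _ _ (fun nu s => \sum_(p : bool * 'I_n) msq (Z nu p.1 p.2) s)).
- by move=> nu; exact: (cont_msq (sZ nu b j)).
- by move=> nu; apply: (cont_sum (h := fun p : bool * 'I_n => msq (Z nu p.1 p.2))) => p; exact: cont_msq.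
- by move=> nu s; exact: sum_z.
- exact: L1z.
Qed.

Let L2zt b j : L2 (Dt (z b j)).
Proof.
pose d : fam := fun nu => edef B (Z nu) (E nu) b j.
have sd : smf d by move=> nu; exact: sdef.
pose q : fam := fun nu s t => sg b * (be j nu s t * z (~~ b) j nu s t).
have sq : smf q by move=> nu; apply: smZ; apply: smM; [exact: sbe|exact: sz].
have -> : Dt (z b j) = fun nu s t => d nu s t + q nu s t.
  by apply: fam_ext => nu s t; rewrite /d /q /edef subrK.
apply: L2D => //.
  apply: (@L1_le _ _ en) => // nu; [exact: (cont_msq (sd nu))|by move=> s; exact: en1].
have sbz : smf (fun nu s t => be j nu s t * z (~~ b) j nu s t) by exact: smfM.
apply: (@L2M _ (fun _ _ _ => sg b) (fun nu s t => be j nu s t * z (~~ b) j nu s t)) => //.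
- by move=> nu; exact: sm_cst.
- exact: LB_cst.
- exact: L2M.
Qed.

(** The nonlocal terms cancel in the derivative of the sum of the squares, which is therefore
    bounded by quantities that are locally integrable. *)
Let SLz b j : SL (z b j).
Proof.
move=> S.
pose N nu s := \sum_(p : bool * 'I_n) msq (Z nu p.1 p.2) s.
pose N' nu s := \sum_(p : bool * 'I_n) circ_int (fun t => 2 * (Z nu p.1 p.2 s t * d_s (Z nu p.1 p.2) s t)).
pose g nu s := \sum_(p : bool * 'I_n) (msq (Z nu p.1 p.2) s + msq (d_t (Z nu p.1 p.2)) s).
have sZs nu b' j' := (sm_ds (sZ nu b' j')).2; have sZt nu b' j' := (sm_dt (sZ nu b' j')).2.
have cZt nu b' j' := cont_msq (sZt nu b' j'); have cZ nu b' j' := cont_msq (sZ nu b' j').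
have dN nu s : der (N nu) s (N' nu s).
  apply: (@der_sum _ _ _ (fun p : bool * 'I_n => msq (Z nu p.1 p.2)) _
    (fun p => circ_int (fun t => 2 * (Z nu p.1 p.2 s t * d_s (Z nu p.1 p.2) s t)))) => p.
  exact: der_msq.
have cN' nu : continuous (N' nu).
  apply: (cont_sum (h := fun (p : bool * 'I_n) s => circ_int (fun t => 2 * (Z nu p.1 p.2 s t * d_s (Z nu p.1 p.2) s t)))) => p.
  apply: (circ_cont (F := fun s t => 2 * (Z nu p.1 p.2 s t * d_s (Z nu p.1 p.2) s t))).
  by apply: sm_cont; apply: smZ; apply: smM; [exact: sZ|exact: sZs].
have cg nu : continuous (g nu).
  apply: (cont_sum (h := fun (p : bool * 'I_n) s => msq (Z nu p.1 p.2) s + msq (d_t (Z nu p.1 p.2)) s)) => p.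
  by apply: contD; [exact: cZ|exact: cZt].
have hg : L1 g.
  apply: (@L1_sum _ _ _ ( fun (p : bool * 'I_n) nu s => msq (Z nu p.1 p.2) s + msq (d_t (Z nu p.1 p.2)) s)) => [p nu|p].
    by apply: contD; [exact: cZ|exact: cZt].
  apply: L1D; [by move=> nu; exact: cZ|by move=> nu; exact: cZt|exact: L2z|exact: L2zt].
have [C hC] : exists C, forall nu s, `|s| <= S -> N nu s <= C.
  apply: (L1_sup dN cN' cg _ L1z hg).
  move=> U U0; have [Cb hCb] := choice (fun j => bound_be j U).
  pose c := \sum_j `|Cb j|; have c0 : 0 <= c by exact: sumr_ge0.
  have hc j' nu s : `|s| <= U -> `|betf B (E nu) j' s| <= c.
    move=> hs; apply: le_trans (hCb j' nu s 0 hs) _; apply: le_trans (ler_norm _) _.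
    exact: (sum_term (f := fun j => `|Cb j|)).
  exists (1 + 2 * c); split => [|nu s hs]; first by rewrite addr_ge0 ?mulr_ge0.
  rewrite /N' /g (sum_bj (fun b j => circ_int (fun t => 2 * (Z nu b j s t * d_s (Z nu b j) s t)))).
  rewrite (sum_bj (fun b j => msq (Z nu b j) s + msq (d_t (Z nu b j)) s)) mulr_sumr.
  apply: le_trans (ler_norm_sum _ _ _) _; apply: ler_sum => j' _.
  have [sysZ _] := sys nu.
  have c1 b' := sm_contl (s := s) (sZ nu b' j'); have c2 b' := sm_contl (s := s) (sZs nu b' j').
  have c3 b' := sm_contl (s := s) (sZt nu b' j').
  have c4 b' : continuous (fun t => 2 * (Z nu b' j' s t * d_s (Z nu b' j') s t)).
    by apply: contM; [exact: cont_cst|apply: contM; [exact: c1|exact: c2]].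
  have c5 b' : continuous (fun t => Z nu b' j' s t ^+ 2 + d_t (Z nu b' j') s t ^+ 2).
    by apply: contD; apply: contX; [exact: c1|exact: c3].
  rewrite -(circD (c4 true) (c4 false)).
  have c6 : continuous (fun t => 2 * (Z nu true j' s t * d_s (Z nu true j') s t) + 2 * (Z nu false j' s t * d_s (Z nu false j') s t)).
    exact: contD (c4 true) (c4 false).
  have c7 : continuous (fun t => (Z nu true j' s t ^+ 2 + d_t (Z nu true j') s t ^+ 2) + (Z nu false j' s t ^+ 2 + d_t (Z nu false j') s t ^+ 2)).
    exact: contD (c5 true) (c5 false).
  apply: le_trans (circ_abs c6) _; rewrite !msqE.
  rewrite -(circD (contX (m := 2) (c1 true)) (contX (m := 2) (c3 true))).
  rewrite -(circD (contX (m := 2) (c1 false)) (contX (m := 2) (c3 false))).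
  rewrite -(circD (c5 true) (c5 false)) -(circZ _ c7).
  apply: circ_le; [exact: (cont_abs c6)|exact: (contM (@cont_cst _ _) c7)|].
  move=> t _; rewrite !sysZ /=; have := hc j' nu s hs; rewrite ler_norml => /andP[b1 b2].
  set x := Z nu true j' s t; set y := Z nu false j' s t; set xt := d_t _ s t; set yt := d_t _ s t.
  set w := betf _ _ _ _ in b1 b2 *; set q := gaf _ _ _ _ _ _.
  (* the terms with the nonlocal coefficient [q] cancel between the two components *)
  rewrite (_ : _ + _ = 2 * (x * xt - y * yt + w * (x ^+ 2 + y ^+ 2))); last by rewrite /sg; ring.
  have p1 := sqr_ge0 (x - xt); have p2 := sqr_ge0 (x + xt); have p3 := sqr_ge0 (y - yt); have p4 := sqr_ge0 (y + yt).
  have p5 : 0 <= x ^+ 2 + y ^+ 2 by rewrite addr_ge0 ?sqr_ge0.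
  have p6 : w * (x ^+ 2 + y ^+ 2) <= c * (x ^+ 2 + y ^+ 2) by rewrite ler_wpM2r.
  have p7 : - c * (x ^+ 2 + y ^+ 2) <= w * (x ^+ 2 + y ^+ 2) by rewrite ler_wpM2r.
  have p8 : 0 <= c * (xt ^+ 2 + yt ^+ 2) by rewrite mulr_ge0 // addr_ge0 ?sqr_ge0.
  rewrite ler_norml; apply/andP; split; nra.
exists C => nu s hs; apply: le_trans (sum_z nu s b j) _; exact: hC.
Qed.

(** The moment map is quadratic, so its [L^1] norm over the circle is bounded by [SLz]. *)
Let abs_mu l S : exists C, forall nu s, `|s| <= S -> 2 * circ_int (fun t => `|mu l nu s t|) <= C.
Proof.
have [C hC] := choice (fun p : bool * 'I_n => SLz p.1 p.2 S).
exists (\sum_(p : bool * 'I_n) `|B p.2 l| * C p) => nu s hs.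
have cm := sm_contl (s := s) (smu l nu).
have cZ p : continuous (fun t => `|B p.2 l| * Z nu p.1 p.2 s t ^+ 2).
  by apply: contM; [exact: cont_cst|apply: contX; exact: sm_contl].
apply: (@le_trans _ _ (2 * (2^-1 * \sum_(p : bool * 'I_n) `|B p.2 l| * msq (Z nu p.1 p.2) s))); last first.
  rewrite mulrA divff ?mul1r //; apply: ler_sum => p _; apply: ler_wpM2l => //; exact: hC.
apply: ler_wpM2l => //.
have -> : \sum_(p : bool * 'I_n) `|B p.2 l| * msq (Z nu p.1 p.2) s = circ_int (fun t => \sum_(p : bool * 'I_n) `|B p.2 l| * Z nu p.1 p.2 s t ^+ 2).
  rewrite (@circ_sum _ _ _ (fun p t => `|B p.2 l| * Z nu p.1 p.2 s t ^+ 2)) //; apply: eq_bigr => p _.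
  by rewrite msqE circZ //; apply: contX; exact: sm_contl.
have cS : continuous (fun t => \sum_(p : bool * 'I_n) `|B p.2 l| * Z nu p.1 p.2 s t ^+ 2).
  exact: (cont_sum (h := fun p t => `|B p.2 l| * Z nu p.1 p.2 s t ^+ 2)).
rewrite -circZ //; apply: circ_le; [exact: cont_abs|by apply: contM => //; exact: cont_cst|].
move=> x _; rewrite /mu /muf normrM normrN (ger0_norm (_ : 0 <= 2^-1)) ?invr_ge0 //.
apply: ler_wpM2l; first by rewrite invr_ge0.
rewrite (sum_bj (fun b j => `|B j l| * Z nu b j s x ^+ 2)).
apply: le_trans (ler_norm_sum _ _ _) _; apply: ler_sum => j _.
by rewrite -mulrDr normrM ler_wpM2l // !expr2 ger0_norm // addr_ge0 // -expr2 sqr_ge0.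
Qed.

(** The mean-zero primitive of a function bounded in [L^1] is bounded in the sup norm: this is why
    the nonlocal coefficient is harmless. *)
Let bound_mz l : LB (fun nu s t => mzp (mu l nu s) t).
Proof.
move=> S; have [C hC] := abs_mu l S; exists C => nu s t hs; apply: le_trans (hC nu s hs).
have cm := sm_contl (s := s) (smu l nu).
have [t0 t01 ->] := per_red t; last by exact: (periodic_mzp cm (sm_per (smu l nu) s)).
exact: mzp_le.
Qed.

Let bound_mean l : LB (fun nu s _ => circ_int (mu l nu s)).
Proof.
move=> S; have [C hC] := abs_mu l S; exists C => nu s t hs; apply: le_trans (hC nu s hs).
have cm := sm_contl (s := s) (smu l nu).
have h := circ_abs cm; have := normr_ge0 (circ_int (mu l nu s)); lra.
Qed.

Let r_bnd b nu : `|sg b * r nu| <= 1.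
Proof. by case/andP: (hr nu) => r0 r1; case: b; rewrite /sg ?mul1r ?mulN1r ?normrN ger0_norm. Qed.

Let Ge b j : G b j = fun nu s t => (sg b * r nu) * \sum_l B j l * mzp (mu l nu s) t.
Proof. by apply: fam_ext => nu s t; rewrite /G /gaf mulrA. Qed.

Let smz l : smf (fun nu s t => mzp (mu l nu s) t).
Proof. by move=> nu; apply: sm_mzp; exact: smu. Qed.

Let LBr b : LB (fun nu _ _ => sg b * r nu).
Proof. by move=> S; exists 1 => nu s t _; exact: r_bnd. Qed.

Let bound_G b j : LB (G b j).
Proof.
rewrite Ge; apply: (@LBM _ (fun nu _ _ => sg b * r nu)); first exact: LBr.
apply: (@LB_sum _ _ _ (fun l nu s t => B j l * mzp (mu l nu s) t)) => l.
apply: (@LBZ _ _ (fun nu s t => mzp (mu l nu s) t)); exact: bound_mz.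
Qed.

Let Dt_G b j : Dt (G b j) = fun nu s t => (sg b * r nu) *
  \sum_l B j l * (mu l nu s t + (-1) * circ_int (mu l nu s)).
Proof.
rewrite Ge; apply: fam_ext => nu s t; apply: d_tE; apply: derZ.
apply: (@der_sum _ _ _ (fun l t => B j l * mzp (mu l nu s) t)) => l; apply: derZ.
rewrite mulN1r; apply: der_mzp; apply: sm_contl; exact: smu.
Qed.

Let zz b j : fam := fun nu s t => z b j nu s t * z b j nu s t.
Let szz b j : smf (zz b j). Proof. by apply: smfM. Qed.
Let szz2 j : smf (fun nu s t => zz true j nu s t + zz false j nu s t).
Proof. by apply: smfD. Qed.
Let smean l : smf (fun nu s _ => circ_int (mu l nu s)).
Proof. by move=> nu; exact: (sm_mean (smu l nu)). Qed.
Let sr b : smf (fun nu _ _ => sg b * r nu).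
Proof. by move=> nu; exact: sm_cst. Qed.
Let scen l : smf (fun nu s t => mu l nu s t + (-1) * circ_int (mu l nu s)).
Proof. by apply: smfD => // nu; apply: smZ; exact: smean. Qed.

(** The induction hypothesis over the order of the [t]-derivatives. *)
Definition Pm m := forall b j, graded m (z b j) /\ L2 (iter m.+1 Dt (z b j)).

Let P0 : Pm 0. Proof. by move=> b j; split; [exact: SLz|exact: L2zt]. Qed.

Let graded_mu m l : (forall b j, graded m.+1 (z b j)) -> graded m.+1 (mu l).
Proof.
move=> h; apply: (@gradedM _ m (fun _ _ _ => - 2^-1) (fun nu s t => \sum_j B j l * (zz true j nu s t + zz false j nu s t))).
- by move=> nu; exact: sm_cst.
- by move=> nu; apply: sm_sum => j; apply: smZ; exact: szz2.
- exact: graded_cst.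
apply: (@graded_sum _ m.+1 _ _ (fun j nu s t => B j l * (zz true j nu s t + zz false j nu s t))) => j.
  by move=> nu; apply: smZ; exact: szz2.
apply: (@gradedM _ m (fun _ _ _ => B j l) (fun nu s t => zz true j nu s t + zz false j nu s t)).
- by move=> nu; exact: sm_cst.
- exact: szz2.
- exact: graded_cst.
- by apply: gradedD; [exact: szz|exact: szz|exact: gradedM|exact: gradedM].
Qed.

Let graded_Gt m b j : (forall b j, graded m.+1 (z b j)) -> graded m.+1 (Dt (G b j)).
Proof.
move=> h; rewrite Dt_G.
apply: (@gradedM _ m (fun nu _ _ => sg b * r nu) (fun nu s t => \sum_l B j l * (mu l nu s t + (-1) * circ_int (mu l nu s)))).
- exact: sr.
- by move=> nu; apply: sm_sum => l; apply: smZ; exact: scen.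
- by apply: (@graded_indep _ m.+1 (fun nu _ => sg b * r nu)); [exact: sr|exact: LBr].
apply: (@graded_sum _ m.+1 _ _ (fun l nu s t => B j l * (mu l nu s t + (-1) * circ_int (mu l nu s)))) => l.
  by move=> nu; apply: smZ; exact: scen.
have hm := graded_mu l h.
apply: (@gradedM _ m (fun _ _ _ => B j l) (fun nu s t => mu l nu s t + (-1) * circ_int (mu l nu s))).
- by move=> nu; exact: sm_cst.
- exact: scen.
- exact: graded_cst.
apply: gradedD => //.
- by move=> nu; apply: smZ; exact: smean.
- apply: (@graded_indep _ m.+1 (fun nu s => -1 * circ_int (mu l nu s))).
    by move=> nu; apply: smZ; exact: smean.
  apply: (@LBZ _ (-1) (fun nu s _ => circ_int (mu l nu s))); exact: bound_mean.
Qed.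

Let graded_be m j : graded m (Dt (be j)).
Proof.
rewrite (_ : Dt (be j) = fun _ _ _ => 0); first exact: graded_cst.
exact: (Dt_indep (fun nu => betf B (E nu) j)).
Qed.

Let forcing_beta m b j : Pm m -> L2 (iter m.+1 Dt (fun nu s t => be j nu s t * z b j nu s t)).
Proof.
move=> h; have [h1 h2] := h b j.
by apply: (@lead _ m.+1).
Qed.

Let sZc (c : R) (F : fam) : smf F -> smf (fun nu s t => c * F nu s t).
Proof. by move=> h nu; exact: smZ. Qed.
Let L2Z (c : R) (F : fam) : smf F -> L2 F -> L2 (fun nu s t => c * F nu s t).
Proof. by move=> sF; apply: (@L2M _ (fun _ _ _ => c)) => //; [move=> nu; exact: sm_cst|exact: LB_cst]. Qed.

Let mu_z l b j : L2 (fun nu s t => mu l nu s t * z b j nu s t).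
Proof.
pose F i := fun nu s t => B i l * (z true i nu s t * z true i nu s t * z b j nu s t
  + z false i nu s t * z false i nu s t * z b j nu s t).
have -> : (fun nu s t => mu l nu s t * z b j nu s t) = fun nu s t => - 2^-1 * \sum_i F i nu s t.
  apply: fam_ext => nu s t; rewrite /mu /muf -mulrA; congr (_ * _); rewrite mulr_suml.
  by apply: eq_bigr => i _; rewrite -mulrA mulrDl.
have c b1 i : L2 (fun nu s t => z b1 i nu s t * z b1 i nu s t * z b j nu s t).
  by apply: cubic.
have sc b1 i : smf (fun nu s t => z b1 i nu s t * z b1 i nu s t * z b j nu s t).
  by apply: (smfM (szz b1 i)).
have sF i : smf (F i) by apply: sZc; exact: (smfD (sc true i) (sc false i)).
apply: (@L2Z _ (fun nu s t => \sum_i F i nu s t)); first by move=> nu; apply: sm_sum => i; exact: sF.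
apply: L2_sum => // i; apply: L2Z; first exact: (smfD (sc true i) (sc false i)).
exact: (L2D (sc true i) (sc false i)).
Qed.

(** At the lowest level the derivative of the coefficient comes from the moment map minus its mean,
    only bounded in [L^1] of the circle; the resulting cubic terms go through [cubic]. *)
Let forcing_gamma0 b b' j : L2 (Dt (fun nu s t => G b j nu s t * z b' j nu s t)).
Proof.
have sGt := smf_Dt (sG b j); have szt := smf_Dt (sz b' j).
rewrite DtM //; apply: L2D; [exact: smfM|exact: smfM| |by apply: L2M => //; exact: L2zt].
rewrite Dt_G.
pose F l := fun nu s t => B j l * (mu l nu s t * z b' j nu s t) + (- B j l) * (circ_int (mu l nu s) * z b' j nu s t).
have -> : (fun nu s t => (sg b * r nu * \sum_l B j l * (mu l nu s t + -1 * circ_int (mu l nu s))) * z b' j nu s t)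
  = fun nu s t => (sg b * r nu) * \sum_l F l nu s t.
  apply: fam_ext => nu s t; rewrite -mulrA; congr (_ * _); rewrite mulr_suml; apply: eq_bigr => l _.
  by rewrite /F; ring.
have s1 l : smf (fun nu s t => mu l nu s t * z b' j nu s t) by exact: smfM.
have s2 l : smf (fun nu s t => circ_int (mu l nu s) * z b' j nu s t) by exact: (smfM (smean l) (sz b' j)).
have sF l : smf (F l) by apply: (@smfD _ (fun nu s t => B j l * (mu l nu s t * z b' j nu s t))); exact: sZc.
apply: (@L2M _ (fun nu _ _ => sg b * r nu) (fun nu s t => \sum_l F l nu s t)) => //.
  by move=> nu; apply: sm_sum => l; exact: sF.
apply: L2_sum => // l.
apply: (@L2D _ (fun nu s t => B j l * (mu l nu s t * z b' j nu s t))); [exact: sZc|exact: sZc| |].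
  by apply: L2Z => //; exact: mu_z.
apply: L2Z => //; apply: (@L2M _ (fun nu s _ => circ_int (mu l nu s))) => //; exact: L2z.
Qed.

Let forcing_gamma m b b' j : Pm m -> L2 (iter m.+1 Dt (fun nu s t => G b j nu s t * z b' j nu s t)).
Proof.
case: m => [|m] h; first exact: forcing_gamma0.
have [h1 h2] := h b' j.
apply: (@lead _ m.+1) => //.
- by apply: graded_Gt => b1 j1; case: (h b1 j1).
Qed.

Let system_fam b j : Ds (z b j) = fun nu s t => sg b * Dt (z (~~ b) j) nu s t
  + (be j nu s t * z b j nu s t + G b j nu s t * z (~~ b) j nu s t).
Proof. by apply: fam_ext => nu s t; have [h _] := sys nu; exact: h. Qed.

Let forcing m b j (F : fam) : Pm m -> (forall nu s t, F nu s t =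
  Ds (iter m.+1 Dt (z b j)) nu s t - sg b * Dt (iter m.+1 Dt (z (~~ b) j)) nu s t) -> L2 F.
Proof.
move=> h eF; have szt := smf_Dt (sz (~~ b) j).
have s1 := smfM (sbe j) (sz b j); have s2 := smfM (sG b j) (sz (~~ b) j).
have -> : F = fun nu s t => iter m.+1 Dt (fun nu s t => be j nu s t * z b j nu s t) nu s t
    + iter m.+1 Dt (fun nu s t => G b j nu s t * z (~~ b) j nu s t) nu s t.
  apply: fam_ext => nu s t; rewrite eF Ds_Dtn // system_fam.
  rewrite DtnD; [|exact: sZc|exact: smfD]; rewrite DtnD // DtnZ //.
  by rewrite -iterSr iterS addrAC subrr add0r.
apply: L2D; [exact: smf_Dtn|exact: smf_Dtn|exact: forcing_beta|exact: forcing_gamma].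
Qed.

(** The elliptic estimate for the derivatives of order [m + 1], whose right-hand side is the
    derivative of the zeroth order terms. *)
Let PmS m : Pm m -> Pm m.+1.
Proof.
move=> h b j.
have [h1 h2] := h true j; have [h3 h4] := h false j.
have s1 := smf_Dtn m.+1 (sz true j); have s2 := smf_Dtn m.+1 (sz false j).
have [e1 e2 e3 e4] : [/\ L2 (Ds (iter m.+1 Dt (z true j))), L2 (Dt (iter m.+1 Dt (z true j))),
    L2 (Ds (iter m.+1 Dt (z false j))) & L2 (Dt (iter m.+1 Dt (z false j)))].
  apply: (L2_elliptic s1 s2 h2 h4).
    by apply: (forcing (b := true) (j := j) h) => nu s t; rewrite mul1r.
  by apply: (forcing (b := false) (j := j) h) => nu s t; rewrite mulN1r opprK.
have key b' : graded m (z b' j) -> L2 (iter m.+1 Dt (z b' j)) -> L2 (Ds (iter m.+1 Dt (z b' j))) -> graded m.+1 (z b' j).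
  move=> k1 k2 k3.
  have k4 := L2_SL (smf_Dtn m.+1 (sz b' j)) k2 k3.
  exact: (graded_up k1 (SL_LB (smf_Dtn m (sz b' j)) (graded_SL k1) k4) k4).
by case: b; [exact: (conj (key true h1 h2 e1) e2)|exact: (conj (key false h3 h4 e3) e4)].
Qed.

Let Tz m b j : graded m (z b j).
Proof. suff : Pm m by move=> /(_ b j)[]. by elim: m => [|m]; [exact: P0|exact: PmS]. Qed.

Let LBz m b j : LB (iter m Dt (z b j)).
Proof. exact: graded_LBn (ltnSn m) (Tz m.+1 b j). Qed.

Let mixed0 N (F : fam) : (forall m, LB (iter m Dt F)) -> mixed N 0 F.
Proof.
elim: N F => [|N IH] F h; first by split => //; exact: (h 0%N).
split; first exact: (h 0%N).
by split => //; apply: IH => m; rewrite -iterSr; exact: (h m.+1).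
Qed.

Let Qa a := (forall N b j, mixed N a (z b j)) /\ forall N l, mixed N a (e l).

Let mixed_mu N a l : (forall b j, mixed N a (z b j)) -> mixed N a (mu l).
Proof.
move=> h; apply: (@mixedZ _ N a _ (fun nu s t => \sum_j B j l * (zz true j nu s t + zz false j nu s t))).
  by move=> nu; apply: sm_sum => j; apply: smZ; exact: szz2.
apply: (@mixed_sum _ N a _ _ (fun j nu s t => B j l * (zz true j nu s t + zz false j nu s t))) => j.
  by move=> nu; apply: smZ; exact: szz2.
apply: mixedZ; first exact: szz2.
by apply: mixedD; [exact: szz|exact: szz|exact: mixedM|exact: mixedM].
Qed.

Let mixed_G N a b j : (forall b j, mixed N a (z b j)) -> mixed N a (G b j).
Proof.
move=> h; rewrite Ge.
have sS : smf (fun nu s t => \sum_l B j l * mzp (mu l nu s) t).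
  by move=> nu; apply: sm_sum => l; apply: smZ; exact: smz.
apply: (@mixedM _ N a (fun nu _ _ => sg b * r nu)) => //; first exact: (@mixed_cst _ N a (fun nu => sg b * r nu) 1 (r_bnd b)).
apply: (@mixed_sum _ N a _ _ (fun l nu s t => B j l * mzp (mu l nu s) t)) => l; first by apply: sZc; exact: smz.
apply: mixedZ; first exact: smz.
by apply: mixed_mzp => //; exact: mixed_mu.
Qed.

Let mixed_be N a j : (forall l, mixed N a (e l)) -> mixed N a (be j).
Proof.
move=> h; apply: (@mixed_sum _ N a _ _ (fun l nu s t => B j l * e l nu s t)) => l; first exact: sZc.
by apply: mixedZ.
Qed.

(** Each [s]-derivative is replaced by the flow equation. *)
Let mixed_all a : Qa a.
Proof.
elim: a => [|a [hz he]].
  split => [N b j|N l]; first by apply: mixed0 => m; exact: LBz.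
  case: N => [|N]; first by split.
  by apply: (@mixed_indep _ N 0%N (fun nu s => E nu l s)); first exact: (bound_e l).
have hds b j N : mixed N a (Ds (z b j)).
  rewrite system_fam.
  have s1 := smfM (sbe j) (sz b j); have s2 := smfM (sG b j) (sz (~~ b) j).
  have s3 := smf_Dt (sz (~~ b) j).
  apply: mixedD; [exact: sZc|exact: smfD| |apply: mixedD => //].
  - by apply: mixedZ => //; have [] := hz N.+1 (~~ b) j => _ [].
  - by apply: mixedM => //; apply: mixed_be => l; exact: he.
  - by apply: mixedM => //; apply: mixed_G => b' j'; exact: hz.
split => N.
  have key m b j : mixed N a.+1 (iter m Dt (z b j)).
    elim: N m => [|N IH] m; first by split => //; exact: LBz.
    split; first exact: LBz.
    split; first by rewrite -iterS; exact: IH.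
    by rewrite Ds_Dtn //; exact: mixed_Dtn.
  by move=> b j; exact: (key 0%N).
move=> l; case: N => [|N]; first by split.
apply: (@mixed_indep _ N a.+1 (fun nu s => E nu l s)); [exact: (bound_e l)|move=> _ [<-]].
rewrite (_ : Ds _ = fun nu s _ => tau l + (-1) * circ_int (mu l nu s)); last first.
  by apply: fam_ext => nu s t; apply: d_sE; rewrite mulN1r; have [_] := sys nu.
apply: (@mixedD _ N a (fun _ _ _ => tau l) (fun nu s _ => -1 * circ_int (mu l nu s))).
- by move=> nu; exact: sm_cst.
- by apply: (@sZc _ (fun nu s _ => circ_int (mu l nu s))).
- exact: (@mixed_cst _ N a (fun _ => tau l) `|tau l|).
- apply: (@mixedZ _ N a _ (fun nu s _ => circ_int (mu l nu s))) => //.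
  by apply: mixed_mean => //; apply: mixed_mu => b j; exact: hz.
Qed.

(** The Sobolev embedding turns the [L^2] bounds of all [t]-derivatives into sup bounds, and
    [mixed_all] adds the [s]-derivatives. *)
Theorem system_bounds : (forall b j w, LB (fun nu => pderiv w (Z nu b j))) /\
  forall l w, LB (fun nu => pderiv w (fun s _ => E nu l s)).
Proof.
split => i; last first.
  by move=> w; have [_ h] := mixed_all (size w); apply: (@mixed_pderiv _ w (size w) (size w) (e i)).
by move=> j w; have [h _] := mixed_all (size w); apply: (@mixed_pderiv _ w (size w) (size w) (z i j)).
Qed.

End Bootstrap.

(** * Subsequences converging with all derivatives *)

Section UltraLimits.
Context {R : realType} (U : set_system nat) {UU : UltraFilter U}.
Implicit Types (a : nat -> R).

(** The values lie in a compact interval, and an ultrafilter converges to any of its cluster points.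
    *)
Lemma ultra_cvg a C : (forall nu, `|a nu| <= C) -> exists l : R, a @ U --> l.
Proof.
move=> h; have [] := @segment_compact R (- C) C (a @ U) _.
  by apply: (filterE (F := U)) => nu; rewrite /= in_itv /= -ler_norml; exact: h.
move=> l [_ hl]; exists l => V nV; have [//|nU] := in_ultra_setVsetC (a @^-1` V) UU.
by have [x [nx vx]] := hl _ _ (nU : (a @ U) (~` V)) nV.
Qed.

Lemma ultra_le a (l : R) C : (forall nu, `|a nu| <= C) -> a @ U --> l -> `|l| <= C.
Proof.
move=> h cv; have cn := cvg_norm cv.
rewrite leNgt; apply/negP => lt.
have FU : Filter U by exact: _.
have h1 := cvgr_gt _ (cn FU) _ lt.
have [nu] := filter_ex (h1 FU).
by rewrite ltNge => /negP; apply; exact: h.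
Qed.
End UltraLimits.

Section Compactness.
Context {R : realType}.
Implicit Types (F : nat -> R -> R -> R).

Lemma pderiv_lip (f : R -> R -> R) S C s t s' t' : sm f ->
  (forall s t, `|s| <= S -> `|d_s f s t| <= C) -> (forall s t, `|s| <= S -> `|d_t f s t| <= C) ->
  `|s| <= S -> `|s'| <= S -> `|f s t - f s' t'| <= C * (`|s - s'| + `|t - t'|).
Proof.
move=> sf hs ht bs bs'; have [ds _] := sm_ds sf; have [dt _] := sm_dt sf.
have [c1 /andP[m1 m2] e1] := der_MVT s' s (fun x => ds x t).
have [c2 _ e2] := der_MVT t' t (dt s').
have bc : `|c1| <= S.
  move: bs bs' m1 m2; rewrite !ler_norml => /andP[p1 p2] /andP[p3 p4].
  by rewrite minElt maxElt; case: ifP => _ m1 m2; apply/andP; split; lra.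
rewrite (_ : _ - _ = (f s t - f s' t) + (f s' t - f s' t')); last by ring.
rewrite e1 e2 [leRHS]mulrDr; apply: le_trans (ler_normD _ _) _; rewrite !normrM.
by apply: lerD; apply: ler_wpM2r => //; [exact: hs|exact: ht].
Qed.

(** The mean value theorem twice.  The estimate has no limits in it and survives passing to the
    limit, which then is differentiable ([der_taylor]). *)
Lemma taylor_le (f f' f'' : R -> R) x h C : (forall y, der f y (f' y)) -> (forall y, der f' y (f'' y)) ->
  (forall y, `|y - x| <= `|h| -> `|f'' y| <= C) -> `|f (x + h) - f x - h * f' x| <= C * h ^+ 2.
Proof.
move=> df df' b.
have C0 : 0 <= C by apply: le_trans (b x _); rewrite // subrr normr0.
have [c1 /andP[m1 m2] e1] := der_MVT x (x + h) df.
have [c2 /andP[m3 m4] e2] := der_MVT x c1 df'.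
have bc : `|c1 - x| <= `|h|.
  move: m1 m2; rewrite minElt maxElt; case: ifP => hh m1 m2; move: hh.
    by move=> hh; rewrite ger0_norm ?ger0_norm; lra.
  move=> /negbT; rewrite -leNgt => hh; rewrite ler0_norm ?ler0_norm; lra.
have bc2 : `|c2 - x| <= `|h|.
  apply: le_trans bc; move: m3 m4; rewrite minElt maxElt; case: ifP => hh m3 m4; move: hh.
    by move=> hh; rewrite ger0_norm ?ger0_norm; lra.
  move=> /negbT; rewrite -leNgt => hh; rewrite ler0_norm ?ler0_norm; lra.
rewrite e1 addrAC subrr add0r mulrC -mulrBr e2 !normrM -real_normK ?num_real // mulrC expr2 mulrA.
by rewrite ler_wpM2r // ler_pM // b.
Qed.

Lemma der_taylor (f : R -> R) s l C : (forall h, `|h| <= 1 -> `|f (s + h) - f s - h * l| <= C * h ^+ 2) ->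
  der f s l.
Proof.
move=> H; apply: der_eps => e e0.
pose d := Num.min 1 (e / (`|C| + 1)).
have C1 : 0 < `|C| + 1 by rewrite ltr_wpDl.
exists d; first by rewrite lt_min ltr01 divr_gt0.
move=> h; rewrite lt_min => /andP[h1 h2]; apply: le_trans (H _ (ltW h1)) _.
rewrite -real_normK ?num_real // expr2 mulrA; apply: ler_wpM2r => //.
rewrite ltr_pdivlMr // in h2; apply: le_trans (ltW h2).
rewrite mulrC; apply: ler_wpM2l => //; have := ler_norm C; lra.
Qed.

Section OneFamily.
Variables (U : set_system nat) (F : nat -> R -> R -> R).
Context {UU : UltraFilter U}.
Hypothesis (sF : smf F) (bF : forall w, LB (fun nu => pderiv w (F nu))).

(** The limit is taken along an ultrafilter at every point and for every partial derivative at once;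
    this replaces a diagonal extraction. *)
Lemma lim_ex : exists G : seq bool -> R -> R -> R,
  forall w s t, (fun nu => pderiv w (F nu) s t) @ U --> G w s t.
Proof.
have h w s t : exists l : R, (fun nu => pderiv w (F nu) s t) @ U --> l.
  have [C hC] := bF w `|s|; apply: (ultra_cvg (C := C)) => nu; exact: hC.
have [G hG] := choice (fun x : seq bool * R * R => h x.1.1 x.1.2 x.2).
by exists (fun w s t => G (w, s, t)) => w s t; exact: (hG (w, s, t)).
Qed.

Variable G : seq bool -> R -> R -> R.
Hypothesis hG : forall w s t, (fun nu => pderiv w (F nu) s t) @ U --> G w s t.

Let lipF w S : exists C, 0 <= C /\ forall nu s t s' t', `|s| <= S -> `|s'| <= S ->
  `|pderiv w (F nu) s t - pderiv w (F nu) s' t'| <= C * (`|s - s'| + `|t - t'|).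
Proof.
have [C1 h1] := bF (true :: w) S; have [C2 h2] := bF (false :: w) S.
exists (`|C1| + `|C2|); split; first by rewrite addr_ge0.
move=> nu s t s' t' bs bs'; apply: (@pderiv_lip _ S) => //; first exact: sm_pderiv.
- move=> x y hx; apply: le_trans (h1 nu x y hx) _; have := ler_norm C1; have := normr_ge0 C2; lra.
- move=> x y hx; apply: le_trans (h2 nu x y hx) _; have := ler_norm C2; have := normr_ge0 C1; lra.
Qed.

Let lipG w S : exists C, 0 <= C /\ forall s t s' t', `|s| <= S -> `|s'| <= S ->
  `|G w s t - G w s' t'| <= C * (`|s - s'| + `|t - t'|).
Proof.
have [C [C0 hC]] := lipF w S; exists C; split => // s t s' t' bs bs'.
by apply: (ultra_le (fun nu => hC nu s t s' t' bs bs')); apply: cvgB; exact: hG.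
Qed.

Let contG w : cont2 (G w).
Proof.
move=> [s t]; have [C [C0 hC]] := lipG w (`|s| + 1).
apply/cvgrPdist_le => e e0 /=.
have C1 : 0 < 2 * (C + 1) by rewrite mulr_gt0 // ltr_wpDl.
pose d := Num.min 1 (e / (2 * (C + 1))).
have d0 : 0 < d by rewrite lt_min ltr01 divr_gt0.
exists ([set x : R | `|x - s| < d], [set y : R | `|y - t| < d]).
  by split; apply/nbhs_ballP; exists d => // y; rewrite /ball /= distrC.
move=> [x y] [/= hx hy].
have hx1 : `|x - s| < 1 by apply: lt_le_trans hx _; rewrite ge_min lexx.
have hd : d <= e / (2 * (C + 1)) by rewrite ge_min lexx orbT.
rewrite distrC; apply: le_trans (hC x y s t _ _) _.
- by rewrite -[x in `|x| <= _](subrK s); apply: le_trans (ler_normD _ _) _; lra.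
- by rewrite lerDl.
- have q : `|x - s| + `|y - t| <= 2 * (e / (2 * (C + 1))) by lra.
  apply: (@le_trans _ _ ((C + 1) * (2 * (e / (2 * (C + 1)))))).
    by apply: ler_pM => //; lra.
  rewrite le_eqVlt; apply/orP; left; apply/eqP; field; lra.
Qed.

Let perG w : per2 (G w).
Proof.
move=> s t; have h := @hG w s (t + 1).
have E : (fun nu => pderiv w (F nu) s (t + 1)) = fun nu => pderiv w (F nu) s t.
  by apply/funext => nu; exact: (sm_per (sm_pderiv w (sF nu))).
by rewrite E in h; exact: (cvg_unique _ h (@hG w s t)).
Qed.

Let derGs w s t : der (G w ^~ t) s (G (true :: w) s t).
Proof.
have [C hC] := bF (true :: true :: w) (`|s| + 1).
apply: (@der_taylor _ _ _ C) => h h1.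
apply: (@ultra_le _ U _ (fun nu => pderiv w (F nu) (s + h) t - pderiv w (F nu) s t - h * pderiv (true :: w) (F nu) s t)).
  move=> nu; have sw := sm_pderiv w (sF nu); have [d1 s1] := sm_ds sw; have [d2 s2] := sm_ds s1.
  apply: (taylor_le (f := pderiv w (F nu) ^~ t) (f' := d_s (pderiv w (F nu)) ^~ t)
    (f'' := d_s (d_s (pderiv w (F nu))) ^~ t)) => // y hy.
  apply: hC; rewrite -[y in `|y| <= _](subrK s); apply: le_trans (ler_normD _ _) _; lra.
by apply: cvgB; [apply: cvgB; exact: hG|apply: cvgM; [exact: cvg_cst|exact: hG]].
Qed.

Let derGt w s t : der (G w s) t (G (false :: w) s t).
Proof.
have [C hC] := bF (false :: false :: w) `|s|.
apply: (@der_taylor _ _ _ C) => h h1.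
apply: (@ultra_le _ U _ (fun nu => pderiv w (F nu) s (t + h) - pderiv w (F nu) s t - h * pderiv (false :: w) (F nu) s t)).
  move=> nu; have sw := sm_pderiv w (sF nu); have [d1 s1] := sm_dt sw; have [d2 s2] := sm_dt s1.
  apply: (taylor_le (f := pderiv w (F nu) s) (f' := d_t (pderiv w (F nu)) s)
    (f'' := d_t (d_t (pderiv w (F nu))) s)) => // y hy.
  exact: hC.
by apply: cvgB; [apply: cvgB; exact: hG|apply: cvgM; [exact: cvg_cst|exact: hG]].
Qed.

Lemma lim_sm : sm (G [::]).
Proof.
suff h n w : Cn true n (G w) by move=> n; exact: h.
elim: n w => [|n IH] w; first by split; [exact: contG|exact: perG|].
split; [exact: contG|exact: perG|split].
  by exists (G (true :: w)) => //; exact: IH.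
by move=> _; exists (G (false :: w)) => //; exact: IH.
Qed.

Lemma lim_pderiv w : pderiv w (G [::]) = G w.
Proof.
elim: w => //= b w ->; case: b; do 2!apply/funext => ?; [exact: d_sE|exact: d_tE].
Qed.

(** The family and its limit satisfy the same local Lipschitz bound, so convergence at one point
    controls a neighbourhood, and compactness does the rest. *)
Lemma lim_unif w S e : 0 < e ->
  U [set nu | forall s t, `|s| <= S -> `|t| <= S -> `|pderiv w (F nu) s t - pderiv w (G [::]) s t| <= e].
Proof.
move=> e0; rewrite lim_pderiv.
have [CF [CF0 hF]] := lipF w (`|S| + 1); have [CG [CG0 hL]] := lipG w (`|S| + 1).
have cK : compact (`[- S, S] `*` `[- S, S] : set (R * R)).
  by apply: compact_setX; exact: segment_compact.
have := (compact_near_coveringP _).1 cK nat U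
  (fun nu q => `|q.1| <= S -> `|pderiv w (F nu) q.1 q.2 - G w q.1 q.2| <= e) _.
have H : forall x : R * R, (`[- S, S] `*` `[- S, S]) x ->
   \forall q \near x & nu \near U, `|q.1| <= S -> `|pderiv w (F nu) q.1 q.2 - G w q.1 q.2| <= e.
  move=> [s0 t0] [/= hs0 ht0].
  have bs0 : `|s0| <= `|S| + 1.
    move: hs0; rewrite in_itv /= -ler_norml => hs0; apply: le_trans hs0 _; have := ler_norm S; lra.
  have C1 : 0 < 8 * (CF + CG + 1) by rewrite mulr_gt0 // ltr_wpDl // addr_ge0.
  pose d := e / (8 * (CF + CG + 1)).
  have d0 : 0 < d by rewrite divr_gt0.
  have ed : e = d * (8 * (CF + CG + 1)) by rewrite /d; field; lra.
  have e2 : 0 < e / 2 by rewrite divr_gt0.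
  exists ([set q : R * R | `|q.1 - s0| < d /\ `|q.2 - t0| < d],
          [set nu | `|pderiv w (F nu) s0 t0 - G w s0 t0| < e / 2]).
    split.
      exists ([set x : R | `|x - s0| < d], [set y : R | `|y - t0| < d]) => //.
      by split; apply/nbhs_ballP; exists d => // y; rewrite /ball /= distrC.
    by have /cvgrPdist_lt/(_ _ e2) := @hG w s0 t0; apply: filterS => nu; rewrite distrC.
  move=> [[s t] nu] [/= [h1 h2] h3] hs.
  have bs : `|s| <= `|S| + 1 by apply: le_trans hs _; have := ler_norm S; lra.
  have p1 := hF nu s t s0 t0 bs bs0; have p2 := hL s t s0 t0 bs bs0.
  have p3 : CF * (`|s - s0| + `|t - t0|) <= CF * (2 * d) by apply: ler_wpM2l => //; lra.
  have p4 : CG * (`|s - s0| + `|t - t0|) <= CG * (2 * d) by apply: ler_wpM2l => //; lra.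
  rewrite (_ : _ - _ = (pderiv w (F nu) s t - pderiv w (F nu) s0 t0) + ((pderiv w (F nu) s0 t0 - G w s0 t0) - (G w s t - G w s0 t0))); last by ring.
  apply: le_trans (ler_normD _ _) _.
  have p5 := ler_normB (pderiv w (F nu) s0 t0 - G w s0 t0) (G w s t - G w s0 t0).
  have p6 : e / 2 = 4 * (CF * d + CG * d + d) by rewrite ed; field.
  lra.
move=> /(_ _ H); apply: filterS => nu /= hn s t hs ht.
by apply: (hn (s, t)) => //; split; rewrite /= in_itv /= -ler_norml.
Qed.

End OneFamily.

Lemma pick_subseq (A : nat -> set nat) : (forall j m, exists p, (m < p)%N /\ A j p) ->
  exists phi, {homo phi : i j / (i < j)%N} /\ forall j, A j (phi j).
Proof.
move=> h; have [c hc] := choice (fun x : nat * nat => h x.1 x.2).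
pose phi := fix phi j := if j is i.+1 then c (j, phi i) else c (0%N, 0%N).
exists phi; split; last by case=> [|j]; [exact: (hc (0%N, 0%N)).2|exact: (hc (j.+1, phi j)).2].
by apply: homo_ltn => [|j]; [exact: ltn_trans|exact: (hc (j.+1, phi j)).1].
Qed.

(** Along the ultrafilter, the first [m] conditions of an enumeration of components and derivatives
    hold to accuracy [1 / (m + 1)] on the square of size [m]; choosing the [m]-th index in this set
    beyond the previous one gives the subsequence. *)
Lemma smooth_subseq (I : countType) (F : I -> nat -> R -> R -> R) :
  (forall i, smf (F i)) -> (forall i w, LB (fun nu => pderiv w (F i nu))) ->
  exists (phi : nat -> nat) (G : I -> R -> R -> R),
    [/\ {homo phi : i j / (i < j)%N}, forall i, sm (G i) &
      forall i w S e, 0 < e -> exists N, forall j, (N <= j)%N -> forall s t, `|s| <= S -> `|t| <= S ->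
        `|pderiv w (F i (phi j)) s t - pderiv w (G i) s t| <= e].
Proof.
move=> sF bF; have [U [UU hU]] := ultraFilterLemma (F := \oo) _.
have [G0 hG0] := choice (fun i => lim_ex (UU := UU) (bF i)).
pose G i := G0 i [::].
pose good m (x : option (I * seq bool)) : set nat := [set nu | if x is Some (i, w) then
  forall s t, `|s| <= m%:R -> `|t| <= m%:R -> `|pderiv w (F i nu) s t - pderiv w (G i) s t| <= m.+1%:R^-1 else True].
have Ugood m x : U (good m x).
  case: x => [[i w]|]; last exact: filterE.
  by apply: (lim_unif (UU := UU) (sF i) (bF i) (hG0 i)); rewrite invr_gt0.
pose A m : set nat := [set nu | forall p, (p < m)%N -> good m (unpickle p) nu].
have UA m : U (A m).
  suff h q : U [set nu | forall p, (p < q)%N -> good m (unpickle p) nu] by exact: h.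
  elim: q => [|q IH]; first by apply: filterE.
  apply: filterS (filterI IH (Ugood m (unpickle q))) => nu [h1 h2] p.
  by rewrite ltnS leq_eqVlt => /predU1P[->//|]; exact: h1.
have [phi [hphi hA]] : exists phi, {homo phi : i j / (i < j)%N} /\ forall j, A j (phi j).
  apply: pick_subseq => j m.
  have h : U [set p | (m < p)%N] by apply: hU; exists m.+1.
  by have [p [h1 h2]] := filter_ex (filterI (UA j) h); exists p.
exists phi, G; split => //; first by move=> i; exact: (lim_sm (UU := UU) (sF i) (bF i) (hG0 i)).
move=> i w S e e0.
have [N1 h1] : exists N : nat, `|S| <= N%:R by exists (Num.truncn `|S|).+1; apply/ltW; exact: truncnS_gt.
have [N2 h2] : exists N : nat, e^-1 <= N%:R by exists (Num.truncn e^-1).+1; apply/ltW; exact: truncnS_gt.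
exists (maxn (pickle (i, w)).+1 (maxn N1 N2)) => j; rewrite !geq_max => /and3P[j1 j2 j3] s t hs ht.
have := hA j _ j1; rewrite pickleK /= => /(_ s t) h.
have SN : S <= j%:R by apply: le_trans (ler_norm _) _; apply: le_trans h1 _; rewrite ler_nat.
apply: le_trans (h _ _) _; [exact: le_trans hs SN|exact: le_trans ht SN|].
rewrite -[leRHS]invrK lef_pV2 ?posrE ?invr_gt0 //; apply: le_trans h2 _.
by rewrite ler_nat; exact: leqW.
Qed.

End Compactness.

(** * Passing to the limit in the flow equations *)

Section UniformLimits.
Context {R : realType}.
Notation fam := (nat -> R -> R -> R).
Implicit Types (F G : fam) (f g : R -> R -> R).

Definition uconv F f := forall S e, 0 < e -> exists N, forall j, (N <= j)%N ->
  forall s t, `|s| <= S -> `|t| <= S -> `|F j s t - f s t| <= e.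

Lemma uconv_unique F f g : uconv F f -> uconv F g -> f = g.
Proof.
move=> hf hg; apply/funext => s; apply/funext => t.
apply/eqP; rewrite -subr_eq0 -normr_le0; apply/ler_addgt0Pl => e e0; rewrite addr0.
have e2 : 0 < e / 2 by rewrite divr_gt0.
have [N1 h1] := hf (`|s| + `|t|) _ e2; have [N2 h2] := hg (`|s| + `|t|) _ e2.
have bs : `|s| <= `|s| + `|t| by rewrite lerDl.
have bt : `|t| <= `|s| + `|t| by rewrite lerDr.
have {}h1 := h1 _ (leq_maxl N1 N2) s t bs bt.
have {}h2 := h2 _ (leq_maxr N1 N2) s t bs bt.
have -> : f s t - g s t = (F (maxn N1 N2) s t - g s t) - (F (maxn N1 N2) s t - f s t) by ring.
by apply: le_trans (ler_normB _ _) _; lra.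
Qed.

Lemma uconv_fix f : uconv (fun _ => f) f.
Proof. by move=> S e e0; exists 0%N => j _ s t _ _; rewrite subrr normr0 ltW. Qed.

Lemma uconvD F G f g : uconv F f -> uconv G g ->
  uconv (fun j s t => F j s t + G j s t) (fun s t => f s t + g s t).
Proof.
move=> hf hg S e e0; have e2 : 0 < e / 2 by rewrite divr_gt0.
have [N1 h1] := hf S _ e2; have [N2 h2] := hg S _ e2.
exists (maxn N1 N2) => j; rewrite geq_max => /andP[j1 j2] s t hs ht.
have := h1 j j1 s t hs ht; have := h2 j j2 s t hs ht.
have -> : F j s t + G j s t - (f s t + g s t) = (F j s t - f s t) + (G j s t - g s t) by ring.
by move=> p1 p2; apply: le_trans (ler_normD _ _) _; lra.
Qed.

Lemma cont2_bnd f S : cont2 f -> exists C, forall s t, `|s| <= S -> `|t| <= S -> `|f s t| <= C.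
Proof.
move=> cf.
have cK : compact (`[- S, S] `*` `[- S, S] : set (R * R)).
  by apply: compact_setX; exact: segment_compact.
have /compact_bounded[M [_ hM]] : compact ((fun q : R * R => f q.1 q.2) @` (`[- S, S] `*` `[- S, S])).
  by apply: continuous_compact => //; exact: continuous_subspaceT.
exists (M + 1) => s t hs ht; apply: (hM (M + 1)); first by rewrite ltrDl.
by exists (s, t) => //; split; rewrite /= in_itv /= -ler_norml.
Qed.

Lemma uconvM F G f g : cont2 f -> cont2 g -> uconv F f -> uconv G g ->
  uconv (fun j s t => F j s t * G j s t) (fun s t => f s t * g s t).
Proof.
move=> cf cg hf hg S e e0.
have [C1 b1] := cont2_bnd S cf; have [C2 b2] := cont2_bnd S cg.
pose K := `|C1| + `|C2| + 1.
have K0 : 0 < K by rewrite ltr_wpDl // addr_ge0.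
pose d := Num.min 1 (e / (2 * K)).
have d0 : 0 < d by rewrite lt_min ltr01 divr_gt0 // mulr_gt0.
have d1 : d <= 1 by rewrite ge_min lexx.
have d2 : d * (2 * K) <= e by rewrite -ler_pdivlMr ?mulr_gt0 // ge_min lexx orbT.
have [N1 h1] := hf S _ d0; have [N2 h2] := hg S _ d0.
exists (maxn N1 N2) => j; rewrite geq_max => /andP[j1 j2] s t hs ht.
have p1 := h1 j j1 s t hs ht; have p2 := h2 j j2 s t hs ht.
have q1 : `|f s t| <= `|C1| by apply: le_trans (b1 s t hs ht) (ler_norm _).
have q2 : `|g s t| <= `|C2| by apply: le_trans (b2 s t hs ht) (ler_norm _).
have -> : F j s t * G j s t - f s t * g s t = (F j s t - f s t) * (G j s t - g s t)
  + ((F j s t - f s t) * g s t + f s t * (G j s t - g s t)) by ring.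
apply: le_trans (ler_normD _ _) _; apply: (@le_trans _ _ (d * 1 + (d * `|C2| + `|C1| * d))).
  apply: lerD; first by rewrite normrM; apply: ler_pM => //; exact: le_trans p2 d1.
  by apply: le_trans (ler_normD _ _) _; rewrite !normrM; apply: lerD; exact: ler_pM.
have : 0 <= d * K by rewrite mulr_ge0 // ltW.
rewrite /K in d2 *; lra.
Qed.

Lemma uconvZ c F f : uconv F f -> uconv (fun j s t => c * F j s t) (fun s t => c * f s t).
Proof.
move=> h S e e0.
have c0 : 0 < `|c| + 1 by rewrite ltr_wpDl.
have [N hN] := h S (e / (`|c| + 1)) (divr_gt0 e0 c0); exists N => j jN s t hs ht.
rewrite -mulrBr normrM; have := hN j jN s t hs ht; rewrite ler_pdivlMr // => p.
by apply: le_trans p; rewrite mulrC ler_wpM2l // lerDl.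
Qed.

Lemma uconv_sum (I : Type) (r : seq I) (F : I -> fam) (f : I -> R -> R -> R) :
  (forall i, uconv (F i) (f i)) ->
  uconv (fun j s t => \sum_(i <- r) F i j s t) (fun s t => \sum_(i <- r) f i s t).
Proof.
move=> h; elim: r => [|i r IH].
  by move=> S e e0; exists 0%N => j _ s t _ _; rewrite !big_nil subrr normr0 ltW.
move=> S e e0; have [N hN] := uconvD (h i) IH S e0; exists N => j jN s t hs ht.
by rewrite !big_cons; exact: hN.
Qed.

Lemma uconv_mean F f : (forall j, sm (F j)) -> sm f -> uconv F f ->
  uconv (fun j s _ => circ_int (F j s)) (fun s _ => circ_int (f s)).
Proof.
move=> sF sf h S e e0; have [N hN] := h (`|S| + 1) e e0; exists N => j jN s t hs ht.
have cF := sm_contl (s := s) (sF j); have cf := sm_contl (s := s) sf.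
rewrite -circB //; apply: circ_bnd; first exact: contB.
move=> x /andP[x0 x1]; apply: hN => //.
  by apply: le_trans hs _; have := ler_norm S; lra.
by rewrite ger0_norm //; have := normr_ge0 S; lra.
Qed.

(** The mean-zero primitive is bounded for the sup norm over one period. *)
Lemma uconv_mzp F f : (forall j, sm (F j)) -> sm f -> uconv F f ->
  uconv (fun j s t => mzp (F j s) t) (fun s t => mzp (f s) t).
Proof.
move=> sF sf h S e e0; have e2 : 0 < e / 2 by rewrite divr_gt0.
have [N hN] := h (`|S| + 1) _ e2; exists N => j jN s t hs ht.
have cF := sm_contl (s := s) (sF j); have cf := sm_contl (s := s) sf.
rewrite -mzpB //; rewrite (_ : e = 2 * (e / 2)); last by field.
apply: mzp_supp; first exact: contB.
  by move=> x; rewrite (sm_per (sF j)) (sm_per sf).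
move=> x /andP[x0 x1]; apply: hN => //.
  by apply: le_trans hs _; have := ler_norm S; lra.
by rewrite ger0_norm //; have := normr_ge0 S; lra.
Qed.

End UniformLimits.

Section LimitSystem.
Context {R : realType} {n k : nat} (B : 'I_n -> 'I_k -> R) (tau : 'I_k -> R).
Variables (r : nat -> R) (Z : nat -> bool -> 'I_n -> R -> R -> R) (E : nat -> 'I_k -> R -> R).
Variables (r0 : R) (Z0 : bool -> 'I_n -> R -> R -> R) (E0 : 'I_k -> R -> R).
Hypothesis (sZ : forall nu b j, sm (Z nu b j)) (sE : forall nu l, sm (fun s _ => E nu l s)).
Hypothesis (sZ0 : forall b j, sm (Z0 b j)) (sE0 : forall l, sm (fun s _ => E0 l s)).
Hypothesis (sys : forall nu, flow_system B tau (r nu) (Z nu) (E nu)).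
Hypothesis (cr : uconv (fun nu _ _ => r nu) (fun _ _ => r0)).
Hypothesis (cZ : forall b j w, uconv (fun nu => pderiv w (Z nu b j)) (pderiv w (Z0 b j))).
Hypothesis (cE : forall l w, uconv (fun nu => pderiv w (fun s _ => E nu l s)) (pderiv w (fun s _ => E0 l s))).

Let cmu l : uconv (fun nu => muf B (Z nu) l) (muf B Z0 l).
Proof.
apply: uconvZ; apply: (@uconv_sum _ _ _ (fun j nu s t => B j l * (Z nu true j s t * Z nu true j s t + Z nu false j s t * Z nu false j s t))
  (fun j s t => B j l * (Z0 true j s t * Z0 true j s t + Z0 false j s t * Z0 false j s t))) => j.
apply: uconvZ.
have cc b := sm_cont (sZ0 b j).
exact: (uconvD (uconvM (cc true) (cc true) (@cZ true j [::]) (@cZ true j [::]))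
  (uconvM (cc false) (cc false) (@cZ false j [::]) (@cZ false j [::]))).
Qed.

(** Both sides of each equation converge, and limits are unique. *)
Lemma flow_system_lim : flow_system B tau r0 Z0 E0.
Proof.
have smu nu l : sm (muf B (Z nu) l) by apply: sm_muf; exact: sZ.
have smu0 l : sm (muf B Z0 l) by apply: sm_muf; exact: sZ0.
split.
  move=> b j s t.
  have h1 := @cZ b j [:: true]; have h2 := @cZ (~~ b) j [:: false].
  have hb : uconv (fun nu s _ => betf B (E nu) j s) (fun s _ => betf B E0 j s).
    apply: (@uconv_sum _ _ _ (fun l nu s _ => B j l * E nu l s) (fun l s _ => B j l * E0 l s)) => l.
    apply: (@uconvZ _ _ (fun nu s _ => E nu l s)); exact: (@cE l [::]).
  have hS : uconv (fun nu s t => \sum_l B j l * mzp (muf B (Z nu) l s) t) (fun s t => \sum_l B j l * mzp (muf B Z0 l s) t).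
    apply: (@uconv_sum _ _ _ (fun l nu s t => B j l * mzp (muf B (Z nu) l s) t) (fun l s t => B j l * mzp (muf B Z0 l s) t)) => l.
    apply: uconvZ; apply: uconv_mzp => //; exact: cmu.
  have sS : sm (fun s t => \sum_l B j l * mzp (muf B Z0 l s) t).
    by apply: sm_sum => l; apply: smZ; exact: sm_mzp.
  have hg : uconv (fun nu s t => sg b * gaf B (r nu) (Z nu) j s t) (fun s t => sg b * gaf B r0 Z0 j s t).
    apply: uconvZ; apply: (uconvM (f := fun _ _ => r0)) => //; last exact: sm_cont.
    by apply: sm_cont; exact: sm_cst.
  have hb0 : sm (fun s _ => betf B E0 j s) by apply: sm_betf.
  have hg0 : sm (fun s t => sg b * gaf B r0 Z0 j s t) by apply: smZ; apply: sm_gaf.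
  have H := uconvD (uconvZ (sg b) h2) (uconvD (uconvM (sm_cont hb0) (sm_cont (sZ0 b j)) hb (@cZ b j [::]))
    (uconvM (sm_cont hg0) (sm_cont (sZ0 (~~ b) j)) hg (@cZ (~~ b) j [::]))).
  rewrite (_ : (fun nu s t => sg b * _ + _) = fun nu => pderiv [:: true] (Z nu b j)) in H; last first.
    apply/funext => nu; apply/funext => x; apply/funext => y; apply/esym.
    by have [h _] := sys nu; exact: h.
  have := uconv_unique h1 H => /= /(congr1 (fun f => f s t)) ->; by [].
move=> l s; have h1 := @cE l [:: true].
have h2 : uconv (fun nu s (_ : R) => tau l + (-1) * circ_int (muf B (Z nu) l s)) (fun s _ => tau l + (-1) * circ_int (muf B Z0 l s)).
  apply: (@uconvD _ (fun _ _ _ => tau l)); first exact: uconv_fix.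
  apply: (@uconvZ _ _ (fun nu s _ => circ_int (muf B (Z nu) l s))); apply: uconv_mean => //; exact: cmu.
rewrite (_ : (fun nu s _ => _ + _) = fun nu => pderiv [:: true] (fun s _ => E nu l s)) in h2; last first.
  apply/funext => nu; apply/funext => x; apply/funext => y; rewrite /= mulN1r; apply/esym/d_sE.
  by have [_ h] := sys nu; exact: h.
have := uconv_unique h1 h2 => /= /(congr1 (fun f => f s 0)) e.
have [d _] := sm_ds (sE0 l); apply: (der_eq (d s 0)); by rewrite e mulN1r.
Qed.

End LimitSystem.

(** * Flow lines and gauge transformations in components *)

Section Components.
Context {R : realType} {n k : nat} (A : 'M[int]_(n, k)) (tau : 'rV[R]_k).
Implicit Types (y : R -> config R n k).

Local Notation B := (@Bc R n k A).
Local Notation tauc := (fun l => tau 0 l).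

Definition Zc y (b : bool) (j : 'I_n) : R -> R -> R := if b then reY y j else imY y j.
Definition Ec y (l : 'I_k) (s : R) : R := (y s).2 0 l.

Lemma Zc_sm y b j : smooth_curve y -> sm (Zc y b j).
Proof. by move=> /smooth_curve_sm[h1 h2]; case: b; [exact: h1|exact: h2]. Qed.

Lemma Ec_sm y l : smooth_curve y -> sm (fun s _ => Ec y l s).
Proof. by move=> [_ _ /r_smooth h]; apply: sm_fst; exact: (h l). Qed.

Lemma muf_mom y l s t : muf B (Zc y) l s t = mom A (y s) l t.
Proof.
rewrite /muf /mom momentE -mulNr; by congr (_ * _); apply: eq_bigr => j _.
Qed.

Lemma gaf_gam r y j s t : gaf B r (Zc y) j s t = r * gam A (y s) j t.
Proof.
congr (_ * _); apply: eq_bigr => l _; congr (_ * _); apply: mzp_ext => x; exact: muf_mom.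
Qed.

Lemma mean_mom y l s : circ_int (muf B (Zc y) l s) = moment_mean A (y s).1 0 l.
Proof. by rewrite mxE; apply: circ_int_ext => t; rewrite muf_mom. Qed.

Lemma betf_weight y j s : betf B (Ec y) j s = weight A (y s).2 0 j.
Proof. by rewrite weightE. Qed.

Lemma ds_cc y i s t : smooth_curve y ->
  cc i (d_s (fun s t => (y s).1 t) s t) = d_s (fun s t => cc i ((y s).1 t)) s t.
Proof. by move=> [h _ _]; exact: (C_pderiv [:: true] i s t h). Qed.

Lemma flow_systemP r y : 0 <= r -> smooth_curve y ->
  flow_line A tau (gm A r) y <-> flow_system B tauc r (Zc y) (Ec y).
Proof.
move=> r0 sy; rewrite flow_lineP //.
have dE l s : der (Ec y l) s ((fun s => (y s).2)^`() s 0 l).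
  have [_ _ h] := sy; have h' := h 0%N s.
  have e := @r_derive1 R k (fun s => (y s).2) s l h'.
  move: h => /r_smooth/(_ l)/(_ 0%N s) h.
  by apply: der_eq (derivable_der h) _; rewrite -[LHS]e.
split => [[_ H]|[hZ hE]].
  split => [b j s t|l s].
    have {}H : (curve_ds y s).1 t + (gradA A tau r (y s)).1 t = 0.
      by have := H s => /(congr1 (fun p => p.1 t)).
    rewrite gaf_gam betf_weight; case: b => /=.
      have := ds_cc (inl j) s t sy; rewrite /= => <-.
      move: H => /(congr1 (fun v : 'rV[R]_n * 'rV[R]_n => v.1 0 j)); rewrite !mxE /= => /eqP; rewrite addr_eq0 => /eqP ->.
      by rewrite /sg /Zc /imY /reY /d_t; ring.
    have := ds_cc (inr j) s t sy; rewrite /= => <-.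
    move: H => /(congr1 (fun v : 'rV[R]_n * 'rV[R]_n => v.2 0 j)); rewrite !mxE /= => /eqP; rewrite addr_eq0 => /eqP ->.
    by rewrite /sg /Zc /imY /reY /d_t; ring.
  rewrite mean_mom; apply: der_eq (dE l s) _.
  have e (a b c : 'rV[R]_k) : a + (b - c) = 0 -> a 0 l = c 0 l - b 0 l.
    by move=> /(congr1 (fun v : 'rV[R]_k => v 0 l)); rewrite !mxE; lra.
  by apply: e; have := H s => /(congr1 snd).
split => // s; rewrite [LHS]surjective_pairing; congr pair.
  apply/funext => t; apply: (v_ext (@cc_e R n)) => i.
  case: i => j /=; rewrite !mxE.
    have := ds_cc (inl j) s t sy; rewrite /= => ->.
    have := hZ true j s t; rewrite gaf_gam betf_weight /= => ->.
    by rewrite !mxE /sg /Zc /imY /reY /d_t; ring.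
  have := ds_cc (inr j) s t sy; rewrite /= => ->.
  have := hZ false j s t; rewrite gaf_gam betf_weight /= => ->.
  by rewrite !mxE /sg /Zc /imY /reY /d_t; ring.
apply/rowP => l; have e (a b c : 'rV[R]_k) : a 0 l = c 0 l - b 0 l -> (a + (b - c)) 0 l = 0.
  by rewrite !mxE; lra.
rewrite [RHS]mxE; apply: e; rewrite -mean_mom; exact: der_unique (dE l s) (hE l s).
Qed.

End Components.

Section ComponentGauge.
Context {R : realType} {n k : nat} (B : 'I_n -> 'I_k -> R) (tau : 'I_k -> R).
Variables (r : R) (Z : bool -> 'I_n -> R -> R -> R) (E : 'I_k -> R -> R) (d : 'I_k -> R).
Hypothesis (sZ : forall b j, sm (Z b j)) (sE : forall l, sm (fun s _ => E l s)).

(** The weight [(A d)_j], the rotation speed of [z_j] under the gauge transformation with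
    logarithmic derivative [d]. *)
Definition gc j : R := \sum_l B j l * d l.
Definition gZ b j s t : R := cos (gc j * t) * Z b j s t - sg b * (sin (gc j * t) * Z (~~ b) j s t).
Definition gE l s : R := E l s - d l.

Hypothesis (pc : forall j, periodic (fun t => cos (gc j * t)) 1) (ps : forall j, periodic (fun t => sin (gc j * t)) 1).

Lemma gZ_sm b j : sm (gZ b j).
Proof.
have [h1 h2] := sm_cos (@pc j) (@ps j).
by apply: smB; [apply: smM|apply: smZ; apply: smM].
Qed.

Lemma gE_sm l : sm (fun s _ => gE l s).
Proof. by apply: smB => //; exact: sm_cst. Qed.

Lemma gc_sqr j s t : gZ true j s t * gZ true j s t + gZ false j s t * gZ false j s t =
  Z true j s t * Z true j s t + Z false j s t * Z false j s t.
Proof.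
rewrite /gZ /sg /=; set c := cos _; set x := sin _.
have h : c ^+ 2 = 1 - x ^+ 2 by exact: cs1.
transitivity ((c ^+ 2 + x ^+ 2) * (Z true j s t * Z true j s t + Z false j s t * Z false j s t)); first ring.
by rewrite h; ring.
Qed.

Lemma gmuf l s t : muf B gZ l s t = muf B Z l s t.
Proof. by congr (_ * _); apply: eq_bigr => j _; rewrite gc_sqr. Qed.

Lemma gbetf j s : betf B gE j s = betf B E j s - gc j.
Proof. by rewrite /betf /gc -sumrB; apply: eq_bigr => l _; rewrite mulrBr. Qed.

Lemma d_t_gZ b j s t : d_t (gZ b j) s t =
  cos (gc j * t) * d_t (Z b j) s t - sg b * (sin (gc j * t) * d_t (Z (~~ b) j) s t)
  - gc j * (sin (gc j * t) * Z b j s t + sg b * (cos (gc j * t) * Z (~~ b) j s t)).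
Proof.
have [d1 _] := sm_dt (sZ b j); have [d2 _] := sm_dt (sZ (~~ b) j).
have dc : der (fun t => cos (gc j * t)) t (- gc j * sin (gc j * t)).
  by apply: der_eq (der_comp (g := fun t => gc j * t) (is_derive_cos _) (derZ (gc j) (der_id t))) _; ring.
have ds : der (fun t => sin (gc j * t)) t (gc j * cos (gc j * t)).
  by apply: der_eq (der_comp (g := fun t => gc j * t) (is_derive_sin _) (derZ (gc j) (der_id t))) _; ring.
apply: d_tE; apply: der_eq (derB (derM dc (d1 s t)) (derZ (sg b) (derM ds (d2 s t)))) _.
by ring.
Qed.

Lemma d_s_gZ b j s t : d_s (gZ b j) s t =
  cos (gc j * t) * d_s (Z b j) s t - sg b * (sin (gc j * t) * d_s (Z (~~ b) j) s t).
Proof.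
have [d1 _] := sm_ds (sZ b j); have [d2 _] := sm_ds (sZ (~~ b) j).
exact: (d_sE (derB (derZ _ (d1 s t)) (derZ (sg b) (derZ _ (d2 s t))))).
Qed.

(** The rotation commutes with the moment map; the term from differentiating it in [t] is
    compensated by the shift of eta. *)
Lemma gauge_system : flow_system B tau r Z E -> flow_system B tau r gZ gE.
Proof.
move=> [hZ hE]; split => [b j s t|l s].
  have -> : gaf B r gZ j s t = gaf B r Z j s t.
    by congr (_ * _); apply: eq_bigr => l _; congr (_ * _); apply: mzp_ext => x; exact: gmuf.
  rewrite d_s_gZ !hZ d_t_gZ gbetf /gZ !negbK.
  by case: b; rewrite /sg /=; ring.
rewrite (circ_int_ext (gmuf l s)).
by apply: der_eq (derB (hE l s) (der_cst _ _)) _; rewrite subr0.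
Qed.

Lemma edef_g b j s t : edef B gZ gE b j s t =
  cos (gc j * t) * edef B Z E b j s t - sg b * (sin (gc j * t) * edef B Z E (~~ b) j s t).
Proof.
by rewrite /edef d_t_gZ gbetf /gZ !negbK; case: b; rewrite /sg /=; ring.
Qed.

Lemma gauge_edens s : edens B tau gZ gE s = edens B tau Z E s.
Proof.
congr (_ + _); last by apply: eq_bigr => l _; rewrite (circ_int_ext (gmuf l s)).
rewrite (sum_bj (fun b j => msq (edef B gZ gE b j) s)) (sum_bj (fun b j => msq (edef B Z E b j) s)).
apply: eq_bigr => j _; rewrite !msqE.
have c1 b : continuous (edef B gZ gE b j s).
  by apply: sm_contl; apply: sm_edef; [exact: gE_sm|exact: gZ_sm].
have c2 b : continuous (edef B Z E b j s) by apply: sm_contl; exact: sm_edef.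
rewrite -(circD (contX (m := 2) (c1 true)) (contX (m := 2) (c1 false))).
rewrite -(circD (contX (m := 2) (c2 true)) (contX (m := 2) (c2 false))).
apply: circ_int_ext => t; rewrite !edef_g /sg /=; set c := cos _; set x := sin _.
have h : c ^+ 2 = 1 - x ^+ 2 by exact: cs1.
transitivity ((c ^+ 2 + x ^+ 2) * (edef B Z E true j s t ^+ 2 + edef B Z E false j s t ^+ 2)); first ring.
by rewrite h; ring.
Qed.

End ComponentGauge.

(** * Gauge transformations with winding *)

Section WindingGauge.
Import complex.
Local Open Scope complex_scope.
Local Open Scope ring_scope.
Local Open Scope classical_set_scope.
Context {R : realType} {n k : nat} (A : 'M[int]_(n, k)).
Local Notation B := (@Bc R n k A).

Lemma cos_sin_winding (m : int) (x : R) :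
  cos (x + 2 * pi * m%:~R) = cos x /\ sin (x + 2 * pi * m%:~R) = sin x.
Proof.
have H (q : nat) (z : R) : cos (z + 2 * pi * q%:R) = cos z /\ sin (z + 2 * pi * q%:R) = sin z.
  have -> : 2 * pi * q%:R = (pi *+ 2) *+ q :> R by rewrite mulr_natr mulr_natl.
  by split; [exact: (periodicn (@cosD2pi R))|exact: (periodicn (@sinD2pi R))].
case: m => q; first exact: H.
have := H q.+1 (x + 2 * pi * (Negz q)%:~R).
by rewrite NegzE mulrNz mulrN subrK => -[<- <-].
Qed.

Lemma winding_per (m : int) : periodic (fun t : R => cos (2 * pi * m%:~R * t)) 1 /\
  periodic (fun t : R => sin (2 * pi * m%:~R * t)) 1.
Proof.
by split => t; rewrite mulrDr mulr1; have [] := cos_sin_winding m (2 * pi * m%:~R * t).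
Qed.

Variable m : 'I_k -> int.

(** The logarithmic derivative of the loop with winding numbers [m]. *)
Definition wd (l : 'I_k) : R := 2 * pi * (m l)%:~R.
Definition wgauge (t : R) : Cvec R k := expi (\row_l (wd l * t)).

Lemma wgauge_loop : loop wgauge.
Proof.
apply/C_loop => i; case: i => l.
  have -> : (fun x => cc (inl l) (wgauge x)) = fun t => cos (wd l * t).
    by apply/funext => t; rewrite /= !mxE.
  have [h1 h2] := winding_per (m l); have [h3 _] := sm_cos h1 h2.
  by split => //; exact: (sm_slice (s := 0) h3).
have -> : (fun x => cc (inr l) (wgauge x)) = fun t => sin (wd l * t).
  by apply/funext => t; rewrite /= !mxE.
have [h1 h2] := winding_per (m l); have [_ h3] := sm_cos h1 h2.
by split => //; exact: (sm_slice (s := 0) h3).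
Qed.

(** A loop [e^(i d t)] has derivative [i d e^(i d t)]. *)
Lemma wgauge_logder t : logder wgauge t = (0, \row_l wd l).
Proof.
have [sw _] := wgauge_loop; have dw := sw 0%N t.
have dc l : (fun x => cc (inl l) (wgauge x))^`() t = - wd l * sin (wd l * t).
  apply: der_derive1; apply: (der_ext (f := fun t => cos (wd l * t))); first by move=> x; rewrite /= !mxE.
  by apply: der_eq (der_comp (g := fun t => wd l * t) (is_derive_cos _) (derZ _ (der_id t))) _; ring.
have ds l : (fun x => cc (inr l) (wgauge x))^`() t = wd l * cos (wd l * t).
  apply: der_derive1; apply: (der_ext (f := fun t => sin (wd l * t))); first by move=> x; rewrite /= !mxE.
  by apply: der_eq (der_comp (g := fun t => wd l * t) (is_derive_sin _) (derZ _ (der_id t))) _; ring.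
have E l : (coordC (wgauge t) l)^-1 * coordC (wgauge^`() t) l = 0 +i* wd l.
  have e1 : (wgauge^`() t).1 0 l = - wd l * sin (wd l * t) by rewrite -dc -(C_derive1 (inl l) dw).
  have e2 : (wgauge^`() t).2 0 l = wd l * cos (wd l * t) by rewrite -ds -(C_derive1 (inr l) dw).
  have -> : coordC (wgauge^`() t) l = coordC (wgauge t) l * (0 +i* wd l).
    by rewrite /coordC e1 e2 /wgauge /= !mxE; simpc; congr (_ +i* _); ring.
  apply: mulKf; apply/eqP => /(congr1 (fun z : R[i] => complex.Re z ^+ 2 + complex.Im z ^+ 2)).
  by rewrite /wgauge /= !mxE cos2Dsin2 expr0n addr0 => /eqP; rewrite oner_eq0.
by congr pair; apply/rowP => l; rewrite !mxE E.
Qed.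

Lemma wgauge_gauge : gauge wgauge.
Proof.
split; first exact: wgauge_loop.
  by move=> t; exists (\row_l (wd l * t)).
move=> t; rewrite (_ : logder wgauge = fun=> (0, \row_l wd l)); last by apply/funext => x; exact: wgauge_logder.
exact: derive1_cst.
Qed.

Lemma gc_winding j : gc B wd j = 2 * pi * (\sum_l A j l * m l)%:~R.
Proof.
rewrite /gc rmorph_sum /= mulr_sumr; apply: eq_bigr => l _.
by rewrite /Bc /wd rmorphM /=; ring.
Qed.

Lemma gc_per j : periodic (fun t => cos (gc B wd j * t)) 1 /\ periodic (fun t => sin (gc B wd j * t)) 1.
Proof. rewrite gc_winding; exact: winding_per. Qed.

Lemma wgauge_weight j t : weight A (\row_l (wd l * t)) 0 j = gc B wd j * t.
Proof. by rewrite weightE /gc mulr_suml; apply: eq_bigr => l _; rewrite mxE mulrA. Qed.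

Lemma Zc_wgauge (y : R -> config R n k) b j s t :
  Zc (fun s => gauge_act A wgauge (y s)) b j s t = gZ B (Zc y) wd b j s t.
Proof.
rewrite /gZ -!wgauge_weight; case: b; rewrite /Zc /reY /imY /reC /imC /sg /= ?rho1 ?rho2 /reC /imC /=.
  by rewrite mul1r.
by rewrite mulN1r opprK.
Qed.

Lemma Ec_wgauge (y : R -> config R n k) l s :
  Ec (fun s => gauge_act A wgauge (y s)) l s = gE (Ec y) wd l s.
Proof. have -> : Ec (fun s => gauge_act A wgauge (y s)) l s = ((y s).2 - (logder wgauge 0).2) 0 l by [].
by rewrite wgauge_logder !mxE. Qed.

Lemma curve_smooth (y : R -> config R n k) : (forall b j, sm (Zc y b j)) ->
  (forall l, sm (fun s _ => Ec y l s)) -> smooth_curve y.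
Proof.
move=> hZ hE; split.
- apply/C_smooth2 => i; case: i => j; apply: sm_smooth2; [exact: (hZ true j)|exact: (hZ false j)].
- move=> s; apply/C_per => i t; case: i => j; [exact: (sm_per (hZ true j) s t)|exact: (sm_per (hZ false j) s t)].
- apply/r_smooth => l; apply: (@smooth_Cn R (Ec y l)) => q; apply: sm_false; exact: hE.
Qed.

Lemma wgauge_smooth (y : R -> config R n k) : smooth_curve y -> smooth_curve (fun s => gauge_act A wgauge (y s)).
Proof.
move=> sy; apply: curve_smooth => [b j|l].
  have -> : Zc (fun s => gauge_act A wgauge (y s)) b j = gZ B (Zc y) wd b j.
    by do 2!apply/funext => ?; exact: Zc_wgauge.
  apply: gZ_sm => [b' j'|j'|j']; [exact: Zc_sm|by have [] := gc_per j'|by have [] := gc_per j'].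
have -> : (fun s (_ : R) => Ec (fun s => gauge_act A wgauge (y s)) l s) = fun s _ => gE (Ec y) wd l s.
  by do 2!apply/funext => ?; exact: Ec_wgauge.
by apply: gE_sm => l'; exact: Ec_sm.
Qed.

End WindingGauge.

(** * Energy and properness *)

Section EnergyBound.
Context {R : realType} {n k : nat} (A : 'M[int]_(n, k)) (tau : 'rV[R]_k).
Local Notation B := (@Bc R n k A).
Local Notation tauc := (fun l => tau 0 l).
Variable y : R -> config R n k.
Hypothesis sy : smooth_curve y.

Lemma density_components s t : energy_density A tau y s t =
  \sum_(p : bool * 'I_n) edef B (Zc y) (Ec y) p.1 p.2 s t ^+ 2
  + \sum_l (circ_int (muf B (Zc y) l s) - tau 0 l) ^+ 2.
Proof.
have dz : derivable (y s).1 t 1 by have [h _] := smooth_curve_L0 s sy; exact: (h 0%N t).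
rewrite /energy_density; set u := d_t _ s t + _; congr (_ + _); last first.
  by apply: eq_bigr => l _; rewrite mean_mom -expr2 !mxE.
have e1 j : u.1 0 j = edef B (Zc y) (Ec y) true j s t.
  rewrite /u /edef betf_weight /sg mul1r /= mxE inf_act1; congr (_ - _).
  exact: (C_derive1 (inl j) dz).
have e2 j : u.2 0 j = edef B (Zc y) (Ec y) false j s t.
  rewrite /u /edef betf_weight /sg mulN1r opprK /= mxE inf_act2; congr (_ + _).
  exact: (C_derive1 (inr j) dz).
rewrite (sum_bj (fun b j => edef B (Zc y) (Ec y) b j s t ^+ 2)) /dotC /dot -big_split.
by apply: eq_bigr => j _; rewrite /= e1 e2 -!expr2.
Qed.

Let sd b j : sm (edef B (Zc y) (Ec y) b j).
Proof. by apply: sm_edef => *; [exact: Ec_sm|exact: Zc_sm]. Qed.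

Let cd b j s : continuous (fun t => edef B (Zc y) (Ec y) b j s t ^+ 2).
Proof. by apply: contX; exact: sm_contl. Qed.

Lemma density_cont s : continuous (energy_density A tau y s).
Proof.
have /funext -> := density_components s.
apply: contD; last exact: cont_cst.
by apply: (cont_sum (h := fun (p : bool * 'I_n) t => edef B (Zc y) (Ec y) p.1 p.2 s t ^+ 2)) => p; exact: cd.
Qed.

Lemma circ_density s : circ_int (energy_density A tau y s) = edens B tauc (Zc y) (Ec y) s.
Proof.
rewrite (circ_int_ext (density_components s)) circD; last exact: cont_cst.
  rewrite circ_cst; congr (_ + _).
  rewrite (@circ_sum _ _ _ (fun (p : bool * 'I_n) t => edef B (Zc y) (Ec y) p.1 p.2 s t ^+ 2)).
    by apply: eq_bigr => p _; rewrite msqE.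
  by move=> p; exact: cd.
by apply: (cont_sum (h := fun (p : bool * 'I_n) t => edef B (Zc y) (Ec y) p.1 p.2 s t ^+ 2)) => p; exact: cd.
Qed.

Lemma edens_cont : continuous (edens B tauc (Zc y) (Ec y)).
Proof.
apply: contD.
  by apply: (cont_sum (h := fun p : bool * 'I_n => msq (edef B (Zc y) (Ec y) p.1 p.2))) => p; apply: cont_msq; exact: sd.
apply: (cont_sum (h := fun l s => (circ_int (muf B (Zc y) l s) - tau 0 l) ^+ 2)) => l.
apply: contX; apply: contB; last exact: cont_cst.
by apply: circ_cont; apply: sm_cont; apply: sm_muf => b j; exact: Zc_sm.
Qed.

Lemma edens_ge0 s : 0 <= edens B tauc (Zc y) (Ec y) s.
Proof.
by rewrite addr_ge0 // sumr_ge0 // => [p|l] _; [apply: msq_ge0; exact: sd|exact: sqr_ge0].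
Qed.

Lemma EFin_int (f : R -> R) a b : continuous f -> a <= b ->
  (\int[@lebesgue_measure R]_(t in `[a, b]) (f t)%:E = (seg f a b)%:E)%E.
Proof.
move=> cf ab; rewrite /seg -Rint_prim // /Rintegral fineK //.
by apply: integrable_fin_num => //; exact: cont_integrable.
Qed.

(** The energy density is nonnegative, so its integral over a bounded interval is at most the
    energy. *)
Lemma energy_seg (C S : R) : (energy A tau y <= C%:E)%E -> 0 <= S ->
  seg (edens B tauc (Zc y) (Ec y)) (- S) S <= C.
Proof.
move=> hC S0; rewrite -lee_fin -EFin_int //; [|exact: edens_cont|by lra].
apply: le_trans hC; rewrite /energy.
have -> : (fun s => (\int[@lebesgue_measure R]_(t in `[0%R, 1%R]) (energy_density A tau y s t)%:E)%E)
  = fun s => (edens B tauc (Zc y) (Ec y) s)%:E.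
  apply/funext => s; rewrite EFin_int //; last exact: density_cont.
  by rewrite -circ_density circ_seg //; exact: density_cont.
apply: ge0_subset_integral => //.
- apply/measurable_EFinP; apply: measurable_funS (continuous_measurable_fun edens_cont) => //.
- by move=> s _; rewrite lee_fin; exact: edens_ge0.
Qed.

End EnergyBound.

Section Properness.
Context {R : realType} {n k : nat} (A : 'M[int]_(n, k)).
Local Notation B := (@Bc R n k A).

Lemma moment_scale (c : R) (z : Cvec R n) l : moment A (c *: z) 0 l = c ^+ 2 * moment A z 0 l.
Proof.
rewrite !momentE mulrN mulrCA; congr (- (_ * _)); rewrite mulr_sumr; apply: eq_bigr => j _.
by rewrite /= !mxE; ring.
Qed.

(** The preimage of the unit cube is compact, hence bounded; scaling [z] by the root of [sum |mu_l
    (z)|] brings it into this preimage, as [mu] is quadratic.  The [e] in the proof covers the case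
    of a zero moment map. *)
Lemma proper_bound : @moment_proper R n k A -> exists M : R, 0 <= M /\
  forall (z : Cvec R n) j, z.1 0 j ^+ 2 <= M * \sum_l `|moment A z 0 l|.
Proof.
move=> hp.
pose K : set 'rV[R]_k := [set v | forall l, `[-1, 1]%classic (v ord0 l)].
have cK : compact K by exact: (@rV_compact R k (fun=> `[-1, 1]%classic) (fun=> @segment_compact R (-1) 1)).
have cmp j : exists M, forall z : Cvec R n, K (moment A z) -> `|z.1 0 j| <= M.
  have /compact_bounded[M0 [_ hM]] : compact ((fun z : Cvec R n => z.1 0 j) @` (moment A @^-1` K)).
    apply: continuous_compact; last exact: hp.
    by apply: continuous_subspaceT; exact: (@cc_cont R n (inl j)).
  exists (M0 + 1) => z Kz; apply: (hM (M0 + 1)); first by rewrite ltrDl.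
  by exists z.
have [M1 hM1] := choice cmp.
pose M := \sum_j `|M1 j|.
have bnd (z : Cvec R n) j : K (moment A z) -> `|z.1 0 j| <= M.
  move=> Kz; apply: le_trans (hM1 j z Kz) _; apply: le_trans (ler_norm _) _.
  exact: (sum_term (f := fun j => `|M1 j|)).
have Mge0 : 0 <= M by exact: sumr_ge0.
exists (M ^+ 2); split => [|z j]; first exact: sqr_ge0.
set m := \sum_l _; have m0 : 0 <= m by rewrite sumr_ge0.
have key e : 0 < e -> z.1 0 j ^+ 2 <= M ^+ 2 * (m + e).
  move=> e0; have me : 0 < m + e by lra.
  pose c := (Num.sqrt (m + e))^-1.
  have c2 : c ^+ 2 = (m + e)^-1 by rewrite exprVn sqr_sqrtr // ltW.
  have c0 : 0 < c by rewrite invr_gt0 sqrtr_gt0.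
  have : `|(c *: z).1 0 j| <= M.
    apply: bnd => l; rewrite /= in_itv /= -ler_norml moment_scale normrM c2 (ger0_norm (_ : 0 <= (m + e)^-1)) ?invr_ge0 ?(ltW me) //.
    rewrite mulrC ler_pdivrMr // mul1r.
    apply: le_trans (_ : m <= _); last lra.
    exact: (sum_term (f := fun l => `|moment A z 0 l|)).
  rewrite /= mxE normrM (ger0_norm (ltW c0)) => h.
  have h2 : (c * `|z.1 0 j|) ^+ 2 <= M ^+ 2 by rewrite lerXn2r ?nnegrE ?mulr_ge0 // ?(ltW c0).
  rewrite exprMn c2 real_normK ?num_real // in h2.
  by rewrite mulrC -ler_pdivrMl // mulrC.
apply/ler_addgt0Pr => e e0.
have M2 : 0 < M ^+ 2 + 1 by rewrite ltr_wpDl // sqr_ge0.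
apply: le_trans (key (e / (M ^+ 2 + 1)) (divr_gt0 e0 M2)) _.
rewrite mulrDr lerD2l mulrA ler_pdivrMr //.
rewrite mulrC ler_wpM2l ?ltW //; lra.
Qed.

(** [proper_bound] for the vector with entries [sqrt (mean |z_j|^2)], whose moment map is the mean
    of the moment map of the loop. *)
Lemma msq_moment : @moment_proper R n k A -> exists M : R, forall Z : bool -> 'I_n -> R -> R -> R,
  (forall b j, sm (Z b j)) -> forall s,
  \sum_(p : bool * 'I_n) msq (Z p.1 p.2) s <= M * \sum_l `|circ_int (muf B Z l s)|.
Proof.
move=> /proper_bound[M [M0 hM]]; exists (n%:R * M) => Z sZ s.
rewrite (sum_bj (fun b j => msq (Z b j) s)).
pose z : Cvec R n := (\row_j Num.sqrt (msq (Z true j) s + msq (Z false j) s), 0).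
have cc b j := sm_contl (s := s) (sZ b j).
have e j : z.1 0 j ^+ 2 = msq (Z true j) s + msq (Z false j) s.
  by rewrite /= mxE sqr_sqrtr // addr_ge0 // msq_ge0.
have em l : moment A z 0 l = circ_int (muf B Z l s).
  have c2 j : continuous (fun t => Z true j s t * Z true j s t + Z false j s t * Z false j s t).
    by apply: contD; apply: contM; exact: cc.
  rewrite momentE /muf circZ; last first.
    by apply: (cont_sum (h := fun j t => B j l * (Z true j s t * Z true j s t + Z false j s t * Z false j s t))) => j;
      apply: contM => //; exact: cont_cst.
  rewrite mulNr (@circ_sum _ _ _ (fun j t => B j l * (Z true j s t * Z true j s t + Z false j s t * Z false j s t))); last first.
    by move=> j; apply: contM => //; exact: cont_cst.
  congr (- (_ * _)); apply: eq_bigr => j _; rewrite circZ //; congr (_ * _).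
  rewrite e [(_ : Cvec R n).2]/= mxE expr0n addr0 !msqE -circD; [|by apply: contX; exact: cc|by apply: contX; exact: cc].
  by apply: circ_int_ext => t; rewrite !expr2.
apply: le_trans (_ : \sum_(j < n) M * \sum_l `|circ_int (muf B Z l s)| <= _).
  apply: ler_sum => j _; rewrite -e; apply: le_trans (hM z j) _.
  by rewrite (eq_bigr _ (fun l _ => congr1 Num.norm (em l))).
by rewrite sumr_const card_ord -mulrA mulr_natl.
Qed.

End Properness.

(** * Compactness *)

Section Assembly.
Context {R : realType}.

Lemma cvg_unif (T : choiceType) (V : pseudoMetricType R) (K : set T) (F : nat -> T -> V) (f : T -> V) :
  (forall e : R, 0 < e -> exists N, forall j, (N <= j)%N -> forall x, K x -> ball (f x) e (F j x)) ->
  {uniform K, F @ \oo --> f}.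
Proof.
move=> h P /uniform_nbhs[E [entE sub]].
move: entE; rewrite -entourage_ballE => -[e /= e0 he].
have [N hN] := h e e0; exists N => // j jN; apply: sub => x Kx; apply: he; exact: hN.
Qed.

Lemma ball_rc m (u v : 'rV[R]_m) (e : R) : 0 < e -> (forall i, `|rc i u - rc i v| < e) -> ball u e v.
Proof. by move=> e0 h; split => // i j; rewrite ord1; exact: h. Qed.

Lemma ball_cc m (u v : Cvec R m) (e : R) : 0 < e -> (forall i, `|cc i u - cc i v| < e) -> ball u e v.
Proof. by move=> e0 h; split; apply: ball_rc => // i; [exact: (h (inl i))|exact: (h (inr i))]. Qed.

Lemma compact_abs (K : set (R * R)) : compact K -> exists S, forall q, K q -> `|q.1| <= S /\ `|q.2| <= S.
Proof.
move=> cK.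
have b (g : R * R -> R) : continuous g -> exists S, forall q, K q -> `|g q| <= S.
  move=> cg; have /compact_bounded[M [_ hM]] : compact (g @` K).
    by apply: continuous_compact => //; exact: continuous_subspaceT.
  by exists (M + 1) => q Kq; apply: (hM (M + 1)); [rewrite ltrDl|exists q].
have [S1 h1] := b fst (fun q => cvg_fst (F := nbhs q.1) (G := nbhs q.2)).
have [S2 h2] := b snd (fun q => cvg_snd (F := nbhs q.1) (G := nbhs q.2)).
exists (Num.max S1 S2) => q Kq; rewrite !le_max.
by split; apply/orP; [left; exact: h1|right; exact: h2].
Qed.

Lemma compact_abs1 (K : set R) : compact K -> exists S, forall q, K q -> `|q| <= S.
Proof.
move=> /compact_bounded[M [_ hM]].
by exists (M + 1) => q Kq; apply: (hM (M + 1)) => //; rewrite ltrDl.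
Qed.

Lemma pderiv_fst (f : R -> R) m s t : pderiv (nseq m true) (fun s _ => f s) s t = f^`(m) s.
Proof.
elim: m s t => [|m IH] s t //; rewrite derive1nS.
have /funext e : (fun x => pderiv (nseq m true) (fun s _ => f s) x t) =1 f^`(m) by move=> x; exact: IH.
by rewrite -e.
Qed.

Lemma uniform_index (I : finType) (P : I -> nat -> Prop) :
  (forall i, exists N, forall j, (N <= j)%N -> P i j) -> exists N, forall j, (N <= j)%N -> forall i, P i j.
Proof.
move=> /choice[N hN]; exists (\max_i N i) => j jN i; apply: hN.
exact: leq_trans (leq_bigmax i) jN.
Qed.

Section CurveLimit.
Context {n k : nat} (y : nat -> R -> config R n k) (y0 : R -> config R n k).
Hypothesis (sy : forall j, smooth_curve (y j)) (sy0 : smooth_curve y0).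

Lemma cvg_Cloc_components :
  (forall b i w, uconv (fun j => pderiv w (Zc (y j) b i)) (pderiv w (Zc y0 b i))) ->
  (forall l w, uconv (fun j => pderiv w (fun s _ => Ec (y j) l s)) (pderiv w (fun s _ => Ec y0 l s))) ->
  cvg_Cloc y y0.
Proof.
move=> hZ hE; split => [w K cK|m K cK].
  have [S hS] := compact_abs cK; apply: cvg_unif => e e0; have e2 : 0 < e / 2 by rewrite divr_gt0.
  have H : forall i : 'I_n + 'I_n, exists N, forall j, (N <= j)%N -> forall s t, `|s| <= S -> `|t| <= S ->
    `|pderiv w (fun s t => cc i ((y j s).1 t)) s t - pderiv w (fun s t => cc i ((y0 s).1 t)) s t| <= e / 2.
    by case=> i; [exact: (hZ true i w)|exact: (hZ false i w)].
  have [N hN] := uniform_index H; exists N => j jN [s t] /hS[hs ht].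
  apply: ball_cc => // i; have [sj _ _] := sy j; have [s0 _ _] := sy0.
  rewrite (C_pderiv w i s t sj) (C_pderiv w i s t s0) distrC.
  apply: le_lt_trans (hN j jN i s t hs ht) _; lra.
have [S hS] := compact_abs1 cK; apply: cvg_unif => e e0; have e2 : 0 < e / 2 by rewrite divr_gt0.
have H : forall l : 'I_k, exists N, forall j, (N <= j)%N -> forall s t, `|s| <= S -> `|t| <= S ->
    `|pderiv (nseq m true) (fun s _ => Ec (y j) l s) s t - pderiv (nseq m true) (fun s _ => Ec y0 l s) s t| <= e / 2.
  by move=> l; exact: (hE l).
have [N hN] := uniform_index H; exists N => j jN s /hS hs.
apply: ball_rc => // l; have [_ _ sj] := sy j; have [_ _ s0] := sy0.
rewrite -(r_derive1n m l s sj) -(r_derive1n m l s s0) distrC -!(pderiv_fst _ m s s).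
apply: le_lt_trans (hN j jN l s s hs hs) _; lra.
Qed.
End CurveLimit.
End Assembly.

Theorem theoremC (R : realType) (n k : nat) (A : 'M[int]_(n, k))
    (tau : 'rV[R]_k) :
  (1 <= k <= n)%N ->
  @moment_proper R n k A ->
  moment_regular_value A tau ->
  exists g : R -> config R n k -> config R n k -> config R n k -> R,
    [/\ metric_path A tau g,
        forall r, 0 <= r <= 1 -> gauge_invariant A (g r)
      & forall (r_ : nat -> R) (y_ : nat -> R -> config R n k),
          (forall nu, 0 <= r_ nu <= 1) ->
          (forall nu, flow_line A tau (g (r_ nu)) (y_ nu)) ->
          (exists C : R, forall nu, (energy A tau (y_ nu) <= C%:E)%E) ->
          exists (phi : nat -> nat) (h : nat -> R -> Cvec R k) (r : R)
                 (y : R -> config R n k),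
            [/\ {homo phi : i j / (i < j)%N},
                forall j, gauge (h j),
                0 <= r <= 1,
                flow_line A tau (g r) y
              & cvg_Cloc (fun j s => gauge_act A (h j) (y_ (phi j) s)) y]].
Proof.
move=> _ hprop _; exists (gm A); split; [exact: gm_path|by move=> r _; exact: gm_gauge|].
move=> r_ y_ hr hflow [C hC].
have r0 nu : 0 <= r_ nu by case/andP: (hr nu).
have sy nu : smooth_curve (y_ nu) by case: (hflow nu).
pose B := @Bc R n k A; pose tauc l := tau 0 l.
have pi2 : 0 < 2 * pi :> R by rewrite mulr_gt0 ?pi_gt0.
(* these winding numbers bring eta (0) into the cube with sides from 0 to 2 pi *)
pose m nu l := Num.floor (Ec (y_ nu) l 0 / (2 * pi)).
pose y' nu s := gauge_act A (wgauge (m nu)) (y_ nu s).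
have sy' nu : smooth_curve (y' nu) by exact: wgauge_smooth.
have eZ nu : Zc (y' nu) = gZ B (Zc (y_ nu)) (wd (m nu)).
  by do 4!apply/funext => ?; exact: Zc_wgauge.
have eE nu : Ec (y' nu) = gE (Ec (y_ nu)) (wd (m nu)).
  by do 2!apply/funext => ?; exact: Ec_wgauge.
have sZ0 nu b j : sm (Zc (y_ nu) b j) by exact: Zc_sm.
have sE0 nu l : sm (fun s _ => Ec (y_ nu) l s) by exact: Ec_sm.
have sZ nu b j : sm (Zc (y' nu) b j) by exact: Zc_sm.
have sE nu l : sm (fun s _ => Ec (y' nu) l s) by exact: Ec_sm.
have sys nu : flow_system B tauc (r_ nu) (Zc (y' nu)) (Ec (y' nu)).
  by rewrite eZ eE; apply: gauge_system => //; exact/flow_systemP.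
have bE l : exists c, forall nu, `|Ec (y' nu) l 0| <= c.
  exists (2 * pi) => nu; rewrite eE /gE /wd /m; set x := Ec _ _ _.
  have h1 := floor_le_tmp (x / (2 * pi)); have h2 := floorD1_gt (x / (2 * pi)).
  have ex : x = 2 * pi * (x / (2 * pi)) by rewrite mulrC divfK // gt_eqF.
  rewrite {1}ex -mulrBr normrM (gtr0_norm pi2) -[leRHS]mulr1 ler_wpM2l ?ltW //.
  rewrite intrD in h2; rewrite ger0_norm; lra.
have hen : L1 (fun nu => edens B tauc (Zc (y' nu)) (Ec (y' nu))).
  move=> S S0; exists C => nu; apply: le_trans (energy_seg (sy nu) (hC nu) S0).
  rewrite le_eqVlt; apply/orP; left; apply/eqP; congr seg; apply/funext => s.
  rewrite eZ eE; apply: gauge_edens => // j; by have [] := @gc_per R n k A (m nu) j.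
have hp : exists M, forall nu s, \sum_(p : bool * 'I_n) msq (Zc (y' nu) p.1 p.2) s
    <= M * \sum_l `|circ_int (muf B (Zc (y' nu)) l s)|.
  by have [M hM] := msq_moment hprop; exists M => nu s; apply: hM => b j; exact: sZ.
have [bZ bEw] := system_bounds hr sZ sE sys bE hen hp.
(* the parameters enter as one more function, so that a single extraction serves for all *)
pose F (i : (bool * 'I_n) + 'I_k + unit) nu : R -> R -> R :=
  match i with inl (inl p) => Zc (y' nu) p.1 p.2 | inl (inr l) => fun s _ => Ec (y' nu) l s
  | inr _ => fun _ _ => r_ nu end.
have sF i : smf (F i).
  by case: i => [[p|l]|u] nu; [exact: sZ|exact: sE|exact: sm_cst].
have bF i w : LB (fun nu => pderiv w (F i nu)).
  case: i => [[p|l]|u]; [exact: bZ|exact: bEw|].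
  apply: (@mixed_pderiv _ w (size w) (size w) (fun nu _ _ => r_ nu)) => //.
  apply: (@mixed_cst _ _ _ r_ 1) => nu; by case/andP: (hr nu) => p q; rewrite ger0_norm.
have [phi [G [hphi sG hG]]] := smooth_subseq sF bF.
pose r := G (inr tt) 0 0.
pose E0 l s := G (inl (inr l)) s 0.
pose Z0 b j := G (inl (inl (b, j))).
have cZ b j w : uconv (fun i => pderiv w (Zc (y' (phi i)) b j)) (pderiv w (Z0 b j)).
  exact: (hG (inl (inl (b, j))) w).
have ind (f : nat -> R -> R) (g : R -> R -> R) : uconv (fun i s _ => f i s) g -> g = fun s _ => g s 0.
  move=> h; apply: (uconv_unique h) => S e e0; have [N hN] := h `|S| e e0.
  exists N => j jN s t hs ht; apply: (hN j jN s 0); last by rewrite normr0.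
  exact: le_trans hs (ler_norm S).
have eE0 l : G (inl (inr l)) = fun s _ => E0 l s.
  exact: (ind (fun i s => Ec (y' (phi i)) l s)) (hG (inl (inr l)) [::]).
have er0 : G (inr tt) = fun _ _ => r.
  have h := hG (inr tt) [::]; apply: (uconv_unique h) => S e e0.
  have [N hN] := h `|S| e e0; exists N => j jN s t hs ht.
  by apply: (hN j jN 0 0); rewrite normr0.
have cE l w : uconv (fun i => pderiv w (fun s _ => Ec (y' (phi i)) l s)) (pderiv w (fun s _ => E0 l s)).
  by rewrite -eE0; exact: (hG (inl (inr l)) w).
have cr : uconv (fun i _ _ => r_ (phi i)) (fun _ _ => r) by rewrite -er0; exact: (hG (inr tt) [::]).
have r01 : 0 <= r <= 1.
  have key (s : R) : forall e, 0 < e -> exists i, `|r_ i - r| <= e.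
    by move=> e e0; have [N hN] := cr 0 e e0; exists (phi N); apply: (hN N (leqnn N) 0 0); rewrite normr0.
  apply/andP; split; apply/ler_addgt0Pl => e e0; have [i] := key 0 e e0; case/andP: (hr i) => p q;
    rewrite ler_norml => /andP[]; lra.
pose y s : config R n k := (fun t => (\row_j Z0 true j s t, \row_j Z0 false j s t), \row_l E0 l s).
have eZy : Zc y = Z0.
  apply/funext => b; apply/funext => j; apply/funext => s; apply/funext => t.
  by case: b; rewrite /Zc /reY /imY /reC /imC /= mxE.
have eEy : Ec y = E0 by apply/funext => l; apply/funext => s; rewrite /Ec /= mxE.
have smy : smooth_curve y.
  apply: curve_smooth => [b j|l]; first by rewrite eZy; exact: sG.
  by rewrite eEy; have := sG (inl (inr l)); rewrite eE0.
have rge : 0 <= r by case/andP: r01.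
have sG0 l : sm (fun s _ => E0 l s) by have := sG (inl (inr l)); rewrite eE0.
have lim := @flow_system_lim R n k B tauc (fun i => r_ (phi i)) (fun i => Zc (y' (phi i)))
  (fun i => Ec (y' (phi i))) r Z0 E0 (fun i b j => sZ (phi i) b j)
  (fun b j => sG (inl (inl (b, j)))) sG0 (fun i => sys (phi i)) cr cZ cE.
have flow : flow_line A tau (gm A r) y.
  apply: (@flow_systemP R n k A tau r y rge smy).2; rewrite eZy eEy; exact: lim.
have conv : cvg_Cloc (fun j => y' (phi j)) y.
  apply: (cvg_Cloc_components (fun j => sy' (phi j)) smy) => [b i w|l w].
    by rewrite eZy; exact: cZ.
  by rewrite eEy; exact: cE.
exists phi, (fun j => wgauge (m (phi j))), r, y.
exact: And5 hphi (fun j => wgauge_gauge (m (phi j))) r01 flow conv.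
Qed.
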